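(* Let $N\ge 1$ be an integer, let $\delta>0$, let $\Omega:=(\mathbb{R}^N\setminus\{0\})\times\mathbb{R}^N$, and let $f:\Omega\to\mathbb{R}^N$ satisfy: (1) $f\in C^1(\Omega;\mathbb{R}^N)$; (2) $f(-y,-u)=-f(y,u)$ for every $(y,u)\in\Omega$; (3) there exists $\Phi\in C^2(\Omega)$ such that $f=\nabla_u\Phi$ and $$\Phi(y,u)=\kappa\frac{|u|^p}{|y|^{N+\alpha p}}+\Psi(y,u)\qquad\text{for every }(y,u)\in\Omega,$$ where $\kappa>0$ and $0<\alpha<1$ are constants, $p=2$, and, for some nonnegative $g\in L^2_{\rm loc}(\mathbb{R}^N)$, $$\Psi(y,0)=0\le\Psi(y,u),\qquad |\nabla_u\Psi(y,u)|\le g(y),\qquad |D^2_u\Psi(y,u)|\le g(y)\qquad\text{for every }(y,u)\in\Omega.$$ Let $(u_0,v_0)$ and $(\tilde u_0,\tilde v_0)$ be initial data with $u_0,v_0,\tilde u_0,\tilde v_0\in L^2(\mathbb{R}^N;\mathbb{R}^N)$ and $$\int_{\mathbb{R}^N}\int_{B_\delta(0)}\Phi\big(y,u_0(x)-u_0(x-y)\big)\,dy\,dx<\infty,\qquad \int_{\mathbb{R}^N}\int_{B_\delta(0)}\Phi\big(y,\tilde u_0(x)-\tilde u_0(x-y)\big)\,dy\,dx<\infty .$$ If $u$ and $\tilde u$ are weak solutions of the equation $$\partial_t^2u(x,t)=(Ku(\cdot,t))(x),\qquad x\in\mathbb{R}^N,\ t>0,$$ with initial data $(u,\partial_tu)|_{t=0}=(u_0,v_0)$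 and $(\tilde u,\partial_t\tilde u)|_{t=0}=(\tilde u_0,\tilde v_0)$, respectively, then for every $t>0$ $$\begin{aligned} &\|\partial_tu(\cdot,t)-\partial_t\tilde u(\cdot,t)\|_{L^2(\mathbb{R}^N)}^2+\kappa\int_{\mathbb{R}^N}\int_{B_\delta(0)}\frac{|u(x,t)-u(x-y,t)-\tilde u(x,t)+\tilde u(x-y,t)|^2}{|y|^{N+2\alpha}}\,dy\,dx\\ &\quad\le e^{\left(\lambda+\frac1\kappa\right)t}\|v_0-\tilde v_0\|_{L^2(\mathbb{R}^N)}^2+\kappa\, e^{\left(\lambda+\frac1\kappa\right)t}\int_{\mathbb{R}^N}\int_{B_\delta(0)}\frac{|u_0(x)-u_0(x-y)-\tilde u_0(x)+\tilde u_0(x-y)|^2}{|y|^{N+2\alpha}}\,dy\,dx, \end{aligned}$$ where $$\lambda:=\int_{B_\delta(0)}g^2(y)\,|y|^{N+2\alpha}\,dy .$$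
   Context: $B_\delta(0)$ is the open ball of radius $\delta$ centered at the origin of $\mathbb{R}^N$. Operator. $(Ku)(x):=\int_{B_\delta(x)}f(x'-x,u(x')-u(x))\,dx'=-\int_{B_\delta(0)}f(y,u(x)-u(x-y))\,dy$. Since the kernel is singular at $y=0$, the integral of $Ku$ against a smooth compactly supported $v:\mathbb{R}^N\to\mathbb{R}^N$ is understood in the symmetrized form (obtained from the oddness of $f$) $$\int_{\mathbb{R}^N}(Ku)(x)\cdot v(x)\,dx:=-\frac12\int_{\mathbb{R}^N}\int_{B_\delta(0)}f\big(y,u(x)-u(x-y)\big)\cdot\big(v(x)-v(x-y)\big)\,dy\,dx .$$ Function spaces (here with $p=2$). $\mathcal{W}$ is the space of functions $u\in L^2(\mathbb{R}^N;\mathbb{R}^N)$ with finite norm $$\|u\|_{\mathcal{W}}:=\|u\|_{L^2(\mathbb{R}^N;\mathbb{R}^N)}+\left(\int_{\mathbb{R}^N}\int_{B_\delta(0)}\frac{|u(x)-u(x-y)|^2}{|y|^{N+2\alpha}}\,dy\,dx\right)^{1/2}.$$ $\mathcal{X}$ is the set of functions $u:\mathbb{R}^N\times[0,\infty)\to\mathbb{R}^N$ such that $u\in L^\infty(0,T;\mathcal{W})$ for every $T>0$ and $\partial_tu\in L^\infty(0,\infty;L^2(\mathbb{R}^N;\mathbb{R}^N))$. Weak solution. $u:\mathbb{R}^N\times[0,\infty)\to\mathbb{R}^N$ is a weak solution with initial datum $(u_0,v_0)$ if $u\in\mathcal{X}$ and, for every $v\in C^\infty(\mathbb{R}^{N+1};\mathbb{R}^N)$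 with compact support (as a function of $(x,t)$), $$\int_0^\infty\int_{\mathbb{R}^N}\Big(u(x,t)\cdot\partial_t^2v(x,t)-(Ku(\cdot,t))(x)\cdot v(x,t)\Big)dx\,dt-\int_{\mathbb{R}^N}v_0(x)\cdot v(x,0)\,dx+\int_{\mathbb{R}^N}u_0(x)\cdot\partial_tv(x,0)\,dx=0 .$$ Pointwise-in-time values of $u$ and $\partial_tu$ are those of the representatives (after modification on a null set of times) for which $t\mapsto u(\cdot,t)$ is weakly continuous in $\mathcal{W}$ and $t\mapsto\partial_tu(\cdot,t)$ is weakly continuous in $L^2(\mathbb{R}^N;\mathbb{R}^N)$. *)

(* Defs.v *)
From HB Require Import structures.
From mathcomp Require Import all_boot all_order all_algebra.
From mathcomp Require Import all_classical all_reals all_analysis.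

Set Implicit Arguments.
Unset Strict Implicit.
Unset Printing Implicit Defensive.

Import Order.TTheory GRing.Theory Num.Theory.
Import numFieldNormedType.Exports.

Local Open Scope classical_set_scope.
Local Open Scope ring_scope.

(* The sigma-algebra on R^n generated by the coordinates, which is the Borel
   sigma-algebra. *)
Section measurable_rV.
Variables (R : realType) (n : nat).

Let coor (i : 'I_n) (x : 'rV[R]_n) : measurableTypeR R := x ord0 i.

Let rV_set0 : g_sigma_preimage coor set0.
Proof. exact: sigma_algebra0. Qed.

Let rV_setC A : g_sigma_preimage coor A -> g_sigma_preimage coor (~` A).
Proof. exact: sigma_algebraC. Qed.

Let rV_bigcup (F : (set 'rV[R]_n)^nat) : (forall i, g_sigma_preimage coor (F i)) ->
  g_sigma_preimage coor (\bigcup_i (F i)).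
Proof. exact: sigma_algebra_bigcup. Qed.

HB.instance Definition _ := @isMeasurable.Build default_measure_display
  'rV[R]_n (g_sigma_preimage coor) rV_set0 rV_setC rV_bigcup.

Lemma measurable_coor (i : 'I_n) :
  measurable_fun setT (fun x : 'rV[R]_n => x ord0 i : measurableTypeR R).
Proof.
move=> _ A mA; rewrite setTI; apply: sub_sigma_algebra.
rewrite (bigD1 i) //=; left; exists A => //.
by rewrite setTI.
Qed.

Lemma measurable_fun_rV d (T : measurableType d) (f : T -> 'rV[R]_n) :
  (forall i, measurable_fun setT (fun x => f x ord0 i : measurableTypeR R)) ->
  measurable_fun setT f.
Proof.
move=> mf _ A; rewrite setTI; move: A.
suff H : measurable `<=` [set A | measurable (f @^-1` A)] by exact: H.
apply: smallest_sub.
  split => [|A mA|F mF] /=.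
  - by rewrite preimage_set0.
  - by rewrite setTD preimage_setC; exact: measurableC.
  - by rewrite preimage_bigcup; apply: bigcup_measurable => k _; exact: mF.
elim/big_ind : _ => //= [A B hA hB|i _ _ [B mB <-] /=].
  by rewrite subUset.
by rewrite setTI; have := mf i measurableT B mB; rewrite setTI.
Qed.

End measurable_rV.

Lemma product_sigma_finite d1 d2 (T1 : measurableType d1)
    (T2 : measurableType d2) (R : realType)
    (m1 : {sigma_finite_measure set T1 -> \bar R})
    (m2 : {sigma_finite_measure set T2 -> \bar R}) :
  sigma_finite setT (m1 \x m2)%E.
Proof.
have /sigma_finiteP[F [TF ndF Foo]] := sigma_finiteT m1.
have /sigma_finiteP[G [TG ndG Goo]] := sigma_finiteT m2.
exists (fun n => F n `*` G n).
  rewrite -setXTT TF TG predeqE => -[x y]; split.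
    move=> [/= [n _ Fnx] [k _ Gky]]; exists (maxn n k) => //; split.
    - by move: x Fnx; exact/subsetPset/ndF/leq_maxl.
    - by move: y Gky; exact/subsetPset/ndG/leq_maxr.
  by move=> [n _ []/= ? ?]; split; exists n.
move=> k; have [? ?] := Foo k; have [? ?] := Goo k.
split; first exact: measurableX.
by rewrite product_measure1E// lte_mul_pinfty// ge0_fin_numE.
Qed.

(* Lebesgue measure on R^n, by induction on n from the product measure. *)
Section lebesgue_step.
Variables (R : realType) (n : nat).
Variable m : {sigma_finite_measure set 'rV[R]_n -> \bar R}.

Definition cons_rV (p : measurableTypeR R * 'rV[R]_n) : 'rV[R]_n.+1 :=
  row_mx p.1%:M p.2 : 'rV_(1 + n).

Let cons_rV0 p : cons_rV p ord0 ord0 = p.1.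
Proof.
rewrite /cons_rV (_ : ord0 = lshift n (ord0 : 'I_1)); last exact/val_inj.
by rewrite (row_mxEl (p.1)%:M p.2) mxE eqxx.
Qed.

Let cons_rVS p (j : 'I_n) : cons_rV p ord0 (lift ord0 j) = p.2 ord0 j.
Proof.
rewrite /cons_rV (_ : lift ord0 j = rshift 1 j); last exact/val_inj.
exact: (row_mxEr (p.1)%:M p.2).
Qed.

Lemma measurable_cons_rV : measurable_fun setT cons_rV.
Proof.
apply: measurable_fun_rV => i; case: (unliftP ord0 i) => [j|] ->.
  rewrite (_ : (fun _ => _) = (fun x : 'rV[R]_n => x ord0 j) \o snd); last first.
    by apply/funext => p /=; rewrite cons_rVS.
  by apply: measurableT_comp; [exact: measurable_coor|exact: measurable_snd].
rewrite (_ : (fun _ => _) = fst) //.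
by apply/funext => p; rewrite cons_rV0.
Qed.

Definition lebesgue_step : set 'rV[R]_n.+1 -> \bar R :=
  pushforward (lebesgue_measure \x m)%E cons_rV.

Let mpre A : measurable A -> measurable (cons_rV @^-1` A).
Proof. by move=> mA; rewrite -[X in measurable X]setTI; exact: measurable_cons_rV. Qed.

Let step0 : lebesgue_step set0 = 0%E.
Proof. by rewrite /lebesgue_step /pushforward preimage_set0 measure0. Qed.

Let step_ge0 A : (0 <= lebesgue_step A)%E.
Proof. by rewrite /lebesgue_step /pushforward measure_ge0. Qed.

Let step_sigma_additive : semi_sigma_additive lebesgue_step.
Proof.
move=> F mF tF mUF; rewrite /lebesgue_step /pushforward preimage_bigcup.
apply: measure_semi_sigma_additive.
- by move=> k; exact: mpre.
- apply/trivIsetP => /= i j _ _ ij; rewrite -preimage_setI.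
  by move/trivIsetP : tF => /(_ _ _ _ _ ij) ->//; rewrite preimage_set0.
- by rewrite -preimage_bigcup; exact: mpre.
Qed.

HB.instance Definition _ := isMeasure.Build _ _ _
  lebesgue_step step0 step_ge0 step_sigma_additive.

Let uncons_rV (x : 'rV[R]_n.+1) : measurableTypeR R * 'rV[R]_n :=
  (x ord0 ord0, \row_j x ord0 (lift ord0 j)).

Let measurable_uncons_rV : measurable_fun setT uncons_rV.
Proof.
apply/measurable_fun_pairP; split; first exact: measurable_coor.
apply: measurable_fun_rV => i /=; under eq_fun do rewrite mxE.
exact: measurable_coor.
Qed.

Let cons_rVK : cancel cons_rV uncons_rV.
Proof.
move=> [a x]; rewrite /uncons_rV cons_rV0; congr (_, _).
by apply/rowP => j; rewrite mxE cons_rVS.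
Qed.

Let step_sigma_finite : sigma_finite setT lebesgue_step.
Proof.
have [F FT mF] := product_sigma_finite (@lebesgue_measure R) m.
exists (fun i => uncons_rV @^-1` F i).
  by rewrite -preimage_bigcup -FT preimage_setT.
move=> i; have [mFi Fi] := mF i; split.
  by rewrite -[X in measurable X]setTI; exact: measurable_uncons_rV.
rewrite /lebesgue_step /pushforward -comp_preimage.
rewrite (_ : uncons_rV \o cons_rV = id) //.
by apply/funext => x; exact: cons_rVK.
Qed.

HB.instance Definition _ := @Measure_isSigmaFinite.Build _ _ _
  lebesgue_step step_sigma_finite.

End lebesgue_step.

Fixpoint lebesgue_rV (R : realType) (n : nat) :
    {sigma_finite_measure set 'rV[R]_n -> \bar R} :=
  match n with
  | 0 => \d_(0 : 'rV[R]_0)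
  | n.+1 => lebesgue_step (lebesgue_rV R n)
  end.

(* The library norm on 'rV[R]_N is the sup norm; the Euclidean norm of R^N is
   defined separately. *)
Definition dotp (R : realType) (N : nat) (x y : 'rV[R]_N) : R :=
  \sum_(i < N) x ord0 i * y ord0 i.

Definition enorm (R : realType) (N : nat) (x : 'rV[R]_N) : R :=
  Num.sqrt (dotp x x).

Definition eball (R : realType) (N : nat) (r : R) : set 'rV[R]_N :=
  [set y | enorm y < r].

(* Operator norm with respect to the Euclidean norm. *)
Definition opnorm (R : realType) (N : nat) (A : 'M[R]_N) : R :=
  sup [set enorm (x *m A) | x in [set x : 'rV[R]_N | enorm x <= 1]].

Arguments dotp {R N} x y.
Arguments enorm {R N} x.
Arguments eball {R N} r.
Arguments opnorm {R N} A.

(* f is of class C^k on the open set D: all iterated directional derivatives of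
   order at most k exist and are continuous on D. *)
Fixpoint class_C (R : realType) (V W : normedModType R) (k : nat) (D : set V)
    (f : V -> W) : Prop :=
  (forall x, D x -> {for x, continuous f}) /\
  match k with
  | 0 => True
  | k'.+1 => forall v : V,
      (forall x, D x -> derivable f x v) /\ class_C k' D ('D_v f)
  end.

Arguments class_C {R V W} k D f.

Definition test_function (R : realType) (V W : normedModType R) (v : V -> W) :=
  (forall k, class_C k setT v) /\ compact (closure [set z | v z != 0]).

Definition Omega (R : realType) (N : nat) : set ('rV[R]_N * 'rV[R]_N) :=
  [set z | z.1 != 0].

Section partial_derivatives.
Variables (R : realType) (N : nat).

(* Gradient and Hessian of F(y, u) in the variable u. *)
Definition grad_u (F : 'rV[R]_N * 'rV[R]_N -> R) (z : 'rV[R]_N * 'rV[R]_N) :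
    'rV[R]_N :=
  \row_i 'D_((0, delta_mx ord0 i) : 'rV[R]_N * 'rV[R]_N) F z.

Definition hess_u (F : 'rV[R]_N * 'rV[R]_N -> R) (z : 'rV[R]_N * 'rV[R]_N) :
    'M[R]_N :=
  \matrix_(i, j) 'D_((0, delta_mx ord0 i) : 'rV[R]_N * 'rV[R]_N)
    ('D_((0, delta_mx ord0 j) : 'rV[R]_N * 'rV[R]_N) F) z.

(* Derivative of v(x, t) in the variable t. *)
Definition dt (v : 'rV[R]_N * R -> 'rV[R]_N) : 'rV[R]_N * R -> 'rV[R]_N :=
  'D_((0, 1) : 'rV[R]_N * R) v.

End partial_derivatives.
Arguments Omega {R N}.
Arguments grad_u {R N} F z.
Arguments hess_u {R N} F z.
Arguments dt {R N} v.

(* The sigma-algebras in use are the Borel ones; functions that are measurable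
   for the completed measure are those that agree almost everywhere with a
   Borel function. *)
Definition ae_measurable d d' (T : measurableType d) (T' : measurableType d')
    (R : realType) (mu : {measure set T -> \bar R}) (D : set T) (f : T -> T') :=
  exists2 g : T -> T', measurable_fun D g & ae_eq mu D f g.

Section function_spaces.
Variables (R : realType) (N : nat).
Local Notation E := 'rV[R]_N.
Local Notation mu := (lebesgue_rV R N).
Local Notation leb := (@lebesgue_measure R).
Implicit Types (h w : E -> E) (u ut U : E -> R -> E).

Definition L2norm h : \bar R := ('N[mu]_(2%:E)[EFin \o (enorm \o h)])%E.

Definition L2 : set (E -> E) :=
  [set h | ae_measurable mu setT h /\ (L2norm h < +oo)%E].

Definition L2loc (g : E -> R) : Prop :=
  ae_measurable mu setT (g : E -> measurableTypeR R) /\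
  forall K : set E, compact K -> (\int[mu]_(y in K) ((g y) ^+ 2)%:E < +oo)%E.

Variables (delta alpha : R).

Definition seminorm2 h : \bar R :=
  (\int[mu]_x \int[mu]_(y in eball delta)
    (enorm (h x - h (x - y)) ^+ 2 / enorm y `^ (N%:R + 2 * alpha))%:E)%E.

Definition Wnorm h : \bar R := (L2norm h + seminorm2 h `^ (2^-1))%E.

Definition W : set (E -> E) := [set h | L2 h /\ (Wnorm h < +oo)%E].

(* The Bochner space L^oo(J; H), for H = L2 or H = W. These are separable Hilbert
   spaces of functions of x, and measurability of t |-> u(., t) is stated as joint
   measurability of u. *)
Definition Linfty_in_time (J : set R) (H : set (E -> E))
    (nrm : (E -> E) -> \bar R) u : Prop :=
  ae_measurable (mu \x leb)%E (setT `*` J)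
    (fun z : E * measurableTypeR R => u z.1 z.2) /\
  exists C : R, {ae leb, forall t, J t -> H (u^~ t) /\ (nrm (u^~ t) <= C%:E)%E}.

(* ut is the distributional derivative of u in t on R^N x (0, +oo). *)
Definition weak_dt u ut : Prop :=
  forall phi : E * R -> E, test_function phi ->
    closure [set z | phi z != 0] `<=` [set z | 0 < z.2] ->
    \int[leb]_(t in `]0, +oo[) \int[mu]_x dotp (u x t) (dt phi (x, t)) =
    - \int[leb]_(t in `]0, +oo[) \int[mu]_x dotp (ut x t) (phi (x, t)).

Definition time_derivative u ut : Prop :=
  Linfty_in_time `]0, +oo[ L2 L2norm ut /\ weak_dt u ut.

Definition space_X u : Prop :=
  (forall T : R, 0 < T -> Linfty_in_time `]0, T[ W Wnorm u) /\
  exists ut, time_derivative u ut.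

Definition bounded_functional (H : set (E -> E)) (nrm : (E -> E) -> \bar R)
    (l : (E -> E) -> R) : Prop :=
  (forall (a : R) h w, H h -> H w ->
     l (fun x => a *: h x + w x) = a * l h + l w) /\
  exists C : R, forall h, H h -> (`|l h|%:E <= C%:E * nrm h)%E.

(* U agrees with u for almost every time and t |-> U(., t) is continuous from
   [0, +oo) to H with its weak topology. *)
Definition weakly_continuous_rep (H : set (E -> E)) (nrm : (E -> E) -> \bar R)
    u U : Prop :=
  [/\ {ae leb, forall t, 0 < t -> ae_eq mu setT (u^~ t) (U^~ t)},
      forall t, 0 <= t -> H (U^~ t) &
      forall l, bounded_functional H nrm l ->
        {within `[0, +oo[, continuous (fun t => l (U^~ t))}].

End function_spaces.
Arguments L2norm {R N} h.
Arguments L2 {R N}.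
Arguments seminorm2 {R N} delta alpha h.
Arguments Wnorm {R N} delta alpha h.
Arguments W {R N} delta alpha.
Arguments L2loc {R N} g.
Arguments time_derivative {R N} u ut.
Arguments space_X {R N} delta alpha u.
Arguments weakly_continuous_rep {R N} H nrm u U.

Section equation.
Variables (R : realType) (N : nat).
Local Notation E := 'rV[R]_N.
Local Notation mu := (lebesgue_rV R N).
Local Notation leb := (@lebesgue_measure R).
Variables (delta alpha : R) (f : E * E -> E).

(* The integral of (K h) . v over R^N, in symmetrized form. *)
Definition K_form (h v : E -> E) : R :=
  - (2^-1 * \int[mu]_x \int[mu]_(y in eball delta)
      dotp (f (y, h x - h (x - y))) (v x - v (x - y))).

Definition weak_solution (u : E -> R -> E) (u0 v0 : E -> E) : Prop :=
  space_X delta alpha u /\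
  forall v : E * R -> E, test_function v ->
    \int[leb]_(t in `[0, +oo[)
      (\int[mu]_x dotp (u x t) (dt (dt v) (x, t)) -
       K_form (u^~ t) (fun x => v (x, t)))
    - \int[mu]_x dotp (v0 x) (v (x, 0))
    + \int[mu]_x dotp (u0 x) (dt v (x, 0)) = 0.

End equation.
Arguments weak_solution {R N} delta alpha f u u0 v0.

(* Main.v *)
Require Import Defs.
From HB Require Import structures.
From mathcomp Require Import all_boot all_order all_algebra.
From mathcomp Require Import all_classical all_reals all_analysis.
From mathcomp Require Import measurable_realfun ring lra.

Set Implicit Arguments.
Unset Strict Implicit.
Unset Printing Implicit Defensive.

Import Order.TTheory GRing.Theory Num.Theory.
Import numFieldNormedType.Exports.

Local Open Scope classical_set_scope.
Local Open Scope ring_scope.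

(** The weak formulation only allows testing with smooth functions, and the
    difference of two solutions is not regular enough for the energy identity.
    Both are therefore mollified in space. Testing with products
    theta(t) eta_n(z - x) e_i and arguing as in the lemma of du Bois-Reymond shows
    that the mollified solution is, for every x, a C^2 function of t that solves an
    ordinary differential equation whose right-hand side is the mollified operator;
    weak continuity in time identifies the initial values.

    Write w for a difference of two solutions and w_n for its mollification. The
    principal part is linear, commutes with mollification and contributes the
    derivative of the kappa-term of the energy. The remaining part of f is dominated
    by g and is g-Lipschitz in u, because it is the gradient of Psi; by AM-GM,
    2 |d_t w_n| g |Dw| <= g^2 |y|^(N + 2 alpha) |d_t w_n|^2 + |Dw|^2 / |y|^(N + 2 alpha),
    so that the energy of w_n at time t is at most its initial value plus
    (lambda + 1/kappa) times the time integral of the energy of w. Mollification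
    does not increase the initial energy, and n tends to infinity by lower
    semicontinuity. The energy of w is not known to be measurable in time, so
    Gronwall's inequality is applied through continuous majorants. *)

(** * Integrals and measurability *)

(** Weak continuity in time does not suffice for the nonlinear term, which is not continuous under
    weak convergence. Since the time derivative is bounded in L^2 uniformly in time, a duality
    argument shows that solutions are Lipschitz in time with values in L^2; this makes the mollified
    nonlinear term continuous in time and the mollified velocity C^1. Mollification does not commute
    with the nonlinear term. That term is therefore kept as a pairing of G, the part of f that comes
    from Psi, with differences of the kernel; only its size is estimated, through mollifications of
    |Dw|, and Young's inequality removes the mollification at the end. In the time derivative of the
    mollified energy the principal terms do not cancel at a given x. They cancel after integration
    over x, by the symmetry of the operator, and this is why integrability in x and exchanges of
    integrals take so much room. AM-GM leaves lambda |d_t w|^2 + |Dw|^2 / |y|^(N + 2 alpha), whereas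
    the energy carries the second term with the factor kappa; hence the constant lambda +
    1/kappa. *)

Section integral_almost_everywhere.
Context d (T : measurableType d) (R : realType) (mu : {measure set T -> \bar R}).
Local Open Scope ereal_scope.

Import HBNNSimple.

(* The integral is a supremum over simple functions, so that no measurability
   is required. *)
Lemma ge0_le_integral_ae (f g : T -> \bar R) : (forall x, 0 <= f x) ->
  (forall x, 0 <= g x) -> {ae mu, forall x, f x <= g x} ->
  \int[mu]_x f x <= \int[mu]_x g x.
Proof.
move=> f0 g0 [A [mA A0 fgA]].
rewrite [leLHS]ge0_integralTE//; apply: ge_ereal_sup => _ [h hf <-].
have mAC : measurable (~` A) by exact: measurableC.
(* Setting [h] to 0 on the null set where the bound may fail keeps its integral, and the result lies
   below [g] everywhere. *)
pose h' := proj_nnsfun h mAC.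
rewrite -integralT_nnsfun.
have -> : \int[mu]_x (h x)%:E = \int[mu]_x (h' x)%:E.
  apply: ge0_ae_eq_integral => //.
  - exact/measurable_EFinP.
  - exact/measurable_EFinP.
  - by move=> x _; rewrite lee_fin.
  - by move=> x _; rewrite lee_fin.
  exists A; split => // x /= hx; apply: contrapT => nAx; apply: hx => _.
  by rewrite /= mindicE mem_set// mulr1.
rewrite integralT_nnsfun ge0_integralTE//; apply: ereal_sup_ubound => /=.
exists h' => // x; rewrite /= mindicE.
have [xA|xA] := boolP (x \in ~` A); last by rewrite mulr0.
rewrite mulr1 (le_trans (hf x))//.
apply: contrapT => fgx; move: xA; rewrite inE; apply.
exact: fgA.
Qed.

Lemma ge0_le_integralW (f g : T -> \bar R) : (forall x, 0 <= f x) ->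
  (forall x, f x <= g x) -> \int[mu]_x f x <= \int[mu]_x g x.
Proof.
move=> f0 fg; apply: ge0_le_integral_ae => //; last exact: aeW.
by move=> x; apply: le_trans (fg x).
Qed.

(** The comparison is applied in both directions to positive and negative parts. As no measurability
    enters, a solution may be replaced by a Borel representative under any integral. *)
Lemma integral_ae_eqW (f g : T -> \bar R) : ae_eq mu setT f g ->
  \int[mu]_x f x = \int[mu]_x g x.
Proof.
move=> fg; rewrite integralE [RHS]integralE.
have ge0E (f' g' : T -> \bar R) : (forall x, 0 <= f' x) ->
  (forall x, 0 <= g' x) -> ae_eq mu setT f' g' ->
  \int[mu]_x f' x = \int[mu]_x g' x.
  move=> f0 g0 fg'; apply/eqP; rewrite eq_le !ge0_le_integral_ae//.
    by apply: filterS fg' => x /(_ I) ->.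
  by apply: filterS fg' => x /(_ I) ->.
congr (_ - _); apply: ge0E => //.
  by apply: filterS fg => x /(_ I) fgx _; rewrite !funeposE fgx.
by apply: filterS fg => x /(_ I) fgx _; rewrite !funenegE fgx.
Qed.

Lemma Rintegral_ae_eqW (f g : T -> R) : {ae mu, forall x, f x = g x} ->
  (\int[mu]_x f x = \int[mu]_x g x)%R.
Proof.
move=> fg; rewrite /Rintegral (@integral_ae_eqW _ (EFin \o g))//.
by apply: filterS fg => x /= ->.
Qed.

End integral_almost_everywhere.

Section rounding.
Context d (T : measurableType d) (R : realType).

(* A function that is continuous along countably valued approximations of the
   identity is a pointwise limit of measurable functions. *)
Lemma measurable_fun_rounding (D : set T) (r : nat -> T -> T) (F : T -> R) :
  measurable D ->
  (forall n, measurable_fun setT (r n)) -> (forall n, countable (range (r n))) ->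
  (forall n x, measurable ((r n) @^-1` [set x])) ->
  (forall x, D x -> F (r n x) @[n --> \oo] --> F x) ->
  measurable_fun D F.
Proof.
move=> mD mr cr fr FF.
apply: (@measurable_fun_cvg _ _ _ D (fun n => F \o r n)) => // n.
move=> _ A mA; apply: measurableI => //.
(* After rounding, [F] takes countably many values, so that preimages are countable unions of level
   sets of [r n], whatever [F] is. *)
have -> : (F \o r n) @^-1` A =
    \bigcup_(y in range (r n) `&` [set y | A (F y)]) ((r n) @^-1` [set y]).
  apply/seteqP; split => [x /= AFx|x [y [_ /= AFy] /= ->//]].
  by exists (r n x) => //; split => //; exists x.
rewrite bigcup_set_type; apply: countable_bigcupT_measurable => [|y]; last exact: fr.
by rewrite (eq_countable (card_setT _)); apply: sub_countable (cr n); apply: subset_card_le => y [].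
Qed.

End rounding.

(** * Approximation of points of R^N by grids *)

Section rounding_rV.
Variable R : realType.

Definition grid (n : nat) (x : R) : R := (Num.floor (x * n.+1%:R))%:~R / n.+1%:R.

Lemma grid_bounds n x : x - n.+1%:R^-1 < grid n x <= x.
Proof.
have n0 : 0 < n.+1%:R :> R by rewrite ltr0n.
have := floor_itv (x * n.+1%:R); rewrite intrD => /andP[h1 h2].
by rewrite /grid ler_pdivrMr// h1 andbT ltrBlDr -{2}[n.+1%:R^-1]mul1r -mulrDl ltr_pdivlMr.
Qed.

Lemma measurable_grid n :
  measurable_fun setT (grid n : measurableTypeR R -> measurableTypeR R).
Proof.
apply: nondecreasing_measurable => // x y xy.
by rewrite /grid ler_pM2r ?invr_gt0 ?ltr0n// ler_int le_floor// ler_pM2r ?ltr0n.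
Qed.

Lemma cvg_grid (x : R) : grid n x @[n --> \oo] --> x.
Proof.
apply/cvgrPdist_le => e e0; near=> n.
have := grid_bounds n x => /andP[h1 h2]; rewrite ger0_norm ?subr_ge0//.
have : n.+1%:R^-1 < e by near: n; exact: near_infty_natSinv_lt (PosNum e0).
by move=> h3; apply/ltW/(lt_trans _ h3); rewrite ltrBlDr addrC -ltrBlDr.
Unshelve. all: by end_near. Qed.

Variable N : nat.
Local Notation E := 'rV[R]_N.

Definition rV_grid n (x : E) : E := map_mx (grid n) x.

Lemma measurable_rV_grid n : measurable_fun setT (rV_grid n).
Proof.
apply: measurable_fun_rV => i; under eq_fun do rewrite mxE.
exact: measurableT_comp (measurable_grid n) (measurable_coor i).
Qed.

Lemma countable_range_rV_grid n : countable (range (rV_grid n)).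
Proof.
pose G (v : 'rV[int]_N) : E := map_mx (fun z : int => z%:~R / n.+1%:R) v.
have sub : range (rV_grid n) `<=` range G.
  move=> _ [x _ <-]; exists (map_mx (fun s => Num.floor (s * n.+1%:R)) x) => //.
  by apply/matrixP => i j; rewrite !mxE.
apply: (sub_countable (card_le_trans (subset_card_le sub) (card_image_le _ _))).
exact: countableP.
Qed.

Lemma cvg_rV (F : nat -> E) (x : E) :
  (forall i, F n ord0 i @[n --> \oo] --> x ord0 i) -> F n @[n --> \oo] --> x.
Proof.
move=> Fx; apply/cvg_ballP => e e0.
have : \forall n \near \oo, forall i, ball (x ord0 i) e (F n ord0 i).
  by apply: filter_forall => i; have /cvg_ballP := Fx i; apply.
by apply: filterS => n h; split => // i j; rewrite (ord1 i); exact: h.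
Qed.

Lemma cvg_rV_grid (x : E) : rV_grid n x @[n --> \oo] --> x.
Proof.
by apply: cvg_rV => i; under eq_fun do rewrite mxE; exact: cvg_grid.
Qed.

Lemma measurable_rV_set1 (x : E) : measurable [set x].
Proof.
have -> : [set x] = \bigcap_(i in [set: 'I_N]) ((fun y : E => y ord0 i) @^-1` [set x ord0 i]).
  apply/seteqP; split => [_ ->//|y h]; apply/rowP => i; exact: (h i).
apply: fin_bigcap_measurable => // i _; rewrite -[X in measurable X]setTI.
exact: (measurable_coor i).
Qed.

(** The sigma-algebra is generated by the coordinates and not by the open sets, so that continuity
    has to be turned into measurability by rounding. Rounded points may leave [D]; this is harmless
    because [F] is total and only limits at points of [D] are taken. *)
Lemma measurable_fun_continuous_rV2 (D : set (E * E)) (F : E * E -> R) :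
  measurable D ->
  (forall x, D x -> {for x, continuous F}) -> measurable_fun D F.
Proof.
move=> mD cF; pose r n (z : E * E) := (rV_grid n z.1, rV_grid n z.2).
have mr n : measurable_fun setT (r n).
  by apply/measurable_fun_pairP; split;
    apply: measurableT_comp (measurable_rV_grid n) _.
apply: (@measurable_fun_rounding _ _ _ _ r) => //.
- move=> n; apply: sub_countable (countableX (countable_range_rV_grid n)
    (countable_range_rV_grid n)).
  by apply: subset_card_le => _ [z _ <-]; split => /=; eexists.
- move=> n [x y]; rewrite -[X in measurable X]setTI; apply: mr => //.
  have -> : [set (x, y)] = [set x] `*` [set y].
    by apply/seteqP; split => [_ -> //|[? ?] [/= -> ->]].
  by apply: measurableX; exact: measurable_rV_set1.
- move=> [x y] Dx; apply: (@cvg_comp _ _ _ (fun n => r n (x, y)) F); last exact: cF.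
  exact: (cvg_pair (@cvg_rV_grid x) (@cvg_rV_grid y)).
Qed.

End rounding_rV.

(** * Lebesgue measure on R^N *)

Section lebesgue_translate.
Variable R : realType.

Let measurable_addr (a : R) :
  measurable_fun setT (fun x : measurableTypeR R => x + a : measurableTypeR R).
Proof. exact: (@measurable_funD _ _ _ _ id (cst a)). Qed.

(** The pushforward under a translation gives every half-open interval its length, which
    characterises Lebesgue measure. *)
Lemma lebesgue_measure_translate (a : R) (A : set (measurableTypeR R)) :
  measurable A ->
  lebesgue_measure ((fun x => x + a) @^-1` A) = lebesgue_measure A.
Proof.
move=> mA; pose m := measure_function_pushforward__canonical__measure_function_Measure
  (@lebesgue_measure R) (measurable_addr a).
rewrite [RHS](@lebesgue_measure_unique R m)// => _ [[x y] _ <-].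
rewrite /m /= /pushforward.
have -> : (fun z => z + a) @^-1` `]x, y] = `](x - a), (y - a)]%classic.
  by apply/seteqP; split => z /=; rewrite !in_itv/= ltrBlDr lerBrDr.
rewrite !lebesgue_measure_itv/= !lte_fin ltrD2r.
by case: ifPn => // _; rewrite -!EFinB; congr (_%:E); lra.
Qed.

Lemma cons_rV_ord0 (n : nat) (p : measurableTypeR R * 'rV[R]_n) :
  cons_rV p ord0 ord0 = p.1.
Proof.
rewrite /cons_rV (_ : ord0 = lshift n (ord0 : 'I_1)); last exact/val_inj.
by rewrite (row_mxEl (p.1)%:M p.2) mxE eqxx.
Qed.

Lemma cons_rV_lift (n : nat) (p : measurableTypeR R * 'rV[R]_n) (j : 'I_n) :
  cons_rV p ord0 (lift ord0 j) = p.2 ord0 j.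
Proof.
rewrite /cons_rV (_ : lift ord0 j = rshift 1 j); last exact/val_inj.
exact: (row_mxEr (p.1)%:M p.2).
Qed.

Variable N : nat.

(** Induction on the dimension: through [cons_rV] a translation acts on each factor separately, and
    a product measure is determined by rectangles. *)
Lemma lebesgue_rV_translate (a : 'rV[R]_N) (A : set 'rV[R]_N) :
  measurable A ->
  lebesgue_rV R N ((fun x => x + a) @^-1` A) = lebesgue_rV R N A.
Proof.
elim: N a A => [a A mA|n IH a A mA].
  by congr (lebesgue_rV R 0 _); apply/seteqP; split => x /=;
    rewrite (thinmx0 x) (thinmx0 a) addr0.
have mD := @measurable_cons_rV R n.
pose a0 := a ord0 ord0; pose a' : 'rV[R]_n := \row_j a ord0 (lift ord0 j).
pose s (p : measurableTypeR R * 'rV[R]_n) : measurableTypeR R * 'rV[R]_n :=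
  (p.1 + a0, p.2 + a').
have ms : measurable_fun setT s.
  apply/measurable_fun_pairP; split.
    exact: measurableT_comp (measurable_addr a0) measurable_fst.
  apply: measurable_fun_rV => i; under eq_fun do rewrite mxE.
  apply: measurable_funD => //.
  exact: measurableT_comp (measurable_coor i) measurable_snd.
pose P := (@lebesgue_measure R \x lebesgue_rV R n)%E.
pose m := measure_function_pushforward__canonical__measure_function_Measure P ms.
rewrite /= /lebesgue_step /pushforward.
have mC : measurable ((@cons_rV R n) @^-1` A).
  by rewrite -[X in measurable X]setTI; exact: (mD measurableT _ mA).
rewrite [RHS](@product_measure_unique _ _ _ _ _ _ _ m) => [|B C mB mC'|//].
  rewrite /m /= /pushforward; congr (P _).
  have sE z : cons_rV z + a = cons_rV (s z).
    apply/rowP => i; rewrite mxE; case: (unliftP ord0 i) => [j|] ->.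
      by rewrite !cons_rV_lift /= !mxE.
    by rewrite !cons_rV_ord0.
  by apply/seteqP; split => z /=; rewrite sE.
rewrite /m /= /pushforward (_ : s @^-1` _ = ((fun x => x + a0) @^-1` B) `*`
  ((fun x => x + a') @^-1` C)); last by apply/seteqP; split => -[].
have mB' : measurable ((fun x : measurableTypeR R => x + a0) @^-1` B).
  by rewrite -[X in measurable X]setTI; exact: (measurable_addr a0 measurableT mB).
have mC'' : measurable ((fun x => x + a') @^-1` C).
  rewrite -[X in measurable X]setTI.
  suff mt : measurable_fun setT (fun x : 'rV[R]_n => x + a') by exact: (mt measurableT _ mC').
  apply: measurable_fun_rV => i; under eq_fun do rewrite mxE.
  apply: measurable_funD => //; exact: measurable_coor.
rewrite /P product_measure1E//; congr (_ * _)%E; last exact: IH.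
exact: lebesgue_measure_translate.
Qed.

Lemma measurable_cube (n : nat) (r : R) :
  measurable [set x : 'rV[R]_n | forall i, `|x ord0 i| <= r].
Proof.
have -> : [set x : 'rV[R]_n | forall i, `|x ord0 i| <= r] =
    \bigcap_(i in [set: 'I_n]) ((fun x : 'rV[R]_n => x ord0 i) @^-1` `[- r, r]).
  by apply/seteqP; split => x /= h i; have := h i; rewrite /= in_itv/= ler_norml// => /(_ I).
apply: fin_bigcap_measurable => // i _; rewrite -[X in measurable X]setTI.
by apply: (measurable_coor i).
Qed.

Lemma lebesgue_rV_cube (r : R) : 0 <= r ->
  lebesgue_rV R N [set x | forall i, `|x ord0 i| <= r] = ((r *+ 2) ^+ N)%:E.
Proof.
move=> r0; elim: N => [|n IH].
  rewrite expr0 /= diracE (_ : _ \in _ = true)//; apply/mem_set => -[].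
  by [].
rewrite /= /lebesgue_step /pushforward.
have -> : (@cons_rV R n) @^-1` [set x | forall i, `|x ord0 i| <= r] =
    `[- r, r]%classic `*` [set x : 'rV[R]_n | forall i, `|x ord0 i| <= r].
  apply/seteqP; split => -[x y] /= => [h|[hx hy] i].
    split; first by have := h ord0; rewrite cons_rV_ord0/= in_itv/= ler_norml.
    by move=> i; have := h (lift ord0 i); rewrite cons_rV_lift.
  case: (unliftP ord0 i) => [j|] ->; first by rewrite cons_rV_lift.
  by rewrite cons_rV_ord0/= ler_norml; move: hx; rewrite in_itv.
have mc := @measurable_cube n r.
have lr : lebesgue_measure (`[- r, r]%classic : set R) = (r *+ 2)%:E.
  rewrite lebesgue_measure_itv/= lte_fin; case: ifPn => [rr|].
    by rewrite -EFinB opprK -mulr2n.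
  rewrite -leNgt => rr; have -> : r = 0 by lra.
  by rewrite mul0rn.
rewrite product_measure1E// exprS EFinM; congr (_ * _)%E; [exact: lr|exact: IH].
Qed.

End lebesgue_translate.

(** * Translation invariance of integrals *)

Section translate_integral.
Variables (R : realType) (N : nat).
Local Notation E := 'rV[R]_N.
Local Notation mu := (lebesgue_rV R N).

Lemma measurable_addrV : measurable_fun setT (fun z : E * E => z.1 + z.2).
Proof.
apply: measurable_fun_rV => i; under eq_fun do rewrite mxE.
by apply: measurable_funD;
  [exact: measurableT_comp (measurable_coor i) measurable_fst|
   exact: measurableT_comp (measurable_coor i) measurable_snd].
Qed.

Lemma measurable_subrV : measurable_fun setT (fun z : E * E => z.1 - z.2).
Proof.
apply: measurable_fun_rV => i; under eq_fun do rewrite !mxE.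
by apply: measurable_funB;
  [exact: measurableT_comp (measurable_coor i) measurable_fst|
   exact: measurableT_comp (measurable_coor i) measurable_snd].
Qed.

Lemma measurable_translate (a : E) : measurable_fun setT (fun x : E => x + a).
Proof.
apply: measurable_fun_rV => i; under eq_fun do rewrite mxE.
by apply: measurable_funD => //; exact: measurable_coor.
Qed.

Lemma ge0_integral_translate (f : E -> \bar R) (a : E) :
  measurable_fun setT f -> (forall x, 0 <= f x)%E ->
  (\int[mu]_x f (x + a)%R = \int[mu]_x f x)%E.
Proof.
move=> mf f0.
have := @ge0_integral_pushforward _ _ _ _ _ _ (measurable_translate a) mu setT f
  measurableT mf (fun y _ => f0 y).
rewrite preimage_setT => <-.
apply: eq_measure_integral; first exact: measurable_translate.
by move=> m A mA _; exact: (lebesgue_rV_translate a mA).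
Qed.

Lemma integral_translate (f : E -> \bar R) (a : E) : measurable_fun setT f ->
  (\int[mu]_x f (x + a)%R = \int[mu]_x f x)%E.
Proof.
move=> mf; rewrite integralE [RHS]integralE; congr (_ - _)%E.
  rewrite -(ge0_integral_translate a (measurable_funepos mf))//.
  by apply: eq_integral => x _; rewrite !funeposE.
rewrite -(ge0_integral_translate a (measurable_funeneg mf))//.
by apply: eq_integral => x _; rewrite !funenegE.
Qed.

Lemma Rintegral_translate (f : E -> R) (a : E) : measurable_fun setT f ->
  \int[mu]_x f (x + a) = \int[mu]_x f x.
Proof.
move=> mf; rewrite /Rintegral (integral_translate a (f := EFin \o f))//.
exact/measurable_EFinP.
Qed.

Lemma integrable_translate (f : E -> R) (a : E) :
  mu.-integrable setT (EFin \o f) ->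
  mu.-integrable setT (fun x => (f (x + a))%:E).
Proof.
move=> /integrableP[mf foo]; apply/integrableP; split.
  exact: (measurableT_comp mf (measurable_translate a)).
rewrite (ge0_integral_translate a (f := fun x => `|(f x)%:E|%E))//.
exact: measurableT_comp.
Qed.

End translate_integral.

(** * The Euclidean norm and its balls *)

Section euclidean_norm.
Variables (R : realType) (N : nat).
Local Notation E := 'rV[R]_N.
Implicit Types x y : E.

Lemma dotp_ge0 x : 0 <= dotp x x.
Proof. by apply: sumr_ge0 => i _; rewrite -expr2 sqr_ge0. Qed.

Lemma enorm_ge0 x : 0 <= enorm x. Proof. exact: sqrtr_ge0. Qed.

Lemma enorm_sqr x : enorm x ^+ 2 = \sum_i x ord0 i ^+ 2.
Proof. by rewrite sqr_sqrtr ?dotp_ge0//; apply: eq_bigr => i _; rewrite expr2. Qed.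

Lemma coor_le_enorm x i : `|x ord0 i| <= enorm x.
Proof.
rewrite -(@ler_pXn2r _ 2)// ?nnegrE ?enorm_ge0// enorm_sqr real_normK ?num_real//.
by rewrite (bigD1 i)//= lerDl sumr_ge0// => j _; exact: sqr_ge0.
Qed.

Lemma enorm0 : enorm (0 : E) = 0.
Proof.
by apply/eqP; rewrite sqrtr_eq0 /dotp big1// => i _; rewrite mxE mul0r.
Qed.

Lemma enorm_eq0 x : (enorm x == 0) = (x == 0).
Proof.
apply/eqP/eqP => [x0|->]; last exact: enorm0.
apply/rowP => i; rewrite mxE; apply/eqP; rewrite -normr_le0.
by rewrite -x0 coor_le_enorm.
Qed.

Lemma enorm_gt0 x : (0 < enorm x) = (x != 0).
Proof. by rewrite lt0r enorm_ge0 andbT enorm_eq0. Qed.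

Lemma dotp_le_enorm x y : `|dotp x y| <= enorm x * enorm y.
Proof.
have key : forall a b : R, 0 <= a ^+ 2 * dotp x x + b ^+ 2 * dotp y y + 2 * a * b * dotp x y.
  move=> a b; have -> : a ^+ 2 * dotp x x + b ^+ 2 * dotp y y + 2 * a * b * dotp x y =
      dotp (a *: x + b *: y) (a *: x + b *: y).
    rewrite /dotp !mulr_sumr -!big_split /=; apply: eq_bigr => i _.
    by rewrite !mxE; ring.
  exact: dotp_ge0.
have xx : enorm x ^+ 2 = dotp x x by rewrite sqr_sqrtr ?dotp_ge0.
have yy : enorm y ^+ 2 = dotp y y by rewrite sqr_sqrtr ?dotp_ge0.
have [y0|y0] := eqVneq y 0.
  rewrite y0 enorm0 mulr0 /dotp big1 ?normr0// => i _; by rewrite mxE mulr0.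
have py : 0 < enorm y by rewrite enorm_gt0.
have px := enorm_ge0 x.
(* With these coefficients the form is 2 |x| |y| (|x| |y| + x.y), respectively with - x.y; dividing
   by |x| |y| gives both signs. *)
have h1 := key (enorm y) (enorm x); have h2 := key (enorm y) (- enorm x).
rewrite -xx -yy in h1 h2.
have [x0|x0] := eqVneq x 0.
  rewrite x0 enorm0 mul0r /dotp big1 ?normr0// => i _; by rewrite mxE mul0r.
have pxx : 0 < enorm x by rewrite enorm_gt0.
have pxy : 0 < enorm x * enorm y by rewrite mulr_gt0.
rewrite ler_norml; apply/andP; split; nra.
Qed.

Lemma measurable_enorm : measurable_fun setT (fun x => enorm x).
Proof.
apply: (measurableT_comp (continuous_measurable_fun (@sqrt_continuous R))).
rewrite /dotp; apply: measurable_sum => i.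
by apply: measurable_funM; exact: measurable_coor.
Qed.

Lemma measurable_eball (r : R) : measurable (@eball R N r).
Proof.
rewrite (_ : eball r = enorm @^-1` `]-oo, r[); last first.
  by apply/seteqP; split => x /=; rewrite in_itv.
by rewrite -[X in measurable X]setTI; exact: measurable_enorm.
Qed.

(** Only the rate r^N matters, so that the ball is compared with the cube around it. *)
Lemma eball_bound (r : R) : 0 <= r ->
  (lebesgue_rV R N (eball r) <= ((r *+ 2) ^+ N)%:E)%E.
Proof.
move=> r0; rewrite -lebesgue_rV_cube//; apply: le_measure.
- by rewrite inE; exact: measurable_eball.
- by rewrite inE; exact: measurable_cube.
- by move=> x /= xr i; rewrite (le_trans (coor_le_enorm x i))// ltW.
Qed.

End euclidean_norm.

(** * Real-valued and square integrable functions *)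

Section real_integrals.
Context d (T : measurableType d) (R : realType).
Variable nu : {measure set T -> \bar R}.
Implicit Types f g h : T -> R.

Definition rintegrable f := nu.-integrable setT (EFin \o f).

Lemma rintegrable_measurable f : rintegrable f -> measurable_fun setT f.
Proof. by move=> /integrableP[/measurable_EFinP]. Qed.

Lemma rintegrable_lty f : rintegrable f -> (\int[nu]_x `|f x|%:E < +oo)%E.
Proof. by move=> /integrableP[]. Qed.

Lemma rintegrableP f : measurable_fun setT f ->
  (\int[nu]_x `|f x|%:E < +oo)%E -> rintegrable f.
Proof. by move=> mf foo; apply/integrableP; split => //; exact/measurable_EFinP. Qed.

Lemma rintegrable_le f g : measurable_fun setT f -> (forall x, `|f x| <= g x) ->
  rintegrable g -> rintegrable f.
Proof.
move=> mf fg ig; apply: le_integrable ig => //; first exact/measurable_EFinP.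
by move=> x _ /=; rewrite lee_fin (le_trans (fg x))// ler_norm.
Qed.

Lemma rintegrableD f g : rintegrable f -> rintegrable g ->
  rintegrable (fun x => f x + g x).
Proof. by move=> fi gi; exact: (integrableD measurableT fi gi). Qed.

Lemma rintegrableB f g : rintegrable f -> rintegrable g ->
  rintegrable (fun x => f x - g x).
Proof. by move=> fi gi; exact: (integrableB measurableT fi gi). Qed.

Lemma rintegrableZ c f : rintegrable f -> rintegrable (fun x => c * f x).
Proof. by move=> fi; exact: (integrableZl measurableT c fi). Qed.

Lemma rintegrable0 : rintegrable (fun=> 0).
Proof. exact: integrable0. Qed.

Lemma rintegrable_sum (I : Type) (s : seq I) (F : I -> T -> R) :
  (forall i, rintegrable (F i)) -> rintegrable (fun x => \sum_(i <- s) F i x).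
Proof.
move=> Fi; elim: s => [|i s IH].
  by under eq_fun do rewrite big_nil; exact: rintegrable0.
by under eq_fun do rewrite big_cons; exact: rintegrableD.
Qed.

Lemma rintegrable_norm f : rintegrable f -> rintegrable (fun x => `|f x|).
Proof. exact: integrable_norm. Qed.

Lemma RintD f g : rintegrable f -> rintegrable g ->
  \int[nu]_x (f x + g x) = \int[nu]_x f x + \int[nu]_x g x.
Proof. by move=> fi gi; rewrite RintegralD. Qed.

Lemma RintB f g : rintegrable f -> rintegrable g ->
  \int[nu]_x (f x - g x) = \int[nu]_x f x - \int[nu]_x g x.
Proof. by move=> fi gi; rewrite RintegralB. Qed.

Lemma RintZ c f : rintegrable f ->
  \int[nu]_x (c * f x) = c * \int[nu]_x f x.
Proof. by move=> fi; rewrite RintegralZl. Qed.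

Lemma Rint_sum (I : Type) (s : seq I) (F : I -> T -> R) :
  (forall i, rintegrable (F i)) ->
  \int[nu]_x (\sum_(i <- s) F i x) = \sum_(i <- s) \int[nu]_x F i x.
Proof.
move=> Fi; elim: s => [|i s IH].
  by under eq_Rintegral do rewrite big_nil; rewrite big_nil /Rintegral integral0.
under eq_Rintegral do rewrite big_cons.
by rewrite big_cons -IH RintD//; exact: rintegrable_sum.
Qed.

Lemma Rint_le f g : rintegrable f -> rintegrable g -> (forall x, f x <= g x) ->
  \int[nu]_x f x <= \int[nu]_x g x.
Proof. by move=> fi gi fg; apply: le_Rintegral. Qed.

Lemma Rint_norm f : rintegrable f ->
  `|\int[nu]_x f x| <= \int[nu]_x `|f x|.
Proof. by move=> fi; exact: le_normr_Rintegral. Qed.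

Lemma EFin_Rint f : rintegrable f -> (\int[nu]_x f x)%:E = (\int[nu]_x (f x)%:E)%E.
Proof. by move=> fi; rewrite /Rintegral fineK//; exact: integrable_fin_num. Qed.

Lemma Rint_ge0 f : (forall x, 0 <= f x) -> 0 <= \int[nu]_x f x.
Proof. by move=> f0; apply: Rintegral_ge0. Qed.

Lemma ge0_rintegrable f : measurable_fun setT f -> (forall x, 0 <= f x) ->
  (\int[nu]_x (f x)%:E < +oo)%E -> rintegrable f.
Proof.
by move=> mf f0 foo; apply: rintegrableP => //; under eq_integral do rewrite ger0_norm//.
Qed.

Lemma rintegrable_indic_cst (A : set T) (c : R) : measurable A -> (nu A < +oo)%E ->
  rintegrable (fun x => c * \1_A x).
Proof.
move=> mA Aoo; apply: rintegrableZ; apply: ge0_rintegrable => //.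
by rewrite integral_indic// setIT.
Qed.

(** The squared L^2 norm is extended-valued because it is also taken of functions whose square
    integrability is not known yet. *)
Definition sqn f : \bar R := (\int[nu]_x (f x ^+ 2)%:E)%E.
Definition sqint f := measurable_fun setT f /\ (sqn f < +oo)%E.

Lemma sqn_ge0 f : (0 <= sqn f)%E.
Proof. by apply: integral_ge0 => x _; rewrite lee_fin sqr_ge0. Qed.

Lemma sqint_fin_num f : sqint f -> sqn f \is a fin_num.
Proof. by move=> [_ foo]; rewrite ge0_fin_numE// sqn_ge0. Qed.

Lemma sqint_sqr f : sqint f -> rintegrable (fun x => f x ^+ 2).
Proof.
move=> [mf foo]; apply: ge0_rintegrable => //; first exact: measurable_funX.
by move=> x; exact: sqr_ge0.
Qed.

Lemma sqintP f : measurable_fun setT f -> rintegrable (fun x => f x ^+ 2) -> sqint f.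
Proof.
move=> mf /rintegrable_lty; under eq_integral do rewrite normrX real_normK ?num_real//.
by [].
Qed.

Lemma sqint_mul f g : sqint f -> sqint g -> rintegrable (fun x => f x * g x).
Proof.
move=> fi gi; have [mf _] := fi; have [mg _] := gi.
apply: rintegrable_le (rintegrableD (sqint_sqr fi) (sqint_sqr gi)).
  exact: measurable_funM.
move=> x; rewrite ler_norml; apply/andP; split; nra.
Qed.

Lemma sqintD f g : sqint f -> sqint g -> sqint (fun x => f x + g x).
Proof.
move=> fi gi; have [mf _] := fi; have [mg _] := gi.
apply: sqintP; first exact: measurable_funD.
apply: rintegrable_le (rintegrableD (rintegrableZ 2 (sqint_sqr fi)) (rintegrableZ 2 (sqint_sqr gi))).
  by apply: measurable_funX; exact: measurable_funD.
by move=> x; rewrite ger0_norm ?sqr_ge0//; have := sqr_ge0 (f x - g x); nra.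
Qed.

Lemma sqintZ c f : sqint f -> sqint (fun x => c * f x).
Proof.
move=> fi; have [mf _] := fi; apply: sqintP; first exact: measurable_funM.
by under eq_fun do rewrite exprMn; apply: rintegrableZ; exact: sqint_sqr.
Qed.

Lemma sqintB f g : sqint f -> sqint g -> sqint (fun x => f x - g x).
Proof.
move=> fi gi; have := sqintD fi (sqintZ (-1) gi).
by under [X in sqint X -> _]eq_fun do rewrite mulN1r.
Qed.

Lemma cauchy_schwarz f g : sqint f -> sqint g ->
  (\int[nu]_x (f x * g x)) ^+ 2 <= fine (sqn f) * fine (sqn g).
Proof.
move=> fi gi; set a := fine (sqn f); set c := fine (sqn g); set b := \int[nu]_x _.
have key s t : 0 <= s ^+ 2 * a + 2 * s * t * b + t ^+ 2 * c.
  have -> : s ^+ 2 * a + 2 * s * t * b + t ^+ 2 * c =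
      \int[nu]_x (s ^+ 2 * f x ^+ 2 + (2 * s * t) * (f x * g x) + t ^+ 2 * g x ^+ 2).
    have i1 := sqint_sqr fi; have i2 := sqint_mul fi gi; have i3 := sqint_sqr gi.
    rewrite RintD; [|apply: rintegrableD; exact: rintegrableZ|exact: rintegrableZ].
    by rewrite RintD ?RintZ//; exact: rintegrableZ.
  apply: Rint_ge0 => x.
  by rewrite (_ : _ + _ = (s * f x + t * g x) ^+ 2) ?sqr_ge0//; ring.
have a0 : 0 <= a by rewrite fine_ge0// sqn_ge0.
have c0 : 0 <= c by rewrite fine_ge0// sqn_ge0.
have [a00|ap] := eqVneq a 0.
  rewrite a00 mul0r; have [->|b0] := eqVneq b 0; first by rewrite expr0n.
  (* For a = 0 the form is affine in [s], and this choice gives it the value -1. *)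
  have := key (- (c + 1) / (2 * b)) 1; rewrite a00.
  have -> : (- (c + 1) / (2 * b)) ^+ 2 * 0 + 2 * (- (c + 1) / (2 * b)) * 1 * b +
    1 ^+ 2 * c = - 1 by field.
  lra.
have ap' : 0 < a by rewrite lt0r ap.
(* At (- b, a) the form equals a (a c - b^2). *)
have h := key (- b) a; nra.
Qed.

End real_integrals.

(** * Parameter integrals and Fubini's theorem for real functions *)

Section measurable_integrals.
Context d1 d2 (T1 : measurableType d1) (T2 : measurableType d2) (R : realType).
Variable m1 : {sigma_finite_measure set T1 -> \bar R}.
Variable m2 : {sigma_finite_measure set T2 -> \bar R}.
Variable F : T1 * T2 -> R.
Hypothesis mF : measurable_fun setT F.

(** Integrability is avoided: positive and negative parts are covered by Tonelli's theorem, and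
    [fine] is measurable. *)
Lemma measurable_Rintegral2 : measurable_fun setT (fun x => \int[m2]_y F (x, y)).
Proof.
rewrite /Rintegral; apply: measurableT_comp => //=.
have mFE : measurable_fun setT (EFin \o F) by exact/measurable_EFinP.
have -> : (fun x => \int[m2]_y (F (x, y))%:E)%E =
    (fun x => \int[m2]_y (EFin \o F)^\+ (x, y) - \int[m2]_y (EFin \o F)^\- (x, y))%E.
  apply/funext => x; rewrite [LHS]integralE; congr (_ - _)%E;
  by apply: eq_integral => y _; rewrite ?funeposE ?funenegE.
apply: emeasurable_funB.
  have h : measurable_fun setT (fubini_F m2 ((EFin \o F)^\+)%E).
    by apply: measurable_fun_fubini_tonelli_F => //; exact: measurable_funepos.
  exact: h.
have h : measurable_fun setT (fubini_F m2 ((EFin \o F)^\-)%E).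
    by apply: measurable_fun_fubini_tonelli_F => //; exact: measurable_funeneg.
  exact: h.
Qed.

Lemma measurable_Rintegral1 : measurable_fun setT (fun y => \int[m1]_x F (x, y)).
Proof.
rewrite /Rintegral; apply: measurableT_comp => //=.
have mFE : measurable_fun setT (EFin \o F) by exact/measurable_EFinP.
have -> : (fun y => \int[m1]_x (F (x, y))%:E)%E =
    (fun y => \int[m1]_x (EFin \o F)^\+ (x, y) - \int[m1]_x (EFin \o F)^\- (x, y))%E.
  apply/funext => y; rewrite [LHS]integralE; congr (_ - _)%E;
  by apply: eq_integral => x _; rewrite ?funeposE ?funenegE.
apply: emeasurable_funB.
  have h : measurable_fun setT (fubini_G m1 ((EFin \o F)^\+)%E).
    by apply: measurable_fun_fubini_tonelli_G => //; exact: measurable_funepos.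
  exact: h.
have h : measurable_fun setT (fubini_G m1 ((EFin \o F)^\-)%E).
    by apply: measurable_fun_fubini_tonelli_G => //; exact: measurable_funeneg.
  exact: h.
Qed.

Lemma rintegrable_prodP :
  (\int[m1]_x \int[m2]_y `|F (x, y)|%:E < +oo)%E -> rintegrable (m1 \x m2)%E F.
Proof.
move=> h; apply/(integrable12ltyP); first exact/measurable_EFinP.
exact: h.
Qed.

Lemma rintegrable_prodP2 :
  (\int[m2]_y \int[m1]_x `|F (x, y)|%:E < +oo)%E -> rintegrable (m1 \x m2)%E F.
Proof.
move=> h; apply/(integrable21ltyP); first exact/measurable_EFinP.
exact: h.
Qed.

End measurable_integrals.

Section fubini_real.
Context d1 d2 (T1 : measurableType d1) (T2 : measurableType d2) (R : realType).
Variable m1 : {sigma_finite_measure set T1 -> \bar R}.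
Variable m2 : {sigma_finite_measure set T2 -> \bar R}.

Lemma rintegrable_prod_mul (a : T1 -> R) (b : T2 -> R) :
  rintegrable m1 a -> rintegrable m2 b ->
  rintegrable (m1 \x m2)%E (fun z => a z.1 * b z.2).
Proof.
move=> ai bi; have ma := rintegrable_measurable ai; have mb := rintegrable_measurable bi.
apply: rintegrable_prodP.
  by apply: measurable_funM; [exact: measurableT_comp ma measurable_fst|
    exact: measurableT_comp mb measurable_snd].
under eq_integral do under eq_integral do rewrite /= normrM EFinM.
under eq_integral => x _.
  rewrite ge0_integralZl//; last first.
    by apply/measurable_EFinP; exact: measurableT_comp.
  over.
have bE := rintegrable_lty bi.
have b0 : (0 <= \int[m2]_y `|b y|%:E)%E by apply: integral_ge0.
rewrite ge0_integralZr//; last by apply/measurable_EFinP; exact: measurableT_comp.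
by rewrite lte_mul_pinfty ?rintegrable_lty// ?ge0_fin_numE ?integral_ge0// rintegrable_lty.
Qed.

Variable F : T1 * T2 -> R.
Hypothesis iF : rintegrable (m1 \x m2)%E F.
Let mF := rintegrable_measurable iF.

Lemma rintegrable_Rint2 : rintegrable m1 (fun x => \int[m2]_y F (x, y)).
Proof.
have /integrableP[_ h] := integrable_fubini_F iF.
apply: rintegrableP; first exact: measurable_Rintegral2.
apply: le_lt_trans h; rewrite le_eqVlt; apply/orP; left; apply/eqP.
apply: integral_ae_eqW; apply: filterS (ae_integrable1 iF) => x xi _ /=.
by rewrite /fubini_F -abse_EFin /Rintegral fineK//; exact: (integrable_fin_num _ xi).
Qed.

Lemma ae_rintegrable2 : {ae m1, forall x, rintegrable m2 (fun y => F (x, y))}.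
Proof. exact: ae_integrable1 iF. Qed.

Lemma ae_rintegrable1 : {ae m2, forall y, rintegrable m1 (fun x => F (x, y))}.
Proof. exact: ae_integrable2 iF. Qed.

Lemma Rint_fubini2 : \int[m1]_x \int[m2]_y F (x, y) = \int[(m1 \x m2)%E]_z F z.
Proof.
rewrite /Rintegral -(integral12_prod_meas1 iF); congr fine.
apply: integral_ae_eqW; apply: filterS ae_rintegrable2 => x xi _ /=.
by rewrite fineK//; exact: integrable_fin_num xi.
Qed.

Lemma Rint_fubini1 : \int[m2]_y \int[m1]_x F (x, y) = \int[(m1 \x m2)%E]_z F z.
Proof.
rewrite /Rintegral -(integral21_prod_meas1 iF); congr fine.
apply: integral_ae_eqW; apply: filterS ae_rintegrable1 => x xi _ /=.
by rewrite fineK//; exact: integrable_fin_num xi.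
Qed.

Lemma Rint_fubini : \int[m1]_x \int[m2]_y F (x, y) = \int[m2]_y \int[m1]_x F (x, y).
Proof. by rewrite Rint_fubini2 Rint_fubini1. Qed.

End fubini_real.

(** * Mollification *)

Section mollification.
Variables (R : realType) (N : nat).
Local Notation E := 'rV[R]_N.
Local Notation mu := (lebesgue_rV R N).
Implicit Types (psi h k : E -> R).

(** Bounded and integrable, hence square integrable: Cauchy-Schwarz gives pointwise bounds and
    Young's inequality L^2 bounds. Neither sign nor smoothness is asked for, so that the nonlocal
    operator applied to a mollifier is again a kernel. *)
Definition kernel psi :=
  rintegrable mu psi /\ exists M : R, forall z, `|psi z| <= M.

(* The convolution of h with the reflection of psi. *)
Definition mollify psi h (x : E) : R := \int[mu]_z (psi z * h (z + x)).

Definition l1norm psi : R := \int[mu]_z `|psi z|.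

Lemma l1norm_ge0 psi : 0 <= l1norm psi.
Proof. by apply: Rint_ge0. Qed.

Lemma kernel_measurable psi : kernel psi -> measurable_fun setT psi.
Proof. by move=> [/rintegrable_measurable]. Qed.

Lemma kernel_sqint psi : kernel psi -> sqint mu psi.
Proof.
move=> [ipsi [M hM]]; apply: sqintP; first exact: rintegrable_measurable ipsi.
apply: rintegrable_le (rintegrableZ M (rintegrable_norm ipsi)).
  by apply: measurable_funX; exact: rintegrable_measurable ipsi.
move=> x; rewrite normrX expr2; apply: ler_wpM2r => //; exact: hM.
Qed.

Lemma kernelB psi psi' : kernel psi -> kernel psi' ->
  kernel (fun z => psi z - psi' z).
Proof.
move=> [i1 [M1 h1]] [i2 [M2 h2]]; split; first exact: rintegrableB.
by exists (M1 + M2) => z; rewrite (le_trans (ler_normB _ _))// lerD.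
Qed.

Lemma kernelZ c psi : kernel psi -> kernel (fun z => c * psi z).
Proof.
move=> [i1 [M1 h1]]; split; first exact: rintegrableZ.
by exists (`|c| * M1) => z; rewrite normrM ler_wpM2l.
Qed.

Lemma kernel_translate psi a : kernel psi -> kernel (fun z => psi (z + a)).
Proof.
by move=> [i1 [M1 h1]]; split; [exact: integrable_translate|exists M1].
Qed.

Lemma sqn_translate h a : measurable_fun setT h ->
  sqn mu (fun x => h (x + a)) = sqn mu h.
Proof.
move=> mh; rewrite /sqn.
rewrite (ge0_integral_translate a (f := fun x => (h x ^+ 2)%:E))//.
  exact/measurable_EFinP/measurable_funX.
by move=> x; rewrite lee_fin sqr_ge0.
Qed.

Lemma sqint_translate h a : sqint mu h -> sqint mu (fun x => h (x + a)).
Proof.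
move=> [mh hoo]; split; last by rewrite sqn_translate.
exact: measurableT_comp mh (measurable_translate a).
Qed.

Lemma rintegrable_mollify psi h x : sqint mu psi -> sqint mu h ->
  rintegrable mu (fun z => psi z * h (z + x)).
Proof. by move=> ipsi ih; apply: sqint_mul => //; exact: sqint_translate. Qed.

Lemma measurable_shift h : measurable_fun setT h ->
  measurable_fun setT (fun p : E * E => h (p.2 + p.1)).
Proof.
move=> mh; have m21 : measurable_fun setT (fun p : E * E => p.2 + p.1).
  have := @measurable_addrV R N; congr (measurable_fun _ _).
  by apply/funext => p; rewrite addrC.
exact: (measurableT_comp mh m21).
Qed.

Lemma measurable_mollify psi h : measurable_fun setT psi -> measurable_fun setT h ->
  measurable_fun setT (mollify psi h).
Proof.
move=> mpsi mh.
apply: (@measurable_Rintegral2 _ _ _ _ R mu (fun p : E * E => psi p.2 * h (p.2 + p.1))).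
apply: measurable_funM; first exact: measurableT_comp mpsi measurable_snd.
exact: measurable_shift.
Qed.

Lemma mollifyB psi h k : sqint mu psi -> sqint mu h -> sqint mu k ->
  mollify psi (fun x => h x - k x) = (fun x => mollify psi h x - mollify psi k x).
Proof.
move=> ip ih ik; apply/funext => x; rewrite /mollify -RintB; try exact: rintegrable_mollify.
by apply: eq_Rintegral => z _; rewrite mulrBr.
Qed.

Lemma mollifyD psi h k : sqint mu psi -> sqint mu h -> sqint mu k ->
  mollify psi (fun x => h x + k x) = (fun x => mollify psi h x + mollify psi k x).
Proof.
move=> ip ih ik; apply/funext => x; rewrite /mollify -RintD; try exact: rintegrable_mollify.
by apply: eq_Rintegral => z _; rewrite mulrDr.
Qed.

Lemma mollifyZ psi c h : sqint mu psi -> sqint mu h ->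
  mollify psi (fun x => c * h x) = (fun x => c * mollify psi h x).
Proof.
move=> ip ih; apply/funext => x; rewrite /mollify -RintZ; try exact: rintegrable_mollify.
by apply: eq_Rintegral => z _; rewrite mulrCA.
Qed.

Lemma mollify_translate psi h a :
  mollify psi (fun x => h (x + a)) = (fun x => mollify psi h (x + a)).
Proof. by apply/funext => x; apply: eq_Rintegral => z _; rewrite addrA. Qed.

Lemma mollify_kernel_translate psi h a : measurable_fun setT psi ->
  measurable_fun setT h ->
  mollify (fun z => psi (z + a)) h = (fun x => mollify psi h (x - a)).
Proof.
move=> mp mh; apply/funext => x; rewrite /mollify.
rewrite -[LHS](Rintegral_translate (- a) (f := fun z => psi (z + a) * h (z + x))).
  by apply: eq_Rintegral => z _; rewrite subrK -addrA [- a + x]addrC.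
apply: measurable_funM; first exact: measurableT_comp mp (measurable_translate a).
exact: measurableT_comp mh (measurable_translate x).
Qed.

Lemma mollify_kernelB psi psi' h : sqint mu psi -> sqint mu psi' -> sqint mu h ->
  mollify (fun z => psi z - psi' z) h = (fun x => mollify psi h x - mollify psi' h x).
Proof.
move=> ip ip' ih; apply/funext => x; rewrite /mollify -RintB; try exact: rintegrable_mollify.
by apply: eq_Rintegral => z _; rewrite mulrBl.
Qed.

Lemma mollify_kernelZ c psi h : sqint mu psi -> sqint mu h ->
  mollify (fun z => c * psi z) h = (fun x => c * mollify psi h x).
Proof.
move=> ip ih; apply/funext => x; rewrite /mollify -RintZ; try exact: rintegrable_mollify.
by apply: eq_Rintegral => z _; rewrite mulrA.
Qed.

Lemma mollify_bound psi h x : sqint mu psi -> sqint mu h ->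
  mollify psi h x ^+ 2 <= fine (sqn mu psi) * fine (sqn mu h).
Proof.
move=> ip ih; have := cauchy_schwarz ip (sqint_translate x ih).
by rewrite sqn_translate//; case: ih.
Qed.

(** Cauchy-Schwarz for sqrt |psi| and sqrt |psi| |h|; the mass of |psi| comes out as the first
    factor. *)
Let young_pointwise psi h x : kernel psi -> sqint mu h ->
  mollify psi h x ^+ 2 <= l1norm psi * \int[mu]_z (`|psi z| * h (z + x) ^+ 2).
Proof.
move=> kp ih; have ip := kernel_sqint kp; have mp := kernel_measurable kp.
have [ip1 [M hM]] := kp.
have ihx := sqint_translate x ih; have [mhx _] := ihx.
have mps : measurable_fun setT (fun z => Num.sqrt `|psi z|).
  apply: (measurableT_comp (continuous_measurable_fun (@sqrt_continuous R))).
  exact: measurableT_comp.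
have i2 : rintegrable mu (fun z => `|psi z| * h (z + x) ^+ 2).
  apply: rintegrable_le (rintegrableZ M (sqint_sqr ihx)).
    by apply: measurable_funM; [exact: measurableT_comp|exact: measurable_funX].
  move=> z; rewrite normrM normr_id normrX real_normK ?num_real//.
  by rewrite ler_wpM2r ?sqr_ge0.
have s1 : sqint mu (fun z => Num.sqrt `|psi z|).
  apply: sqintP => //; under eq_fun do rewrite sqr_sqrtr//.
  exact: rintegrable_norm.
have s2 : sqint mu (fun z => Num.sqrt `|psi z| * `|h (z + x)|).
  apply: sqintP; first by apply: measurable_funM => //; exact: measurableT_comp.
  by under eq_fun do rewrite exprMn sqr_sqrtr// real_normK ?num_real//.
have := cauchy_schwarz s1 s2.
have -> : fine (sqn mu (fun z => Num.sqrt `|psi z|)) = l1norm psi.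
  by rewrite /sqn /l1norm /Rintegral; under eq_integral do rewrite sqr_sqrtr//.
have -> : fine (sqn mu (fun z => Num.sqrt `|psi z| * `|h (z + x)|)) =
    \int[mu]_z (`|psi z| * h (z + x) ^+ 2).
  rewrite /sqn /Rintegral; congr fine; apply: eq_integral => z _.
  by rewrite exprMn sqr_sqrtr// real_normK ?num_real.
apply: le_trans; rewrite -[leLHS]real_normK ?num_real//.
have := Rint_norm (rintegrable_mollify x ip ih) => hn.
rewrite ler_sqr ?nnegrE//; last first.
  by apply: Rint_ge0 => z; rewrite !mulr_ge0 ?sqrtr_ge0.
rewrite (le_trans hn)// le_eqVlt; apply/orP; left; apply/eqP.
apply: eq_Rintegral => z _; rewrite mulrA -expr2 sqr_sqrtr// normrM//.
Qed.

(** Young's inequality: the pointwise bound is integrated in x, and after exchanging the integrals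
    the inner one is the translation-invariant norm of [h]. *)
Lemma sqn_mollify psi h : kernel psi -> sqint mu h ->
  (sqn mu (mollify psi h) <= (l1norm psi ^+ 2)%:E * sqn mu h)%E.
Proof.
move=> kp ih; have mp := kernel_measurable kp; have [mh _] := ih.
have [ip1 [M hM]] := kp.
have mF : measurable_fun setT (fun p : E * E => `|psi p.2| * h (p.2 + p.1) ^+ 2).
  apply: measurable_funM.
    by apply: measurableT_comp => //; exact: measurableT_comp mp measurable_snd.
  by apply: measurable_funX; exact: measurable_shift.
have i2 x : rintegrable mu (fun z => `|psi z| * h (z + x) ^+ 2).
  have ihx := sqint_translate x ih; have [mhx _] := ihx.
  apply: rintegrable_le (rintegrableZ M (sqint_sqr ihx)).
    by apply: measurable_funM; [exact: measurableT_comp|exact: measurable_funX].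
  move=> z; rewrite normrM normr_id normrX real_normK ?num_real//.
  by rewrite ler_wpM2r ?sqr_ge0.
apply: (@le_trans _ _ (\int[mu]_x ((l1norm psi)%:E *
    \int[mu]_z (`|psi z| * h (z + x) ^+ 2)%:E))%E).
  apply: ge0_le_integral => //.
  - by move=> x _; rewrite lee_fin sqr_ge0.
  - by apply/measurable_EFinP/measurable_funX; exact: measurable_mollify.
  - apply: emeasurable_funM => //.
    have h1 : measurable_fun setT (fubini_F mu (fun p : E * E => (`|psi p.2| * h (p.2 + p.1) ^+ 2)%:E)).
      apply: measurable_fun_fubini_tonelli_F; first exact/measurable_EFinP.
      by move=> p; rewrite lee_fin mulr_ge0 ?sqr_ge0.
    exact: h1.
  - by move=> x _; rewrite -EFin_Rint// -EFinM lee_fin young_pointwise.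
rewrite ge0_integralZl//; last 3 first.
- have h1 : measurable_fun setT (fubini_F mu (fun p : E * E => (`|psi p.2| * h (p.2 + p.1) ^+ 2)%:E)).
    apply: measurable_fun_fubini_tonelli_F; first exact/measurable_EFinP.
    by move=> p; rewrite lee_fin mulr_ge0 ?sqr_ge0.
  exact: h1.
- by move=> x _; apply: integral_ge0 => z _; rewrite lee_fin mulr_ge0 ?sqr_ge0.
- by rewrite lee_fin l1norm_ge0.
rewrite expr2 EFinM -muleA lee_wpmul2l ?lee_fin ?l1norm_ge0//.
rewrite (fubini_tonelli (fun p : E * E => (`|psi p.2| * h (p.2 + p.1) ^+ 2)%:E))/=; last 2 first.
- exact/measurable_EFinP.
- by move=> p; rewrite lee_fin mulr_ge0 ?sqr_ge0.
under eq_integral => z _.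
  under eq_integral do rewrite EFinM.
  rewrite ge0_integralZl//; last 2 first.
  - apply/measurable_EFinP/measurable_funX; apply: (measurableT_comp mh).
    by have := measurable_translate z; under eq_fun do rewrite addrC.
  - by move=> x _; rewrite lee_fin sqr_ge0.
  rewrite (_ : (\int[mu]_x _)%E = sqn mu h); last first.
    rewrite -(sqn_translate z mh); apply: eq_integral => x _; by rewrite addrC.
  over.
rewrite ge0_integralZr ?sqn_ge0//; last by apply/measurable_EFinP; exact: measurableT_comp.
by rewrite /l1norm EFin_Rint//; exact: rintegrable_norm.
Qed.

Lemma sqint_mollify psi h : kernel psi -> sqint mu h -> sqint mu (mollify psi h).
Proof.
move=> kp ih; split.
  by apply: measurable_mollify; [exact: kernel_measurable|case: ih].
apply: le_lt_trans (sqn_mollify kp ih) _; rewrite lte_mul_pinfty ?lee_fin ?sqr_ge0//.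
by case: ih.
Qed.

Definition diffq h (y x : E) : R := h x - h (x - y).

Lemma sqint_diffq h y : sqint mu h -> sqint mu (diffq h y).
Proof. by move=> ih; apply: sqintB => //; exact: sqint_translate. Qed.

Lemma diffq_mollify psi h y : sqint mu psi -> sqint mu h ->
  diffq (mollify psi h) y = mollify psi (diffq h y).
Proof.
move=> ip ih; rewrite /diffq mollifyB//; last exact: sqint_translate.
by rewrite mollify_translate.
Qed.

End mollification.

Section square_norm_limits.
Context d (T : measurableType d) (R : realType).
Variable nu : {measure set T -> \bar R}.

Lemma sqn_cvg0 (f : nat -> T -> R) (g : T -> R) :
  (forall n, measurable_fun setT (f n)) -> (forall n x, `|f n x| <= g x) ->
  sqint nu g -> (forall x, f n x @[n --> \oo] --> 0) ->
  forall e : R, 0 < e -> \forall n \near \oo, (sqn nu (f n) <= e%:E)%E.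
Proof.
move=> mf fg ig f0 e e0.
have [] := @dominated_convergence _ _ _ nu setT measurableT
  (fun n x => (f n x ^+ 2)%:E) (fun=> 0%E) (fun x => (g x ^+ 2)%:E).
- by move=> n; apply/measurable_EFinP/measurable_funX.
- exact: measurable_cst.
- apply: aeW => x _ /=; apply: cvg_EFin; first exact: nearW.
  have h : f n x * f n x @[n --> \oo] --> (0 : R).
    by rewrite -[X in _ --> X](mulr0 0); exact: cvgM.
  by apply: cvg_trans h; apply: near_eq_cvg; apply: nearW => n /=; rewrite expr2.
- exact: sqint_sqr.
- apply: aeW => x n _ /=; rewrite lee_fin normrX lerXn2r ?nnegrE//.
  exact: le_trans (fg n x).
move=> _ _; rewrite integral0 => /fine_cvgP[fin /cvgrPdist_le /(_ _ e0) h].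
apply: filterS2 fin h => n /= fn; rewrite sub0r normrN => hn.
by rewrite /sqn -(fineK fn) lee_fin (le_trans (ler_norm _)).
Qed.

Lemma sqn_sub_le (f g : T -> R) : sqint nu f -> sqint nu g ->
  (sqn nu (fun x => f x + g x)%R <= 2%:E * sqn nu f + 2%:E * sqn nu g)%E.
Proof.
move=> fi gi; have i1 := sqint_sqr fi; have i2 := sqint_sqr gi.
have i3 := sqint_sqr (sqintD fi gi).
rewrite /sqn -!EFin_Rint// -!EFinM -EFinD lee_fin -!RintZ// -RintD;
  try exact: rintegrableZ.
apply: Rint_le => //; first by apply: rintegrableD; exact: rintegrableZ.
by move=> x; have := sqr_ge0 (f x - g x); nra.
Qed.

End square_norm_limits.

(** * Convergence of mollifications in L^2 *)

Section approximate_unit.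
Variables (R : realType) (N : nat).
Local Notation E := 'rV[R]_N.
Local Notation mu := (lebesgue_rV R N).
Implicit Types (h k : E -> R).

(** The supports lie on one side of the origin. A small nonnegative shift does not change membership
    in a half-open box, so that mollified indicators of boxes converge at every point, boundary
    included. *)
Definition approximate_unit (eta : nat -> E -> R) :=
  [/\ forall n, kernel (eta n), forall n z, 0 <= eta n z,
      forall n, \int[mu]_z eta n z = 1 &
      forall n z, eta n z != 0 -> forall i, 0 <= z ord0 i <= n.+1%:R^-1].

Variable eta : nat -> E -> R.
Hypothesis eta_unit : approximate_unit eta.

Let etak n : kernel (eta n). Proof. by case: eta_unit. Qed.
Let etas n : sqint mu (eta n). Proof. exact: kernel_sqint. Qed.

Lemma l1norm_unit n : l1norm (eta n) = 1.
Proof.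
have [_ e0 e1 _] := eta_unit; rewrite -(e1 n); apply: eq_Rintegral => z _.
by rewrite ger0_norm.
Qed.

Lemma sqn_mollify_unit n h : sqint mu h ->
  (sqn mu (mollify (eta n) h) <= sqn mu h)%E.
Proof.
by move=> ih; have := sqn_mollify (etak n) ih; rewrite l1norm_unit expr1n mul1e.
Qed.

(** This class turns out to be all of L^2: it contains the boxes, is linear and closed, hence
    contains bounded Borel sets by a pi-lambda argument, then truncated simple functions and their
    limits. *)
Definition approximable h := sqint mu h /\ forall e : R, 0 < e ->
  \forall n \near \oo, (sqn mu (fun x => mollify (eta n) h x - h x)%R <= e%:E)%E.

Lemma approximable_sum a h k : approximable h -> approximable k ->
  approximable (fun x => a * h x + k x).
Proof.
move=> [ih ch] [ik ck]; split; first by apply: sqintD => //; exact: sqintZ.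
(* Each of the two errors, doubled by [sqn_sub_le], is at most e / 2; the added 1 allows a = 0. *)
move=> e e0; have a1 : 0 < 4 * (a ^+ 2 + 1) by have := sqr_ge0 a; lra.
have e1 : 0 < e / (4 * (a ^+ 2 + 1)) by rewrite divr_gt0.
have e2 : 0 < e / 4 by lra.
near=> n.
have h1 : (sqn mu (fun x => mollify (eta n) h x - h x)%R <= (e / (4 * (a ^+ 2 + 1)))%:E)%E.
  by near: n; exact: ch.
have h2 : (sqn mu (fun x => mollify (eta n) k x - k x)%R <= (e / 4)%:E)%E.
  by near: n; exact: ck.
rewrite mollifyD//; last exact: sqintZ.
rewrite mollifyZ//.
have m1 := sqintB (sqint_mollify (etak n) ih) ih.
have m2 := sqintB (sqint_mollify (etak n) ik) ik.
have -> : (fun x => a * mollify (eta n) h x + mollify (eta n) k x - (a * h x + k x)) =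
  (fun x => a * (mollify (eta n) h x - h x) + (mollify (eta n) k x - k x)).
  by apply/funext => x; ring.
apply: le_trans (sqn_sub_le (sqintZ a m1) m2) _.
have -> : sqn mu (fun x => a * (mollify (eta n) h x - h x)) =
    ((a ^+ 2)%:E * sqn mu (fun x => (mollify (eta n) h x - h x))%R)%E.
  rewrite /sqn; under eq_integral do rewrite exprMn.
  rewrite -!EFin_Rint ?RintZ//; try exact: sqint_sqr.
  by apply: rintegrableZ; exact: sqint_sqr.
move: h1 h2; rewrite -(fineK (sqint_fin_num m1)) -(fineK (sqint_fin_num m2)).
rewrite -!EFinM -EFinD !lee_fin => h1 h2.
have : a ^+ 2 * fine (sqn mu (fun x => mollify (eta n) h x - h x))%R <= e / 4.
  apply: le_trans (ler_wpM2l (sqr_ge0 a) h1) _.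
  rewrite mulrCA ler_pM2l//.
  rewrite invfM mulrCA ler_piMr ?invr_ge0// ler_pdivrMr ?mul1r//; have := sqr_ge0 a; lra.
lra.
Unshelve. all: by end_near. Qed.

Lemma approximable0 : approximable (fun=> 0).
Proof.
split.
  split; first exact: measurable_cst.
  by rewrite /sqn; under eq_integral do rewrite expr0n/=; rewrite integral0.
move=> e e0; apply: nearW => n.
rewrite /sqn (eq_integral (fun=> 0%E)) ?integral0 ?lee_fin ?ltW// => x _.
rewrite subr0 /mollify /Rintegral (eq_integral (fun=> 0%E)) ?integral0 ?expr0n//.
by move=> z _; rewrite mulr0.
Qed.

(** Mollification contracts L^2, so that replacing [h] by [k] costs the same small error for every
    [n]. Two uses of [sqn_sub_le] turn errors of e / 10 into 4 + 4 + 2 tenths of [e]. *)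
Lemma approximable_closure h : sqint mu h ->
  (forall e : R, 0 < e -> exists2 k, approximable k &
    (sqn mu (fun x => h x - k x)%R <= e%:E)%E) -> approximable h.
Proof.
move=> ih clo; split=> // e e0; have e10 : 0 < e / 10 by lra.
have [k [ik ck] hk] := clo _ e10.
near=> n.
have h1 : (sqn mu (fun x => mollify (eta n) k x - k x)%R <= (e / 10)%:E)%E.
  by near: n; exact: ck.
have ihk := sqintB ih ik.
have m1 := sqint_mollify (etak n) ihk.
have m2 := sqintB (sqint_mollify (etak n) ik) ik.
have -> : (fun x => mollify (eta n) h x - h x) =
  (fun x => (mollify (eta n) (fun x => h x - k x) x + (-1) * (h x - k x)) +
            (mollify (eta n) k x - k x)).
  by rewrite mollifyB//; apply/funext => x; ring.
have m3 := sqintZ (-1) ihk.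
apply: le_trans (sqn_sub_le (sqintD m1 m3) m2) _.
apply: (@le_trans _ _ (2%:E * (2%:E * (e / 10)%:E + 2%:E * (e / 10)%:E) + 2%:E * (e / 10)%:E)%E); last first.
  by rewrite -!EFinM -!EFinD lee_fin; lra.
rewrite leeD ?lee_wpmul2l ?lee_fin//.
apply: le_trans (sqn_sub_le m1 m3) _.
have -> : sqn mu (fun x => -1 * (h x - k x)) = sqn mu (fun x => h x - k x).
  by apply: eq_integral => x _; rewrite mulN1r sqrrN.
rewrite leeD ?lee_wpmul2l ?lee_fin//.
by apply: le_trans hk; exact: sqn_mollify_unit.
Unshelve. all: by end_near. Qed.

Definition hbox (a b : E) : set E := [set x | forall i, a ord0 i <= x ord0 i < b ord0 i].

Lemma measurable_hbox a b : measurable (hbox a b).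
Proof.
have -> : hbox a b = \bigcap_(i in [set: 'I_N])
    ((fun x : E => x ord0 i) @^-1` `[a ord0 i, b ord0 i[).
  by apply/seteqP; split => x /= h i; have := h i; rewrite /= in_itv/= => // /(_ I).
apply: fin_bigcap_measurable => // i _; rewrite -[X in measurable X]setTI.
by apply: (measurable_coor i).
Qed.

Lemma hboxI a b a' b' : hbox a b `&` hbox a' b' =
  hbox (\row_i Num.max (a ord0 i) (a' ord0 i)) (\row_i Num.min (b ord0 i) (b' ord0 i)).
Proof.
apply/seteqP; split => x.
  by move=> [h h'] i; rewrite !mxE ge_max lt_min; have := h i; have := h' i;
    move=> /andP[-> ->] /andP[-> ->].
move=> h; split => i; have := h i; rewrite !mxE ge_max lt_min;
  by move=> /andP[/andP[ha ha'] /andP[hb hb']]; rewrite ?ha ?hb ?ha' ?hb'.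
Qed.

Lemma hbox_lty a b : (mu (hbox a b) < +oo)%E.
Proof.
pose r := enorm a + enorm b.
have r0 : 0 <= r by rewrite addr_ge0 ?enorm_ge0.
apply: (@le_lt_trans _ _ ((r *+ 2) ^+ N)%:E); last exact: ltry.
rewrite -lebesgue_rV_cube//; apply: le_measure.
- by rewrite inE; exact: measurable_hbox.
- by rewrite inE; exact: measurable_cube.
move=> x /= h i; have /andP[h1 h2] := h i.
have := coor_le_enorm a i; have := coor_le_enorm b i.
rewrite !ler_norml /r => /andP[h3 h4] /andP[h5 h6].
have := enorm_ge0 a; have := enorm_ge0 b.
by move=> h7 h8; apply/andP; split; lra.
Qed.

Lemma sqint_indic (A : set E) : measurable A -> (mu A < +oo)%E -> sqint mu (\1_A).
Proof.
move=> mA Aoo; apply: sqintP => //.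
have -> : (fun x => \1_A x ^+ 2) = (fun x => 1 * \1_A x : R).
  by apply/funext => x; rewrite indicE; case: (x \in A); rewrite ?expr1n ?expr0n ?mul1r ?mulr0.
exact: rintegrable_indic_cst.
Qed.

Lemma mollify_sub n h x : sqint mu h ->
  mollify (eta n) h x - h x = \int[mu]_z (eta n z * (h (z + x) - h x)).
Proof.
move=> ih; have [_ _ e1 _] := eta_unit; have [ie _] := etak n.
have -> : h x = \int[mu]_z (h x * eta n z) by rewrite RintZ// e1 mulr1.
rewrite /mollify -RintB; [|exact: rintegrable_mollify|exact: rintegrableZ].
apply: eq_Rintegral => z _; rewrite (RintZ _ ie) e1; ring.
Qed.

Lemma approximable_hbox a b : approximable (\1_(hbox a b)).
Proof.
have mB := measurable_hbox a b.
have iB := sqint_indic mB (hbox_lty a b).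
have [_ e0 e1 es] := eta_unit.
split => // e ep.
(* The kernels reach forward by at most 1, so that every mollified indicator vanishes outside of the
   box whose lower corner is moved back by 1. This box dominates. *)
pose a' : E := \row_i (a ord0 i - 1).
apply: (@sqn_cvg0 _ _ _ _ _ (\1_(hbox a' b))) => //.
- move=> n; apply: measurable_funB => //.
  by apply: measurable_mollify => //; exact: kernel_measurable.
- move=> n x; rewrite mollify_sub//.
  have ib : rintegrable mu (fun z => eta n z * (\1_(hbox a b) (z + x) - \1_(hbox a b) x)).
    have [ie _] := etak n.
    have := rintegrableB (rintegrable_mollify x (etas n) iB) (rintegrableZ (\1_(hbox a b) x) ie).
    by apply: eq_integrable => // z _ /=; congr (_%:E); ring.
  apply: le_trans (Rint_norm ib) _.
  have -> : \1_(hbox a' b) x = \int[mu]_z (\1_(hbox a' b) x * eta n z).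
    by rewrite RintZ ?e1 ?mulr1//; case: (etak n).
  apply: Rint_le; first exact: rintegrable_norm.
    by apply: rintegrableZ; case: (etak n).
  move=> z; have [->|zn] := eqVneq (eta n z) 0; first by rewrite mul0r mulr0 normr0.
  rewrite normrM (ger0_norm (e0 n z)) mulrC ler_wpM2r//.
  rewrite [X in _ <= X]indicE; have [xB|xB] := boolP (x \in _).
    by rewrite !indicE; do 2 case: (_ \in _); rewrite ?subrr ?subr0 ?sub0r ?normrN ?normr1 ?normr0.
  have nx : x \in hbox a b = false.
    apply/negbTE; apply: contra xB; rewrite !inE => h i; have /andP[h1 h2] := h i.
    by rewrite mxE h2 andbT; lra.
  have nzx : z + x \in hbox a b = false.
    apply/negbTE; apply: contra xB; rewrite !inE => h i; have /andP[] := h i.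
    have /andP[z0 z1] := es n z zn i.
    have : n.+1%:R^-1 <= 1 :> R by rewrite invf_le1 ?ltr0n// ler1n.
    rewrite [(z + x) _ _]mxE [a' _ _]mxE => h1 h2 h3; apply/andP; split.
      by rewrite lerBlDl (le_trans h2)// lerD2r (le_trans z1).
    by rewrite (le_lt_trans _ h3)// lerDr.
  by rewrite !indicE nx nzx subrr normr0.
- exact: sqint_indic (measurable_hbox _ _) (hbox_lty _ _).
move=> x.
have key i : \forall n \near \oo, forall s : R, 0 <= s <= n.+1%:R^-1 ->
    (a ord0 i <= s + x ord0 i < b ord0 i) = (a ord0 i <= x ord0 i < b ord0 i).
  (* A bound on the distance to the end points that lie ahead of x_i, where 1 stands for an end
     point already passed; a shift shorter than [m] crosses neither. *)
  pose m := Num.min (if x ord0 i < a ord0 i then a ord0 i - x ord0 i else 1)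
                    (if x ord0 i < b ord0 i then b ord0 i - x ord0 i else 1).
  have m0 : 0 < m by rewrite /m lt_min; apply/andP; split; case: ifPn => ?//; rewrite subr_gt0.
  have := near_infty_natSinv_lt (PosNum m0); apply: filterS => n /= nm s /andP[s0 s1].
  have : s < m by exact: le_lt_trans nm.
  rewrite /m lt_min => /andP[]; case: ifPn; case: ifPn; rewrite -?leNgt => h1 h2 h3 h4;
  apply/idP/idP => /andP[h5 h6]; apply/andP; split; lra.
have : \forall n \near \oo, forall i, forall s : R, 0 <= s <= n.+1%:R^-1 ->
    (a ord0 i <= s + x ord0 i < b ord0 i) = (a ord0 i <= x ord0 i < b ord0 i).
  exact: filter_forall.
move=> keyA; apply/cvgrPdist_le => /= e' e'0; apply: filterS keyA => n kn.
rewrite sub0r normrN mollify_sub// (_ : Rintegral _ _ _ = 0) ?normr0 ?ltW//.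
rewrite /Rintegral (eq_integral (fun=> 0%E)) ?integral0// => z _; congr (_%:E).
have [->|zn] := eqVneq (eta n z) 0; first by rewrite mul0r.
rewrite !indicE; suff -> : (z + x \in hbox a b) = (x \in hbox a b) by rewrite subrr mulr0.
apply/idP/idP; rewrite !inE => h i; have := h i; rewrite ?mxE kn//; exact: es.
Qed.

Let hboxes : set (set E) := [set A | exists a b, A = hbox a b].

(** A half-space x_i < c is a countable union of boxes, so that the boxes generate the coordinate
    sigma-algebra. *)
Let hboxes_sigma (A : set E) : measurable A -> <<s hboxes >> A.
Proof.
suff H : measurable `<=` <<s hboxes >> by exact: H.
apply: smallest_sub; first exact: smallest_sigma_algebra.
elim/big_ind : _ => [//|B C hB hC|i _]; first by rewrite subUset.
move=> _ [B mB <-]; rewrite setTI.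
pose T' := g_sigma_algebraType hboxes.
suff mi : measurable_fun setT (fun x : T' => (x : E) ord0 i : measurableTypeR R).
  by have := mi measurableT B mB; rewrite setTI.
apply: (measurability (@RGenInftyO.G R)); first exact: RGenInftyO.measurableE.
move=> _ [_ [c ->] <-]; rewrite setTI.
have -> : (fun x : T' => (x : E) ord0 i) @^-1` `]-oo, c[ =
    \bigcup_(m : nat) hbox (const_mx (- m%:R))
       (\row_j (if j == i then c else m%:R)).
  apply/seteqP; split => x /=; rewrite in_itv/=.
    move=> xc; exists (Num.truncn (enorm (x : E))).+1 => // j.
    have := truncnS_gt (enorm (x : E)); have := coor_le_enorm (x : E) j.
    rewrite !mxE ler_norml => /andP[h1 h2] h3.
    apply/andP; split; first by rewrite (le_trans _ h1)// lerN2 ltW.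
    by case: eqP => [->//|_]; exact: le_lt_trans h3.
  by move=> [m _ h]; have := h i; rewrite !mxE eqxx => /andP[].
apply: bigcupT_measurable => m; apply: sub_sigma_algebra.
by eexists; eexists.
Qed.

(** Intersecting with a fixed box keeps all measures finite: complements and increasing unions then
    stay in L^2, and the indicator of the box dominates the limits. *)
Let approximable_indic (A : set E) (c : E) : measurable A ->
  approximable (\1_(A `&` hbox (- c) c)).
Proof.
move=> mA; have mc := measurable_hbox (- c) c.
suff : [set B | measurable B /\ approximable (\1_(B `&` hbox (- c) c))] A by case.
have hI : setI_closed hboxes.
  by move=> _ _ [a [b ->]] [a' [b' ->]]; rewrite hboxI; eexists; eexists.
apply: (@lambda_system_subset _ hboxes hI setT) => //; last exact: hboxes_sigma.
- split => [//||B C CB [mB gB] [mC gC]|F ndF gF].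
  + by split => //; rewrite setTI; exact: approximable_hbox.
  + split; first exact: measurableD.
    have -> : \1_((B `\` C) `&` hbox (- c) c) = (fun x =>
        (-1) * \1_(C `&` hbox (- c) c) x + \1_(B `&` hbox (- c) c) x : R).
      apply/funext => x; rewrite !indicE in_setI in_setD (in_setI x C) (in_setI x B).
      have [xC|xC] := boolP (x \in C); last by rewrite andbT mulr0 add0r.
      have -> : x \in B by rewrite inE; apply: CB; rewrite -inE.
      by rewrite andbF/= mulN1r addNr.
    exact: approximable_sum.
  + have mF n : measurable (F n) by have [] := gF n.
    split; first exact: bigcupT_measurable.
    have mU : measurable (\bigcup_n F n `&` hbox (- c) c).
      by apply: measurableI => //; exact: bigcupT_measurable.
    have fin (B : set E) : measurable B -> (mu (B `&` hbox (- c) c) < +oo)%E.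
      move=> mB; apply: le_lt_trans (hbox_lty (- c) c).
      by apply: le_measure; rewrite ?inE//; exact: measurableI.
    apply: approximable_closure.
      by apply: sqint_indic => //; apply: fin; exact: bigcupT_measurable.
    move=> e e0.
    have : \forall n \near \oo, (sqn mu (fun x => \1_(\bigcup_n F n `&` hbox (- c) c) x -
        \1_(F n `&` hbox (- c) c) x)%R <= e%:E)%E; last first.
      move=> [n _ hn]; exists (\1_(F n `&` hbox (- c) c)); first by case: (gF n).
      exact: (hn n (leqnn n)).
    apply: (@sqn_cvg0 _ _ _ _ _ (\1_(hbox (- c) c))) => //.
    * by move=> n; apply: measurable_funB => //; apply: measurable_indic => //; exact: measurableI.
    * move=> n x; rewrite !indicE !in_setI; case: (x \in hbox _ _); last by rewrite !andbF subrr normr0.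
      by do 2 case: (_ \in _); rewrite ?subrr ?subr0 ?sub0r ?normrN ?normr0 ?normr1.
    * exact: sqint_indic mc (hbox_lty _ _).
    * move=> x; have [[n _ Fx]|nF] := pselect ((\bigcup_n F n) x).
        apply: cvg_near_cst; exists n => // m /= nm; rewrite !indicE !in_setI.
        have -> : x \in \bigcup_n F n by rewrite inE; exists n.
        have -> : x \in F m by rewrite inE; exact: (subsetPset _ _ (ndF _ _ nm)).
        by rewrite subrr.
      apply: cvg_near_cst; apply: nearW => m; rewrite !indicE !in_setI.
      have -> : x \in \bigcup_n F n = false by apply/negbTE; rewrite notin_setE.
      have -> : x \in F m = false.
        by apply/negbTE; rewrite notin_setE => Fx; apply: nF; exists m.
      by rewrite subrr.
- by move=> _ [a [b ->]]; split; [exact: measurable_hbox|rewrite hboxI; exact: approximable_hbox].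
Qed.

Import HBNNSimple.

(** The simple approximations are cut off to growing boxes, which brings their level sets under
    [approximable_indic]; [h] itself dominates the errors. *)
Let approximable_ge0 h : sqint mu h -> (forall x, 0 <= h x) -> approximable h.
Proof.
move=> ih h0; have [mh _] := ih.
have mhE : measurable_fun setT (EFin \o h) by exact/measurable_EFinP.
pose s := nnsfun_approx measurableT mhE.
pose B n : set E := hbox (- const_mx n%:R) (const_mx n%:R).
have mB n : measurable (B n) by exact: measurable_hbox.
have gs n : approximable (fun x => s n x * \1_(B n) x).
  have -> : (fun x => s n x * \1_(B n) x) = (fun x => \sum_(y \in range (s n))
      y * \1_(s n @^-1` [set y] `&` B n) x).
    apply/funext => x; rewrite [in LHS]fimfunE !fsbig_finite//= mulr_suml.
    by apply: eq_bigr => y _; rewrite indicI /= mulrA.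
  rewrite [X in approximable X](_ : _ = (fun x => \sum_(y <- finmap.enum_fset (fset_set (range (s n))))
      y * \1_(s n @^-1` [set y] `&` B n) x)); last by apply/funext => x; rewrite fsbig_finite.
  elim: (finmap.enum_fset _) => [|y r IH].
    by under eq_fun do rewrite big_nil; exact: approximable0.
  under eq_fun do rewrite big_cons; apply: approximable_sum => //.
  by apply: approximable_indic; rewrite -[X in measurable X]setTI; exact: measurable_funP.
apply: approximable_closure => // e e0.
have sh n x : 0 <= s n x <= h x.
  apply/andP; split => //; by rewrite -lee_fin /s nnsfun_approxE le_approx// => z _; rewrite lee_fin.
have : \forall n \near \oo, (sqn mu (fun x => h x - s n x * \1_(B n) x)%R <= e%:E)%E; last first.
  move=> [n _ hn]; exists (fun x => s n x * \1_(B n) x) => //.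
  exact: (hn n (leqnn n)).
apply: (@sqn_cvg0 _ _ _ _ _ h) => //.
- by move=> n; apply: measurable_funB => //; apply: measurable_funM.
- move=> n x; have /andP[s0 s1] := sh n x; rewrite indicE; case: (_ \in _);
    rewrite ?mulr1 ?mulr0 ger0_norm; lra.
- move=> x; have := @cvg_nnsfun_approx _ _ _ _ measurableT _ mhE (fun x _ => h0 x) x I.
  move=> /fine_cvgP[_] /= sx.
  have : \forall n \near \oo, x \in B n.
    exists (Num.truncn (enorm x)).+1 => // n /= nx; rewrite inE => i; rewrite !mxE.
    have := truncnS_gt (enorm x); have := coor_le_enorm x i.
    rewrite ler_norml => /andP[h1 h2] h3.
    have : (Num.truncn (enorm x)).+1%:R <= n%:R :> R by rewrite ler_nat.
    by move=> h4; apply/andP; split; lra.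
  move=> xB; rewrite -(subrr (h x)); apply: cvgB; first exact: cvg_cst.
  apply: cvg_trans sx; apply: near_eq_cvg; apply: filterS xB => n xn.
  by rewrite indicE xn mulr1.
Qed.

Lemma approximable_sqint h : sqint mu h -> approximable h.
Proof.
move=> ih; have [mh _] := ih.
have mp : measurable_fun setT (fun x => Num.max (h x) 0) by exact: measurable_maxr.
have mn : measurable_fun setT (fun x => Num.max (- h x) 0).
  by apply: measurable_maxr => //; exact: measurableT_comp.
have -> : h = (fun x => (-1) * Num.max (- h x) 0 + Num.max (h x) 0).
  by apply/funext => x; case: (leP (h x) 0) => h0; case: (leP (- h x) 0) => h1; lra.
apply: approximable_sum; apply: approximable_ge0; try by move=> x; rewrite le_max lexx orbT.
- apply: sqintP => //; apply: rintegrable_le (sqint_sqr ih); first exact: measurable_funX.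
  move=> x; rewrite ger0_norm ?sqr_ge0//.
  by case: (leP (- h x) 0) => h1; rewrite ?sqrrN// expr0n/= sqr_ge0.
- apply: sqintP => //; apply: rintegrable_le (sqint_sqr ih); first exact: measurable_funX.
  move=> x; rewrite ger0_norm ?sqr_ge0//.
  by case: (leP (h x) 0) => h1//; rewrite expr0n/= sqr_ge0.
Qed.

End approximate_unit.

(** * The singular kernel and its quadratic form *)

Section singular_weight.
Variables (R : realType) (N : nat) (delta alpha : R).
Local Notation E := 'rV[R]_N.
Local Notation mu := (lebesgue_rV R N).
Hypotheses (delta0 : 0 < delta) (alpha01 : 0 < alpha < 1).

(* At y = 0 the weight is 1 / 0 = 0. *)
Definition weight (y : E) : R :=
  \1_(eball delta) y / enorm y `^ (N%:R + 2 * alpha).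

Lemma weight_ge0 y : 0 <= weight y.
Proof. by rewrite divr_ge0// powR_ge0. Qed.

Lemma measurable_weight : measurable_fun setT weight.
Proof.
have -> : weight = (fun y => \1_(eball delta) y * (enorm y `^ (- (N%:R + 2 * alpha)))).
  by apply/funext => y; rewrite powRN.
apply: measurable_funM; first by apply: measurable_indic; exact: measurable_eball.
exact: (measurableT_comp (measurable_powR _) (@measurable_enorm R N)).
Qed.

Lemma weight_out y : delta <= enorm y -> weight y = 0.
Proof.
move=> h; rewrite /weight indicE (_ : (y \in _) = false) ?mul0r//.
by apply/negbTE; rewrite notin_setE /= => h'; move: h; rewrite leNgt h'.
Qed.

Let s : R := N%:R + 2 * alpha.
Let s0 : 0 < s. Proof. by case/andP: alpha01 => a0 _; rewrite /s ltr_wpDl// mulr_gt0. Qed.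
Let dk (k : nat) : R := delta * 2^-1 ^+ k.
Let dk0 k : 0 < dk k. Proof. by rewrite mulr_gt0// exprn_gt0. Qed.
(** Bound of the integrand on the shell between the radii [dk k.+1] and [dk k]: the square is taken
    at the outer radius, the singular factor at the inner one. *)
Let ck k : R := dk k ^+ 2 / (dk k.+1) `^ s.
Let ck0 k : 0 <= ck k.
Proof. by rewrite mulr_ge0 ?sqr_ge0// invr_ge0 powR_ge0. Qed.

Let shell n y : dk n <= enorm y ->
  weight y * enorm y ^+ 2 <= \sum_(k < n) ck k * \1_(eball (dk k)) y.
Proof.
elim: n => [|n IH] h.
  by rewrite big_ord0 weight_out ?mul0r//; move: h; rewrite /dk expr0 mulr1.
rewrite big_ord_recr /=; have [yn|yn] := leP (dk n) (enorm y).
  by rewrite (le_trans (IH yn))// lerDl mulr_ge0.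
rewrite -[leLHS]add0r lerD//.
  by apply: sumr_ge0 => k _; rewrite mulr_ge0.
rewrite [X in _ <= _ * X]indicE mem_set// mulr1 mulrC /ck.
have e0 := enorm_ge0 y.
have ey : 0 < enorm y by exact: lt_le_trans h.
apply: ler_pM; rewrite ?sqr_ge0 ?weight_ge0//.
  by rewrite lerXn2r ?nnegrE// ltW.
apply: (@le_trans _ _ (1 / enorm y `^ s)).
  by rewrite /weight ler_wpM2r ?invr_ge0 ?powR_ge0// indicE lern1 leq_b1.
rewrite div1r lef_pV2 ?posrE ?powR_gt0//.
by apply: ge0_ler_powR => //; rewrite ?nnegrE ltW.
Qed.

(** Ratio of the geometric series: a shell of radius r contributes at most a multiple of r^(2 - s +
    N) = r^(2 - 2 alpha), and alpha < 1 makes the ratio less than 1. *)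
Let rho : R := 2^-1 `^ (2 - 2 * alpha).
Let rho1 : 0 <= rho < 1.
Proof.
case/andP: alpha01 => a0 a1; rewrite powR_ge0/=.
rewrite /rho [ltRHS](_ : 1 = 1 `^ (2 - 2 * alpha)); last by rewrite powR1.
apply: gt0_ltr_powR; rewrite ?nnegrE ?invr_ge0//; first lra.
by rewrite invf_lt1 ?ltr1n.
Qed.

Let ckE k : ck k * (dk k *+ 2) ^+ N =
  (2 `^ s * 2 ^+ N * delta `^ (2 - 2 * alpha)) * rho ^+ k.
Proof.
have d0 := dk0 k; have nz : dk k != 0 by rewrite gt_eqF.
rewrite /ck (_ : dk k.+1 = dk k * 2^-1); last by rewrite /dk exprSr mulrA.
have -> : (dk k *+ 2) ^+ N = dk k `^ N%:R * 2 ^+ N.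
  by rewrite -(mulr_natr (dk k) 2) exprMn powR_mulrn// ltW.
have -> : rho ^+ k = (2^-1 ^+ k) `^ (2 - 2 * alpha).
  rewrite /rho; move: (2 - 2 * alpha) => b; move: (2^-1 : R) (invr_ge0 (2 : R)) => a.
  rewrite ler0n => a0.
  transitivity ((a `^ b) `^ k%:R).
    by apply/esym/powR_mulrn/powR_ge0.
  by apply: etrans (powRAC _ _ _) _; congr powR; exact: powR_mulrn.
rewrite -[RHS]mulrA -powRM ?exprn_ge0 ?invr_ge0 ?(ltW delta0)// -/(dk k).
rewrite powRM ?invr_ge0 ?(ltW d0)// -(powR_mulrn 2 (ltW d0)).
have -> : (2 - 2 * alpha) = 2%:R + N%:R - s by rewrite /s; ring.
rewrite powRB ?nz ?implybT//.
have -> : dk k `^ (2%:R + N%:R) = dk k `^ 2%:R * dk k `^ N%:R.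
  by rewrite powRD// nz implybT.
have -> : (2^-1 `^ s) = (2 `^ s)^-1 :> R by rewrite -powRN -powR_inv1 // -powRrM mulN1r.
by rewrite invfM invrK; ring.
Qed.

(** The integrand is of order |y|^(2 - N - 2 alpha). With the ball of radius [dk n] removed, the
    shells sum to a bound that does not depend on [n]; monotone convergence then restores the
    ball. *)
Lemma rintegrable_weight : rintegrable mu (fun y => weight y * enorm y ^+ 2).
Proof.
have mw : measurable_fun setT (fun y => weight y * enorm y ^+ 2).
  by apply: measurable_funM; [exact: measurable_weight|by apply: measurable_funX; exact: measurable_enorm].
apply: ge0_rintegrable => //; first by move=> y; rewrite mulr_ge0 ?weight_ge0 ?sqr_ge0.
pose wn n y := weight y * enorm y ^+ 2 * \1_[set y : E | dk n <= enorm y] y.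
have mS n : measurable [set y : E | dk n <= enorm y].
  rewrite (_ : [set y : E | dk n <= enorm y] = enorm @^-1` `[dk n, +oo[); last first.
    by apply/seteqP; split => y /=; rewrite in_itv/= andbT.
  by rewrite -[X in measurable X]setTI; exact: measurable_enorm.
pose C := 2 `^ s * 2 ^+ N * delta `^ (2 - 2 * alpha).
have C0 : 0 <= C by rewrite !mulr_ge0 ?powR_ge0 ?exprn_ge0.
have bnd n : (\int[mu]_y (wn n y)%:E <= (C / (1 - rho))%:E)%E.
  apply: (@le_trans _ _ (\int[mu]_y (\sum_(k < n) ck k * \1_(eball (dk k)) y)%:E)%E).
    apply: ge0_le_integral => //.
    - by move=> y _; rewrite lee_fin /wn mulr_ge0// mulr_ge0 ?weight_ge0 ?sqr_ge0.
    - by apply/measurable_EFinP/measurable_funM => //; exact: measurable_indic.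
    - apply/measurable_EFinP/measurable_sum => k; apply: measurable_funM => //.
      by apply: measurable_indic; exact: measurable_eball.
    - move=> y _; rewrite lee_fin /wn indicE; case: (boolP (y \in _)) => [|_].
        by rewrite inE mulr1 => /shell.
      by rewrite mulr0; apply: sumr_ge0 => k _; rewrite mulr_ge0.
  under eq_integral do rewrite -sumEFin.
  rewrite ge0_integral_sum//; last 2 first.
  - by move=> k; apply/measurable_EFinP/measurable_funM => //; apply: measurable_indic; exact: measurable_eball.
  - by move=> k y _; rewrite lee_fin mulr_ge0.
  apply: (@le_trans _ _ (\sum_(k < n) (C * rho ^+ k)%:E)%E).
    apply: lee_sum => k _; rewrite -ckE.
    under eq_integral do rewrite EFinM.
    rewrite ge0_integralZl_EFin//; last first.
      by apply/measurable_EFinP/measurable_indic; exact: measurable_eball.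
    rewrite integral_indic ?setIT//; last exact: measurable_eball.
    by rewrite [leRHS]EFinM lee_wpmul2l ?lee_fin// eball_bound// ltW.
  rewrite sumEFin lee_fin -mulr_sumr ler_wpM2l//.
  have /andP[r0 r1] := rho1.
  rewrite -[leRHS]div1r ler_pdivlMr ?subr_gt0//.
  have -> : (\sum_(k < n) rho ^+ k) * (1 - rho) = 1 - rho ^+ n.
    by rewrite mulrC -opprB mulNr -subrX1 opprB.
  by rewrite gerBl exprn_ge0.
have wlim y : limn (fun n => (wn n y)%:E) = (weight y * enorm y ^+ 2)%:E.
  apply/cvg_lim => //; apply: cvg_near_cst; have [y0|y0] := eqVneq (enorm y) 0.
    by apply: nearW => n; rewrite /wn y0 expr0n/= mulr0 mul0r.
  have yp : 0 < enorm y by rewrite lt0r y0 enorm_ge0.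
  have : 0 < enorm y / delta by rewrite divr_gt0.
  have /cvgrPdist_lt h : (2^-1 : R) ^+ n @[n --> \oo] --> (0 : R).
    by apply: cvg_expr; rewrite ger0_norm ?invr_ge0// invf_lt1 ?ltr1n.
  move=> /h; apply: filterS => n; rewrite sub0r normrN ger0_norm ?exprn_ge0 ?invr_ge0//.
  rewrite ltr_pdivlMr// mulrC => hn; rewrite /wn indicE mem_set ?mulr1//=.
  exact: ltW.
have cv : (\int[mu]_y (wn n y)%:E)%E @[n --> \oo] -->
    (\int[mu]_y limn (fun n => (wn n y)%:E))%E.
  apply: cvg_monotone_convergence => //.
  - by move=> n; apply/measurable_EFinP/measurable_funM => //; exact: measurable_indic.
  - by move=> n y _; rewrite lee_fin /wn mulr_ge0// mulr_ge0 ?weight_ge0 ?sqr_ge0.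
  - move=> y _ m n mn; rewrite lee_fin ler_wpM2l//.
      by rewrite mulr_ge0 ?weight_ge0 ?sqr_ge0.
    rewrite !indicE ler_nat; have [|//] := boolP (y \in [set y0 | dk m <= enorm y0]).
    rewrite inE/= => h; rewrite mem_set//= (le_trans _ h)// /dk ler_pM2l//.
    by rewrite ler_wiXn2l// ?invr_ge0// invf_le1// ler1n.
under eq_integral do rewrite -wlim.
apply: (@le_lt_trans _ _ (C / (1 - rho))%:E); last exact: ltry.
rewrite -(cvg_lim _ cv)//; apply: lime_le; first by apply/cvg_ex; eexists; exact: cv.
exact: nearW.
Qed.

End singular_weight.

(** * The nonlocal operator and its quadratic form *)

Section nonlocal_laplacian.
Variables (R : realType) (N : nat) (delta alpha : R).
Local Notation E := 'rV[R]_N.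
Local Notation mu := (lebesgue_rV R N).
Hypotheses (delta0 : 0 < delta) (alpha01 : 0 < alpha < 1).
Local Notation w := (weight delta alpha).
Implicit Types (phi h p q : E -> R).

Definition sdiff q (y x : E) : R := 2 * q x - q (x - y) - q (x + y).

(** A fractional Laplacian with horizon [delta], up to a constant. Second differences of smooth
    functions are of order |y|^2, so that the integral converges absolutely for every alpha < 1. *)
Definition nlap q (x : E) : R := \int[mu]_y (w y * sdiff q y x).

(** The squared seminorm with the x-integral inside: at fixed [y] the first difference is an L^2
    function, to which Young's inequality and mollification apply directly. *)
Definition wsemi h : \bar R := (\int[mu]_y ((w y)%:E * sqn mu (diffq h y)))%E.

(** Of a smooth function with compact support only these bounds on its size, first and second
    differences are used. *)
Definition bump phi := measurable_fun setT phi /\ exists r M : R,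
  [/\ 0 <= r, 0 <= M, forall z, `|phi z| <= M &
   [/\ forall z, phi z != 0 -> forall i, `|z ord0 i| <= r,
       forall z y, `|phi (z + y) - phi z| <= M * enorm y &
       forall z y, `|sdiff phi y z| <= M * enorm y ^+ 2]].

(** The factor 1 + c stands in for sqrt c after Cauchy-Schwarz. *)
Let sqr_mul_le (a c : R) : 0 <= c -> a ^+ 2 * c <= (a * (1 + c)) ^+ 2.
Proof. by move=> c0; rewrite exprMn ler_wpM2l ?sqr_ge0//; have := sqr_ge0 c; nra. Qed.

Lemma measurable_diffq2 h : measurable_fun setT h ->
  measurable_fun setT (fun p : E * E => diffq h p.2 p.1).
Proof.
move=> mh; apply: measurable_funB; first exact: measurableT_comp mh measurable_fst.
exact: (measurableT_comp mh (@measurable_subrV R N)).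
Qed.

Lemma measurable_sdiff2 h : measurable_fun setT h ->
  measurable_fun setT (fun p : E * E => sdiff h p.2 p.1).
Proof.
move=> mh; apply: measurable_funB; last exact: (measurableT_comp mh (@measurable_addrV R N)).
apply: measurable_funB; last exact: (measurableT_comp mh (@measurable_subrV R N)).
by apply: measurable_funM => //; exact: measurableT_comp mh measurable_fst.
Qed.

Let mw2 : measurable_fun setT (fun p : E * E => w p.2).
Proof. exact: measurableT_comp (measurable_weight _ _) measurable_snd. Qed.

Let mw1 : measurable_fun setT (fun p : E * E => w p.1).
Proof. exact: measurableT_comp (measurable_weight _ _) measurable_fst. Qed.

Lemma measurable_nlap h : measurable_fun setT h -> measurable_fun setT (nlap h).
Proof.
move=> mh; apply: (@measurable_Rintegral2 _ _ _ _ R mu (fun p : E * E => w p.2 * sdiff h p.2 p.1)).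
by apply: measurable_funM; [exact: mw2|exact: measurable_sdiff2].
Qed.

Lemma sqint_sdiff h y : sqint mu h -> sqint mu (sdiff h y).
Proof.
move=> ih; apply: sqintB; last exact: sqint_translate.
by apply: sqintB; [exact: sqintZ|exact: sqint_translate].
Qed.

Definition cub (r : R) : set E := [set x | forall i, `|x ord0 i| <= r].

Lemma measurable_cub r : measurable (cub r).
Proof. exact: measurable_cube. Qed.

Lemma cub_lty r : (mu (cub r) < +oo)%E.
Proof.
have [r0|r0] := leP 0 r; first by rewrite /cub lebesgue_rV_cube// ltry.
apply: (@le_lt_trans _ _ (mu (cub 0))); last by rewrite /cub lebesgue_rV_cube// ltry.
apply: le_measure; rewrite ?inE; [exact: measurable_cube|exact: measurable_cube|].
by move=> x h i; rewrite (le_trans (h i))// ltW.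
Qed.

Lemma bump_kernel phi : bump phi -> kernel phi.
Proof.
move=> [mphi [r [M [r0 M0 hM [sup _ _]]]]]; split; last by exists M.
apply: (@rintegrable_le _ _ _ _ _ (fun z => M * \1_(cub r) z)) => //.
  move=> z; have [->|zn] := eqVneq (phi z) 0; first by rewrite normr0 mulr_ge0.
  by rewrite indicE mem_set ?mulr1//; exact: sup.
by apply: rintegrable_indic_cst; [exact: measurable_cub|exact: cub_lty].
Qed.

Lemma bump_translate phi a : bump phi -> bump (fun z => phi (z + a)).
Proof.
move=> [mphi [r [M [r0 M0 hM [sup l1 l2]]]]].
split; first exact: measurableT_comp mphi (measurable_translate a).
exists (r + enorm a), M; split => //; first by rewrite addr_ge0// enorm_ge0.
split.
- move=> z /sup h i; have := h i; rewrite mxE => hi.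
  rewrite -[z ord0 i](addrK (a ord0 i)) (le_trans (ler_normB _ _))// lerD//.
  exact: coor_le_enorm.
- by move=> z y; rewrite addrAC.
- by move=> z y; have := l2 (z + a) y; rewrite /sdiff !(addrAC z a).
Qed.

(** Where the weight is nonzero the shifts are shorter than [delta], so that second differences live
    in the cube enlarged by [delta]. The first bound serves under integrals in [y], the second at
    fixed [y]. *)
Lemma wsdiff_le phi : bump phi -> exists r M : R, [/\ 0 <= M,
  (forall y z, `|w y * sdiff phi y z| <= (w y * enorm y ^+ 2) * (M * \1_(cub r) z)) &
  forall y z, w y != 0 -> `|sdiff phi y z| <= M * enorm y ^+ 2 * \1_(cub r) z].
Proof.
move=> [mphi [r [M [r0 M0 hM [sup _ l2]]]]].
have key y z : w y != 0 -> `|sdiff phi y z| <= M * enorm y ^+ 2 * \1_(cub (r + delta)) z.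
  move=> wy; have [zc|zc] := boolP (z \in cub (r + delta)).
    by rewrite indicE zc mulr1; exact: l2.
  have yd : enorm y < delta by rewrite ltNge; apply: contra wy => /weight_out ->.
  have out (a : E) : enorm a <= enorm y -> phi (z + a) = 0.
    move=> ay; apply/eqP; apply: contraNT zc => /sup h; rewrite inE => i.
    have := h i; rewrite mxE => hi; rewrite -[z ord0 i](addrK (a ord0 i)).
    rewrite (le_trans (ler_normB _ _))// lerD// (le_trans (coor_le_enorm _ _))//.
    by rewrite (le_trans ay)// ltW.
  have eN : enorm (- y) = enorm y.
    by rewrite /enorm /dotp; congr Num.sqrt; apply: eq_bigr => i _; rewrite !mxE mulrNN.
  rewrite /sdiff out ?eN// out// -[z in phi z]addr0 out ?enorm0 ?enorm_ge0//.
  by rewrite mulr0 !subr0 normr0; do 2?[apply: mulr_ge0 => //]; exact: sqr_ge0.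
exists (r + delta), M; split => // y z.
have [->|wy] := eqVneq (w y) 0; first by rewrite !mul0r normr0.
rewrite normrM ger0_norm ?weight_ge0// -mulrA ler_wpM2l ?weight_ge0//.
by rewrite mulrCA mulrA key.
Qed.

(** Second differences are supported in one cube, so that [nlap phi] is bounded with bounded support
    and can itself mollify rough functions. *)
Lemma kernel_nlap phi : bump phi -> kernel (nlap phi).
Proof.
move=> bphi; have [mphi _] := bphi; have [r [M [M0 h _]]] := wsdiff_le bphi.
have iw := rintegrable_weight N delta0 alpha01.
pose W := \int[mu]_y (w y * enorm y ^+ 2).
have W0 : 0 <= W by apply: Rint_ge0 => y; rewrite mulr_ge0 ?weight_ge0 ?sqr_ge0.
have bnd z : `|nlap phi z| <= W * M * \1_(cub r) z.
  have i1 : rintegrable mu (fun y => w y * enorm y ^+ 2 * (M * \1_(cub r) z)).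
    by have := rintegrableZ (M * \1_(cub r) z) iw; under eq_fun do rewrite mulrC.
  have i2 : rintegrable mu (fun y => w y * sdiff phi y z).
    apply: rintegrable_le i1 => //; apply: measurable_funM; first exact: measurable_weight.
    exact: (measurableT_comp (measurable_sdiff2 mphi) (measurable_pair1 z)).
  apply: le_trans (Rint_norm i2) _.
  apply: le_trans (Rint_le (rintegrable_norm i2) i1 _) _ => //.
  by under eq_Rintegral do rewrite mulrC; rewrite RintZ// mulrC mulrA.
split; last first.
  exists (W * M) => z; rewrite (le_trans (bnd z))// indicE.
  by case: (_ \in _); rewrite ?mulr1 ?mulr0 ?mulr_ge0.
apply: (@rintegrable_le _ _ _ _ _ (fun z => (W * M) * \1_(cub r) z)) => //.
  exact: measurable_nlap.
by apply: rintegrable_indic_cst; [exact: measurable_cub|exact: cub_lty].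
Qed.

Lemma kernel_sdiff phi y : kernel phi -> kernel (sdiff phi y).
Proof.
move=> kphi; apply: kernelB; last exact: kernel_translate.
by apply: kernelB; [exact: kernelZ|exact: kernel_translate].
Qed.

Lemma sdiff_mollify phi h y : kernel phi -> sqint mu h ->
  sdiff (mollify phi h) y = mollify (sdiff phi y) h.
Proof.
move=> kphi ih; have ip := kernel_sqint kphi; have mp := kernel_measurable kphi.
have [mh _] := ih; have tr a := kernel_sqint (kernel_translate a kphi).
rewrite /sdiff mollify_kernelB//; last first.
  by apply: sqintB => //; exact: sqintZ.
rewrite mollify_kernelB//; last exact: sqintZ.
rewrite mollify_kernelZ// !mollify_kernel_translate//.
by apply/funext => x; rewrite opprK; ring.
Qed.

(** The operator falls on the kernel, hence [h] needs no regularity; the bound of [wsdiff_le]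
    permits the exchange of integrals. *)
Lemma nlap_mollify phi h : bump phi -> sqint mu h ->
  nlap (mollify phi h) = mollify (nlap phi) h.
Proof.
move=> bphi ih; have kphi := bump_kernel bphi.
have [mphi _] := bphi; have [mh _] := ih; have [r [M [M0 hb _]]] := wsdiff_le bphi.
have iw := rintegrable_weight N delta0 alpha01.
pose F (p : E * E) := w p.1 * (sdiff phi p.1 p.2).
have mF : measurable_fun setT F.
  apply: measurable_funM; first exact: mw1.
  have msw : measurable_fun setT (fun p : E * E => (p.2, p.1)).
    apply/measurable_fun_pairP; split; [exact: measurable_snd|exact: measurable_fst].
  exact: (measurableT_comp (measurable_sdiff2 mphi) msw).
apply/funext => x; have ihx := sqint_translate x ih; have [mhx _] := ihx.
have iF : rintegrable (mu \x mu)%E (fun p : E * E => F p * h (p.2 + x)).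
  have ib : rintegrable mu (fun z => (M * \1_(cub r) z) * `|h (z + x)|).
    apply: sqint_mul; last first.
      apply: sqintP; first exact: measurableT_comp.
      by under eq_fun do rewrite real_normK ?num_real//; exact: sqint_sqr.
    by apply: sqintZ; apply: sqint_indic => //; [exact: measurable_cub|exact: cub_lty].
  apply: rintegrable_le (rintegrable_prod_mul iw ib).
    by apply: measurable_funM; [exact: mF|exact: measurableT_comp mhx measurable_snd].
  by move=> [y z] /=; rewrite normrM [leRHS]mulrA ler_wpM2r//; exact: hb.
rewrite /nlap; under eq_Rintegral do rewrite sdiff_mollify//.
transitivity (\int[mu]_y \int[mu]_z (F (y, z) * h (z + x))).
  apply: eq_Rintegral => y _; rewrite -RintZ; last first.
    by apply: rintegrable_mollify => //; exact/kernel_sqint/kernel_sdiff.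
  by apply: eq_Rintegral => z _; rewrite /F mulrA.
rewrite (Rint_fubini iF); apply: eq_Rintegral => z _ /=.
rewrite mulrC -RintZ; first by apply: eq_Rintegral => y _; rewrite mulrC.
apply: rintegrable_le (rintegrableZ (M * \1_(cub r) z) iw).
  exact: (measurableT_comp mF (measurable_pair2 z)).
by move=> y; rewrite [leRHS]mulrC; exact: hb.
Qed.

(** The order |y|^2 in L^2 is what integration against the weight requires. It holds for bumps and
    for mollified L^2 functions. *)
Definition nlap_dominated q (K : R) := 0 <= K /\
  forall y, w y != 0 -> (sqn mu (sdiff q y) <= ((K * enorm y ^+ 2) ^+ 2)%:E)%E.

Lemma bump_dominated phi : bump phi -> exists K : R, nlap_dominated phi K.
Proof.
move=> bphi; have [r [M [M0 _ h]]] := wsdiff_le bphi.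
pose c := fine (mu (cub r)).
have cE : (c%:E = mu (cub r))%E by rewrite fineK// ge0_fin_numE// cub_lty.
have c0 : 0 <= c by rewrite fine_ge0.
exists (M * (1 + c)); split => [|y wy]; first by rewrite mulr_ge0// addr_ge0.
apply: (@le_trans _ _ (\int[mu]_z (((M * enorm y ^+ 2) ^+ 2) * \1_(cub r) z)%:E)%E).
  apply: ge0_le_integral => //.
  - by move=> z _; rewrite lee_fin sqr_ge0.
  - apply/measurable_EFinP/measurable_funX.
    by have [mphi _] := bphi; exact: (measurableT_comp (measurable_sdiff2 mphi) (measurable_pair2 y)).
  - apply/measurable_EFinP/measurable_funM => //; apply: measurable_indic; exact: measurable_cub.
  move=> z _; rewrite lee_fin -[leLHS]real_normK ?num_real//.
  have := h y z wy; rewrite indicE; case: (_ \in _); rewrite ?mulr1 ?mulr0 => hz.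
    by rewrite lerXn2r ?nnegrE// mulr_ge0 ?sqr_ge0.
  have -> : `|sdiff phi y z| = 0 by apply/eqP; rewrite eq_le hz normr_ge0.
  by rewrite expr0n.
under eq_integral do rewrite EFinM.
rewrite ge0_integralZl_EFin ?sqr_ge0//; last first.
  by apply/measurable_EFinP/measurable_indic; exact: measurable_cub.
rewrite integral_indic ?setIT//; last exact: measurable_cub.
apply: (@le_trans _ _ ((M * enorm y ^+ 2) ^+ 2 * c)%:E).
  by rewrite [in leRHS]EFinM cE.
by rewrite lee_fin [in leRHS]mulrAC; exact: sqr_mul_le.
Qed.

Lemma l1norm_sdiff phi : bump phi -> exists K : R, 0 <= K /\
  forall y, w y != 0 -> l1norm (sdiff phi y) <= K * enorm y ^+ 2.
Proof.
move=> bphi; have [r [M [M0 _ h]]] := wsdiff_le bphi.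
pose c := fine (mu (cub r)).
have c0 : 0 <= c by rewrite fine_ge0.
exists (M * c); split => [|y wy]; first by rewrite mulr_ge0.
have [k1 _] := kernel_sdiff y (bump_kernel bphi).
apply: le_trans (Rint_le (g := fun z => M * enorm y ^+ 2 * \1_(cub r) z) _ _ _) _.
- exact: rintegrable_norm.
- by apply: rintegrable_indic_cst; [exact: measurable_cub|exact: cub_lty].
- by move=> z; exact: h.
rewrite RintZ; last by have := rintegrable_indic_cst 1 (measurable_cub r) (cub_lty r);
  under eq_fun do rewrite mul1r.
by rewrite /Rintegral integral_indic ?setIT//; [rewrite mulrAC|exact: measurable_cub].
Qed.

Lemma mollify_dominated phi h : bump phi -> sqint mu h ->
  exists K : R, nlap_dominated (mollify phi h) K.
Proof.
move=> bphi ih; have [K [K0 hK]] := l1norm_sdiff bphi; have kphi := bump_kernel bphi.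
pose c := fine (sqn mu h); have c0 : 0 <= c by rewrite fine_ge0// sqn_ge0.
exists (K * (1 + c)); split => [|y wy]; first by rewrite mulr_ge0// addr_ge0.
rewrite sdiff_mollify//; apply: le_trans (sqn_mollify (kernel_sdiff y kphi) ih) _.
rewrite -(fineK (sqint_fin_num ih)) -/c -EFinM lee_fin [in leRHS]mulrAC [leRHS]exprMn.
apply: ler_pM; rewrite ?sqr_ge0//.
  by rewrite lerXn2r ?nnegrE ?l1norm_ge0 ?hK// mulr_ge0 ?sqr_ge0.
have := sqr_ge0 c; nra.
Qed.

Let mdiff h y : measurable_fun setT h -> measurable_fun setT (diffq h y).
Proof. by move=> mh; exact: (measurableT_comp (measurable_diffq2 mh) (measurable_pair2 y)). Qed.

(** Summation by parts: the second difference at x is the first difference at x minus that at x + y,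
    and the latter term is translated by [y]. *)
Lemma sdiff_form q p y : sqint mu q -> sqint mu p ->
  \int[mu]_x (sdiff q y x * p x) = \int[mu]_x (diffq q y x * diffq p y x).
Proof.
move=> iq ip; have [mq _] := iq.
have idq := sqint_diffq y iq; have mdq := mdiff y mq.
have iqp := sqint_mul idq ip.
have iqpy := sqint_mul idq (sqint_translate (- y) ip).
have iqyp : rintegrable mu (fun x => diffq q y (x + y) * p x).
  by apply: sqint_mul => //; exact: sqint_translate.
transitivity (\int[mu]_x (diffq q y x * p x - diffq q y (x + y) * p x)).
  by apply: eq_Rintegral => x _; rewrite -mulrBl /sdiff /diffq addrK; congr (_ * _); ring.
rewrite RintB//.
have -> : \int[mu]_x (diffq q y (x + y) * p x) = \int[mu]_x (diffq q y x * p (x - y)).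
  rewrite -(Rintegral_translate y (f := fun x => diffq q y x * p (x - y))).
    by apply: eq_Rintegral => x _; rewrite addrK.
  exact: rintegrable_measurable iqpy.
by rewrite -RintB//; apply: eq_Rintegral => x _; rewrite -mulrBr.
Qed.

(** [nlap_dominated] and Cauchy-Schwarz in x leave a multiple of |y|^2 times the weight, which is
    integrable. The integrals may thus be exchanged, and summation by parts is done at each [y]. *)
Lemma form_identity q p K : sqint mu q -> nlap_dominated q K -> sqint mu p ->
  \int[mu]_x (nlap q x * p x) = \int[mu]_y (w y * \int[mu]_x (diffq q y x * diffq p y x)).
Proof.
move=> iq [K0 hK] ip; have [mq _] := iq; have [mp _] := ip.
have iw := rintegrable_weight N delta0 alpha01.
have mF : measurable_fun setT (fun z : E * E => w z.2 * sdiff q z.2 z.1 * p z.1).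
  apply: measurable_funM; last exact: measurableT_comp mp measurable_fst.
  by apply: measurable_funM; [exact: mw2|exact: measurable_sdiff2].
have isp y : rintegrable mu (fun x => sdiff q y x * p x).
  by apply: sqint_mul => //; exact: sqint_sdiff.
have iF : rintegrable (mu \x mu)%E (fun z : E * E => w z.2 * sdiff q z.2 z.1 * p z.1).
  apply: rintegrable_prodP2 => //=.
  pose c := fine (sqn mu p); have c0 : 0 <= c by rewrite fine_ge0// sqn_ge0.
  apply: (@le_lt_trans _ _ (\int[mu]_y ((K * (1 + c)) * (w y * enorm y ^+ 2))%:E)%E); last first.
    rewrite -EFin_Rint ?ltry//; exact: rintegrableZ.
  apply: ge0_le_integral => //.
  - by move=> y _; apply: integral_ge0.
  - have h1 : measurable_fun setT (fubini_G mu (fun z : E * E => `|w z.2 * sdiff q z.2 z.1 * p z.1|%:E)).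
      apply: measurable_fun_fubini_tonelli_G => [|z]; last by rewrite lee_fin.
      by apply/measurable_EFinP; exact: measurableT_comp.
    exact: h1.
  - apply/measurable_EFinP; exact: rintegrable_measurable (rintegrableZ _ iw).
  move=> y _; have [wy|wy] := eqVneq (w y) 0.
    rewrite (eq_integral (fun=> 0%E)) ?integral0 ?wy ?mul0r ?mulr0// => x _.
    by rewrite !mul0r normr0.
  under eq_integral do rewrite -mulrA normrM EFinM.
  rewrite ge0_integralZl_EFin//; last first.
    by apply/measurable_EFinP; exact: rintegrable_measurable (rintegrable_norm (isp y)).
  rewrite -EFin_Rint ?rintegrable_norm// -EFinM lee_fin ger0_norm ?weight_ge0//.
  rewrite mulrCA ler_wpM2l ?weight_ge0//.
  have iqy : sqint mu (sdiff q y) := sqint_sdiff y iq.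
  have ia (f : E -> R) : sqint mu f -> sqint mu (fun x => `|f x|).
    move=> f2; have [mf _] := f2; apply: sqintP; first exact: measurableT_comp.
    by under eq_fun do rewrite real_normK ?num_real//; exact: sqint_sqr.
  have na (f : E -> R) : sqn mu (fun x => `|f x|) = sqn mu f.
    by apply: eq_integral => x _; rewrite real_normK ?num_real.
  have := cauchy_schwarz (ia _ iqy) (ia _ ip); rewrite !na -/c.
  rewrite [in X in X -> _](_ : \int[mu]_x _ = \int[mu]_x `|sdiff q y x * p x|); last first.
    by apply: eq_Rintegral => x _; rewrite normrM.
  have := hK y wy; rewrite -(fineK (sqint_fin_num iqy)) lee_fin => h1 h2.
  have I0 : 0 <= \int[mu]_x `|sdiff q y x * p x| by apply: Rint_ge0.
  have ub0 : 0 <= K * (1 + c) * enorm y ^+ 2.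
    by rewrite mulr_ge0 ?sqr_ge0// mulr_ge0 ?addr_ge0.
  rewrite -ler_sqr ?nnegrE//.
  apply: (le_trans h2); apply: (le_trans (ler_wpM2r c0 h1)).
  by rewrite [K * (1 + c) * _]mulrAC; exact: sqr_mul_le.
transitivity (\int[mu]_x \int[mu]_y (w y * sdiff q y x * p x)).
  apply: Rintegral_ae_eqW; apply: filterS (ae_rintegrable2 iF) => x /= ix.
  (* Fubini's theorem gives integrability in [y] of the product with [p x]. This factor is divided
     out, and where it is 0 both sides vanish. *)
  have [p0|p0] := eqVneq (p x) 0.
    by rewrite p0 mulr0 /Rintegral (eq_integral (fun=> 0%E)) ?integral0// => y _; rewrite mulr0.
  rewrite mulrC -RintZ; first by apply: eq_Rintegral => y _; rewrite mulrC.
  have := rintegrableZ (p x)^-1 ix; congr (rintegrable mu _).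
  by apply/funext => y; rewrite mulrC mulfK.
rewrite (Rint_fubini iF); apply: eq_Rintegral => y _ /=.
have -> : \int[mu]_x (w y * sdiff q y x * p x) = w y * \int[mu]_x (sdiff q y x * p x).
  by rewrite -RintZ//; apply: eq_Rintegral => x _; rewrite mulrA.
congr (_ * _).
exact: sdiff_form.
Qed.

Lemma nlap_sym q p K K' : sqint mu q -> nlap_dominated q K -> sqint mu p ->
  nlap_dominated p K' ->
  \int[mu]_x (nlap q x * p x) = \int[mu]_x (nlap p x * q x).
Proof.
move=> iq dq ip dp; rewrite (form_identity iq dq ip) (form_identity ip dp iq).
apply: eq_Rintegral => y _; congr (_ * _).
by apply: eq_Rintegral => x _; rewrite mulrC.
Qed.

Lemma nlap_self q K : sqint mu q -> nlap_dominated q K ->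
  \int[mu]_x (nlap q x * q x) = fine (wsemi q).
Proof.
move=> iq dq; rewrite (form_identity iq dq iq) /Rintegral /wsemi; congr fine.
apply: eq_integral => y _; rewrite EFinM; congr (_ * _)%E.
rewrite -/(Rintegral _ _ _) EFin_Rint; last by apply: sqint_mul; exact: sqint_diffq.
by apply: eq_integral => x _; rewrite expr2.
Qed.

Lemma wsemi_ge0 h : (0 <= wsemi h)%E.
Proof.
by apply: integral_ge0 => y _; apply: mule_ge0; [rewrite lee_fin weight_ge0|exact: sqn_ge0].
Qed.

Lemma measurable_sqn_diffq h : measurable_fun setT h ->
  measurable_fun setT (fun y => sqn mu (diffq h y)).
Proof.
move=> mh.
have h1 : measurable_fun setT (fubini_G mu (fun z : E * E => (diffq h z.2 z.1 ^+ 2)%:E)).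
  apply: measurable_fun_fubini_tonelli_G => [|z]; last by rewrite lee_fin sqr_ge0.
  by apply/measurable_EFinP/measurable_funX; exact: measurable_diffq2.
exact: h1.
Qed.

Lemma rintegrable_wsqn h : measurable_fun setT h -> (wsemi h < +oo)%E ->
  rintegrable (mu \x mu)%E (fun z : E * E => w z.2 * diffq h z.2 z.1 ^+ 2).
Proof.
move=> mh hoo; apply: rintegrable_prodP2.
  by apply: measurable_funM; [exact: mw2|apply: measurable_funX; exact: measurable_diffq2].
apply: le_lt_trans hoo; rewrite /wsemi le_eqVlt; apply/orP; left; apply/eqP.
apply: eq_integral => y _ /=.
under eq_integral => x _ do rewrite normrM (ger0_norm (weight_ge0 _ _ _)) (ger0_norm (sqr_ge0 _)) EFinM.
rewrite ge0_integralZl_EFin ?weight_ge0//; last first.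
  by apply/measurable_EFinP/measurable_funX; exact: mdiff.
by move=> x _; rewrite lee_fin sqr_ge0.
Qed.

Lemma wsemi_fubini h : measurable_fun setT h ->
  wsemi h = (\int[mu]_x \int[mu]_y (w y * diffq h y x ^+ 2)%:E)%E.
Proof.
move=> mh; rewrite (fubini_tonelli (fun z : E * E => (w z.2 * diffq h z.2 z.1 ^+ 2)%:E))/=.
- apply: eq_integral => y _.
  under [RHS]eq_integral do rewrite EFinM.
  rewrite ge0_integralZl_EFin ?weight_ge0//; last first.
    by apply/measurable_EFinP/measurable_funX; exact: mdiff.
  by move=> x _; rewrite lee_fin sqr_ge0.
- apply/measurable_EFinP/measurable_funM; first exact: mw2.
  by apply: measurable_funX; exact: measurable_diffq2.
- by move=> z; rewrite lee_fin mulr_ge0 ?weight_ge0 ?sqr_ge0.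
Qed.

Lemma rintegrable_wform h p : measurable_fun setT h -> measurable_fun setT p ->
  (wsemi h < +oo)%E -> (wsemi p < +oo)%E ->
  rintegrable (mu \x mu)%E (fun z : E * E => w z.2 * (diffq h z.2 z.1 * diffq p z.2 z.1)).
Proof.
move=> mh mp ho po.
apply: rintegrable_le (rintegrableD (rintegrable_wsqn mh ho) (rintegrable_wsqn mp po)).
  by apply: measurable_funM; [exact: mw2|apply: measurable_funM; exact: measurable_diffq2].
move=> z; rewrite normrM ger0_norm ?weight_ge0// -mulrDr ler_wpM2l ?weight_ge0//.
rewrite ler_norml; apply/andP; split; nra.
Qed.

(** Summation by parts bounds the squared norm of the first difference by the norm of the second
    one, of order |y|^2, times that of [phi]. *)
Lemma bump_wsemi phi : bump phi -> (wsemi phi < +oo)%E.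
Proof.
move=> bphi; have kphi := bump_kernel bphi; have iphi := kernel_sqint kphi.
have [K [K0 hK]] := bump_dominated bphi; have [mphi _] := bphi.
have iw := rintegrable_weight N delta0 alpha01.
pose c := fine (sqn mu phi); have c0 : 0 <= c by rewrite fine_ge0// sqn_ge0.
apply: (@le_lt_trans _ _ (\int[mu]_y ((K * (1 + c)) * (w y * enorm y ^+ 2))%:E)%E); last first.
  rewrite -EFin_Rint ?ltry//; exact: rintegrableZ.
apply: ge0_le_integral => //.
- by move=> y _; apply: mule_ge0; rewrite ?sqn_ge0 ?lee_fin ?weight_ge0.
- apply: emeasurable_funM; last exact: measurable_sqn_diffq.
  by apply/measurable_EFinP; exact: measurable_weight.
- apply/measurable_EFinP; exact: rintegrable_measurable (rintegrableZ _ iw).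
move=> y _; have [wy|wy] := eqVneq (w y) 0; first by rewrite wy mul0e mul0r mulr0.
have idq := sqint_diffq y iphi.
rewrite -(fineK (sqint_fin_num idq)) -EFinM lee_fin mulrCA ler_wpM2l ?weight_ge0//.
have iqy : sqint mu (sdiff phi y) := sqint_sdiff y iphi.
have -> : fine (sqn mu (diffq phi y)) = \int[mu]_x (sdiff phi y x * phi x).
  by rewrite sdiff_form// /sqn; congr (fine _).
have := cauchy_schwarz iqy iphi; rewrite -/c.
have := hK y wy; rewrite -(fineK (sqint_fin_num iqy)) lee_fin => h1 h2.
have ub0 : 0 <= K * (1 + c) * enorm y ^+ 2 by rewrite mulr_ge0 ?sqr_ge0// mulr_ge0 ?addr_ge0.
apply: le_trans (ler_norm _) _.
rewrite -ler_sqr ?nnegrE// real_normK ?num_real//.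
apply: (le_trans h2); apply: (le_trans (ler_wpM2r c0 h1)).
by rewrite [K * (1 + c) * _]mulrAC; exact: sqr_mul_le.
Qed.

Lemma nlap_translate q a : nlap (fun x => q (x + a)) = (fun x => nlap q (x + a)).
Proof.
apply/funext => x; apply: eq_Rintegral => y _; rewrite /sdiff.
by rewrite !(addrAC x _ a).
Qed.

(** The form is symmetric, so that the operator can be placed on the smooth factor: [h] has a finite
    seminorm, but nothing is known about [nlap h]. *)
Lemma wform_bump phi h x0 : bump phi -> sqint mu h -> (wsemi h < +oo)%E ->
  \int[mu]_x \int[mu]_y (w y * (diffq h y x * diffq (fun z => phi (z - x0)) y x)) =
  mollify (nlap phi) h x0.
Proof.
move=> bphi ih ho; have [mh _] := ih.
have bx := bump_translate (- x0) bphi; have [mx _] := bx.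
have ix := kernel_sqint (bump_kernel bx); have [K dK] := bump_dominated bx.
rewrite (Rint_fubini (rintegrable_wform mh mx ho (bump_wsemi bx))) /=.
transitivity (\int[mu]_x (nlap (fun z => phi (z - x0)) x * h x)).
  rewrite (form_identity ix dK ih); apply: eq_Rintegral => y _.
  rewrite -RintZ; last by apply: sqint_mul; exact: sqint_diffq.
  by apply: eq_Rintegral => x _; congr (_ * _); rewrite mulrC.
rewrite nlap_translate /mollify.
rewrite -(Rintegral_translate x0 (f := fun x => nlap phi (x - x0) * h x)).
  by apply: eq_Rintegral => x _; rewrite addrK.
apply: measurable_funM => //.
apply: (measurableT_comp _ (measurable_translate (- x0))).
by apply: measurable_nlap; case: bphi.
Qed.

End nonlocal_laplacian.

(** * Behaviour of the norms under mollification *)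

Section mollified_norms.
Variables (R : realType) (N : nat) (delta alpha : R).
Local Notation E := 'rV[R]_N.
Local Notation mu := (lebesgue_rV R N).
Local Notation w := (weight delta alpha).
Local Notation wsemi := (wsemi delta alpha).
Variable eta : nat -> E -> R.
Hypothesis eta_unit : approximate_unit eta.
Implicit Types h : E -> R.

Let etak n : kernel (eta n). Proof. by case: eta_unit. Qed.

(** With T the mollified function, the difference of the square norms is the integral of (T - h)(h +
    T). Cauchy-Schwarz bounds its square by e^2 / (4 a + 1) times 4 a. *)
Lemma sqn_mollify_near h : sqint mu h -> forall e : R, 0 < e ->
  \forall n \near \oo, (sqn mu h <= sqn mu (mollify (eta n) h) + e%:E)%E.
Proof.
move=> ih e e0; pose a := fine (sqn mu h).
have a0 : 0 <= a by rewrite fine_ge0// sqn_ge0.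
have d0 : 0 < e ^+ 2 / (4 * a + 1) by rewrite divr_gt0 ?exprn_gt0//; lra.
have [_ /(_ _ d0)] := approximable_sqint eta_unit ih; apply: filterS => n hn.
have im := sqint_mollify (etak n) ih.
set T := mollify (eta n) h in hn im *.
have b := sqn_mollify_unit eta_unit n ih.
have i1 := sqintB im ih; have i2 := sqintD ih im.
have := cauchy_schwarz i1 i2.
have -> : \int[mu]_x ((T x - h x) * (h x + T x)) = fine (sqn mu T) - a.
  transitivity (\int[mu]_x (T x ^+ 2 - h x ^+ 2)).
    by apply: eq_Rintegral => x _; ring.
  by rewrite RintB//; exact: sqint_sqr.
have s2 : fine (sqn mu (fun x => h x + T x)) <= 4 * a.
  have := sqn_sub_le ih im; rewrite -/T in b *.
  move: b; rewrite -(fineK (sqint_fin_num ih)) -(fineK (sqint_fin_num im)).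
  rewrite -(fineK (sqint_fin_num i2)) -!EFinM -EFinD !lee_fin -/a; lra.
move: hn b; rewrite -/T -(fineK (sqint_fin_num i1)) lee_fin.
rewrite -(fineK (sqint_fin_num ih)) -(fineK (sqint_fin_num im)) -EFinD !lee_fin -/a /=.
set t := fine (sqn mu T); set s := fine (sqn mu (fun x => T x - h x)).
set u := fine (sqn mu (fun x => h x + T x)) in s2 *.
move=> hs ta cs.
have u0 : 0 <= u by rewrite fine_ge0// sqn_ge0.
have s0 : 0 <= s by rewrite fine_ge0// sqn_ge0.
have su : s * u <= e ^+ 2.
  apply: le_trans (ler_pM s0 u0 hs s2) _.
  rewrite mulrAC ler_pdivrMr; last lra.
  by rewrite ler_wpM2l ?sqr_ge0//; lra.
have : (a - t) ^+ 2 <= e ^+ 2 by rewrite -sqrrN opprB (le_trans cs).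
rewrite ler_sqr ?nnegrE; [lra|lra|exact: ltW].
Qed.

Lemma wsemi_mollify_le n h : sqint mu h -> (wsemi (mollify (eta n) h) <= wsemi h)%E.
Proof.
move=> ih; have [mh _] := ih.
have im := sqint_mollify (etak n) ih; have [mm _] := im.
apply: ge0_le_integral => //.
- by move=> y _; apply: mule_ge0; [rewrite lee_fin weight_ge0|exact: sqn_ge0].
- apply: emeasurable_funM; last exact: measurable_sqn_diffq.
  by apply/measurable_EFinP; exact: measurable_weight.
- apply: emeasurable_funM; last exact: measurable_sqn_diffq.
  by apply/measurable_EFinP; exact: measurable_weight.
move=> y _; apply: lee_wpmul2l; first by rewrite lee_fin weight_ge0.
rewrite diffq_mollify//; last exact: kernel_sqint.
by apply: sqn_mollify_unit => //; exact: sqint_diffq.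
Qed.

(** Differences commute with mollification, so that the previous lemma gives convergence at each
    [y]; the integrand of [wsemi h] dominates. *)
Lemma wsemi_mollify_near h : sqint mu h -> (wsemi h < +oo)%E -> forall e : R, 0 < e ->
  \forall n \near \oo, (wsemi h <= wsemi (mollify (eta n) h) + e%:E)%E.
Proof.
move=> ih ho e e0; have [mh _] := ih.
have im n := sqint_mollify (etak n) ih.
pose F n y : R := w y * fine (sqn mu (diffq (mollify (eta n) h) y)).
pose G y : R := w y * fine (sqn mu (diffq h y)).
have idh y := sqint_diffq y ih; have idm n y := sqint_diffq y (im n).
have FE n : (wsemi (mollify (eta n) h) = \int[mu]_y (F n y)%:E)%E.
  by apply: eq_integral => y _; rewrite [RHS]EFinM fineK// sqint_fin_num.
have GE : (wsemi h = \int[mu]_y (G y)%:E)%E.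
  by apply: eq_integral => y _; rewrite [RHS]EFinM fineK// sqint_fin_num.
have m1 k : measurable_fun setT k -> measurable_fun setT
    (fun y => w y * fine (sqn mu (diffq k y))).
  move=> mk; apply: measurable_funM; first exact: measurable_weight.
  exact: (measurableT_comp _ (measurable_sqn_diffq mk)).
have G0 y : 0 <= G y by rewrite mulr_ge0 ?weight_ge0// fine_ge0// sqn_ge0.
have F0 n y : 0 <= F n y by rewrite mulr_ge0 ?weight_ge0// fine_ge0// sqn_ge0.
have FG n y : F n y <= G y.
  rewrite ler_wpM2l ?weight_ge0// fine_le ?sqint_fin_num//.
  rewrite diffq_mollify//; last exact: kernel_sqint.
  exact: sqn_mollify_unit.
have iG : rintegrable mu G by apply: ge0_rintegrable; rewrite -?GE//; exact: m1.
have [] := @dominated_convergence _ _ _ mu setT measurableT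
  (fun n y => (F n y)%:E) (EFin \o G) (EFin \o G).
- by move=> n; apply/measurable_EFinP; apply: m1; case: (im n).
- by apply/measurable_EFinP; exact: m1.
- apply: aeW => y _; apply: cvg_EFin; first exact: nearW.
  apply/cvgrPdist_le => /= d d0.
  have [wy|wy] := eqVneq (w y) 0.
    by apply: nearW => n; rewrite /F /G wy !mul0r subrr normr0 ltW.
  have wp : 0 < w y by rewrite lt0r wy weight_ge0.
  have dw : 0 < d / w y by rewrite divr_gt0.
  apply: filterS (sqn_mollify_near (idh y) dw) => n.
  rewrite -diffq_mollify//; last exact: kernel_sqint.
  rewrite -(fineK (sqint_fin_num (idh y))) -(fineK (sqint_fin_num (idm n y))).
  rewrite -EFinD lee_fin -lerBlDl ler_pdivlMr// => h1.
  by rewrite ger0_norm ?subr_ge0 ?FG// /F /G -mulrBr mulrC.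
- exact: iG.
- by apply: aeW => y n _ /=; rewrite lee_fin ger0_norm.
move=> _ _; rewrite -(fineK (integrable_fin_num measurableT iG)).
move=> /fine_cvgP[fin /cvgrPdist_le /(_ _ e0)] h2.
apply: filterS2 fin h2 => n /= fn; rewrite ler_norml => /andP[_ h3].
rewrite FE GE -(fineK fn) -(fineK (integrable_fin_num measurableT iG)) -EFinD lee_fin.
by rewrite -lerBlDl.
Qed.

End mollified_norms.

(** * Test functions and mollifiers *)

Section smooth_functions_of_one_variable.
Variable R : realType.
Implicit Types s t : R -> R.

(** Smoothness as membership in some class of differentiable functions that is stable under
    derivation; no iterated derivatives have to be computed. *)
Definition smooth1 s := exists P : (R -> R) -> Prop, P s /\
  forall t, P t -> (forall x, derivable t x 1) /\ P (derive1 t).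

Lemma smooth1_derivable s : smooth1 s -> forall x, derivable s x 1.
Proof. by move=> [P [Ps h]]; have [] := h _ Ps. Qed.

Lemma smooth1_derive s : smooth1 s -> smooth1 (derive1 s).
Proof. by move=> [P [Ps h]]; exists P; have [] := h _ Ps. Qed.

Lemma smooth1_continuous s : smooth1 s -> continuous s.
Proof.
move=> /smooth1_derivable h x.
by apply: differentiable_continuous; apply/derivable1_diffP; exact: h.
Qed.

Lemma smooth1_primitive s t : smooth1 s -> (forall x : R, is_derive x 1 t (s x)) ->
  smooth1 t.
Proof.
move=> [P [Ps h]] ts; exists (fun f => f = t \/ P f); split; first by left.
move=> f [->|Pf]; last by have [] := h _ Pf; split => //; right.
split; first by move=> x; have [] := ts x.
right; have -> // : derive1 t = s.
by apply/funext => x; rewrite derive1E; have [_ ->] := ts x.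
Qed.

(** The powers of 1 / x make the family closed under derivation. *)
Definition flat (k : nat) (x : R) : R :=
  if 0 < x then x^-1 ^+ k * expR (- x^-1) else 0.

Lemma flat_ge0 k x : 0 <= flat k x.
Proof.
by rewrite /flat; case: ifPn => // x0; rewrite mulr_ge0 ?expR_ge0 ?exprn_ge0 ?invr_ge0 ?ltW.
Qed.

Lemma flat_le0 k x : x <= 0 -> flat k x = 0.
Proof. by rewrite /flat leNgt => /negbTE ->. Qed.

(** With y = (m + 1) z, both z and 1 are at most e^z, hence z^m <= e^(m z) <= e^((m + 1) z). *)
Let pow_exp (m : nat) (y : R) : 0 <= y -> y ^+ m * expR (- y) <= m.+1%:R ^+ m.
Proof.
move=> y0; rewrite expRN ler_pdivrMr ?expR_gt0//.
have m0 : 0 < m.+1%:R :> R by rewrite ltr0n.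
have -> : y = m.+1%:R * (y / m.+1%:R) by rewrite mulrC divfK ?gt_eqF.
have z0 : 0 <= y / m.+1%:R by rewrite divr_ge0 ?ler0n.
rewrite exprMn ler_wpM2l ?exprn_ge0// expRM_natl exprS.
have e1 : 1 <= expR (y / m.+1%:R).
  by rewrite (le_trans _ (expR_ge1Dx _))// lerDl.
rewrite (@le_trans _ _ (expR (y / m.+1%:R) ^+ m))//.
  by rewrite lerXn2r ?nnegrE ?expR_ge0// (le_trans _ (expR_ge1Dx _))// lerDr.
by rewrite ler_peMl ?exprn_ge0 ?expR_ge0.
Qed.

(** Two spare powers of 1 / x leave a factor x^2, enough for a zero derivative at 0. *)
Let flat_quadratic k (x : R) : flat k x <= k.+3%:R ^+ k.+2 * x ^+ 2.
Proof.
rewrite /flat; case: ifPn => x0; last by rewrite mulr_ge0 ?sqr_ge0// exprn_ge0// ler0n.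
have xn : x != 0 by rewrite gt_eqF.
have := @pow_exp k.+2 x^-1; rewrite invr_ge0 => /(_ (ltW x0)).
rewrite -(ler_pM2r (_ : 0 < x ^+ 2)) ?exprn_gt0//; apply: le_trans.
rewrite le_eqVlt; apply/orP; left; apply/eqP.
rewrite -addn2 exprD; field; exact: xn.
Qed.

Lemma is_derive_flat k (x : R) :
  is_derive x 1 (flat k) (- k%:R * flat k.+1 x + flat k.+2 x).
Proof.
have [x0|x0|x0] := ltgtP x 0.
- rewrite !flat_le0 ?ltW// mulr0 addr0.
  have h : is_derive x (1 : R) (cst 0 : R -> R) 0 by exact: is_derive_cst.
  apply: (near_eq_is_derive _ h).
  near=> y; rewrite flat_le0//; apply: ltW; near: y; exact: lt_nbhsl.
- have xn : x != 0 by rewrite gt_eqF.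
  have h : is_derive x (1 : R) (fun y : R => (y^-1) ^+ k * expR (- y^-1))
      (- k%:R * flat k.+1 x + flat k.+2 x).
    have hv : is_derive x (1 : R) (fun y : R => y^-1) (- x ^- 2).
      have := @is_deriveV R id x 1 1 xn (is_derive_id _ _).
      by rewrite /GRing.scale/= mulr1.
    have hn : is_derive x (1 : R) (fun y : R => - y^-1) (x ^- 2).
      by apply: is_derive_eq; rewrite opprK.
    have he : is_derive x (1 : R) (fun y : R => expR (- y^-1)) (x ^- 2 * expR (- x^-1)).
      have := @is_derive1_comp R expR (fun y : R => - y^-1) x _ _ _ hn.
      by move=> /(_ _ (is_derive_expR _)); rewrite mulrC.
    have hk : is_derive x (1 : R) (fun y : R => y^-1 ^+ k) (k%:R * x^-1 ^+ k.-1 * (- x ^- 2)).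
      have := @is_deriveX R R (fun y : R => y^-1) k x 1 _ hv.
      rewrite (_ : (fun y : R => y^-1 ^+ k) = (fun y : R => y^-1) ^+ k); first by [].
      by apply/funext => y; rewrite exprfctE.
    suff -> : - k%:R * flat k.+1 x + flat k.+2 x =
        x^-1 ^+ k *: (x ^- 2 * expR (- x^-1)) +
        expR (- x^-1) *: (k%:R * x^-1 ^+ k.-1 * - x ^- 2) by exact: is_deriveM hk he.
    rewrite /GRing.scale /= /flat x0; case: k hk => [|k] hk.
      by rewrite expr0 oppr0 !mul0r mulr0 add0r addr0 mul1r exprVn.
    rewrite succnK !exprS; field; exact: xn.
  apply: (near_eq_is_derive _ h).
  near=> y; rewrite /flat ifT//; near: y; exact: lt_nbhsr.
- rewrite x0 !flat_le0// mulr0 addr0.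
  pose C : R := k.+3%:R ^+ k.+2.
  have C0 : 0 <= C by rewrite exprn_ge0 ?ler0n.
  have h : h^-1 *: (flat k (h *: 1 + 0) - flat k 0) @[h --> 0^'] --> (0 : R).
    apply/cvgrPdist_le => /= e e0; near=> h.
    rewrite sub0r normrN addr0 (flat_le0 k (lexx 0)) subr0 normrM normfV.
    have hn : h != 0 by near: h; exact: nbhs_dnbhs_neq.
    rewrite (_ : h *: (1 : R) = h); last by rewrite /GRing.scale/= mulr1.
    rewrite (ger0_norm (flat_ge0 k h)) ler_pdivrMl ?normr_gt0//.
    apply: le_trans (flat_quadratic k h) _.
    rewrite -/C -(real_normK (num_real h)) expr2 mulrA mulrC ler_wpM2l//.
    have : `|h| <= e / (C + 1).
      near: h; apply: dnbhs0_le; rewrite divr_gt0//; lra.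
    rewrite ler_pdivlMr; last lra.
    by move=> h1; apply: le_trans h1; rewrite mulrC ler_wpM2l//; lra.
  by apply: DeriveDef; [apply/cvg_ex; exists 0; exact: h|exact/cvg_lim].
Unshelve. all: by end_near. Qed.

(** Stable under derivation: one induction yields the smoothness of all rescaled bumps and of their
    products with polynomials. *)
Inductive flat_algebra : (R -> R) -> Prop :=
| flat_algebra_flat k a b : flat_algebra (fun x => flat k (a * x + b))
| flat_algebra_cst c : flat_algebra (fun=> c)
| flat_algebra_id : flat_algebra (fun x => x)
| flat_algebra_add s t : flat_algebra s -> flat_algebra t ->
    flat_algebra (fun x => s x + t x)
| flat_algebra_mul s t : flat_algebra s -> flat_algebra t ->
    flat_algebra (fun x => s x * t x).

Lemma flat_algebra_smooth s : flat_algebra s -> smooth1 s.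
Proof.
suff H t : flat_algebra t -> exists2 t', flat_algebra t' & forall x : R, is_derive x 1 t (t' x).
  move=> hs; exists flat_algebra; split => // t /H[t' ht' dt].
  split; first by move=> x; have [] := dt x.
  have -> // : derive1 t = t'.
  by apply/funext => x; rewrite derive1E; have [_ ->] := dt x.
elim=> [k a b|c||f g _ [f' hf df] _ [g' hg dg]|f g hf0 [f' hf df] hg0 [g' hg dg]].
- exists (fun x => a * (- k%:R * flat k.+1 (a * x + b) + flat k.+2 (a * x + b))).
    apply: flat_algebra_mul; first exact: flat_algebra_cst.
    apply: flat_algebra_add; last exact: flat_algebra_flat.
    by apply: flat_algebra_mul; [exact: flat_algebra_cst|exact: flat_algebra_flat].
  move=> x.
  have ha : is_derive x (1 : R) (fun y : R => a * y + b) a.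
    have h1 : is_derive x (1 : R) (fun y : R => a * y) a.
      have := @is_deriveZ R R R id a x 1 _ (is_derive_id x 1).
      by rewrite /GRing.scale /= mulr1.
    have := is_deriveD h1 (is_derive_cst b x 1); rewrite addr0.
    by [].
  have := @is_derive1_comp R (flat k) (fun y : R => a * y + b) x _ _ (is_derive_flat k _) ha.
  by rewrite mulrC.
- by exists (fun=> 0); [exact: flat_algebra_cst|move=> x; exact: is_derive_cst].
- by exists (fun=> 1); [exact: flat_algebra_cst|move=> x; exact: is_derive_id].
- exists (fun x => f' x + g' x); first exact: flat_algebra_add.
  by move=> x; exact: is_deriveD.
- exists (fun x => f x * g' x + g x * f' x).
    by apply: flat_algebra_add; exact: flat_algebra_mul.
  by move=> x; exact: is_deriveM.
Qed.

Definition bump1 (x : R) : R := flat 0 x * flat 0 (1 - x).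

Lemma bump1_affine (a b : R) : flat_algebra (fun x => bump1 (a * x + b)).
Proof.
have -> : (fun x => bump1 (a * x + b)) =
    (fun x => flat 0 (a * x + b) * flat 0 ((- a) * x + (1 - b))).
  by apply/funext => x; rewrite /bump1; congr (_ * flat 0 _); ring.
by apply: flat_algebra_mul; exact: flat_algebra_flat.
Qed.

Lemma bump1_ge0 x : 0 <= bump1 x.
Proof. by rewrite mulr_ge0 ?flat_ge0. Qed.

Lemma bump1_support x : bump1 x != 0 -> 0 < x < 1.
Proof.
move=> h; apply/andP; split; rewrite ltNge; apply: contra h => h.
  by rewrite /bump1 flat_le0 ?mul0r.
by rewrite /bump1 [X in _ * X]flat_le0 ?mulr0// subr_le0.
Qed.

(** Each factor is at least e^(-4) on the middle half of the support; this is used wherever a value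
    or an integral of a bump must be positive. *)
Lemma bump1_bound x : 4^-1 <= x <= 3 / 4 -> expR (- 8) <= bump1 x.
Proof.
move=> /andP[h1 h2].
have key (z : R) : 4^-1 <= z -> expR (- 4) <= flat 0 z.
  move=> hz; rewrite /flat ifT; last by apply: lt_le_trans hz; rewrite invr_gt0.
  rewrite expr0 mul1r ler_expR lerN2 -[leRHS]invrK lef_pV2 ?posrE//.
  by apply: lt_le_trans hz; rewrite invr_gt0.
have -> : - 8 = - 4 + - 4 :> R by lra.
by rewrite expRD ler_pM ?expR_ge0//; apply: key => //; lra.
Qed.

End smooth_functions_of_one_variable.

(** * Smooth functions on normed spaces *)

Section smooth_functions.
Variables (R : realType) (V : normedModType R).

(** Smooth functions of one affine form generate an algebra that is stable under every directional
    derivative, as [class_C] demands at all orders. *)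
Inductive smooth_algebra : (V -> R) -> Prop :=
| smooth_algebra_comp (s : R -> R) (l : {linear V -> R}) (b : R) :
    smooth1 s -> continuous l -> smooth_algebra (fun z => s (l z + b))
| smooth_algebra_cst c : smooth_algebra (fun=> c)
| smooth_algebra_add s t : smooth_algebra s -> smooth_algebra t ->
    smooth_algebra (fun z => s z + t z)
| smooth_algebra_mul s t : smooth_algebra s -> smooth_algebra t ->
    smooth_algebra (fun z => s z * t z).

Lemma smooth_algebra_prod (I : Type) (r : seq I) (F : I -> V -> R) :
  (forall i, smooth_algebra (F i)) -> smooth_algebra (fun z => \prod_(i <- r) F i z).
Proof.
move=> hF; elim: r => [|i r IH].
  by under eq_fun do rewrite big_nil; exact: smooth_algebra_cst.
by under eq_fun do rewrite big_cons; exact: smooth_algebra_mul.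
Qed.

Lemma smooth_algebra_differentiable s : smooth_algebra s -> forall z, differentiable s z.
Proof.
elim=> [t l b st cl|c|f g _ hf _ hg|f g _ hf _ hg] z.
- have h1 : differentiable (fun z => l z + b) z.
    by apply: differentiableD => //; apply: linear_differentiable; exact: cl.
  apply: (@differentiable_comp _ _ _ _ (fun z => l z + b) t) => //.
  by apply/derivable1_diffP; exact: smooth1_derivable.
- exact: differentiable_cst.
- exact: differentiableD.
- exact: differentiableM.
Qed.

Lemma smooth_algebra_derive s v : smooth_algebra s -> smooth_algebra ('D_v s).
Proof.
have df f z := @smooth_algebra_differentiable f ^~ z.
elim=> [t l b st cl|c|f g hf hf' hg hg'|f g hf hf' hg hg'].
- have -> : 'D_v (fun z => t (l z + b)) = (fun z => derive1 t (l z + b) * l v).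
    apply/funext => z.
    have h0 : differentiable (l : V -> R) z by apply: linear_differentiable; exact: cl.
    have h1 : differentiable (fun z => l z + b) z by apply: differentiableD.
    have ht : differentiable t (l z + b) by apply/derivable1_diffP; exact: smooth1_derivable.
    rewrite deriveE; last exact: (@differentiable_comp _ _ _ _ (fun z => l z + b) t).
    rewrite (@diff_comp _ _ _ _ (fun z => l z + b) t)//= diffD//= diff_cst /=.
    rewrite diff_lin//= addr0 derive1E' // -[X in 'd t _ X](mulr1 (l v)).
    by rewrite -[l v * 1]/(l v *: (1 : R)) linearZ /= mulrC.
  apply: smooth_algebra_mul; last exact: smooth_algebra_cst.
  by apply: smooth_algebra_comp => //; exact: smooth1_derive.
- have -> : 'D_v (fun _ : V => c) = (fun=> 0) by apply/funext => z; rewrite derive_cst.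
  exact: smooth_algebra_cst.
- have -> : 'D_v (fun z => f z + g z) = (fun z => 'D_v f z + 'D_v g z).
    by apply/funext => z; rewrite deriveD//; apply: diff_derivable; exact: df.
  exact: smooth_algebra_add.
- have -> : 'D_v (fun z => f z * g z) = (fun z => f z * 'D_v g z + g z * 'D_v f z).
    by apply/funext => z; rewrite deriveM//; apply: diff_derivable; exact: df.
  by apply: smooth_algebra_add; exact: smooth_algebra_mul.
Qed.

Variable W : normedModType R.

Lemma is_derive_scale (s : V -> R) (e : W) z v : derivable s z v ->
  is_derive z v (fun z => s z *: e) ('D_v s z *: e).
Proof.
move=> ds; have h : h^-1 *: ((s (h *: v + z) *: e) - s z *: e) @[h --> 0^'] --> 'D_v s z *: e.
  have h1 : (h^-1 *: (s (h *: v + z) - s z)) *: e @[h --> 0^'] --> 'D_v s z *: e.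
    by apply: cvgZr_tmp; exact: ds.
  apply: cvg_trans h1; apply: near_eq_cvg.
  by apply: nearW => h /=; rewrite -scalerBl scalerA.
by apply: DeriveDef; [apply/cvg_ex; eexists; exact: h|exact/cvg_lim].
Qed.

Lemma class_C_scale (s : V -> R) (e : W) k : smooth_algebra s ->
  class_C k setT (fun z => s z *: e).
Proof.
elim: k s => [|k IH] s hs; (split; first by
  move=> z _; apply: cvgZr_tmp; exact: (differentiable_continuous (smooth_algebra_differentiable hs z))) => //.
move=> v; have ds z : derivable s z v.
  by apply: diff_derivable; exact: smooth_algebra_differentiable.
split; first by move=> z _; have [] := is_derive_scale e (ds z).
have -> : 'D_v (fun z => s z *: e) = (fun z => 'D_v s z *: e).
  by apply/funext => z; have [_ ->] := is_derive_scale e (ds z).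
by apply: IH; exact: smooth_algebra_derive.
Qed.

End smooth_functions.

(** * Test functions with separated variables *)

Section test_functions.
Variables (R : realType) (N : nat).
Local Notation E := 'rV[R]_N.

Let tcoor : {linear (E * R)%type -> R} := snd.

Definition space_smooth (phi : E -> R) :=
  smooth_algebra (fun z : E * R => phi z.1) /\
  exists r : R, forall z, phi z != 0 -> forall i, `|z ord0 i| <= r.

Lemma closed_box (r a b : R) :
  compact ([set z : E * R | (forall i, `|z.1 ord0 i| <= r) /\ a <= z.2 <= b]).
Proof.
have -> : [set z : E * R | (forall i, `|z.1 ord0 i| <= r) /\ a <= z.2 <= b] =
    [set x : E | forall i, `[- r, r]%classic (x ord0 i)] `*` `[a, b]%classic.
  apply/seteqP; split => -[x t] /= [h h']; split; rewrite ?in_itv//=.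
    by move=> i; have := h i; rewrite in_itv/= ler_norml.
  by move=> i; have := h i; rewrite in_itv/= ler_norml.
apply: compact_setX; last exact: segment_compact.
by apply: (@rV_compact _ _ (fun=> `[- r, r]%classic)) => i; exact: segment_compact.
Qed.

Definition separated_test (theta : R -> R) (phi : E -> R) (i : 'I_N) : E * R -> E :=
  fun z => (theta z.2 * phi z.1) *: delta_mx ord0 i.

(** The second claim serves [weak_dt], whose test functions must have their closed support in
    positive times. *)
Lemma separated_test_function theta phi i (a b : R) : smooth1 theta ->
  (forall t, theta t != 0 -> a <= t <= b) -> space_smooth phi ->
  test_function (separated_test theta phi i) /\
  closure [set z | separated_test theta phi i z != 0] `<=` [set z | a <= z.2].
Proof.
move=> st supt [sphi [r supr]].
have sub : [set z | separated_test theta phi i z != 0] `<=`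
    [set z : E * R | (forall i, `|z.1 ord0 i| <= r) /\ a <= z.2 <= b].
  move=> [x t] /=; rewrite /separated_test scaler_eq0 negb_or mulf_eq0 negb_or /=.
  by move=> /andP[/andP[h1 h2] _]; split; [exact: supr|exact: supt].
have cc : closure [set z | separated_test theta phi i z != 0] `<=`
    [set z : E * R | (forall i, `|z.1 ord0 i| <= r) /\ a <= z.2 <= b].
  have cl : closed [set z : E * R | (forall i, `|z.1 ord0 i| <= r) /\ a <= z.2 <= b].
    by apply: compact_closed; [exact: norm_hausdorff|exact: closed_box].
  by rewrite ((closure_id _).1 cl); exact: closureS.
split; last by move=> z /cc[_ /andP[]].
split; last first.
  by apply: (subclosed_compact _ (@closed_box r a b)) => //; exact: closed_closure.
move=> k; apply: class_C_scale; apply: smooth_algebra_mul => //.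
have -> : (fun z : E * R => theta z.2) = (fun z : E * R => theta (tcoor z + 0)).
  by apply/funext => z; rewrite addr0.
apply: smooth_algebra_comp => // z; exact: cvg_snd.
Qed.

Lemma dt_separated theta phi i : smooth1 theta ->
  dt (separated_test theta phi i) = separated_test (derive1 theta) phi i.
Proof.
move=> st; apply/funext => -[x t]; rewrite /dt.
have dth := @smooth1_derivable _ _ st t.
have h : h^-1 *: (separated_test theta phi i (h *: (0, 1) + (x, t)) -
    separated_test theta phi i (x, t)) @[h --> 0^'] -->
    separated_test (derive1 theta) phi i (x, t).
  rewrite /separated_test /= derive1E.
  have h1 : (h^-1 *: (theta (h *: 1 + t) - theta t)) *: (phi x *: (delta_mx ord0 i : E)) @[h --> 0^'] -->
      'D_1 theta t *: (phi x *: delta_mx ord0 i).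
    by apply: cvgZr_tmp; exact: dth.
  have -> : ('D_1 theta t * phi x) *: (delta_mx ord0 i : E) =
    'D_1 theta t *: (phi x *: delta_mx ord0 i) by rewrite scalerA.
  apply: cvg_trans h1; apply: near_eq_cvg; apply: nearW => h /=.
  by rewrite scaler0 add0r -scalerBl -mulrBl !scalerA mulrA.
exact/cvg_lim.
Qed.

End test_functions.

(** * Bounds on first and second differences *)

Section second_order_bounds.
Variable R : realType.

Lemma smooth1_derive_support (s : R -> R) (a b : R) : smooth1 s ->
  (forall x, s x != 0 -> a <= x <= b) ->
  forall x, derive1 s x != 0 -> a <= x <= b.
Proof.
move=> ss sup x; apply: contraNT => nx; rewrite derive1E.
suff h : \near x, cst 0 x = s x.
  by rewrite -(near_eq_derive _ h) derive_cst.
have out y : ~~ (a <= y <= b) -> cst 0 y = s y.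
  by move=> hy; apply/esym/eqP; apply: contraNT hy; exact: sup.
move: nx; rewrite negb_and -!ltNge => /orP[xa|bx].
  near=> y; apply: out; rewrite negb_and -ltNge; apply/orP; left.
  near: y; exact: lt_nbhsl.
near=> y; apply: out; rewrite negb_and -!ltNge; apply/orP; right.
near: y; exact: lt_nbhsr.
Unshelve. all: by end_near. Qed.

Lemma smooth1_bounded (s : R -> R) (a b : R) : a <= b -> smooth1 s ->
  (forall x, s x != 0 -> a <= x <= b) -> exists2 M : R, 0 <= M & forall x, `|s x| <= M.
Proof.
move=> ab ss sup; have cs := smooth1_continuous ss.
have cn : {within `[a, b], continuous (fun x => `|s x|)}.
  apply: continuous_subspaceT => x; apply: continuous_comp; first exact: cs.
  exact: norm_continuous.
have [c _ hc] := EVT_max ab cn.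
exists `|s c| => // x; have [->|/sup xab] := eqVneq (s x) 0; first by rewrite normr0.
by apply: hc; rewrite in_itv.
Qed.

Lemma smooth1_lipschitz (s : R -> R) (M : R) : smooth1 s ->
  (forall x, `|derive1 s x| <= M) -> forall x y, `|s x - s y| <= M * `|x - y|.
Proof.
move=> ss bM; have M0 : 0 <= M by apply: le_trans (bM 0).
have cs := smooth1_continuous ss.
have ds (x : R) : is_derive x 1 s (derive1 s x).
  by rewrite derive1E; apply: derivableP; exact: smooth1_derivable.
have key x y : x <= y -> `|s x - s y| <= M * `|x - y|.
  move=> xy; have [//|c _ E] := @MVT_segment R s (derive1 s) x y xy (fun z _ => ds z).
    exact: continuous_subspaceT.
  by rewrite distrC E normrM distrC ler_wpM2r.
move=> x y; have [|/ltW] := leP x y; first exact: key.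
by move=> /key; rewrite distrC (distrC y).
Qed.

(** Mean values on either side of [x] turn the expression into [h] times a difference of derivatives
    at two points that are at most 2 h apart. *)
Lemma smooth1_second_difference (s : R -> R) (M : R) : smooth1 s ->
  (forall x, `|derive1 (derive1 s) x| <= M) ->
  forall x h, `|2 * s x - s (x - h) - s (x + h)| <= 2 * M * h ^+ 2.
Proof.
move=> ss bM; have M0 : 0 <= M by apply: le_trans (bM 0).
have ls := smooth1_lipschitz (smooth1_derive ss) bM.
have cs := smooth1_continuous ss.
have ds (x : R) : is_derive x 1 s (derive1 s x).
  by rewrite derive1E; apply: derivableP; exact: smooth1_derivable.
have key x h : 0 <= h -> `|2 * s x - s (x - h) - s (x + h)| <= 2 * M * h ^+ 2.
  move=> h0.
  have h1 : x - h <= x by rewrite gerBl.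
  have h2 : x <= x + h by rewrite lerDl.
  have [|c1 ic1 E1] := @MVT_segment R s (derive1 s) _ _ h1 (fun z _ => ds z).
    exact: continuous_subspaceT.
  have [|c2 ic2 E2] := @MVT_segment R s (derive1 s) _ _ h2 (fun z _ => ds z).
    exact: continuous_subspaceT.
  have -> : 2 * s x - s (x - h) - s (x + h) = h * (derive1 s c1 - derive1 s c2).
    rewrite (_ : 2 * s x - s (x - h) - s (x + h) = (s x - s (x - h)) - (s (x + h) - s x)); last ring.
    by rewrite E1 E2; ring.
  rewrite normrM ger0_norm// expr2 mulrCA ler_wpM2l//.
  apply: le_trans (ls _ _) _; rewrite -mulrA mulrCA ler_wpM2l//.
  move: ic1 ic2; rewrite !in_itv/= => /andP[a1 a2] /andP[a3 a4].
  by rewrite ler_norml; apply/andP; split; lra.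
move=> x h; have [|/ltW h0] := leP 0 h; first exact: key.
have := key x (- h); rewrite oppr_ge0 opprK sqrrN => /(_ h0).
by rewrite (addrAC _ (- s (x + h))).
Qed.

Variable N : nat.
Local Notation E := 'rV[R]_N.

Definition second_order_bound (phi : E -> R) := exists2 M : R, 0 <= M &
  [/\ forall z, `|phi z| <= M,
      forall z y, `|phi (z + y) - phi z| <= M * enorm y &
      forall z y, `|sdiff phi y z| <= M * enorm y ^+ 2].

Lemma second_order_bound_coor (s : R -> R) (a b : R) (i : 'I_N) : a <= b -> smooth1 s ->
  (forall x, s x != 0 -> a <= x <= b) -> second_order_bound (fun z => s (z ord0 i)).
Proof.
move=> ab ss sup; have s1 := smooth1_derive ss; have s2 := smooth1_derive s1.
have sup1 := smooth1_derive_support ss sup; have sup2 := smooth1_derive_support s1 sup1.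
have [M0 p0 b0] := smooth1_bounded ab ss sup.
have [M1 p1 b1] := smooth1_bounded ab s1 sup1.
have [M2 p2 b2] := smooth1_bounded ab s2 sup2.
exists (M0 + M1 + 2 * M2); first by lra.
split=> [z|z y|z y].
- by apply: le_trans (b0 _) _; lra.
- rewrite mxE; apply: le_trans (smooth1_lipschitz ss b1 _ _) _.
  rewrite (addrC (z _ _)) addrK.
  apply: ler_pM => //; [lra|exact: coor_le_enorm].
- rewrite /sdiff !mxE; apply: le_trans (smooth1_second_difference ss b2 _ _) _.
  apply: ler_pM; rewrite ?sqr_ge0//; [lra|lra|].
  rewrite -real_normK ?num_real// lerXn2r ?nnegrE ?enorm_ge0//; exact: coor_le_enorm.
Qed.

(** The second difference of a product is the sum of two products with a second difference and two
    products of first differences, each at most A B |y|^2; hence the 4. *)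
Lemma second_order_boundM phi psi : second_order_bound phi -> second_order_bound psi ->
  second_order_bound (fun z => phi z * psi z).
Proof.
move=> [A A0 [a0 a1 a2]] [B B0 [b0 b1 b2]]; exists (4 * A * B).
  by rewrite !mulr_ge0.
have AB0 : 0 <= A * B by rewrite mulr_ge0.
split=> [z|z y|z y].
- rewrite normrM (le_trans (ler_pM _ _ (a0 z) (b0 z)))//; nra.
- rewrite (_ : _ - _ = phi (z + y) * (psi (z + y) - psi z) + (phi (z + y) - phi z) * psi z);
    last ring.
  rewrite (le_trans (ler_normD _ _))// !normrM.
  have h1 := ler_pM (normr_ge0 _) (normr_ge0 _) (a0 (z + y)) (b1 z y).
  have h2 := ler_pM (normr_ge0 _) (normr_ge0 _) (a1 z y) (b0 z).
  have e0 := enorm_ge0 y; apply: le_trans (lerD h1 h2) _.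
  have : 0 <= A * B * enorm y by rewrite mulr_ge0.
  nra.
- have eN : enorm (- y) = enorm y.
    by rewrite /enorm /dotp; congr Num.sqrt; apply: eq_bigr => i _; rewrite !mxE mulrNN.
  rewrite (_ : sdiff _ y z = phi z * sdiff psi y z + sdiff phi y z * psi z -
    ((phi (z + y) - phi z) * (psi (z + y) - psi z) +
     (phi (z - y) - phi z) * (psi (z - y) - psi z))); last by rewrite /sdiff; ring.
  have h1 := ler_pM (normr_ge0 _) (normr_ge0 _) (a0 z) (b2 z y).
  have h2 := ler_pM (normr_ge0 _) (normr_ge0 _) (a2 z y) (b0 z).
  have h3 := ler_pM (normr_ge0 _) (normr_ge0 _) (a1 z y) (b1 z y).
  have h4 := ler_pM (normr_ge0 _) (normr_ge0 _) (a1 z (- y)) (b1 z (- y)).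
  rewrite eN in h4.
  rewrite (le_trans (ler_normB _ _))// (le_trans (lerD (ler_normD _ _) (ler_normD _ _)))//.
  rewrite !normrM (le_trans (lerD (lerD h1 h2) (lerD h3 h4)))//.
  rewrite le_eqVlt; apply/orP; left; apply/eqP; ring.
Qed.

Lemma second_order_bound_cst c : second_order_bound (fun=> c).
Proof.
exists `|c| => //; split=> [//|z y|z y].
  by rewrite subrr normr0 mulr_ge0 ?enorm_ge0.
have -> : sdiff (fun=> c) y z = 0 by rewrite /sdiff; ring.
by rewrite normr0 mulr_ge0 ?sqr_ge0.
Qed.

Lemma second_order_bound_prod (I : Type) (r : seq I) (F : I -> E -> R) :
  (forall i, second_order_bound (F i)) ->
  second_order_bound (fun z => \prod_(i <- r) F i z).
Proof.
move=> hF; elim: r => [|i r IH].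
  by under eq_fun do rewrite big_nil; exact: second_order_bound_cst.
by under eq_fun do rewrite big_cons; exact: second_order_boundM.
Qed.

End second_order_bounds.

(** * The mollifiers *)

Section mollifiers.
Variables (R : realType) (N : nat).
Local Notation E := 'rV[R]_N.
Local Notation mu := (lebesgue_rV R N).

Definition mollifier0 (n : nat) (z : E) : R := \prod_i bump1 (n.+1%:R * z ord0 i).

Definition mollifier (n : nat) (z : E) : R :=
  (\int[mu]_y mollifier0 n y)^-1 * mollifier0 n z.

Let bump1_scale_support n (x : R) : bump1 (n.+1%:R * x) != 0 -> 0 <= x <= n.+1%:R^-1.
Proof.
have n0 : 0 < n.+1%:R :> R by rewrite ltr0n.
move=> /bump1_support/andP[h1 h2]; apply/andP; split.
  by move: h1; rewrite pmulr_rgt0// => /ltW.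
by rewrite -[leRHS]mul1r ler_pdivlMr// mulrC ltW.
Qed.

Let bump1_scale_smooth n b : smooth1 (fun x : R => bump1 (n.+1%:R * x + b)).
Proof. by apply: flat_algebra_smooth; exact: bump1_affine. Qed.

Let mollifier0_support n z : mollifier0 n z != 0 -> forall i, 0 <= z ord0 i <= n.+1%:R^-1.
Proof. by move=> /prodf_neq0 h i; apply: bump1_scale_support; exact: h. Qed.

Let mollifier0_ge0 n z : 0 <= mollifier0 n z.
Proof. by apply: prodr_ge0 => i _; exact: bump1_ge0. Qed.

Let mollifier0_bump n : bump (mollifier0 n).
Proof.
have [M M0 [h0 h1 h2]] : second_order_bound (mollifier0 n).
  apply: second_order_bound_prod => i.
  apply: (@second_order_bound_coor _ _ (fun x => bump1 (n.+1%:R * x)) 0 n.+1%:R^-1).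
  - by rewrite invr_ge0.
  - have := bump1_scale_smooth n 0; congr smooth1.
    by apply/funext => x; rewrite addr0.
  - exact: bump1_scale_support.
split.
  apply: measurable_prod => i _.
  have cb : continuous (fun x : R => bump1 (n.+1%:R * x)).
    have -> : (fun x : R => bump1 (n.+1%:R * x)) = (fun x : R => bump1 (n.+1%:R * x + 0)).
      by apply/funext => x; rewrite addr0.
    exact: smooth1_continuous (bump1_scale_smooth n 0).
  exact: (measurableT_comp (continuous_measurable_fun cb) (measurable_coor i)).
exists 1, M; split => //; split => // z /mollifier0_support h i.
by have /andP[z0 z1] := h i; rewrite ger0_norm// (le_trans z1)// invf_le1 ?ltr0n// ler1n.
Qed.

Lemma mollifier_integral_gt0 n : 0 < \int[mu]_y mollifier0 n y.
Proof.
have n0 : 0 < n.+1%:R :> R by rewrite ltr0n.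
(* [Q] is the cube [r, 3 r]^N, on which every rescaled coordinate lies in [1/4, 3/4], so that
   [bump1_bound] applies to all factors. *)
pose r : R := (4 * n.+1%:R)^-1; have r0 : 0 < r by rewrite invr_gt0 mulr_gt0.
pose c : E := const_mx (2 * r).
pose Q : set E := (fun x => x + - c) @^-1` [set x : E | forall i, `|x ord0 i| <= r].
have mQ : measurable Q.
  rewrite -[X in measurable X]setTI.
  by apply: (measurable_translate (- c)) => //; exact: measurable_cube.
have muQ : mu Q = ((r *+ 2) ^+ N)%:E.
  by rewrite lebesgue_rV_translate ?lebesgue_rV_cube ?ltW//; exact: measurable_cube.
have Qoo : (mu Q < +oo)%E by rewrite muQ ltry.
apply: (@lt_le_trans _ _ (\int[mu]_y (expR (- 8) ^+ N * \1_Q y))).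
  have -> : \int[mu]_y (expR (- 8) ^+ N * \1_Q y) = expR (- 8) ^+ N * (r *+ 2) ^+ N.
    rewrite RintZ; last by have := rintegrable_indic_cst 1 mQ Qoo; under eq_fun do rewrite mul1r.
    rewrite /Rintegral integral_indic// setIT.
    exact: (f_equal (fun z => expR (- 8) ^+ N * fine z) muQ).
  by rewrite mulr_gt0// exprn_gt0 ?expR_gt0// pmulrn_rgt0.
apply: Rint_le; first exact: rintegrable_indic_cst.
  by have [] := bump_kernel (mollifier0_bump n).
move=> z; rewrite indicE; have [zQ|_] := boolP (z \in Q); last by rewrite mulr0.
rewrite mulr1 /mollifier0 -[X in _ ^+ X](card_ord N) -prodr_const.
apply: ler_prod => i _; rewrite expR_ge0/=; apply: bump1_bound.
move: zQ; rewrite inE => /(_ i); rewrite !mxE ler_norml => /andP[h1 h2].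
have rE : n.+1%:R * r = 4^-1 by rewrite /r invfM mulrCA divff ?mulr1// gt_eqF.
apply/andP; split.
  by rewrite -rE ler_pM2l//; lra.
have -> : 3 / 4 = n.+1%:R * (3 * r) :> R by rewrite mulrCA rE.
by rewrite ler_pM2l//; lra.
Qed.

Lemma mollifier_bump n : bump (mollifier n).
Proof.
have [m [r [M [r0 M0 h0 [h1 h2 h3]]]]] := mollifier0_bump n.
have c0 := mollifier_integral_gt0 n; set c := (\int[mu]_y mollifier0 n y)^-1.
have cp : 0 <= c by rewrite invr_ge0 ltW.
split; first exact: measurable_funM.
exists r, (c * M); split => //; first by rewrite mulr_ge0.
  by move=> z; rewrite normrM ger0_norm// ler_wpM2l.
split=> [z|z y|z y].
- by rewrite mulf_eq0 negb_or => /andP[_]; exact: h1.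
- by rewrite -mulrBr normrM ger0_norm// -mulrA ler_wpM2l.
- rewrite (_ : sdiff _ y z = c * sdiff (mollifier0 n) y z); last by rewrite /sdiff /mollifier -/c; ring.
  by rewrite normrM ger0_norm// -mulrA ler_wpM2l.
Qed.

Lemma mollifier_approximate_unit : approximate_unit mollifier.
Proof.
have c0 n := mollifier_integral_gt0 n.
split=> [n|n z|n|n z].
- exact/bump_kernel/mollifier_bump.
- by rewrite mulr_ge0// invr_ge0 ltW.
- rewrite /mollifier RintZ; last by have [] := bump_kernel (mollifier0_bump n).
  by rewrite mulVf// gt_eqF.
- by rewrite mulf_eq0 negb_or => /andP[_]; exact: mollifier0_support.
Qed.

Definition coor_time (i : 'I_N) (z : E * R) : R := z.1 ord0 i.

Let coor_time_linear i : linear (coor_time i).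
Proof. by move=> a x y; rewrite /coor_time /= !mxE. Qed.

HB.instance Definition _ i :=
  GRing.isLinear.Build R (E * R)%type R *:%R (coor_time i) (coor_time_linear i).

Lemma mollifier_smooth n x : space_smooth (fun z => mollifier n (z - x)).
Proof.
split; last first.
  have [_ [r [_ [_ _ _ [sup _ _]]]]] := bump_translate (- x) (mollifier_bump n).
  by exists r.
apply: smooth_algebra_mul; first exact: smooth_algebra_cst.
apply: smooth_algebra_prod => i.
have -> : (fun z : E * R => bump1 (n.+1%:R * (z.1 - x) ord0 i)) =
    (fun z => bump1 (n.+1%:R * ((coor_time i : {linear (E * R)%type -> R}) z + 0) +
      - (n.+1%:R * x ord0 i))).
  by apply/funext => z; rewrite /coor_time /= !mxE addr0 mulrBr.
apply: (@smooth_algebra_comp _ _ (fun u => bump1 (n.+1%:R * u + - (n.+1%:R * x ord0 i)))).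
  exact: bump1_scale_smooth.
move=> z; apply: (@continuous_comp _ _ _ fst (fun y : E => y ord0 i)).
  exact: cvg_fst.
exact: coord_continuous.
Qed.

End mollifiers.

(** * Weak equations in time *)

Section primitives.
Variable R : realType.
Local Notation leb := (@lebesgue_measure R).

Lemma continuous_integrable_segment (f : R -> R) (a b : R) : continuous f ->
  leb.-integrable `[a, b] (EFin \o f).
Proof.
move=> cf; apply: continuous_compact_integrable; first exact: segment_compact.
exact: continuous_subspaceT.
Qed.

Lemma rintegrable_segment (f : R -> R) (a b : R) : continuous f ->
  rintegrable leb (f \_ `[a, b]).
Proof.
move=> cf; rewrite /rintegrable -restrict_EFin.
by rewrite -integrable_mkcond//; exact: continuous_integrable_segment.
Qed.

(** The integral starts from a negative integer depending on [x], so that the fundamental theorem on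
    bounded segments applies; subtracting the value at 0 makes the result independent of this
    choice. *)
Lemma primitive_exists (f : R -> R) : continuous f ->
  exists F : R -> R, forall x : R, is_derive x 1 F (f x).
Proof.
move=> cf; have ci a b := continuous_integrable_segment a b cf.
pose G (m : nat) x := \int[leb]_(t in `[- m%:R, x]) f t.
pose F x := G (Num.truncn `|x|).+1 x - G (Num.truncn `|x|).+1 0.
have Gadd m n (x : R) : (n <= m)%N -> - n%:R <= x ->
    G m x - G m 0 = G n x - G n 0.
  move=> nm nx; have nmR : n%:R <= m%:R :> R by rewrite ler_nat.
  have key y : - n%:R <= y -> G m y - G m (- n%:R) = G n y.
    move=> ny; rewrite /G Rintegral_itvB//.
      rewrite Rintegral_itv_obnd_cbnd//.
      by apply: integrableS (ci (- n%:R) y) => //; exact: subset_itv_oc_cc.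
    by rewrite bnd_simp lerN2.
  have h0 : - n%:R <= 0 :> R by rewrite oppr_le0.
  by rewrite -(key x nx) -(key 0 h0); ring.
(* One more than the index used at [x]: the same base point then serves all [y] within distance 1 of
   [x]. *)
exists F => x; pose m := (Num.truncn `|x|).+2.
have mx : - m%:R < x.
  have := truncnS_gt `|x|; rewrite /m -addn1 natrD => h.
  have : - `|x| <= x by rewrite lerNl -normrN ler_norm.
  lra.
have dG : is_derive x 1 (fun y => G m y - G m 0) (f x).
  have [d e] : derivable (G m) x 1 /\ derive1 (G m) x = f x.
    apply: (@continuous_FTC1_closed _ f (- m%:R) x (x + 1)) => //; first by rewrite ltrDl.
    exact: cf.
  have h : is_derive x 1 (G m) (f x) by rewrite -e derive1E; exact: derivableP.
  by have := is_deriveB h (is_derive_cst (G m 0) x 1); rewrite subr0.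
apply: (near_eq_is_derive _ dG); near=> y; rewrite /F.
apply: Gadd.
  have : `|y| < `|x| + 1.
    have : `|y - x| < 1 by rewrite distrC; near: y; exact: (nbhsx_ballx x (1 : R) ltr01).
    have := ler_normD (y - x) x; rewrite subrK; lra.
  move=> h; rewrite -(ltr_nat R) /m; have : (Num.truncn `|y|)%:R <= `|y| by rewrite truncn_le.
  have := truncnS_gt `|x|; rewrite -[_.+2%N]addn1 natrD; lra.
rewrite lerNl; have := truncnS_gt `|y|; have := ler_norm (- y); rewrite normrN; lra.
Unshelve. all: by end_near. Qed.

Lemma ftc_integral (F f : R -> R) (a b : R) : continuous f ->
  (forall x : R, is_derive x 1 F (f x)) -> a <= b ->
  \int[leb]_(t in `[a, b]) f t = F b - F a.
Proof.
move=> cf dF; rewrite le_eqVlt => /orP[/eqP ->|ab].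
  by rewrite set_itv1 Rintegral_set1 subrr.
have cF : continuous F.
  move=> x; apply: differentiable_continuous; apply/derivable1_diffP.
  by have [] := dF x.
rewrite /Rintegral (@continuous_FTC2 _ f F a b ab)//.
- exact: continuous_subspaceT.
- split; first by move=> x _; have [] := dF x.
    exact: cvg_at_right_filter (cF a).
  exact: cvg_at_left_filter (cF b).
- by move=> x _; rewrite derive1E; have [_ ->] := dF x.
Qed.

Lemma Rintegral_half_line (f : R -> R) (T : R) : (forall t, T < t -> f t = 0) ->
  \int[leb]_(t in `[0, +oo[) f t = \int[leb]_(t in `[0, T]) f t.
Proof.
move=> f0; rewrite Rintegral_mkcond [RHS]Rintegral_mkcond.
apply: eq_Rintegral => t _; rewrite /patch !mem_setE !in_itv/= andbT.
by case: (leP 0 t) => //= _; case: (leP t T) => // /f0 ->.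
Qed.

Lemma half_line_by_parts (q p theta : R -> R) (b : R) : continuous p ->
  (forall x : R, is_derive x 1 q (p x)) -> smooth1 theta ->
  (forall t, theta t != 0 -> t <= b) ->
  \int[leb]_(t in `[0, +oo[) (q t * derive1 theta t) =
  - (\int[leb]_(t in `[0, +oo[) (p t * theta t)) - q 0 * theta 0.
Proof.
move=> cp dq st sup; pose T := Num.max 0 (b + 1).
have T0 : 0 <= T by rewrite le_max lexx.
have bT : b < T by rewrite lt_max ltrDl ltr01 orbT.
have out t : b < t -> theta t = 0.
  by move=> bt; apply/eqP; apply: contraTT bt => /sup; rewrite leNgt.
have dth (x : R) : is_derive x 1 theta (derive1 theta x).
  by rewrite derive1E; apply: derivableP; exact: smooth1_derivable.
have outd t : b < t -> derive1 theta t = 0.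
  move=> bt; rewrite derive1E.
  suff h : \near t, cst 0 t = theta t by rewrite -(near_eq_derive _ h) derive_cst.
  by near=> y; apply/esym/out; near: y; exact: lt_nbhsr.
have cq : continuous q.
  by move=> x; apply: differentiable_continuous; apply/derivable1_diffP; have [] := dq x.
have cth := smooth1_continuous st; have cth' := smooth1_continuous (smooth1_derive st).
rewrite (@Rintegral_half_line _ T); last by move=> t Tt; rewrite outd ?mulr0//; exact: lt_trans Tt.
rewrite (@Rintegral_half_line _ T); last by move=> t Tt; rewrite out ?mulr0//; exact: lt_trans Tt.
have c1 : continuous (fun t => q t * derive1 theta t).
  by move=> x; apply: cvgM; [exact: cq|exact: cth'].
have c2 : continuous (fun t => p t * theta t).
  by move=> x; apply: cvgM; [exact: cp|exact: cth].
have dF (x : R) : is_derive x 1 (fun t => q t * theta t) (q x * derive1 theta x + p x * theta x).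
  have := is_deriveM (dq x) (dth x).
  by rewrite /GRing.scale /= [theta x * _]mulrC.
have cF : continuous (fun t => q t * derive1 theta t + p t * theta t).
  by move=> x; apply: cvgD; [exact: c1|exact: c2].
have := ftc_integral cF dF T0; rewrite (out T bT) mulr0 sub0r.
rewrite RintegralD//; try exact: continuous_integrable_segment.
by move=> h; rewrite -[LHS](addrK (\int[leb]_(t in `[0, T]) (p t * theta t))) h addrC.
Unshelve. all: by end_near. Qed.

(** By continuity Q is nearly constant on the support of the bump, just after [s]. The mass [I] is
    kept as a factor, since all that is known about it is its sign. *)
Lemma bump1_average (Q : R -> R) (s : R) : continuous Q -> 0 < s -> forall e : R, 0 < e ->
  \forall n \near \oo, exists2 I : R, 0 < I &
    I = \int[leb]_(t in `[0, +oo[) bump1 (n.+1%:R * (t - s)) /\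
    `|\int[leb]_(t in `[0, +oo[) (Q t * bump1 (n.+1%:R * (t - s))) - Q s * I| <= e * I.
Proof.
move=> cQ s0 e e0.
have /cvgrPdist_le /(_ _ e0) [d /= d0 hd] := cQ s.
have := near_infty_natSinv_lt (PosNum d0); apply: filterS => n /= nd.
have n0 : 0 < n.+1%:R :> R by rewrite ltr0n.
pose b (t : R) := bump1 (n.+1%:R * (t - s)).
have sb t : b t != 0 -> s < t < s + n.+1%:R^-1.
  move=> /bump1_support/andP[h1 h2]; apply/andP; split.
    by move: h1; rewrite pmulr_rgt0// subr_gt0.
  by rewrite -ltrBlDl -[ltRHS]mul1r ltr_pdivlMr// mulrC.
pose T := s + n.+1%:R^-1.
have outT t : T < t -> b t = 0.
  by move=> h; apply/eqP; apply: contraTT h => /sb/andP[_ h]; rewrite -leNgt ltW.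
have cb : continuous b.
  have -> : b = (fun t => bump1 (n.+1%:R * t + - (n.+1%:R * s))).
    by apply/funext => t; rewrite /b mulrBr.
  by apply: smooth1_continuous; apply: flat_algebra_smooth; exact: bump1_affine.
have c1 : continuous (fun t => Q t * b t) by move=> x; apply: cvgM; [exact: cQ|exact: cb].
rewrite !(@Rintegral_half_line _ T); last 2 first.
- by move=> t /outT; rewrite /b => ->; rewrite mulr0.
- exact: outT.
have b0 t : 0 <= b t by exact: bump1_ge0.
(* [r] is a quarter of the length of the support: between s + r and s + 3 r the bump is at least
   e^(-8). *)
have [r r0 [rE E]] : exists2 r : R, 0 < r & n.+1%:R^-1 = 4 * r /\ n.+1%:R * r = 4^-1.
  exists (4 * n.+1%:R)^-1; first by rewrite invr_gt0 mulr_gt0.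
  split; first by rewrite invfM mulrA divff ?mul1r.
  by rewrite invfM mulrCA divff ?mulr1 ?gt_eqF.
pose u := s + r; pose v := s + 3 * r.
exists (\int[leb]_(t in `[0, T]) b t); last split => //.
  have u0 : u <= v by rewrite /u /v; lra.
  apply: (@lt_le_trans _ _ (\int[leb]_(t in `[u, v]) (expR (- 8) : R))).
    rewrite Rintegral_cst//= lebesgue_measure_itv/= lte_fin; case: ifPn => h.
      by rewrite -EFinB/= mulr_gt0 ?expR_gt0// subr_gt0.
    by move: h; rewrite -leNgt /u /v; lra.
  rewrite Rintegral_mkcond [leRHS]Rintegral_mkcond.
  apply: le_Rintegral => //.
  - by apply: rintegrable_segment; exact: cst_continuous.
  - exact: rintegrable_segment.
  move=> t _; rewrite /patch !mem_setE !in_itv/=; case: ifPn => [/andP[h1 h2]|_].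
    rewrite ifT; last by apply/andP; split; [|move: h2; rewrite /T rE /v]; move: h1; rewrite /u; lra.
    apply: bump1_bound.
    apply/andP; split; first by rewrite -E ler_pM2l// lerBrDl.
    rewrite (_ : 3 / 4 = n.+1%:R * (3 * r)); last by rewrite mulrCA E.
    by rewrite ler_pM2l// lerBlDl.
  by case: ifP.
have iQ := continuous_integrable_segment 0 T c1; have ib := continuous_integrable_segment 0 T cb.
have icb c : leb.-integrable `[0, T] (EFin \o (fun t => c * b t)).
  by apply: continuous_integrable_segment => x; apply: cvgM; [exact: cvg_cst|exact: cb].
have idb : leb.-integrable `[0, T] (EFin \o (fun t => Q t * b t - Q s * b t)).
  exact: (integrableB _ iQ (icb _)).
have -> : \int[leb]_(t in `[0, T]) (Q t * bump1 (n.+1%:R * (t - s))) -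
    Q s * \int[leb]_(t in `[0, T]) b t = \int[leb]_(t in `[0, T]) (Q t * b t - Q s * b t).
  rewrite (@RintegralB _ _ _ leb `[0, T] (fun t => Q t * b t) (fun t => Q s * b t))//.
  by rewrite RintegralZl.
apply: le_trans (le_normr_Rintegral _ _) _ => //.
rewrite -RintegralZl//; apply: le_Rintegral => //.
  exact: integrable_norm idb.
move=> t _; rewrite -mulrBl normrM (ger0_norm (b0 t)).
have [->|/sb/andP[h1 h2]] := eqVneq (b t) 0; first by rewrite !mulr0.
rewrite ler_wpM2r// distrC; apply: hd => /=; rewrite ltr_distlC.
apply/andP; split; first by rewrite (lt_trans _ h1)// ltrBlDr ltrDl.
by rewrite (lt_trans h2)// ltrD2l.
Qed.

End primitives.

(** * Weak equations of first and second order *)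

Section weak_equations.
Variable R : realType.
Local Notation leb := (@lebesgue_measure R).

Definition test1 (theta : R -> R) := smooth1 theta /\
  exists a b : R, forall t, theta t != 0 -> a <= t <= b.

Definition positive_test1 (theta : R -> R) := smooth1 theta /\
  exists a b : R, 0 < a /\ forall t, theta t != 0 -> a <= t <= b.

Lemma positive_test1W theta : positive_test1 theta -> test1 theta.
Proof. by move=> [h [a [b [_ ab]]]]; split => //; exists a, b. Qed.

Let shift_smooth (m s : R) : smooth1 (fun t => bump1 (m * (t - s))).
Proof.
have -> : (fun t => bump1 (m * (t - s))) = (fun t => bump1 (m * t + - (m * s))).
  by apply/funext => t; rewrite mulrBr.
by apply: flat_algebra_smooth; exact: bump1_affine.
Qed.

Let bump1_smooth : smooth1 (@bump1 R).
Proof.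
have -> : @bump1 R = (fun t => bump1 (1 * (t - 0))).
  by apply/funext => t; rewrite mul1r subr0.
exact: shift_smooth.
Qed.

(** The two bumps have the same mass, hence the primitive of their difference vanishes after both
    and is an admissible test function. *)
Let difference_primitive (n : nat) (s t : R) : 0 < s -> 0 < t ->
  exists2 theta, positive_test1 theta & derive1 theta =
    (fun r => bump1 (n.+1%:R * (r - s)) - bump1 (n.+1%:R * (r - t))).
Proof.
move=> s0 t0; pose m : R := n.+1%:R; have m0 : 0 < m by rewrite ltr0n.
have [B dB] := primitive_exists (smooth1_continuous bump1_smooth).
have out0 (x : R) : x <= 0 -> bump1 x = 0.
  by move=> x0; apply/eqP; apply: contraTT x0 => /bump1_support/andP[h _]; rewrite -ltNge.
have out1 (x : R) : 1 <= x -> bump1 x = 0.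
  by move=> x1; apply/eqP; apply: contraTT x1 => /bump1_support/andP[_ h]; rewrite -ltNge.
have cB : continuous B.
  by move=> x; apply: differentiable_continuous; apply/derivable1_diffP; have [] := dB x.
have flatB x y : x <= y -> (forall z, x < z < y -> bump1 z = 0) -> B y = B x.
  move=> xy h; have [//|c ic E] := @MVT_segment R B (@bump1 R) x y xy (fun z _ => dB z).
    exact: continuous_subspaceT.
  have [xyE|xny] := eqVneq x y; first by rewrite xyE.
  have xlty : x < y by rewrite lt_neqAle xny.
  have [//|c' ic' E'] := @MVT R B (@bump1 R) x y xlty (fun z _ => dB z).
    exact: continuous_subspaceT.
  by apply/eqP; rewrite -subr_eq0 E' h ?mul0r//; move: ic'; rewrite in_itv.
have B0 x : x <= 0 -> B x = B 0.
  by move=> x0; apply/esym/flatB => // z /andP[_ z0]; exact/out0/ltW.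
have B1 x : 1 <= x -> B x = B 1.
  by move=> x1; apply/flatB => // z /andP[z1 _]; exact/out1/ltW.
pose theta r := m^-1 * (B (m * (r - s)) - B (m * (r - t))).
have dsh (u r : R) : is_derive r 1 (fun r => B (m * (r - u))) (m * bump1 (m * (r - u))).
  have h1 : is_derive r 1 (fun r : R => m * (r - u)) m.
    have h2 : is_derive r 1 (fun r : R => r - u) 1.
      by have := is_deriveB (is_derive_id r 1) (is_derive_cst u r 1); rewrite subr0.
    by have := is_deriveZ m h2; rewrite /GRing.scale/= mulr1.
  have := @is_derive1_comp R B (fun r : R => m * (r - u)) r _ _ (dB _) h1.
  by rewrite mulrC.
have dth (r : R) : is_derive r 1 theta (bump1 (m * (r - s)) - bump1 (m * (r - t))).
  have := is_deriveZ m^-1 (is_deriveB (dsh s r) (dsh t r)).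
  by rewrite /GRing.scale/= -mulrBr mulKf ?gt_eqF.
have sth : smooth1 theta.
  apply: smooth1_primitive dth.
  have -> : (fun r => bump1 (m * (r - s)) - bump1 (m * (r - t))) =
    (fun r => bump1 (m * r + - (m * s)) + (-1) * bump1 (m * r + - (m * t))).
    by apply/funext => r; rewrite !mulrBr mulN1r.
  apply: flat_algebra_smooth; apply: flat_algebra_add; first exact: bump1_affine.
  by apply: flat_algebra_mul; [exact: flat_algebra_cst|exact: bump1_affine].
exists theta; last by apply/funext => r; rewrite derive1E; have [_ ->] := dth r.
split => //; exists (Num.min s t), (Num.max s t + m^-1); split.
  by rewrite lt_min s0.
move=> r hr; apply/andP; split; rewrite leNgt; apply: contra hr.
  rewrite lt_min => /andP[rs rt]; rewrite /theta !B0 ?subrr ?mulr0//;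
  by rewrite pmulr_rle0// subr_le0 ltW.
move=> h; have [h1 h2] : s + m^-1 < r /\ t + m^-1 < r.
  by split; rewrite (le_lt_trans _ h)// lerD2r le_max lexx ?orbT.
rewrite /theta !B1 ?subrr ?mulr0//; rewrite -ler_pdivrMl// mulr1 lerBrDl; exact: ltW.
Qed.

(** Tested with the primitive of a difference of bumps, the hypothesis equates the weighted averages
    of [Q] just after [s] and just after [t]. Time 0 is reached by continuity. *)
Lemma du_bois_reymond (Q : R -> R) : continuous Q ->
  (forall theta, positive_test1 theta ->
     \int[leb]_(t in `[0, +oo[) (Q t * derive1 theta t) = 0) ->
  forall s t, 0 <= s -> 0 <= t -> Q s = Q t.
Proof.
move=> cQ h.
have pos s t : 0 < s -> 0 < t -> Q s = Q t.
  move=> s0 t0; apply/eqP; rewrite -subr_eq0 -normr_le0; apply/ler_addgt0Pr => e e0.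
  rewrite add0r; have e2 : 0 < e / 2 by rewrite divr_gt0.
  have [n _ /(_ n (leqnn n)) [hs ht]] := filterI (bump1_average cQ s0 e2) (bump1_average cQ t0 e2).
  case: hs => Is Is0 [IsE As]; case: ht => It It0 [ItE At].
  have [theta pth dth] := difference_primitive n s0 t0.
  have [sth [a [b [a0 sup]]]] := pth.
  pose T := Num.max b (Num.max s t + 1).
  have cb u : continuous (fun r : R => bump1 (n.+1%:R * (r - u))).
    exact: smooth1_continuous (shift_smooth _ _).
  have out (u r : R) : u + 1 < r -> bump1 (n.+1%:R * (r - u)) = 0.
    move=> ur; apply/eqP; apply: contraTT ur => /bump1_support/andP[_ h1].
    rewrite -leNgt -lerBlDl; have r1 : 1 <= n.+1%:R :> R by rewrite ler1n.
    have [ru|ru] := leP (r - u) 0; first by rewrite (le_trans ru).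
    by rewrite ltW// (le_lt_trans _ h1)// ler_peMl// ltW.
  have sT : s + 1 <= T by rewrite /T !le_max lerD2r le_max lexx !orbT.
  have tT : t + 1 <= T by rewrite /T !le_max lerD2r le_max lexx !orbT.
  have split' (P : R -> R) : continuous P ->
      \int[leb]_(r in `[0, +oo[) (P r * derive1 theta r) =
      \int[leb]_(r in `[0, +oo[) (P r * bump1 (n.+1%:R * (r - s))) -
      \int[leb]_(r in `[0, +oo[) (P r * bump1 (n.+1%:R * (r - t))).
    move=> cP; rewrite !(@Rintegral_half_line _ _ T).
    - rewrite -RintegralB//.
      + by apply: eq_Rintegral => r _; rewrite dth mulrBr.
      + by apply: continuous_integrable_segment => x; apply: cvgM; [exact: cP|exact: cb].
      + by apply: continuous_integrable_segment => x; apply: cvgM; [exact: cP|exact: cb].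
    - by move=> r Tr; rewrite out ?mulr0//; exact: le_lt_trans Tr.
    - by move=> r Tr; rewrite out ?mulr0//; exact: le_lt_trans Tr.
    - by move=> r Tr; rewrite dth !out ?subrr ?mulr0//; exact: le_lt_trans Tr.
  (* The masses agree, by integration by parts against the constant 1. *)
  have IE : Is = It.
    have := @half_line_by_parts R (cst 1) (cst 0) theta b.
    have -> : theta 0 = 0.
      apply/eqP; apply: contraTT isT => /sup /andP[a0' _]; move: a0; rewrite ltNge a0'//.
    move=> /(_ (@cst_continuous _ _ 0) (fun x => is_derive_cst _ _ _) sth).
    rewrite (split' (cst 1)); last exact: cst_continuous.
    under eq_Rintegral do rewrite mul1r.
    under [X in _ - X]eq_Rintegral do rewrite mul1r.
    rewrite -IsE -ItE => /(_ (fun r hr => proj2 (andP (sup r hr)))).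
    under eq_Rintegral do rewrite mul0r.
    by rewrite /Rintegral integral0/= oppr0 mulr0 subr0 => /eqP; rewrite subr_eq0 => /eqP.
  have := h theta pth; rewrite (split' Q cQ) => /eqP; rewrite subr_eq0 => /eqP QE.
  rewrite QE in As; rewrite -IE in At.
  set X := \int[leb]_(_ in _) _ in As At.
  have : `|(Q s - Q t) * Is| <= e * Is.
    rewrite (_ : (Q s - Q t) * Is = (X - Q t * Is) - (X - Q s * Is)); last ring.
    by apply: le_trans (ler_normB _ _) _; rewrite (le_trans (lerD At As))// -mulrDl -splitr.
  by rewrite normrM (gtr0_norm Is0) ler_pM2r.
have zero s : 0 < s -> Q 0 = Q s.
  move=> s0; apply/eqP; rewrite -subr_eq0 -normr_le0; apply/ler_addgt0Pr => e e0.
  rewrite add0r; have /cvgrPdist_le /(_ _ e0) [d /= d0 hd] := cQ 0.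
  rewrite -(pos (d / 2) s) ?divr_gt0//; apply: hd => /=.
  by rewrite sub0r normrN gtr0_norm ?divr_gt0//; lra.
move=> s t; rewrite !le_eqVlt => /predU1P[<-|s0] /predU1P[<-//|t0].
- exact: zero.
- exact/esym/zero.
- exact: pos.
Qed.

(** After integration by parts q - P has weak derivative 0 on positive times. *)
Lemma weak_first_order (q p : R -> R) : continuous q -> continuous p ->
  (forall theta, positive_test1 theta ->
     \int[leb]_(t in `[0, +oo[) (q t * derive1 theta t) =
     - \int[leb]_(t in `[0, +oo[) (p t * theta t)) ->
  forall P : R -> R, (forall x : R, is_derive x 1 P (p x)) ->
  forall t, 0 <= t -> q t = q 0 + (P t - P 0).
Proof.
move=> cq cp h P dP t t0.
have cP : continuous P.
  by move=> x; apply: differentiable_continuous; apply/derivable1_diffP; have [] := dP x.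
suff : q t - P t = q 0 - P 0 by move=> /eqP; rewrite subr_eq => /eqP ->; ring.
apply: (@du_bois_reymond (fun t => q t - P t)) => //.
  by move=> x; apply: cvgB; [exact: cq|exact: cP].
move=> theta pth; have [sth [a [b [a0 sup]]]] := pth.
have sth' := smooth1_derive sth.
have out r : b < r -> derive1 theta r = 0.
  move=> br; apply/eqP; apply: contraTT br.
  by move=> /(smooth1_derive_support sth sup) /andP[_]; rewrite leNgt.
transitivity (\int[leb]_(t in `[0, +oo[) (q t * derive1 theta t) -
    \int[leb]_(t in `[0, +oo[) (P t * derive1 theta t)).
  rewrite !(@Rintegral_half_line _ _ b); try by move=> r /out ->; rewrite mulr0.
  rewrite -RintegralB//; first by apply: eq_Rintegral => r _; rewrite mulrBl.
    by apply: continuous_integrable_segment => x; apply: cvgM;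
      [exact: cq|exact: (smooth1_continuous sth')].
  by apply: continuous_integrable_segment => x; apply: cvgM;
      [exact: cP|exact: (smooth1_continuous sth')].
rewrite h// (@half_line_by_parts R P p theta b cp dP sth).
  have -> : theta 0 = 0.
    by apply/eqP; apply: contraTT isT => /sup /andP[a0' _]; move: a0; rewrite ltNge a0'.
  by rewrite mulr0 subr0 subrr.
by move=> r /sup/andP[].
Qed.

(** With K a primitive of [k] that vanishes at 0, integrations by parts leave K - p tested with
    theta', plus terms at 0. Test functions supported in positive times show that K - p is constant;
    those that reach time 0 then identify the initial values. *)
Lemma weak_second_order (q p k : R -> R) (l m : R) :
  continuous p -> continuous k ->
  (forall x : R, is_derive x 1 q (p x)) ->
  (forall theta, test1 theta ->
     \int[leb]_(t in `[0, +oo[) (q t * derive1 (derive1 theta) t - k t * theta t)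
     - m * theta 0 + l * derive1 theta 0 = 0) ->
  q 0 = l /\ forall P : R -> R, (forall x : R, is_derive x 1 P (k x)) ->
    forall t, 0 <= t -> p t = m + (P t - P 0).
Proof.
move=> cp ck dq h.
have [K0 dK0] := primitive_exists ck.
pose K t := K0 t - K0 0.
have dK (x : R) : is_derive x 1 K (k x).
  by have := is_deriveB (dK0 x) (is_derive_cst (K0 0) x 1); rewrite subr0.
have cont F f : (forall x : R, is_derive x 1 F (f x)) -> continuous (F : R -> R).
  by move=> dF x; apply: differentiable_continuous; apply/derivable1_diffP; have [] := dF x.
have cq := cont _ _ dq; have cK := cont _ _ dK.
have key theta : test1 theta ->
    \int[leb]_(t in `[0, +oo[) ((K t - p t) * derive1 theta t) =
    m * theta 0 - (l - q 0) * derive1 theta 0.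
  move=> tth; have [sth [a [b sup]]] := tth.
  have s1 := smooth1_derive sth; have s2 := smooth1_derive s1.
  have sup1 := smooth1_derive_support sth sup.
  have sup2 := smooth1_derive_support s1 sup1.
  have out r : b < r -> theta r = 0.
    by move=> br; apply/eqP; apply: contraTT br => /sup /andP[_]; rewrite leNgt.
  have out1 r : b < r -> derive1 theta r = 0.
    by move=> br; apply/eqP; apply: contraTT br => /sup1 /andP[_]; rewrite leNgt.
  have out2 r : b < r -> derive1 (derive1 theta) r = 0.
    by move=> br; apply/eqP; apply: contraTT br => /sup2 /andP[_]; rewrite leNgt.
  have ci (f g : R -> R) : continuous f -> continuous g ->
      leb.-integrable `[0, b] (EFin \o (fun t => f t * g t : R)).
    by move=> cf cg; apply: continuous_integrable_segment => x; apply: cvgM; [exact: cf|exact: cg].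
  have c0 := smooth1_continuous sth; have c1 := smooth1_continuous s1.
  have c2 := smooth1_continuous s2.
  have e1 := @half_line_by_parts R q p (derive1 theta) b cp dq s1.
  have e2 := @half_line_by_parts R K k theta b ck dK sth.
  have := h theta tth.
  have -> : \int[leb]_(t in `[0, +oo[) (q t * derive1 (derive1 theta) t - k t * theta t) =
      \int[leb]_(t in `[0, +oo[) (q t * derive1 (derive1 theta) t) -
      \int[leb]_(t in `[0, +oo[) (k t * theta t).
    rewrite !(@Rintegral_half_line _ _ b); try by move=> r br; rewrite ?out2 ?out ?mulr0 ?subr0.
    by rewrite RintegralB//; exact: ci.
  have -> : \int[leb]_(t in `[0, +oo[) ((K t - p t) * derive1 theta t) =
      \int[leb]_(t in `[0, +oo[) (K t * derive1 theta t) -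
      \int[leb]_(t in `[0, +oo[) (p t * derive1 theta t).
    rewrite !(@Rintegral_half_line _ _ b); try by move=> r br; rewrite ?out1 ?mulr0.
    rewrite -RintegralB//; try exact: ci.
    by apply: eq_Rintegral => r _; rewrite mulrBl.
  rewrite e1 ?e2; last first.
  - by move=> r /sup1/andP[].
  - by move=> r /sup/andP[].
  have -> : K 0 = 0 by rewrite /K subrr.
  move: (\int[leb]_(t in `[0, +oo[) (p t * derive1 theta t)) (\int[leb]_(t in `[0, +oo[) (k t * theta t)).
  move: (q 0) (theta 0) (derive1 theta 0) => q0 th0 th1 A B e.
  apply/eqP; rewrite -subr_eq0; apply/eqP; rewrite -[RHS]e; ring.
have const t : 0 <= t -> p t = p 0 + K t.
  move=> t0; have K00 : K 0 = 0 by rewrite /K subrr.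
  suff : K t - p t = K 0 - p 0 by rewrite K00; lra.
  apply: (@du_bois_reymond (fun t => K t - p t)) => //.
    by move=> x; apply: cvgB; [exact: cK|exact: cp].
  move=> theta pth; rewrite (key _ (positive_test1W pth)).
  have [sth [a [b [a0 sup]]]] := pth.
  have z0 (f : R -> R) : (forall t, f t != 0 -> a <= t <= b) -> f 0 = 0.
    move=> supf; apply/eqP; apply: contraTT isT => /supf /andP[a0' _].
    by move: a0; rewrite ltNge a0'.
  by rewrite (z0 theta)// (z0 (derive1 theta)) ?mulr0 ?subrr//; exact: smooth1_derive_support.
have key2 theta : test1 theta -> (p 0 - m) * theta 0 + (l - q 0) * derive1 theta 0 = 0.
  move=> tth; have [sth [a [b sup]]] := tth; have := key _ tth.
  have -> : \int[leb]_(t in `[0, +oo[) ((K t - p t) * derive1 theta t) =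
      \int[leb]_(t in `[0, +oo[) ((cst (- p 0) : R -> R) t * derive1 theta t).
    apply: eq_Rintegral => t; rewrite inE/= in_itv/= andbT => t0.
    by rewrite (const t t0); congr (_ * _); ring.
  rewrite (@half_line_by_parts R (cst (- p 0)) (cst 0) theta b).
  - under eq_Rintegral do rewrite mul0r.
    by rewrite /Rintegral integral0/= oppr0 sub0r => e; move: e; rewrite /cst; lra.
  - exact: cst_continuous.
  - exact: sth.
  - by move=> t /sup/andP[].
(* [b1] is positive at 0, while [b2] vanishes there with derivative [b1 0]. Hence [b2] isolates the
   initial value of [q], after which [b1] isolates that of [p]. *)
pose b1 (t : R) : R := bump1 (1 * t + 2^-1).
have sb1 : flat_algebra b1 by exact: bump1_affine.
have b1sup t : b1 t != 0 -> - 1 <= t <= 1.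
  by move=> /bump1_support; rewrite mul1r => /andP[h1 h2]; apply/andP; split; lra.
pose b2 (t : R) := t * b1 t.
have sb2 : flat_algebra b2 by apply: flat_algebra_mul => //; exact: flat_algebra_id.
have b10 : 0 < b1 0.
  apply: lt_le_trans (bump1_bound _); first exact: expR_gt0.
  by rewrite mul1r add0r; apply/andP; split; lra.
have t1 : test1 b1 by split; [exact: flat_algebra_smooth|exists (- 1), 1].
have t2 : test1 b2.
  split; first exact: flat_algebra_smooth.
  by exists (- 1), 1 => t; rewrite mulf_eq0 negb_or => /andP[_]; exact: b1sup.
have d2 : derive1 b2 0 = b1 0.
  have h1 : is_derive (0 : R) 1 b1 (derive1 b1 0).
    by rewrite derive1E; apply: derivableP; apply: smooth1_derivable; exact: flat_algebra_smooth.
  have := is_deriveM (is_derive_id (0 : R) 1) h1.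
  rewrite /GRing.scale /= mul0r add0r mulr1 => -[_ e].
  by rewrite derive1E -e.
have lq : q 0 = l.
  have := key2 _ t2; rewrite {1}/b2 mul0r mulr0 add0r d2 => /eqP.
  by rewrite mulf_eq0 (gt_eqF b10) orbF subr_eq0 => /eqP.
have pm : p 0 = m.
  have := key2 _ t1; rewrite lq subrr mul0r addr0 => /eqP.
  by rewrite mulf_eq0 (gt_eqF b10) orbF subr_eq0 => /eqP.
split => // P dP t t0; rewrite const// pm; congr (_ + _).
have := ftc_integral ck dP t0; have := ftc_integral ck dK t0.
by rewrite {2}/K subrr subr0 => -> ->.
Qed.

End weak_equations.

Lemma rintegrable_Rint1 d1 d2 (T1 : measurableType d1) (T2 : measurableType d2)
    (R : realType) (m1 : {sigma_finite_measure set T1 -> \bar R})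
    (m2 : {sigma_finite_measure set T2 -> \bar R}) (F : T1 * T2 -> R) :
  rintegrable (m1 \x m2)%E F -> rintegrable m2 (fun y => \int[m1]_x F (x, y)).
Proof.
move=> iF; have mF := rintegrable_measurable iF.
have h : (\int[m2]_y \int[m1]_x `|F (x, y)|%:E < +oo)%E.
  have mF' : measurable_fun setT (EFin \o F) by exact/measurable_EFinP.
  exact: (iffLR (@integrable21ltyP _ _ _ _ _ m1 m2 _ mF') iF).
apply: rintegrableP; first exact: measurable_Rintegral1.
apply: le_lt_trans h; apply: ge0_le_integral_ae => [//|y|].
  by apply: integral_ge0 => x _; rewrite lee_fin.
apply: filterS (ae_rintegrable1 iF) => y iFy.
by rewrite -EFin_Rint ?lee_fin ?Rint_norm//; exact: rintegrable_norm.
Qed.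

(** * Exchange of integrals in space and over a time segment *)

Section segment_integrals.
Context d (T : measurableType d) (R : realType).
Variable nu : {sigma_finite_measure set T -> \bar R}.
Local Notation leb := (@lebesgue_measure R).

(** With time rounded to a grid the function is glued from countably many sections, each measurable
    in x; continuity in time gives the limit. *)
Lemma caratheodory_measurable (F : T -> R -> R) :
  (forall t, measurable_fun setT (F^~ t)) -> (forall x, continuous (F x)) ->
  measurable_fun setT (fun z : T * measurableTypeR R => F z.1 z.2).
Proof.
move=> mF cF.
apply: (@measurable_fun_cvg _ _ _ setT (fun n z => F z.1 (grid n z.2))) => //; last first.
  move=> z _; apply: continuous_cvg; [exact: cF|exact: cvg_grid].
move=> n _ A mA; rewrite setTI.
have -> : (fun z : T * measurableTypeR R => F z.1 (grid n z.2)) @^-1` A =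
    \bigcup_(y in range (@grid R n))
      ((F^~ y) @^-1` A `*` ((@grid R n) @^-1` [set y])).
  apply/seteqP; split => [z /= Az|z [y _ [/= Ay /= ->//]]].
  by exists (grid n z.2); [exists z.2|].
rewrite bigcup_set_type; apply: countable_bigcupT_measurable => [|y].
  rewrite (eq_countable (card_setT _)).
  have sub : range (@grid R n) `<=` range (fun z : int => z%:~R / n.+1%:R : R).
    by move=> _ [x _ <-]; exists (Num.floor (x * n.+1%:R)).
  apply: (sub_countable (card_le_trans (subset_card_le sub) (card_image_le _ _))).
  exact: countableP.
apply: measurableX.
  by rewrite -[X in measurable X]setTI; exact: mF.
by rewrite -[X in measurable X]setTI; apply: (measurable_grid n) => //; exact: measurable_set1.
Qed.

Variables (F : T -> R -> R) (a b C : R).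
Hypothesis mF : forall t, measurable_fun setT (F^~ t).
Hypothesis cF : forall x, continuous (F x).
Hypothesis F_le : forall t, a <= t <= b -> (\int[nu]_x `|F x t|%:E <= C%:E)%E.

Let G (z : T * measurableTypeR R) : R := (F z.1 \_ `[a, b]) z.2.

Let GE z : G z = F z.1 z.2 * \1_(`[a, b]%classic) z.2.
Proof. by rewrite /G patch_indic. Qed.

Let iG : rintegrable (nu \x leb)%E G.
Proof.
apply: rintegrable_prodP2.
  rewrite (_ : G = (fun z => F z.1 z.2 * \1_(`[a, b]%classic) z.2)); last exact/funext/GE.
  apply: measurable_funM; first exact: caratheodory_measurable.
  by apply: measurableT_comp measurable_snd; exact: measurable_indic.
apply: (@le_lt_trans _ _ (\int[leb]_t (`|C| * \1_(`[a, b]%classic) t)%:E)%E); last first.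
  have /rintegrable_lty : rintegrable leb (fun t => `|C| * \1_(`[a, b]%classic) t).
    apply: rintegrable_indic_cst => //; rewrite /= lebesgue_measure_itv/=.
    by case: ifP => _; rewrite ?ltry// -EFinB ltry.
  apply: le_lt_trans; apply: ge0_le_integralW => // t.
  by rewrite lee_fin ler_norm.
apply: ge0_le_integralW => [t|t]; first exact: integral_ge0.
have [tab|tab] := boolP (t \in `[a, b]%classic); last first.
  under eq_integral do rewrite GE/= indicE (negbTE tab) mulr0 normr0.
  by rewrite integral0 lee_fin mulr_ge0.
under eq_integral do rewrite GE/= indicE tab mulr1.
rewrite indicE tab mulr1; apply: le_trans (F_le _) _; last by rewrite lee_fin ler_norm.
by move: tab; rewrite inE/= in_itv.
Qed.

Let inner : (fun t => \int[nu]_x G (x, t)) = (fun t => \int[nu]_x F x t) \_ `[a, b].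
Proof.
apply/funext => t; rewrite /patch; case: ifPn => tab.
  by apply: eq_Rintegral => x _; rewrite GE/= indicE tab mulr1.
rewrite (_ : (fun x => G (x, t)) = fun=> 0); first by rewrite /Rintegral integral0.
by apply/funext => x; rewrite GE/= indicE (negbTE tab) mulr0.
Qed.

Lemma segment_fubini : \int[nu]_x \int[leb]_(t in `[a, b]) F x t =
  \int[leb]_(t in `[a, b]) \int[nu]_x F x t.
Proof.
have := Rint_fubini iG; rewrite inner -Rintegral_mkcond => <-.
by apply: eq_Rintegral => x _; rewrite Rintegral_mkcond.
Qed.

Lemma segment_integrable_inner :
  leb.-integrable `[a, b] (EFin \o (fun t => \int[nu]_x F x t)).
Proof.
have := rintegrable_Rint1 iG; rewrite inner /rintegrable -restrict_EFin.
by rewrite -integrable_mkcond.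
Qed.

End segment_integrals.

(** * Functions of class C^1 on the half-line *)

Section continuously_differentiable.
Variable R : realType.
Local Notation leb := (@lebesgue_measure R).
Implicit Types q p b : R -> R.

(* q is of class C^1 on [0, +oo), with derivative p. *)
Definition c1_on q p := exists Q b, [/\ continuous b,
  forall x : R, is_derive x 1 Q (b x) &
  forall t, 0 <= t -> q t = Q t /\ p t = b t].

Lemma c1_on_continuous q p : c1_on q p -> exists Q b, [/\ continuous b, continuous Q,
  forall x : R, is_derive x 1 Q (b x) & forall t, 0 <= t -> q t = Q t /\ p t = b t].
Proof.
move=> [Q [b [cb dQ e]]]; exists Q, b; split => //.
by move=> x; apply: differentiable_continuous; apply/derivable1_diffP; have [] := dQ x.
Qed.

Lemma c1_on_primitive (c : R) q p : continuous p ->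
  (forall P : R -> R, (forall x : R, is_derive x 1 P (p x)) ->
    forall t, 0 <= t -> q t = c + (P t - P 0)) -> c1_on q p.
Proof.
move=> cp h; have [P dP] := primitive_exists cp.
exists (fun t => c + (P t - P 0)), p; split => // [x|t t0]; last by rewrite -h.
have := is_deriveD (is_derive_cst c x 1) (is_deriveB (dP x) (is_derive_cst (P 0) x 1)).
by rewrite add0r subr0.
Qed.

Lemma c1_onD q1 p1 q2 p2 : c1_on q1 p1 -> c1_on q2 p2 ->
  c1_on (fun t => q1 t + q2 t) (fun t => p1 t + p2 t).
Proof.
move=> [Q1 [b1 [c1 d1 e1]]] [Q2 [b2 [c2 d2 e2]]].
exists (fun t => Q1 t + Q2 t), (fun t => b1 t + b2 t); split.
- by move=> x; apply: cvgD; [exact: c1|exact: c2].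
- by move=> x; exact: is_deriveD.
- by move=> t t0; have [-> ->] := e1 _ t0; have [-> ->] := e2 _ t0.
Qed.

Lemma c1_onM q1 p1 q2 p2 : c1_on q1 p1 -> c1_on q2 p2 ->
  c1_on (fun t => q1 t * q2 t) (fun t => q1 t * p2 t + q2 t * p1 t).
Proof.
move=> /c1_on_continuous[Q1 [b1 [c1 C1 d1 e1]]] /c1_on_continuous[Q2 [b2 [c2 C2 d2 e2]]].
exists (fun t => Q1 t * Q2 t), (fun t => Q1 t * b2 t + Q2 t * b1 t); split.
- move=> x; apply: cvgD; apply: cvgM; by [exact: c1|exact: c2|exact: C1|exact: C2].
- by move=> x; exact: is_deriveM.
- by move=> t t0; have [-> ->] := e1 _ t0; have [-> ->] := e2 _ t0.
Qed.

Lemma c1_on_cst c : c1_on (fun=> c) (fun=> 0).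
Proof.
by exists (fun=> c), (fun=> 0); split => // x; [exact: cst_continuous|exact: is_derive_cst].
Qed.

Lemma c1_onZ c q p : c1_on q p -> c1_on (fun t => c * q t) (fun t => c * p t).
Proof.
move=> h; have := c1_onM (c1_on_cst c) h.
by under [X in c1_on _ X]eq_fun do rewrite mulr0 addr0.
Qed.

Lemma c1_onB q1 p1 q2 p2 : c1_on q1 p1 -> c1_on q2 p2 ->
  c1_on (fun t => q1 t - q2 t) (fun t => p1 t - p2 t).
Proof.
move=> h1 /(c1_onZ (-1)) h2; have := c1_onD h1 h2.
by under eq_fun do rewrite mulN1r; under [X in c1_on _ X]eq_fun do rewrite mulN1r.
Qed.

Lemma c1_on_sum (I : Type) (r : seq I) (q p : I -> R -> R) :
  (forall i, c1_on (q i) (p i)) ->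
  c1_on (fun t => \sum_(i <- r) q i t) (fun t => \sum_(i <- r) p i t).
Proof.
move=> h; elim: r => [|i r IH].
  under eq_fun do rewrite big_nil; under [X in c1_on _ X]eq_fun do rewrite big_nil.
  exact: c1_on_cst.
under eq_fun do rewrite big_cons; under [X in c1_on _ X]eq_fun do rewrite big_cons.
exact: c1_onD.
Qed.

Lemma c1_on_ftc q p T : c1_on q p -> 0 <= T ->
  \int[leb]_(t in `[0, T]) p t = q T - q 0.
Proof.
move=> [Q [b [cb dQ e]]] T0; have [-> _] := e _ T0; have [-> _] := e _ (lexx 0).
rewrite -(ftc_integral cb dQ T0); apply: eq_Rintegral => t.
by rewrite inE/= in_itv/= => /andP[t0 _]; have [_ ->] := e _ t0.
Qed.

End continuously_differentiable.

(** * Gronwall's inequality *)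

Section gronwall.
Variable R : realType.
Local Notation leb := (@lebesgue_measure R).

(* F need not be measurable: it only enters through continuous majorants. *)
Lemma gronwall_majorant (F : R -> R) (F0 M c T : R) : 0 < c -> 0 <= F0 -> 0 <= M ->
  (forall t, 0 <= t <= T -> F t <= M) ->
  (forall Y : R -> R, continuous Y -> (forall t, 0 <= t <= T -> F t <= Y t) ->
     forall t, 0 <= t <= T -> F t <= F0 + c * \int[leb]_(s in `[0, t]) Y s) ->
  forall t, 0 <= t <= T -> F t <= F0 * expR (c * t).
Proof.
move=> c0 F00 M0 FM step.
(* Feeding the current bound back as majorant gains a factor c / l. This contracts because the rate
   [l] is slightly larger than [c]; then [k] tends to infinity, and [l] to [c]. *)
have iter (l : R) (k : nat) t : c < l -> 0 <= t <= T ->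
    F t <= (F0 + M * (c / l) ^+ k) * expR (l * t).
  move=> cl; have l0 : 0 < l := lt_trans c0 cl.
  have r1 : c / l <= 1 by rewrite ler_pdivrMr// mul1r ltW.
  have r0 : 0 <= c / l by rewrite divr_ge0// ltW.
  elim: k t => [|k IH] t tT.
    rewrite expr0 mulr1; apply: le_trans (FM _ tT) _.
    have e1 : 1 <= expR (l * t).
      by rewrite -expR0 ler_expR mulr_ge0 ?(ltW l0)//; case/andP: tT.
    by apply: (@le_trans _ _ (F0 + M)); [rewrite lerDr|rewrite ler_peMr// addr_ge0].
  pose D := M * (c / l) ^+ k; have D0 : 0 <= D by rewrite mulr_ge0// exprn_ge0.
  have dY (s : R) : is_derive s 1 (fun s => (F0 + D) / l * expR (l * s))
      ((F0 + D) * expR (l * s)).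
    have h1 : is_derive s 1 (fun s : R => l * s) l.
      by have := is_deriveZ l (is_derive_id s 1); rewrite /GRing.scale/= mulr1.
    have h2 := @is_derive1_comp R expR (fun s : R => l * s) s _ _ (is_derive_expR _) h1.
    have := is_deriveZ ((F0 + D) / l) h2; rewrite /GRing.scale/=.
      rewrite (_ : _ * (_ * l) = (F0 + D) * expR (l * s))//; field; by rewrite gt_eqF.
  have cY : continuous (fun s => (F0 + D) * expR (l * s)).
    move=> s; apply: cvgM; first exact: cvg_cst.
    apply: continuous_comp; last exact: continuous_expR.
    by apply: cvgM; [exact: cvg_cst|exact: cvg_id].
  have /andP[t0 tT'] := tT.
  apply: le_trans (step _ cY IH _ tT) _.
  rewrite (ftc_integral cY dY t0) mulr0 expR0 mulr1 exprSr mulrA -/D.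
  set e := expR _; have e1 : 1 <= e.
    by rewrite /e -expR0 ler_expR mulr_ge0// ltW.
  rewrite (_ : c * _ = c / l * ((F0 + D) * (e - 1))); last by field; rewrite gt_eqF.
  move: (c / l) r0 r1 => r r0 r1; rewrite -subr_ge0.
  rewrite (_ : _ - _ = (1 - r) * F0 * (e - 1) + D * r); last ring.
  apply: addr_ge0; last exact: mulr_ge0.
  by apply: mulr_ge0; [apply: mulr_ge0 => //|]; rewrite subr_ge0.
have lim (l : R) t : c < l -> 0 <= t <= T -> F t <= F0 * expR (l * t).
  move=> cl tT; have l0 : 0 < l := lt_trans c0 cl.
  have h : (F0 + M * (c / l) ^+ k) * expR (l * t) @[k --> \oo] --> (F0 + M * 0) * expR (l * t).
    apply: cvgM; last exact: cvg_cst.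
    apply: cvgD; first exact: cvg_cst.
    apply: cvgM; first exact: cvg_cst.
    apply: cvg_expr; rewrite ger0_norm ?divr_ge0 ?ltW//.
    by rewrite ltr_pdivrMr// mul1r.
  rewrite mulr0 addr0 in h; rewrite -(cvg_lim _ h)//.
  by apply: limr_ge; [apply/cvg_ex; eexists; exact: h|near=> k; exact: iter].
move=> t tT.
have h : F0 * expR ((c + k.+1%:R^-1) * t) @[k --> \oo] --> F0 * expR ((c + 0) * t).
  apply: cvgM; first exact: cvg_cst.
  apply: continuous_cvg; first exact: continuous_expR.
  apply: cvgM; last exact: cvg_cst.
  by apply: cvgD; [exact: cvg_cst|exact: cvg_harmonic].
rewrite addr0 in h; rewrite -(cvg_lim _ h)//.
apply: limr_ge; first by apply/cvg_ex; eexists; exact: h.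
by near=> k; apply: lim => //; rewrite ltrDl invr_gt0 ltr0n.
Unshelve. all: by end_near. Qed.

End gronwall.

(** * Time derivatives of L^2-valued functions *)

Section weak_time_derivative.
Variables (R : realType) (N : nat).
Local Notation E := 'rV[R]_N.
Local Notation mu := (lebesgue_rV R N).
Local Notation leb := (@lebesgue_measure R).

Lemma abs_le_of_sqr (x e : R) : 0 <= e -> x ^+ 2 <= e ^+ 2 -> `|x| <= e.
Proof. by move=> e0; rewrite -[x ^+ 2]real_normK ?num_real// ler_sqr ?nnegrE. Qed.

Lemma mollifyE (psi h : E -> R) x : measurable_fun setT psi -> measurable_fun setT h ->
  mollify psi h x = \int[mu]_z (h z * psi (z - x)).
Proof.
move=> mpsi mh; rewrite /mollify.
rewrite -(@Rintegral_translate R N (fun z => h z * psi (z - x)) x).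
  by apply: eq_Rintegral => z _; rewrite addrK mulrC.
by apply: measurable_funM => //; exact: measurableT_comp (measurable_translate _).
Qed.

Lemma bounded_cvg_segment (f : nat -> R -> R) (g : R -> R) (a b M : R) :
  (forall n, leb.-integrable `[a, b] (EFin \o f n)) -> leb.-integrable `[a, b] (EFin \o g) ->
  (forall n t, a <= t <= b -> `|f n t| <= M) ->
  (forall t, a <= t <= b -> f n t @[n --> \oo] --> g t) ->
  \int[leb]_(t in `[a, b]) f n t @[n --> \oo] --> \int[leb]_(t in `[a, b]) g t.
Proof.
move=> intf intg fM fg.
have [|||||_ _ h] := @dominated_convergence _ _ R leb `[a, b] (measurable_itv _)
  (fun n => EFin \o f n) (EFin \o g) (cst M%:E).
- by move=> n; exact: measurable_int (intf n).
- exact: measurable_int intg.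
- by apply: aeW => t; rewrite /= in_itv/= => tab; apply: cvg_EFin; [exact: nearW|exact: fg].
- by apply: (@continuous_integrable_segment R (cst M)); exact: cst_continuous.
- by apply: aeW => t n; rewrite /= in_itv/= => tab; rewrite lee_fin fM.
apply: fine_cvg; rewrite fineK; first exact: h.
by apply: integrable_fin_num intg; exact: measurable_itv.
Qed.

Variable eta : nat -> E -> R.
Hypothesis eta_unit : approximate_unit eta.
Let etak n : kernel (eta n). Proof. by case: eta_unit. Qed.
Let etas n : sqint mu (eta n). Proof. exact: kernel_sqint. Qed.

Lemma mollify_pairing (h phi : E -> R) : sqint mu h -> sqint mu phi ->
  \int[mu]_x (phi x * mollify (eta n) h x) @[n --> \oo] --> \int[mu]_x (phi x * h x).
Proof.
move=> ih iphi; apply/cvgrPdist_le => e e0.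
pose a := fine (sqn mu phi); have a0 : 0 <= a by rewrite fine_ge0// sqn_ge0.
have a1 : 0 < a + 1 by rewrite ltr_wpDl.
have d0 : 0 < e ^+ 2 / (a + 1) by rewrite divr_gt0 ?exprn_gt0.
have [_ /(_ _ d0)] := approximable_sqint eta_unit ih; apply: filterS => n hn.
have im := sqint_mollify (etak n) ih; have id := sqintB im ih.
rewrite distrC -RintB; [|exact: sqint_mul|exact: sqint_mul].
under eq_Rintegral do rewrite -mulrBr.
apply: abs_le_of_sqr; first exact: ltW.
apply: le_trans (cauchy_schwarz iphi id) _; rewrite -/a.
move: hn; rewrite -(fineK (sqint_fin_num id)) lee_fin => hn.
apply: le_trans (ler_wpM2l a0 hn) _.
by rewrite mulrCA ler_piMr ?sqr_ge0// ler_pdivrMr// mul1r lerDl.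
Qed.

Variables (Q P : R -> E -> R) (C : R).
Hypothesis sQ : forall t, sqint mu (Q t).
Hypothesis sP : forall t, sqint mu (P t).
Hypothesis cP : forall phi, sqint mu phi -> continuous (fun t => \int[mu]_x (P t x * phi x)).
Hypothesis bP : forall t, fine (sqn mu (P t)) <= C.
Hypothesis mollified : forall n x,
  c1_on (fun t => mollify (eta n) (Q t) x) (fun t => mollify (eta n) (P t) x).

Let cmP n x : continuous (fun t => mollify (eta n) (P t) x).
Proof.
have := cP (sqint_translate (- x) (etas n)).
rewrite (_ : (fun t => mollify (eta n) (P t) x) =
  (fun t => \int[mu]_z (P t z * eta n (z + - x))))//.
apply/funext => t; apply: mollifyE; first by case: (etas n).
by case: (sP t).
Qed.

(** Extends differentiability in time from the kernels [eta n] to every [phi] in L^2. The identities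
    at each x are integrated in time and paired with [phi]; [n] tends to infinity by dominated
    convergence in time, with the constant bound a + C. *)
Lemma pairing_c1_on phi : sqint mu phi ->
  c1_on (fun t => \int[mu]_x (Q t x * phi x)) (fun t => \int[mu]_x (P t x * phi x)).
Proof.
move=> iphi; apply: (@c1_on_primitive R (\int[mu]_x (Q 0 x * phi x))); first exact: cP.
move=> B dB T T0; rewrite -(ftc_integral (cP iphi) dB T0).
apply/eqP; rewrite addrC -subr_eq; apply/eqP.
have swap (h : E -> R) : \int[mu]_x (h x * phi x) = \int[mu]_x (phi x * h x).
  by apply: eq_Rintegral => x _; rewrite mulrC.
have smP n t := sqint_mollify (etak n) (sP t).
have smQ n t := sqint_mollify (etak n) (sQ t).
have C0 : 0 <= C by apply: le_trans (bP 0); rewrite fine_ge0// sqn_ge0.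
pose a := fine (sqn mu phi); have a0 : 0 <= a by rewrite fine_ge0// sqn_ge0.
have sqP n t : fine (sqn mu (mollify (eta n) (P t))) <= C.
  apply: le_trans (bP t); rewrite -lee_fin !fineK ?sqint_fin_num//.
  exact: sqn_mollify_unit.
have prodle n t x : `|phi x * mollify (eta n) (P t) x| <=
    phi x ^+ 2 + mollify (eta n) (P t) x ^+ 2.
  move: (phi x) (mollify _ _ _) => u v; rewrite ler_norml; apply/andP; split; nra.
have bnd n t : (\int[mu]_x `|phi x * mollify (eta n) (P t) x|%:E <= (a + C)%:E)%E.
  have i1 := sqint_mul iphi (smP n t).
  rewrite -EFin_Rint ?lee_fin; last exact: rintegrable_norm.
  apply: (@le_trans _ _ (\int[mu]_x (phi x ^+ 2 + mollify (eta n) (P t) x ^+ 2))).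
    apply: Rint_le => //; first exact: rintegrable_norm.
    by apply: rintegrableD; exact: sqint_sqr.
  rewrite RintD; [|exact: sqint_sqr|exact: sqint_sqr].
  by apply: lerD; [exact: lexx|exact: sqP].
have eqn n : \int[mu]_x (phi x * mollify (eta n) (Q T) x) -
    \int[mu]_x (phi x * mollify (eta n) (Q 0) x) =
    \int[leb]_(t in `[0, T]) \int[mu]_x (phi x * mollify (eta n) (P t) x).
  rewrite -(@segment_fubini _ _ _ _ (fun x t => phi x * mollify (eta n) (P t) x) 0 T (a + C)).
  - rewrite -RintB; [|exact: sqint_mul|exact: sqint_mul].
    apply: eq_Rintegral => x _; rewrite -mulrBr.
    by have := c1_on_ftc (c1_onZ (phi x) (mollified n x)) T0; rewrite mulrBr => ->.
  - move=> t; apply: measurable_funM; first by case: iphi.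
    by case: (smP n t).
  - by move=> x t; apply: cvgM; [exact: cvg_cst|exact: cmP].
  - by move=> t _; exact: bnd.
have lhs : \int[mu]_x (phi x * mollify (eta n) (Q T) x) -
    \int[mu]_x (phi x * mollify (eta n) (Q 0) x) @[n --> \oo] -->
    \int[mu]_x (Q T x * phi x) - \int[mu]_x (Q 0 x * phi x).
  by rewrite !swap; apply: cvgB; exact: mollify_pairing.
have pair_le (h : E -> R) : sqint mu h -> fine (sqn mu h) <= C ->
    `|\int[mu]_x (phi x * h x)| <= a + C.
  move=> ih hC; apply: abs_le_of_sqr; first exact: addr_ge0.
  apply: le_trans (cauchy_schwarz iphi ih) _; rewrite -/a.
  have h0 : 0 <= fine (sqn mu h) by rewrite fine_ge0// sqn_ge0.
  by move: (fine _) hC h0 => s; nra.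
have rhs : \int[leb]_(t in `[0, T]) \int[mu]_x (phi x * mollify (eta n) (P t) x)
    @[n --> \oo] --> \int[leb]_(t in `[0, T]) \int[mu]_x (P t x * phi x).
  under [X in _ --> X]eq_Rintegral do rewrite swap.
  apply: (@bounded_cvg_segment _ _ _ _ (a + C)).
  - move=> n.
    apply: (@segment_integrable_inner _ _ _ mu (fun x t => phi x * mollify (eta n) (P t) x) 0 T (a + C)).
    + move=> t; apply: measurable_funM; first by case: iphi.
      by case: (smP n t).
    + by move=> x t; apply: cvgM; [exact: cvg_cst|exact: cmP].
    + by move=> t _; exact: bnd.
  - apply: continuous_integrable_segment.
    by under eq_fun do rewrite -swap; exact: cP.
  - by move=> n t _; exact: pair_le.
  - by move=> t _; exact: mollify_pairing.
have rhs' : \int[mu]_x (phi x * mollify (eta n) (Q T) x) -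
    \int[mu]_x (phi x * mollify (eta n) (Q 0) x) @[n --> \oo] -->
    \int[leb]_(t in `[0, T]) \int[mu]_x (P t x * phi x).
  by under eq_fun do rewrite eqn.
exact: (cvg_unique _ lhs rhs').
Qed.

Lemma mollify_c1_on psi x : kernel psi ->
  c1_on (fun t => mollify psi (Q t) x) (fun t => mollify psi (P t) x).
Proof.
move=> kpsi; have ipsi := kernel_sqint kpsi; have mpsi := kernel_measurable kpsi.
have := pairing_c1_on (sqint_translate (- x) ipsi).
rewrite (_ : (fun t => \int[mu]_z (Q t z * _)) = (fun t => mollify psi (Q t) x)); last first.
  by apply/funext => t; rewrite mollifyE//; case: (sQ t).
rewrite (_ : (fun t => \int[mu]_z (P t z * _)) = (fun t => mollify psi (P t) x))//.
by apply/funext => t; rewrite mollifyE//; case: (sP t).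
Qed.

Lemma mollify_time_continuous psi x : kernel psi ->
  continuous (fun t => mollify psi (P t) x).
Proof.
move=> kpsi; have ipsi := kernel_sqint kpsi; have mpsi := kernel_measurable kpsi.
have := cP (sqint_translate (- x) ipsi).
rewrite (_ : (fun t => \int[mu]_z (P t z * _)) = (fun t => mollify psi (P t) x))//.
by apply/funext => t; rewrite mollifyE//; case: (sP t).
Qed.

(* Duality: the pairing is tested with the difference Q t - Q s itself. *)
Lemma sqn_time_lipschitz s t : 0 <= s -> 0 <= t ->
  fine (sqn mu (fun x => Q t x - Q s x)) <= C * (t - s) ^+ 2.
Proof.
wlog st : s t / s <= t => [hw s0 t0|s0 t0].
  have [st|/ltW ts] := leP s t; first exact: hw.
  have -> : (t - s) ^+ 2 = (s - t) ^+ 2 by ring.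
  have -> : sqn mu (fun x => Q t x - Q s x) = sqn mu (fun x => Q s x - Q t x).
    by apply: eq_integral => x _; congr EFin; ring.
  exact: hw.
pose phi x := Q t x - Q s x; have iphi : sqint mu phi by exact: sqintB.
pose a := fine (sqn mu phi); have a0 : 0 <= a by rewrite fine_ge0// sqn_ge0.
have [B [b [_ cB dB e]]] := c1_on_continuous (pairing_c1_on iphi).
have aE : a = \int[mu]_x (Q t x * phi x) - \int[mu]_x (Q s x * phi x).
  rewrite -RintB; [|exact: sqint_mul|exact: sqint_mul].
  by apply: eq_Rintegral => x _; rewrite -mulrBl expr2.
(* [a] is an increment of the pairing with [phi], hence t - s times the pairing of [P c] with [phi];
   Cauchy-Schwarz gives a^2 <= C a (t - s)^2. *)
have [//|c cst E'] := @MVT_segment R B b s t st (fun z _ => dB z).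
  exact: continuous_subspaceT.
have c0 : 0 <= c by move: cst; rewrite in_itv/= => /andP[+ _]; exact: le_trans.
move: aE; have [-> _] := e _ s0; have [-> _] := e _ t0; rewrite E'.
have [_ <-] := e _ c0 => aE.
have cs := cauchy_schwarz (sP c) iphi; rewrite -/a in cs.
have a2 : a ^+ 2 <= C * a * (t - s) ^+ 2.
  rewrite {1}aE exprMn ler_wpM2r ?sqr_ge0// (le_trans cs)// ler_wpM2r//.
rewrite -[leLHS]/a; have [->|an] := eqVneq a 0.
  by rewrite mulr_ge0 ?sqr_ge0//; apply: le_trans (bP 0); rewrite fine_ge0// sqn_ge0.
have a1 : 0 < a by rewrite lt0r an.
by rewrite -(ler_pM2r a1) -expr2 mulrAC.
Qed.

End weak_time_derivative.

(** * The nonlinear term *)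

Section vector_functions.
Variables (R : realType) (N : nat).
Local Notation E := 'rV[R]_N.
Local Notation mu := (lebesgue_rV R N).
Implicit Types (h : 'I_N -> E -> R).

Definition vnorm h (x : E) : R := enorm (\row_i h i x).

Definition vsqn h : R := \sum_i fine (sqn mu (h i)).

Definition vsub h h' (i : 'I_N) (x : E) : R := h i x - h' i x.

Lemma vnorm_sqr h x : vnorm h x ^+ 2 = \sum_i h i x ^+ 2.
Proof. by rewrite enorm_sqr; apply: eq_bigr => i _; rewrite mxE. Qed.

Lemma vnorm_ge0 h x : 0 <= vnorm h x. Proof. exact: enorm_ge0. Qed.

Lemma measurable_vnorm d (T : measurableType d) (a : 'I_N -> T -> R) :
  (forall i, measurable_fun setT (a i)) ->
  measurable_fun setT (fun x => enorm (\row_i a i x)).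
Proof.
move=> ma; apply: measurableT_comp; first exact: measurable_enorm.
by apply: measurable_fun_rV => i; under eq_fun do rewrite mxE; exact: ma.
Qed.

Lemma sqn_vnorm h : (forall i, measurable_fun setT (h i)) ->
  sqn mu (vnorm h) = (\sum_i sqn mu (h i))%E.
Proof.
move=> mh; rewrite /sqn -ge0_integral_sum//.
- by apply: eq_integral => x _; rewrite vnorm_sqr -sumEFin.
- by move=> i; apply/measurable_EFinP; exact: measurable_funX.
- by move=> i x _; rewrite lee_fin sqr_ge0.
Qed.

Lemma sqint_vnorm h : (forall i, sqint mu (h i)) -> sqint mu (vnorm h).
Proof.
move=> sh; split; first by apply: measurable_vnorm => i; case: (sh i).
by rewrite sqn_vnorm; [apply/lte_sum_pinfty => i _; case: (sh i)|move=> i; case: (sh i)].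
Qed.

End vector_functions.

Section nonlinear_term.
Variables (R : realType) (N : nat) (delta alpha : R).
Local Notation E := 'rV[R]_N.
Local Notation mu := (lebesgue_rV R N).
Local Notation w := (weight delta alpha).
Implicit Types (h p : 'I_N -> E -> R).
Variables (G : 'I_N -> E -> E -> R) (g k : E -> R).
Hypothesis mG : forall i, measurable_fun setT (fun z : E * E => G i z.1 z.2).
Hypothesis G_le : forall i y a, `|G i y a| <= g y.
Hypothesis G_lip : forall y a b, enorm (\row_i (G i y a - G i y b)) <= g y * enorm (a - b).
Hypothesis ig : rintegrable mu g.
Hypothesis ik : rintegrable mu k.
Hypothesis k0 : forall y, 0 <= k y.
Hypothesis gk : forall y, g y ^+ 2 <= w y * k y.
Hypothesis hN : (0 < N)%N.

Let mg := rintegrable_measurable ig.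
Let g0 y : 0 <= g y.
Proof. exact: le_trans (G_le (Ordinal hN) y 0). Qed.

Variable psi : E -> R.
Hypothesis kpsi : kernel psi.
Hypothesis psi0 : forall z, 0 <= psi z.
Hypothesis young : forall f, sqint mu f -> (sqn mu (mollify psi f) <= sqn mu f)%E.
Let spsi : sqint mu psi. Proof. exact: kernel_sqint. Qed.
Let mpsi : measurable_fun setT psi. Proof. exact: kernel_measurable. Qed.
Let ipsi : rintegrable mu psi. Proof. by case: kpsi. Qed.

Definition vdiff h (y z : E) : E := \row_i diffq (h i) y z.

(** The nonlinear part of the symmetrized form, tested with the kernel centred at [x]. The bound of
    [G] by the integrable [g] gives absolute convergence without any cancellation between the two
    kernels. *)
Definition nterm h (i : 'I_N) (x : E) : R := 2^-1 *
  \int[mu]_y \int[mu]_z (G i y (vdiff h y z) * (psi (z - x) - psi (z - y - x))).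

Let T2 := ((E * E) * E)%type.

Let m_shift d (T : measurableType d) (a b : T -> E) : measurable_fun setT a ->
  measurable_fun setT b -> measurable_fun setT (fun t => a t - b t).
Proof.
move=> ma mb; apply: (measurableT_comp (f := fun z : E * E => z.1 - z.2)
  (g := fun t => (a t, b t)) (@measurable_subrV R N)).
exact/measurable_fun_pairP.
Qed.

Let m_psi d (T : measurableType d) (a : T -> E) : measurable_fun setT a ->
  measurable_fun setT (fun t => psi (a t)).
Proof. exact: measurableT_comp. Qed.

Let m_vdiff d (T : measurableType d) h (y z : T -> E) :
  (forall i, measurable_fun setT (h i)) -> measurable_fun setT y ->
  measurable_fun setT z -> measurable_fun setT (fun t => vdiff h (y t) (z t)).
Proof.
move=> mh my mz; apply: measurable_fun_rV => i; under eq_fun do rewrite mxE.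
apply: measurable_funB; first exact: measurableT_comp (mh i) mz.
by apply: measurableT_comp (mh i) _; exact: m_shift.
Qed.

Let m_G d (T : measurableType d) i (y a : T -> E) : measurable_fun setT y ->
  measurable_fun setT a -> measurable_fun setT (fun t => G i (y t) (a t)).
Proof.
move=> my ma; apply: (measurableT_comp (f := fun z : E * E => G i z.1 z.2)
  (g := fun t => (y t, a t)) (mG i)).
exact/measurable_fun_pairP.
Qed.

Let integrand h i x (z : E * E) : R :=
  G i z.1 (vdiff h z.1 z.2) * (psi (z.2 - x) - psi (z.2 - z.1 - x)).

Lemma measurable_nterm h i : (forall j, measurable_fun setT (h j)) ->
  measurable_fun setT (nterm h i).
Proof.
move=> mh; apply: measurable_funM; first exact: measurable_cst.
apply: (@measurable_Rintegral2 _ _ _ _ _ mu (fun z : E * E =>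
  \int[mu]_u (G i z.2 (vdiff h z.2 u) * (psi (u - z.1) - psi (u - z.2 - z.1))))).
apply: (@measurable_Rintegral2 _ _ _ _ _ mu (fun u : T2 =>
  G i u.1.2 (vdiff h u.1.2 u.2) * (psi (u.2 - u.1.1) - psi (u.2 - u.1.2 - u.1.1)))).
have m11 : measurable_fun setT (fun u : T2 => u.1.1).
  by apply: measurableT_comp; [exact: measurable_fst|exact: measurable_fst].
have m12 : measurable_fun setT (fun u : T2 => u.1.2).
  by apply: measurableT_comp; [exact: measurable_snd|exact: measurable_fst].
have m2 : measurable_fun setT (fun u : T2 => u.2) by exact: measurable_snd.
apply: measurable_funM; first by apply: m_G => //; exact: m_vdiff.
by apply: measurable_funB; apply: m_psi; [exact: m_shift|apply: m_shift => //; exact: m_shift].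
Qed.

Let bound x (z : E * E) : R := g z.1 * (psi (z.2 - x) + psi (z.2 - z.1 - x)).

Let measurable_kernels x : measurable_fun setT (fun z : E * E => psi (z.2 - x)) /\
  measurable_fun setT (fun z : E * E => psi (z.2 - z.1 - x)).
Proof.
by split; apply: m_psi; apply: m_shift => //; apply: m_shift.
Qed.

Let int_psi (a : E) : \int[mu]_z psi (z - a) = \int[mu]_z psi z.
Proof. exact: Rintegral_translate. Qed.

Let irpsi a : rintegrable mu (fun z => psi (z - a)).
Proof. exact: integrable_translate. Qed.

Let irpsi2 a b : rintegrable mu (fun z => psi (z - a - b)).
Proof.
have -> : (fun z => psi (z - a - b)) = (fun z => psi (z - (a + b))).
  by apply/funext => z; rewrite opprD addrA.
exact: irpsi.
Qed.

Let rintegrable_bound x : rintegrable (mu \x mu)%E (bound x).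
Proof.
have [m1 m2] := measurable_kernels x.
apply: rintegrable_prodP.
  apply: measurable_funM; first exact: measurableT_comp mg measurable_fst.
  exact: measurable_funD.
have E1 y : (\int[mu]_z `|bound x (y, z)|%:E)%E = (g y * (2 * \int[mu]_z psi z))%:E.
  have i1 := rintegrableZ (g y) (rintegrableD (irpsi x) (irpsi2 y x)).
  under eq_integral => z _.
    rewrite /bound/= ger0_norm; last by rewrite mulr_ge0// addr_ge0.
    over.
  rewrite -EFin_Rint// RintZ; last exact: rintegrableD.
  rewrite RintD// int_psi mulr_natl mulr2n; congr (_ * (_ + _))%:E.
  by rewrite -(int_psi (y + x)); apply: eq_Rintegral => z _; rewrite opprD addrA.
under eq_integral do rewrite E1 mulrC.
have := rintegrable_lty (rintegrableZ (2 * \int[mu]_z psi z) ig).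
apply: le_lt_trans; apply: ge0_le_integralW => y; last by rewrite lee_fin ler_norm.
by rewrite lee_fin mulr_ge0// mulr_ge0// Rint_ge0.
Qed.

Let rintegrable_integrand h i x : (forall j, measurable_fun setT (h j)) ->
  rintegrable (mu \x mu)%E (integrand h i x).
Proof.
move=> mh; have [m1 m2] := measurable_kernels x.
apply: (@rintegrable_le _ _ _ _ _ (bound x)); last exact: rintegrable_bound.
  by apply: measurable_funM; [apply: m_G => //; exact: m_vdiff|exact: measurable_funB].
move=> z; rewrite /integrand normrM ler_pM// (le_trans (ler_normB _ _))//.
by rewrite !ger0_norm.
Qed.

Lemma rintegrable_nterm h i x : (forall j, measurable_fun setT (h j)) ->
  rintegrable (mu \x mu)%E (fun z : E * E =>
    G i z.1 (vdiff h z.1 z.2) * (psi (z.2 - x) - psi (z.2 - z.1 - x))).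
Proof. exact: rintegrable_integrand. Qed.

Definition mollified_vdiff h (y x : E) : R := mollify psi (fun z => enorm (vdiff h y z)) x.

(** Two terms, because the test function is evaluated at z and at z - y: the second kernel is
    centred at x + y. *)
Definition majorant h (x : E) : R :=
  \int[mu]_y (g y * (mollified_vdiff h y x + mollified_vdiff h y (x + y))).

Let sqint_vdiff h y : (forall i, sqint mu (h i)) -> sqint mu (fun z => enorm (vdiff h y z)).
Proof. by move=> sh; apply: (@sqint_vnorm R N (fun i => diffq (h i) y)) => i; exact: sqint_diffq. Qed.

Let mollified_vdiff_ge0 h y x : 0 <= mollified_vdiff h y x.
Proof. by apply: Rint_ge0 => z; rewrite mulr_ge0// enorm_ge0. Qed.

Let fine_sqn_ge0 (f : E -> R) : 0 <= fine (sqn mu f).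
Proof. by rewrite fine_ge0// sqn_ge0. Qed.

Let sqn_diffq_le (f : E -> R) y : sqint mu f ->
  fine (sqn mu (diffq f y)) <= 4 * fine (sqn mu f).
Proof.
move=> sf; have sfy := sqint_translate (- y) sf.
have sNy := sqintZ (-1) sfy.
have := sqn_sub_le sf sNy; have mf := proj1 sf.
have -> : sqn mu (fun x => -1 * f (x - y)) = sqn mu f.
  rewrite -(sqn_translate (- y) mf); apply: eq_integral => x _; congr EFin; ring.
rewrite -(fineK (sqint_fin_num sf)) -!EFinM -EFinD.
have -> : sqn mu (fun x => f x + -1 * f (x - y)) = sqn mu (diffq f y).
  by apply: eq_integral => x _; congr EFin; rewrite /diffq; ring.
rewrite -(fineK (sqint_fin_num (sqint_diffq y sf))) lee_fin; lra.
Qed.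

Lemma mollified_vdiff_bound h y x : (forall i, sqint mu (h i)) ->
  mollified_vdiff h y x ^+ 2 <= 4 * fine (sqn mu psi) * vsqn h.
Proof.
move=> sh; apply: le_trans (mollify_bound x spsi (sqint_vdiff y sh)) _.
rewrite [4 * _]mulrC -mulrA ler_wpM2l// (@sqn_vnorm R N (fun i => diffq (h i) y)); last first.
  by move=> i; case: (sqint_diffq y (sh i)).
rewrite -sum_fine => [|i _]; last exact/sqint_fin_num/sqint_diffq.
by rewrite /vsqn mulr_sumr; apply: ler_sum => i _; exact: sqn_diffq_le.
Qed.

Let le_sqrt_bound (a b : R) : 0 <= a -> a ^+ 2 <= b -> a <= Num.sqrt b.
Proof. by move=> a0 ab; rewrite -[a]ger0_norm// -sqrtr_sqr ler_wsqrtr. Qed.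

Let measurable_mollified h : (forall j, measurable_fun setT (h j)) ->
  measurable_fun setT (fun z : E * E => mollified_vdiff h z.2 z.1).
Proof.
move=> mh; apply: (@measurable_Rintegral2 _ _ _ _ _ mu (fun u : T2 =>
  psi u.2 * enorm (vdiff h u.1.2 (u.2 + u.1.1)))).
have m11 : measurable_fun setT (fun u : T2 => u.1.1).
  by apply: measurableT_comp; [exact: measurable_fst|exact: measurable_fst].
have m12 : measurable_fun setT (fun u : T2 => u.1.2).
  by apply: measurableT_comp; [exact: measurable_snd|exact: measurable_fst].
have m2 : measurable_fun setT (fun u : T2 => u.2) by exact: measurable_snd.
apply: measurable_funM; first exact: m_psi.
apply: measurableT_comp; first exact: measurable_enorm.
apply: m_vdiff => //; apply: (measurableT_comp (f := fun z : E * E => z.1 + z.2)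
  (g := fun u : T2 => (u.2, u.1.1)) (@measurable_addrV R N)).
exact/measurable_fun_pairP.
Qed.

Let measurable_mollified_shift h : (forall j, measurable_fun setT (h j)) ->
  measurable_fun setT (fun z : E * E => mollified_vdiff h z.2 (z.1 + z.2)).
Proof.
move=> mh; apply: (measurableT_comp (measurable_mollified mh) (g := fun z : E * E => (z.1 + z.2, z.2))).
apply/measurable_fun_pairP; split; [exact: measurable_addrV|exact: measurable_snd].
Qed.

Let weighted h (z : E * E) : R :=
  g z.2 * (mollified_vdiff h z.2 z.1 + mollified_vdiff h z.2 (z.1 + z.2)).

Let measurable_weighted h : (forall j, measurable_fun setT (h j)) ->
  measurable_fun setT (weighted h).
Proof.
move=> mh; apply: measurable_funM; first exact: measurableT_comp mg measurable_snd.
by apply: measurable_funD; [exact: measurable_mollified|exact: measurable_mollified_shift].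
Qed.

Let weighted_bound h x y : (forall i, sqint mu (h i)) ->
  0 <= weighted h (x, y) <= 2 * Num.sqrt (4 * fine (sqn mu psi) * vsqn h) * g y.
Proof.
move=> sh; rewrite /weighted/= mulr_ge0 ?addr_ge0//=.
rewrite mulrC ler_wpM2r// mulr_natl mulr2n lerD//;
by apply: le_sqrt_bound => //; exact: mollified_vdiff_bound.
Qed.

Let rintegrable_weighted h x : (forall i, sqint mu (h i)) ->
  rintegrable mu (fun y => weighted h (x, y)).
Proof.
move=> sh; apply: (@rintegrable_le _ _ _ _ _
  (fun y => 2 * Num.sqrt (4 * fine (sqn mu psi) * vsqn h) * g y)).
- apply: (measurableT_comp (@measurable_weighted h _) (pair1_measurable x)).
  by move=> j; case: (sh j).
- by move=> y; have /andP[h1 h2] := weighted_bound x y sh; rewrite ger0_norm.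
- exact: rintegrableZ.
Qed.

Lemma majorant_bound h x : (forall i, sqint mu (h i)) ->
  0 <= majorant h x <=
    2 * Num.sqrt (4 * fine (sqn mu psi) * vsqn h) * \int[mu]_y g y.
Proof.
move=> sh; apply/andP; split.
  by apply: Rint_ge0 => y; have /andP[] := weighted_bound x y sh.
rewrite -RintZ//; apply: Rint_le.
- exact: (rintegrable_weighted x sh).
- exact: rintegrableZ.
- by move=> y; have /andP[] := weighted_bound x y sh.
Qed.

Lemma measurable_majorant h : (forall i, sqint mu (h i)) -> measurable_fun setT (majorant h).
Proof.
move=> sh; apply: (@measurable_Rintegral2 _ _ _ _ _ mu (weighted h)).
by apply: measurable_weighted => j; case: (sh j).
Qed.

Let dominant h x (z : E * E) : R :=
  (g z.1 * enorm (vdiff h z.1 z.2)) * (psi (z.2 - x) + psi (z.2 - z.1 - x)).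

Let inner_dominant h x y : (forall i, sqint mu (h i)) ->
  rintegrable mu (fun z => dominant h x (y, z)) /\
  \int[mu]_z dominant h x (y, z) = weighted h (x, y).
Proof.
move=> sh; have sv := sqint_vdiff y sh.
have s1 := sqint_translate (- x) spsi.
have s2 : sqint mu (fun z => psi (z - y - x)).
  have -> : (fun z => psi (z - y - x)) = (fun z => psi (z + - (x + y))).
    by apply/funext => z; rewrite opprD addrCA addrA [- x + z]addrC addrAC.
  exact: sqint_translate.
have i1 := sqint_mul sv s1; have i2 := sqint_mul sv s2.
have dE : (fun z => dominant h x (y, z)) = (fun z =>
    g y * (enorm (vdiff h y z) * psi (z - x) + enorm (vdiff h y z) * psi (z - y - x))).
  by apply/funext => z; rewrite /dominant/= -mulrDr mulrA.
split; first by rewrite dE; apply: rintegrableZ; exact: rintegrableD.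
rewrite dE RintZ; last exact: rintegrableD.
rewrite RintD// /weighted/=; congr (_ * (_ + _)); rewrite /mollified_vdiff mollifyE//.
- by case: sv.
- by apply: eq_Rintegral => z _; rewrite opprD addrCA addrA [- x + z]addrC addrAC.
- by case: sv.
Qed.

Let rintegrable_dominant h x : (forall i, sqint mu (h i)) ->
  rintegrable (mu \x mu)%E (dominant h x).
Proof.
move=> sh; have [m1 m2] := measurable_kernels x.
have mh j : measurable_fun setT (h j) by case: (sh j).
apply: rintegrable_prodP.
  apply: measurable_funM; last exact: measurable_funD.
  apply: measurable_funM; first exact: measurableT_comp mg measurable_fst.
  by apply: measurableT_comp; [exact: measurable_enorm|exact: m_vdiff].
have E1 y : (\int[mu]_z `|dominant h x (y, z)|%:E)%E = (weighted h (x, y))%:E.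
  have [i1 e1] := inner_dominant x y sh.
  rewrite -e1 EFin_Rint//; apply: eq_integral => z _; rewrite ger0_norm//.
  by rewrite /dominant mulr_ge0 ?addr_ge0// mulr_ge0// enorm_ge0.
under eq_integral do rewrite E1.
have := rintegrable_lty (rintegrable_weighted x sh).
apply: le_lt_trans; apply: ge0_le_integralW => y; last by rewrite lee_fin ler_norm.
by rewrite lee_fin; have /andP[] := weighted_bound x y sh.
Qed.

(** All components are paired with one vector, so that Cauchy-Schwarz and [G_lip], which bounds a
    Euclidean norm, apply without a factor depending on the dimension. *)
Lemma nterm_sub_le h h' (p : 'I_N -> R) x :
  (forall i, sqint mu (h i)) -> (forall i, sqint mu (h' i)) ->
  `|2 * \sum_i p i * (nterm h i x - nterm h' i x)| <=
    enorm (\row_i p i) * majorant (vsub h h') x.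
Proof.
move=> sh sh'; have sw i : sqint mu (vsub h h' i) by exact: sqintB.
have mh j : measurable_fun setT (h j) by case: (sh j).
have mh' j : measurable_fun setT (h' j) by case: (sh' j).
have i1 i := rintegrable_integrand i x mh; have i2 i := rintegrable_integrand i x mh'.
have -> : 2 * \sum_i p i * (nterm h i x - nterm h' i x) =
    \int[(mu \x mu)%E]_z (\sum_i p i * (integrand h i x z - integrand h' i x z)).
  rewrite Rint_sum => [|i]; last by apply: rintegrableZ; exact: rintegrableB.
  rewrite mulr_sumr; apply: eq_bigr => i _.
  rewrite RintZ ?RintB//; last exact: rintegrableB.
  rewrite -(Rint_fubini2 (i1 i)) -(Rint_fubini2 (i2 i)) /nterm /integrand/=.
  by rewrite -mulrBr mulrCA; congr (_ * _); rewrite mulrA divff ?mul1r.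
have -> : enorm (\row_i p i) * majorant (vsub h h') x =
    \int[(mu \x mu)%E]_z (enorm (\row_i p i) * dominant (vsub h h') x z).
  rewrite RintZ; last exact: rintegrable_dominant.
  rewrite -(Rint_fubini2 (rintegrable_dominant x sw)); congr (_ * _).
  by apply: eq_Rintegral => y _; have [_ ->] := inner_dominant x y sw.
have iS : rintegrable (mu \x mu)%E
    (fun z => \sum_i p i * (integrand h i x z - integrand h' i x z)).
  by apply: rintegrable_sum => i; apply: rintegrableZ; exact: rintegrableB.
apply: le_trans (Rint_norm iS) _; apply: Rint_le.
- exact: rintegrable_norm.
- by apply: rintegrableZ; exact: rintegrable_dominant.
move=> [y z]; rewrite /integrand/=.
under eq_bigr do rewrite -mulrBl mulrA.
rewrite -mulr_suml normrM /dominant/= mulrA.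
apply: ler_pM => //; last by rewrite (le_trans (ler_normB _ _))// !ger0_norm.
have -> : \sum_i p i * (G i y (vdiff h y z) - G i y (vdiff h' y z)) =
    dotp (\row_i p i) (\row_i (G i y (vdiff h y z) - G i y (vdiff h' y z))).
  by apply: eq_bigr => i _; rewrite !mxE.
apply: le_trans (dotp_le_enorm _ _) _; rewrite ler_wpM2l ?enorm_ge0//.
apply: le_trans (G_lip _ _ _) _; rewrite ler_wpM2l// le_eqVlt; apply/orP; left.
by apply/eqP; congr enorm; apply/rowP => i; rewrite !mxE /diffq /vsub; ring.
Qed.

Let half_sum (P M M' : E -> R) (a b : R) : sqint mu P -> sqint mu M -> sqint mu M' ->
  (\int[mu]_x (2^-1 * (a * P x ^+ 2 + b * M x ^+ 2) +
               2^-1 * (a * P x ^+ 2 + b * M' x ^+ 2))%:E)%E =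
  (a * fine (sqn mu P) + 2^-1 * (b * fine (sqn mu M)) + 2^-1 * (b * fine (sqn mu M')))%:E.
Proof.
move=> sP sM sM'; have i1 := sqint_sqr sP; have i2 := sqint_sqr sM; have i3 := sqint_sqr sM'.
transitivity (\int[mu]_x (a * P x ^+ 2 + 2^-1 * b * M x ^+ 2 + 2^-1 * b * M' x ^+ 2)%:E)%E.
  by apply: eq_integral => x _; congr EFin; field.
have j1 := rintegrableZ a i1; have j2 := rintegrableZ (2^-1 * b) i2.
have j3 := rintegrableZ (2^-1 * b) i3; have j12 := rintegrableD j1 j2.
rewrite -(EFin_Rint (rintegrableD j12 j3)) (RintD j12 j3) (RintD j1 j2) !RintZ//.
by rewrite !mulrA.
Qed.

(* AM-GM under the triple integral: [2 |p| g |Dw| <= k |p|^2 + weight |Dw|^2]. *)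
Lemma majorant_energy h p : (forall i, sqint mu (h i)) -> (forall i, sqint mu (p i)) ->
  (\int[mu]_x (vnorm p x * majorant h x)%:E <=
   (\int[mu]_y k y)%:E * \sum_i sqn mu (p i) + \sum_i wsemi delta alpha (h i))%E.
Proof.
move=> sh sp; have mh j : measurable_fun setT (h j) by case: (sh j).
have sv := sqint_vnorm sp; have mv := proj1 sv.
pose F (z : E * E) : R := vnorm p z.1 * weighted h z.
have F0 z : 0 <= F z.
  by rewrite mulr_ge0 ?vnorm_ge0//; case: z => x y; have /andP[] := weighted_bound x y sh.
have mF : measurable_fun setT (EFin \o F).
  apply/measurable_EFinP; apply: measurable_funM; last exact: measurable_weighted.
  exact: measurableT_comp mv measurable_fst.
have -> : (\int[mu]_x (vnorm p x * majorant h x)%:E = \int[mu]_x \int[mu]_y (F (x, y))%:E)%E.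
  apply: eq_integral => x _; rewrite -RintZ; last exact: (rintegrable_weighted x sh).
  by rewrite EFin_Rint//; apply: rintegrableZ; exact: (rintegrable_weighted x sh).
rewrite (@fubini_tonelli _ _ _ _ _ mu mu (EFin \o F) mF); last by move=> z; rewrite lee_fin.
have Msq y : sqint mu (mollified_vdiff h y).
  by apply: sqint_mollify => //; exact: sqint_vdiff.
have wk y : 0 <= w y * k y by rewrite mulr_ge0// weight_ge0.
(* AM-GM in squared form, which uses [gk] without taking a root of the weight. The factor 1/2 is
   made up for by the two terms of [weighted]. *)
have key y (a b : R) : 0 <= a -> 0 <= b -> a * (g y * b) <= 2^-1 * (k y * a ^+ 2 + w y * b ^+ 2).
  move=> a0 b0; have w0 := weight_ge0 delta alpha y.
  have kw0 : 0 <= 2^-1 * (k y * a ^+ 2 + w y * b ^+ 2).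
    by rewrite mulr_ge0// addr_ge0// mulr_ge0// sqr_ge0.
  rewrite -[leLHS]ger0_norm ?mulr_ge0//; apply: abs_le_of_sqr => //.
  apply: (@le_trans _ _ ((a * b) ^+ 2 * (w y * k y))).
    rewrite (_ : (a * _) ^+ 2 = (a * b) ^+ 2 * g y ^+ 2); last ring.
    by rewrite ler_wpM2l ?sqr_ge0.
  rewrite -subr_ge0 (_ : _ - _ = (2^-1 * (k y * a ^+ 2 - w y * b ^+ 2)) ^+ 2) ?sqr_ge0//.
  by field.
have inner y : (\int[mu]_x (F (x, y))%:E <=
    (k y)%:E * sqn mu (vnorm p) + (w y)%:E * sqn mu (mollified_vdiff h y))%E.
  have sM := Msq y; have sM' := sqint_translate y sM.
  apply: (@le_trans _ _ (\int[mu]_x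
      (2^-1 * (k y * vnorm p x ^+ 2 + w y * mollified_vdiff h y x ^+ 2) +
       2^-1 * (k y * vnorm p x ^+ 2 + w y * mollified_vdiff h y (x + y) ^+ 2))%:E)%E).
    apply: ge0_le_integralW => x; first by rewrite lee_fin.
    rewrite lee_fin /F /weighted/= !(mulrDr (g y)) (mulrDr (vnorm p x)).
    by apply: lerD; apply: key; [exact: vnorm_ge0|exact: mollified_vdiff_ge0|
      exact: vnorm_ge0|exact: mollified_vdiff_ge0].
  have e2 : sqn mu (fun x => mollified_vdiff h y (x + y)) = sqn mu (mollified_vdiff h y).
    exact: (sqn_translate y (proj1 sM)).
  have e1 := etrans (half_sum (k y) (w y) sv sM sM') (congr1 (fun c =>
    (k y * fine (sqn mu (vnorm p)) + 2^-1 * (w y * fine (sqn mu (mollified_vdiff h y))) +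
     2^-1 * (w y * fine c))%:E) e2).
  apply: le_trans (_ : (_ <= (k y * fine (sqn mu (vnorm p)) +
    2^-1 * (w y * fine (sqn mu (mollified_vdiff h y))) +
    2^-1 * (w y * fine (sqn mu (mollified_vdiff h y))))%:E)%E) _.
    by rewrite -e1; exact: lexx.
  rewrite -{2}(fineK (sqint_fin_num sv)) -{3}(fineK (sqint_fin_num sM)) -!EFinM -EFinD lee_fin.
  rewrite le_eqVlt; apply/orP; left; apply/eqP.
  by move: (fine _) (fine _) => s1 s2; field.
apply: (@le_trans _ _ (\int[mu]_y ((k y)%:E * sqn mu (vnorm p) +
    \sum_i (w y)%:E * sqn mu (diffq (h i) y)))%E).
  apply: ge0_le_integralW => y; first by apply: integral_ge0 => x _; rewrite lee_fin.
  apply: le_trans (inner y) _; rewrite leeD2l//.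
  rewrite -ge0_sume_distrr => [|i _]; last exact: sqn_ge0.
  rewrite lee_wpmul2l ?lee_fin ?weight_ge0//.
  rewrite -(@sqn_vnorm R N (fun i => diffq (h i) y)) => [|i]; last first.
    by case: (sqint_diffq y (sh i)).
  by apply: young; exact: sqint_vdiff.
have mwd i : measurable_fun setT (fun y => (w y)%:E * sqn mu (diffq (h i) y))%E.
  apply: emeasurable_funM; first by apply/measurable_EFinP; exact: measurable_weight.
  exact: measurable_sqn_diffq.
rewrite ge0_integralD//; last first.
- by apply: emeasurable_sum => i; exact: mwd.
- by move=> y _; apply: sume_ge0 => i _; rewrite mule_ge0 ?sqn_ge0// lee_fin weight_ge0.
- apply: emeasurable_funM; first by apply/measurable_EFinP; exact: rintegrable_measurable ik.
  exact: measurable_cst.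
- by move=> y _; rewrite mule_ge0 ?sqn_ge0// lee_fin.
rewrite ge0_integral_sum//; last first.
  by move=> i y _; rewrite mule_ge0 ?sqn_ge0// lee_fin weight_ge0.
rewrite -sqn_vnorm => [|i]; last by case: (sp i).
rewrite leeD2r// -(fineK (sqint_fin_num sv)).
under eq_integral do rewrite -EFinM mulrC.
rewrite -EFin_Rint; last exact: rintegrableZ.
by rewrite RintZ// -EFinM mulrC.
Qed.

End nonlinear_term.

(** * Energy of mollified solutions *)

Section mollified_solutions.
Variables (R : realType) (N : nat) (delta alpha kappa : R).
Local Notation E := 'rV[R]_N.
Local Notation mu := (lebesgue_rV R N).
Local Notation leb := (@lebesgue_measure R).
Local Notation wsemi := (wsemi delta alpha).
Local Notation eta := (@mollifier R N).
Hypotheses (delta0 : 0 < delta) (alpha01 : 0 < alpha < 1) (hN : (0 < N)%N).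
Variables (G : 'I_N -> E -> E -> R) (g : E -> R).
Hypothesis mG : forall i, measurable_fun setT (fun z : E * E => G i z.1 z.2).
Hypothesis G_le : forall i y a, `|G i y a| <= g y.
Hypothesis G_lip : forall y a b, enorm (\row_i (G i y a - G i y b)) <= g y * enorm (a - b).
Hypothesis ig : rintegrable mu g.

Definition mollified_force (h : 'I_N -> E -> R) n i x : R :=
  - (kappa * mollify (nlap delta alpha (eta n)) (h i) x) - nterm G (eta n) h i x.

(* The equation tested with theta(t) eta_n(z - x) e_i; the functions of time are
   extended to negative times by their value at 0. *)
Record mollified_solution (Q P : R -> 'I_N -> E -> R) (u0 v0 : 'I_N -> E -> R) : Prop := {
  ms_sqint : forall t i, sqint mu (Q t i);
  ms_wsemi : forall t i, (wsemi (Q t i) < +oo)%E;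
  ms_dsqint : forall t i, sqint mu (P t i);
  ms_const : forall t, t <= 0 -> Q t = Q 0;
  ms_continuous : forall i phi, sqint mu phi -> continuous (fun t => \int[mu]_x (Q t i x * phi x));
  ms_dcontinuous : forall i phi, sqint mu phi -> continuous (fun t => \int[mu]_x (P t i x * phi x));
  ms_dbound : exists C, forall t i, fine (sqn mu (P t i)) <= C;
  ms_bound : forall T, exists C, forall t i, t <= T ->
    fine (sqn mu (Q t i)) <= C /\ fine (wsemi (Q t i)) <= C;
  ms_first : forall n i x theta, positive_test1 theta ->
    \int[leb]_(t in `[0, +oo[) (mollify (eta n) (Q t i) x * derive1 theta t) =
    - \int[leb]_(t in `[0, +oo[) (mollify (eta n) (P t i) x * theta t);
  ms_second : forall n i x theta, test1 theta ->
    \int[leb]_(t in `[0, +oo[) (mollify (eta n) (Q t i) x * derive1 (derive1 theta) t -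
       mollified_force (Q t) n i x * theta t)
    - mollify (eta n) (v0 i) x * theta 0 + mollify (eta n) (u0 i) x * derive1 theta 0 = 0
}.

Let eta_unit := mollifier_approximate_unit R N.
Let kn n : kernel (eta n). Proof. by case: eta_unit. Qed.
Let eta0 n z : 0 <= eta n z. Proof. by case: eta_unit. Qed.

(** The pairing estimate with a unit vector, followed by the pointwise bound of [majorant]. The
    dependence on [h] is controlled in the L^2 norm, which is why Lipschitz continuity of the
    solution in time is needed. *)
Lemma nterm_lipschitz n h h' i x :
  (forall i, sqint mu (h i)) -> (forall i, sqint mu (h' i)) ->
  (nterm G (eta n) h i x - nterm G (eta n) h' i x) ^+ 2 <=
    4 * fine (sqn mu (eta n)) * (\int[mu]_y g y) ^+ 2 * vsqn (vsub h h').
Proof.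
move=> sh sh'; have sw j : sqint mu (vsub h h' j) by exact: sqintB.
have := nterm_sub_le mG G_le G_lip ig hN (kn n) (eta0 n) (fun j => (j == i)%:R) x sh sh'.
rewrite (bigD1 i)//= eqxx mul1r big1 ?addr0 => [|j ji]; last by rewrite (negbTE ji) mul0r.
have -> : enorm (\row_j ((j == i)%:R : R)) = 1.
  rewrite /enorm /dotp (bigD1 i)//= big1 ?addr0 => [|j ji]; last by rewrite !mxE (negbTE ji) mul0r.
  by rewrite !mxE eqxx mulr1 sqrtr1.
rewrite mul1r => h1.
have /andP[_ h2] := majorant_bound G_le ig hN (kn n) (eta0 n) x sw.
move: (le_trans h1 h2); set D := _ - _; set a := fine _; set S := vsqn _; set I := \int[mu]_y _.
have S0 : 0 <= S by apply: sumr_ge0 => j _; rewrite fine_ge0// sqn_ge0.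
have a0 : 0 <= a by rewrite fine_ge0// sqn_ge0.
rewrite normrM ger0_norm// -mulrA ler_pM2l// => h3.
rewrite -[D ^+ 2]real_normK ?num_real//.
have I0 : 0 <= I by apply: Rint_ge0 => y; exact: le_trans (G_le i y 0).
apply: (@le_trans _ _ ((Num.sqrt (4 * a * S) * I) ^+ 2)).
  by rewrite ler_sqr// nnegrE// mulr_ge0// sqrtr_ge0.
by rewrite exprMn sqr_sqrtr ?mulr_ge0// mulrAC.
Qed.

Variables (Q P : R -> 'I_N -> E -> R) (u0 v0 : 'I_N -> E -> R).
Hypothesis sol : mollified_solution Q P u0 v0.

Lemma mollified_continuous i psi x : kernel psi ->
  continuous (fun t => mollify psi (Q t i) x).
Proof.
move=> kpsi; have ipsi := kernel_sqint kpsi; have mpsi := kernel_measurable kpsi.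
have := ms_continuous sol (i := i) (sqint_translate (- x) ipsi).
rewrite (_ : (fun t => \int[mu]_z (Q t i z * _)) = (fun t => mollify psi (Q t i) x))//.
by apply/funext => t; rewrite mollifyE//; case: (ms_sqint sol t i).
Qed.

Lemma mollified_dcontinuous i psi x : kernel psi ->
  continuous (fun t => mollify psi (P t i) x).
Proof.
move=> kpsi; apply: mollify_time_continuous => //; [exact: (ms_dsqint sol ^~ i)|].
exact: (ms_dcontinuous sol (i := i)).
Qed.

Lemma mollified_c1_on n i x :
  c1_on (fun t => mollify (eta n) (Q t i) x) (fun t => mollify (eta n) (P t i) x).
Proof.
apply: (@c1_on_primitive _ (mollify (eta n) (Q 0 i) x)); first exact: mollified_dcontinuous.
move=> B dB t t0; apply: (@weak_first_order R (fun t => mollify (eta n) (Q t i) x)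
  (fun t => mollify (eta n) (P t i) x)) => //.
- exact: mollified_continuous.
- exact: mollified_dcontinuous.
- exact: (ms_first sol).
Qed.

Lemma kernel_c1_on i psi x : kernel psi ->
  c1_on (fun t => mollify psi (Q t i) x) (fun t => mollify psi (P t i) x).
Proof.
have [C bC] := ms_dbound sol.
move=> kpsi; apply: (@mollify_c1_on R N eta eta_unit (Q^~ i) (P^~ i) C) => //.
- by move=> t; exact: (ms_sqint sol).
- by move=> t; exact: (ms_dsqint sol).
- exact: (ms_dcontinuous sol).
- by move=> n y; exact: mollified_c1_on.
Qed.

(** Negative times are included by passing to positive parts: the functions are constant there, and
    distances do not increase. *)
Lemma solution_lipschitz : exists2 C : R, 0 <= C &
  forall s t : R, vsqn (vsub (Q t) (Q s)) <= C * (t - s) ^+ 2.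
Proof.
have [C bC] := ms_dbound sol; have C0 : 0 <= C.
  by apply: le_trans (bC 0 (Ordinal hN)); rewrite fine_ge0// sqn_ge0.
exists (\sum_(i < N) C) => [|s t]; first by apply: sumr_ge0.
rewrite mulr_suml; apply: ler_sum => i _.
have QM r : Q r = Q (Num.max r 0).
  by case: (leP r 0) => // r0; rewrite (ms_const sol r0).
have M0 (r : R) : 0 <= Num.max r 0 by rewrite le_max lexx orbT.
rewrite (QM t) (QM s) /vsub.
have := @sqn_time_lipschitz R N eta eta_unit (Q^~ i) (P^~ i) C (ms_sqint sol ^~ i)
  (ms_dsqint sol ^~ i) (ms_dcontinuous sol (i := i)) (bC ^~ i)
  (fun n y => mollified_c1_on n i y) (Num.max s 0) (Num.max t 0) (M0 s) (M0 t).
move=> /le_trans; apply; rewrite ler_wpM2l//.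
case: (leP t 0) => t0; case: (leP s 0) => s0; rewrite ?subrr ?expr0n ?sqr_ge0//.
- rewrite -subr_ge0 (_ : _ - _ = t * (t - 2 * s)); last ring.
  by apply: mulr_le0; lra.
- rewrite -subr_ge0 (_ : _ - _ = s * (s - 2 * t)); last ring.
  by apply: mulr_le0; lra.
Qed.

Lemma nterm_continuous n i x : continuous (fun t => nterm G (eta n) (Q t) i x).
Proof.
have [C C0 lip] := solution_lipschitz.
pose K : R := Num.sqrt (4 * fine (sqn mu (eta n)) * (\int[mu]_y g y) ^+ 2 * C).
have K0 : 0 <= K by exact: sqrtr_ge0.
have a0 : 0 <= fine (sqn mu (eta n)) by rewrite fine_ge0// sqn_ge0.
have c0 : 0 <= 4 * fine (sqn mu (eta n)) * (\int[mu]_y g y) ^+ 2.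
  by rewrite mulr_ge0 ?sqr_ge0// mulr_ge0.
have KK : K ^+ 2 = 4 * fine (sqn mu (eta n)) * (\int[mu]_y g y) ^+ 2 * C.
  by rewrite /K sqr_sqrtr// mulr_ge0.
have nl (s t : R) : `|nterm G (eta n) (Q t) i x - nterm G (eta n) (Q s) i x| <= K * `|t - s|.
  apply: abs_le_of_sqr; first exact: mulr_ge0.
  apply: le_trans (nterm_lipschitz n i x (ms_sqint sol t) (ms_sqint sol s)) _.
  rewrite exprMn real_normK ?num_real// KK -[leRHS]mulrA.
  by apply: ler_wpM2l c0 _ _ _; exact: lip.
move=> t; apply/cvgrPdist_le => e e0.
have K1 : 0 < K + 1 by rewrite ltr_wpDl.
near=> s; apply: le_trans (nl s t) _.
have : `|t - s| <= e / (K + 1).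
  by near: s; apply: cvgr_dist_le; [exact: cvg_id|exact: divr_gt0].
rewrite ler_pdivlMr// => h; apply: le_trans h.
by rewrite mulrC ler_wpM2l// lerDl.
Unshelve. all: by end_near. Qed.

Lemma force_continuous n i x : continuous (fun t => mollified_force (Q t) n i x).
Proof.
move=> t; apply: cvgB; last exact: nterm_continuous.
apply: cvgN; apply: cvgM; first exact: cvg_cst.
by apply: mollified_continuous; apply: kernel_nlap => //; exact: mollifier_bump.
Qed.

Lemma velocity_c1_on n i x :
  [/\ c1_on (fun t => mollify (eta n) (P t i) x) (fun t => mollified_force (Q t) n i x),
      mollify (eta n) (P 0 i) x = mollify (eta n) (v0 i) x &
      mollify (eta n) (Q 0 i) x = mollify (eta n) (u0 i) x].
Proof.
pose p t := mollify (eta n) (P t i) x; pose q t := mollify (eta n) (Q t i) x.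
have cp : continuous p by exact: mollified_dcontinuous.
have [B dB] := primitive_exists cp.
have qE t : 0 <= t -> q t = q 0 + (B t - B 0).
  move=> t0; apply: (@weak_first_order R q p) => //; last exact: (ms_first sol).
  exact: mollified_continuous.
(* [q] is frozen for negative times and may have a corner at 0; [qh] is C^1 on the whole line and
   equals [q] for t >= 0. *)
pose qh t := q 0 + (B t - B 0).
have dq (t : R) : is_derive t 1 qh (p t).
  have := is_deriveD (is_derive_cst (q 0) t 1) (is_deriveB (dB t) (is_derive_cst (B 0) t 1)).
  by rewrite add0r subr0.
have cf := @force_continuous n i x.
have weak theta : test1 theta -> \int[leb]_(t in `[0, +oo[) (qh t * derive1 (derive1 theta) t -
       mollified_force (Q t) n i x * theta t)
    - mollify (eta n) (v0 i) x * theta 0 + mollify (eta n) (u0 i) x * derive1 theta 0 = 0.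
  move=> tth; rewrite -[RHS](ms_second sol n i x tth); congr (_ - _ + _).
  by apply: eq_Rintegral => t; rewrite inE/= in_itv/= andbT => t0; rewrite /qh -qE.
have [l pE] := weak_second_order cp cf dq weak.
split.
- by apply: (@c1_on_primitive _ (mollify (eta n) (v0 i) x)) => //; exact: force_continuous.
- have [F dF] := primitive_exists (@force_continuous n i x).
  by have := pE F dF 0 (lexx 0); rewrite subrr addr0.
- by rewrite -l /qh subrr addr0.
Qed.

End mollified_solutions.

(** * The energy of the difference of two solutions *)

Section energy.
Variables (R : realType) (N : nat) (delta alpha kappa : R).
Local Notation E := 'rV[R]_N.
Local Notation mu := (lebesgue_rV R N).
Local Notation leb := (@lebesgue_measure R).
Local Notation wsemi := (wsemi delta alpha).
Local Notation w := (weight delta alpha).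
Local Notation nlap := (nlap delta alpha).
Local Notation eta := (@mollifier R N).
Hypotheses (delta0 : 0 < delta) (alpha01 : 0 < alpha < 1) (hN : (0 < N)%N).
Hypothesis kappa0 : 0 < kappa.

Lemma wsemi_sub (f h : E -> R) : sqint mu f -> sqint mu h ->
  (wsemi (fun x => f x - h x)%R <= 2%:E * wsemi f + 2%:E * wsemi h)%E.
Proof.
move=> sf sh.
have w0 y : (0 <= (w y)%:E)%E by rewrite lee_fin weight_ge0.
have m f' : measurable_fun setT f' ->
    measurable_fun setT (fun y => (w y)%:E * sqn mu (diffq f' y))%E.
  move=> mf; apply: emeasurable_funM; last exact: measurable_sqn_diffq.
  by apply/measurable_EFinP; exact: measurable_weight.
have p f' y : (0 <= (w y)%:E * sqn mu (diffq f' y))%E by rewrite mule_ge0// sqn_ge0.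
rewrite /wsemi -ge0_integralZl//; last exact: m (proj1 sf).
rewrite -ge0_integralZl//; last exact: m (proj1 sh).
rewrite -ge0_integralD//; [|by move=> y _; rewrite mule_ge0|
  by apply: measurable_funeM; exact: m (proj1 sf)|by move=> y _; rewrite mule_ge0|
  by apply: measurable_funeM; exact: m (proj1 sh)].
apply: ge0_le_integralW => // y.
have sfy := sqint_diffq y sf; have shy := sqintZ (-1) (sqint_diffq y sh).
have := sqn_sub_le sfy shy.
have -> : sqn mu (fun x => -1 * diffq h y x) = sqn mu (diffq h y).
  by apply: eq_integral => x _; congr EFin; ring.
have -> : sqn mu (fun x => diffq f y x + -1 * diffq h y x) =
    sqn mu (diffq (fun x => f x - h x) y).
  by apply: eq_integral => x _; congr EFin; rewrite /diffq; ring.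
move=> le0; rewrite ![(2%:E * (_ * _))%E]muleCA -muleDr//; last first.
  by apply: ge0_adde_def; rewrite inE mule_ge0// sqn_ge0.
exact: lee_wpmul2l.
Qed.

Definition vsemi (h : 'I_N -> E -> R) : R := \sum_i fine (wsemi (h i)).

Variables (G : 'I_N -> E -> E -> R) (g k : E -> R).
Hypothesis mG : forall i, measurable_fun setT (fun z : E * E => G i z.1 z.2).
Hypothesis G_le : forall i y a, `|G i y a| <= g y.
Hypothesis G_lip : forall y a b, enorm (\row_i (G i y a - G i y b)) <= g y * enorm (a - b).
Hypothesis ig : rintegrable mu g.
Hypothesis ik : rintegrable mu k.
Hypothesis k0 : forall y, 0 <= k y.
Hypothesis gk : forall y, g y ^+ 2 <= w y * k y.

Variables (Q P Q' P' : R -> 'I_N -> E -> R) (u0 v0 u0' v0' : 'I_N -> E -> R).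
Hypothesis sol : mollified_solution delta alpha kappa G Q P u0 v0.
Hypothesis sol' : mollified_solution delta alpha kappa G Q' P' u0' v0'.

Let eta_unit := mollifier_approximate_unit R N.
Let kn n : kernel (eta n). Proof. by case: eta_unit. Qed.
Let eta0 n z : 0 <= eta n z. Proof. by case: eta_unit. Qed.
Let young n f : sqint mu f -> (sqn mu (mollify (eta n) f) <= sqn mu f)%E.
Proof. exact: sqn_mollify_unit. Qed.
Let kl n : kernel (nlap (eta n)).
Proof. by apply: kernel_nlap => //; exact: mollifier_bump. Qed.

Let wq t := vsub (Q t) (Q' t).
Let wp t := vsub (P t) (P' t).
Let swq t i : sqint mu (wq t i).
Proof. by apply: sqintB; [exact: ms_sqint sol t i|exact: ms_sqint sol' t i]. Qed.
Let swp t i : sqint mu (wp t i).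
Proof. by apply: sqintB; [exact: ms_dsqint sol t i|exact: ms_dsqint sol' t i]. Qed.

Let wsemi_wq_fin t i : wsemi (wq t i) \is a fin_num.
Proof.
rewrite ge0_fin_numE ?wsemi_ge0//; apply: le_lt_trans (wsemi_sub _ _) _.
- exact: ms_sqint sol t i.
- exact: ms_sqint sol' t i.
apply: lte_add_pinfty; apply: lte_mul_pinfty => //.
- exact: (ms_wsemi sol).
- exact: (ms_wsemi sol').
Qed.

Let energy t : R := vsqn (wp t) + kappa * vsemi (wq t).

(** [a] and [b] below equal [nlap] of [q] and of [p]. With the operator placed on the kernel they
    are mollifications of the difference and of its velocity, so that [b] is the time derivative of
    [a]. *)
Let q n i t := mollify (eta n) (wq t i).
Let p n i t := mollify (eta n) (wp t i).
Let a n i t := mollify (nlap (eta n)) (wq t i).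
Let b n i t := mollify (nlap (eta n)) (wp t i).
Let D n i t x := nterm G (eta n) (Q t) i x - nterm G (eta n) (Q' t) i x.

Let sq n i t : sqint mu (q n i t). Proof. exact: sqint_mollify. Qed.
Let sp n i t : sqint mu (p n i t). Proof. exact: sqint_mollify. Qed.
Let sa n i t : sqint mu (a n i t). Proof. exact: sqint_mollify. Qed.
Let sb n i t : sqint mu (b n i t). Proof. exact: sqint_mollify. Qed.

Let aE n i t : a n i t = nlap (q n i t).
Proof. by rewrite /a /q nlap_mollify//; exact: mollifier_bump. Qed.

Let bE n i t : b n i t = nlap (p n i t).
Proof. by rewrite /b /p nlap_mollify//; exact: mollifier_bump. Qed.

Let mollify_wq psi i t x : kernel psi ->
  mollify psi (wq t i) x = mollify psi (Q t i) x - mollify psi (Q' t i) x.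
Proof.
move=> kpsi; rewrite /wq /vsub mollifyB//; first exact: kernel_sqint.
- exact: ms_sqint sol t i.
- exact: ms_sqint sol' t i.
Qed.

Let mollify_wp psi i t x : kernel psi ->
  mollify psi (wp t i) x = mollify psi (P t i) x - mollify psi (P' t i) x.
Proof.
move=> kpsi; rewrite /wp /vsub mollifyB//; first exact: kernel_sqint.
- exact: ms_dsqint sol t i.
- exact: ms_dsqint sol' t i.
Qed.

Let kernel_c1 psi i x : kernel psi ->
  c1_on (fun t => mollify psi (wq t i) x) (fun t => mollify psi (wp t i) x).
Proof.
move=> kpsi; under eq_fun do rewrite mollify_wq//.
under [X in c1_on _ X]eq_fun do rewrite mollify_wp//.
apply: c1_onB.
- exact: (kernel_c1_on sol).
- exact: (kernel_c1_on sol').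
Qed.

Let force_sub (A A' B B' : R) :
  (- (kappa * A) - B) - (- (kappa * A') - B') = - (kappa * (A - A')) - (B - B').
Proof. by ring. Qed.

Let rate_alg (A B P0 Q0 D0 : R) :
  P0 * (- (kappa * A) - D0) + P0 * (- (kappa * A) - D0) + kappa * (Q0 * B + A * P0) =
  kappa * (Q0 * B - A * P0) - 2 * (P0 * D0).
Proof. by ring. Qed.

Let velocity_c1 n i x :
  c1_on (fun t => p n i t x) (fun t => - (kappa * a n i t x) - D n i t x).
Proof.
have [h _ _] := velocity_c1_on delta0 alpha01 hN mG G_le G_lip ig sol n i x.
have [h' _ _] := velocity_c1_on delta0 alpha01 hN mG G_le G_lip ig sol' n i x.
have := c1_onB h h'.
rewrite (_ : (fun t => mollify _ _ x - _) = (fun t => p n i t x)); last first.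
  by apply/funext => t; rewrite /p mollify_wp.
rewrite (_ : (fun t => _ - _) = (fun t => - (kappa * a n i t x) - D n i t x))//.
by apply/funext => t; rewrite /a mollify_wq//; exact: force_sub.
Qed.

(** At each [x] this is made of products of functions that are C^1 in time. The integral of [q]
    times [a] is the squared seminorm of [q], by [nlap_self]. *)
Let density n x t := \sum_i (p n i t x * p n i t x + kappa * (q n i t x * a n i t x)).

Let rate n x t := kappa * \sum_i (q n i t x * b n i t x - a n i t x * p n i t x) -
  2 * \sum_i p n i t x * D n i t x.

Let density_c1 n x : c1_on (density n x) (rate n x).
Proof.
rewrite (_ : rate n x = fun t => \sum_i (
    (p n i t x * (- (kappa * a n i t x) - D n i t x) +
     p n i t x * (- (kappa * a n i t x) - D n i t x)) +
    kappa * (q n i t x * b n i t x + a n i t x * p n i t x))).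
  apply: c1_on_sum => i; apply: c1_onD.
    by apply: c1_onM; exact: velocity_c1.
  by apply: c1_onZ; apply: c1_onM; exact: kernel_c1.
apply/funext => t; rewrite /rate !mulr_sumr -sumrB; apply: eq_bigr => i _; exact/esym/rate_alg.
Qed.

Let density_integral n t : \int[mu]_x density n x t =
  vsqn (fun i => p n i t) + kappa * vsemi (fun i => q n i t).
Proof.
have ipp i := sqint_mul (sp n i t) (sp n i t).
have iqa i := rintegrableZ kappa (sqint_mul (sq n i t) (sa n i t)).
rewrite /density Rint_sum => [|i]; last exact: rintegrableD.
rewrite mulr_sumr -big_split/=; apply: eq_bigr => i _.
rewrite RintD// RintZ; last exact: sqint_mul.
congr (_ + kappa * _).
have [K dK] := mollify_dominated delta alpha (mollifier_bump R N n) (swq t i).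
rewrite -(nlap_self delta0 alpha01 (sq n i t) dK) -aE.
by apply: eq_Rintegral => x _; rewrite mulrC.
Qed.

(** At a given x the principal terms need not cancel; integrated, they do so by the symmetry of the
    form. *)
Let cross n t i : \int[mu]_x (q n i t x * b n i t x - a n i t x * p n i t x) = 0.
Proof.
have [K dK] := mollify_dominated delta alpha (mollifier_bump R N n) (swq t i).
have [K' dK'] := mollify_dominated delta alpha (mollifier_bump R N n) (swp t i).
rewrite RintB; [|exact: sqint_mul|exact: sqint_mul].
have := nlap_sym delta0 alpha01 (sq n i t) dK (sp n i t) dK'.
rewrite -aE -bE => ->.
have -> : \int[mu]_x (q n i t x * b n i t x) = \int[mu]_x (b n i t x * q n i t x).
  by apply: eq_Rintegral => x _; rewrite mulrC.
exact: subrr.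
Qed.

Let dual_le n t x : `|2 * \sum_i p n i t x * D n i t x| <=
  vnorm (fun i => p n i t) x * majorant g (eta n) (wq t) x.
Proof.
exact: (nterm_sub_le mG G_le G_lip ig hN (kn n) (eta0 n) (fun i => p n i t x) x
  (ms_sqint sol t) (ms_sqint sol' t)).
Qed.

Let lambda := \int[mu]_y k y.
Let lambda0 : 0 <= lambda. Proof. exact: Rint_ge0. Qed.

Let vsqnE (h : 'I_N -> E -> R) : (forall i, sqint mu (h i)) ->
  (\sum_i sqn mu (h i))%E = (vsqn h)%:E.
Proof. by move=> sh; rewrite -sumEFin; apply: eq_bigr => i _; rewrite fineK// sqint_fin_num. Qed.

Let vsqn_p n t : vsqn (fun i => p n i t) <= vsqn (wp t).
Proof.
apply: ler_sum => i _; rewrite -lee_fin !fineK ?sqint_fin_num//; exact: young.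
Qed.

Let dual_integral n t :
  rintegrable mu (fun x => vnorm (fun i => p n i t) x * majorant g (eta n) (wq t) x) /\
  \int[mu]_x (vnorm (fun i => p n i t) x * majorant g (eta n) (wq t) x) <=
    lambda * vsqn (wp t) + vsemi (wq t).
Proof.
have sp' i := sp n i t.
have := majorant_energy G_le ig ik k0 gk hN (kn n) (eta0 n) (@young n) (swq t) sp'.
rewrite vsqnE// (_ : (\sum_i wsemi (wq t i))%E = (vsemi (wq t))%:E); last first.
  by rewrite -sumEFin; apply: eq_bigr => i _; rewrite fineK.
rewrite -EFinM -EFinD => h.
have i1 : rintegrable mu (fun x => vnorm (fun i => p n i t) x * majorant g (eta n) (wq t) x).
  apply: ge0_rintegrable => [|x|]; last exact: le_lt_trans h (ltry _).
  - apply: measurable_funM; first by case: (sqint_vnorm sp').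
    by apply: measurable_majorant; [exact: ig|exact: kn|exact: swq].
  - rewrite mulr_ge0 ?vnorm_ge0//.
    by have /andP[] := majorant_bound G_le ig hN (kn n) (eta0 n) x (swq t).
split => //; rewrite -lee_fin EFin_Rint//; apply: le_trans h _.
by rewrite lee_fin lerD2r ler_wpM2l.
Qed.

Let measurable_D n i t : measurable_fun setT (D n i t).
Proof.
by apply: measurable_funB; apply: (measurable_nterm mG (kn n)) => j;
  [case: (ms_sqint sol t j)|case: (ms_sqint sol' t j)].
Qed.

Let idual n t : rintegrable mu (fun x => 2 * \sum_i p n i t x * D n i t x).
Proof.
have [h _] := dual_integral n t; apply: rintegrable_le h => [|x]; last exact: dual_le.
apply: measurable_funM; first exact: measurable_cst.
apply: measurable_sum => i; apply: measurable_funM; last exact: measurable_D.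
by case: (sp n i t).
Qed.

Let icross n t i : rintegrable mu (fun x => q n i t x * b n i t x - a n i t x * p n i t x).
Proof. by apply: rintegrableB; exact: sqint_mul. Qed.

Let icrosses n t : rintegrable mu
  (fun x => kappa * \sum_i (q n i t x * b n i t x - a n i t x * p n i t x)).
Proof. by apply: rintegrableZ; exact: rintegrable_sum. Qed.

Let irate n t : rintegrable mu (fun x => rate n x t).
Proof. exact: rintegrableB. Qed.

Let vsemi_wq0 t : 0 <= vsemi (wq t).
Proof. by apply: sumr_ge0 => i _; rewrite fine_ge0// wsemi_ge0. Qed.

Let vsqn_ge0 (h : 'I_N -> E -> R) : 0 <= vsqn h.
Proof. by apply: sumr_ge0 => i _; rewrite fine_ge0// sqn_ge0. Qed.

Let rate_integral n t : \int[mu]_x rate n x t <= (lambda + kappa^-1) * energy t.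
Proof.
have [i1 le1] := dual_integral n t.
rewrite /rate RintB// RintZ; last exact: rintegrable_sum.
rewrite Rint_sum// big1 ?mulr0 ?sub0r; last by move=> i _; exact: cross.
have le2 : - (\int[mu]_x (2 * \sum_i p n i t x * D n i t x)) <= lambda * vsqn (wp t) + vsemi (wq t).
  apply: le_trans le1; rewrite -mulN1r -RintZ//; apply: Rint_le => //.
    exact: rintegrableZ.
  move=> x; rewrite mulN1r; apply: le_trans (dual_le n t x).
  by rewrite -normrN ler_norm.
apply: (le_trans le2); rewrite /energy.
have vp0 := vsqn_ge0 (wp t); have vs0 := vsemi_wq0 t.
have ki : 0 < kappa^-1 by rewrite invr_gt0.
(* Expanding (lambda + 1/kappa)(|p|^2 + kappa [q]^2) gives the bound already found plus two
   nonnegative mixed terms. *)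
rewrite (_ : (lambda + kappa^-1) * _ = lambda * vsqn (wp t) + vsemi (wq t) +
  (kappa^-1 * vsqn (wp t) + lambda * kappa * vsemi (wq t))).
  rewrite lerDl; apply: addr_ge0; apply: mulr_ge0 => //; first exact: ltW.
  by apply: mulr_ge0 => //; exact: ltW.
by move: (vsqn _) (vsemi _) => s1 s2; field; rewrite gt_eqF.
Qed.

Let vbound T : exists2 M : R, 0 <= M & forall t, t <= T ->
  [/\ forall i, fine (sqn mu (wq t i)) <= M, forall i, fine (sqn mu (wp t i)) <= M &
      forall i, fine (wsemi (wq t i)) <= M].
Proof.
have [C1 b1] := ms_bound sol T; have [C2 b2] := ms_bound sol' T.
have [C3 b3] := ms_dbound sol; have [C4 b4] := ms_dbound sol'.
have fine_sqn0 f : 0 <= fine (sqn mu f) by rewrite fine_ge0// sqn_ge0.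
have fine_sub f h c c' : sqint mu f -> sqint mu h -> fine (sqn mu f) <= c ->
    fine (sqn mu h) <= c' -> fine (sqn mu (fun x => f x - h x)) <= 2 * c + 2 * c'.
  move=> sf sh fc hc; have sNh := sqintZ (-1) sh; have := sqn_sub_le sf sNh.
  have -> : sqn mu (fun x => -1 * h x) = sqn mu h.
    by apply: eq_integral => x _; congr EFin; ring.
  have -> : sqn mu (fun x => f x + -1 * h x) = sqn mu (fun x => f x - h x).
    by apply: eq_integral => x _; congr EFin; ring.
  rewrite -(fineK (sqint_fin_num sf)) -(fineK (sqint_fin_num sh)).
  rewrite -(fineK (sqint_fin_num (sqintB sf sh))) -!EFinM -EFinD lee_fin => h'.
  by apply: (le_trans h'); apply: lerD; rewrite ler_pM2l.
pose M := 2 * `|C1| + 2 * `|C2| + (2 * `|C3| + 2 * `|C4|).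
have M0 : 0 <= M by rewrite !addr_ge0// mulr_ge0.
exists M => // t tT; have le1 : 2 * C1 + 2 * C2 <= M.
  have := ler_norm C1; have := ler_norm C2; have := normr_ge0 C3; have := normr_ge0 C4.
  by rewrite /M; lra.
have le2 : 2 * C3 + 2 * C4 <= M.
  have := ler_norm C3; have := ler_norm C4; have := normr_ge0 C1; have := normr_ge0 C2.
  by rewrite /M; lra.
split => i.
- apply: le_trans le1; apply: fine_sub.
  + exact: ms_sqint sol t i.
  + exact: ms_sqint sol' t i.
  + by have [] := b1 t i tT.
  + by have [] := b2 t i tT.
- apply: le_trans le2; apply: fine_sub => //.
  + exact: ms_dsqint sol t i.
  + exact: ms_dsqint sol' t i.
- apply: le_trans le1.
  have := wsemi_sub (ms_sqint sol t i) (ms_sqint sol' t i).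
  have f1 : wsemi (Q t i) \is a fin_num by rewrite ge0_fin_numE ?wsemi_ge0// (ms_wsemi sol).
  have f2 : wsemi (Q' t i) \is a fin_num by rewrite ge0_fin_numE ?wsemi_ge0// (ms_wsemi sol').
  rewrite -[X in (X <= _)%E](fineK (wsemi_wq_fin t i)).
  rewrite -[X in (_ <= _ * X + _)%E](fineK f1) -[X in (_ <= _ + _ * X)%E](fineK f2).
  rewrite -!EFinM -EFinD lee_fin => h.
  have [_ h1] := b1 t i tT; have [_ h2] := b2 t i tT.
  by apply: (le_trans h); apply: lerD; rewrite ler_pM2l.
Qed.

(** A crude bound that serves only to exchange the integrals in time and space; through [L] it
    depends on [n]. *)
Let rate_norm n T : exists C : R, forall t, t <= T ->
  (\int[mu]_x `|rate n x t|%:E <= C%:E)%E.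
Proof.
have [M M0 bM] := vbound T.
pose L := l1norm (nlap (eta n)) ^+ 2; have L0 : 0 <= L by exact: sqr_ge0.
exists (kappa * \sum_(i < N) (M + L * M + (L * M + M)) +
        (lambda * \sum_(i < N) M + \sum_(i < N) M)) => t tT.
have [b1 b2 b3] := bM t tT; have [i1 le1] := dual_integral n t.
rewrite -EFin_Rint ?lee_fin; last exact: rintegrable_norm.
have sqs f := @sqint_sqr _ _ _ mu f.
have is4 i : rintegrable mu (fun x => (q n i t x ^+ 2 + b n i t x ^+ 2) +
    (a n i t x ^+ 2 + p n i t x ^+ 2)).
  by apply: rintegrableD; apply: rintegrableD; exact: sqs.
have iS : rintegrable mu (fun x => kappa * \sum_i ((q n i t x ^+ 2 + b n i t x ^+ 2) +
    (a n i t x ^+ 2 + p n i t x ^+ 2))).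
  by apply: rintegrableZ; exact: rintegrable_sum.
apply: (@le_trans _ _ (\int[mu]_x (kappa * \sum_i ((q n i t x ^+ 2 + b n i t x ^+ 2) +
    (a n i t x ^+ 2 + p n i t x ^+ 2)) +
    vnorm (fun i => p n i t) x * majorant g (eta n) (wq t) x))).
  apply: Rint_le; [exact: rintegrable_norm|exact: rintegrableD|] => x.
  apply: le_trans (ler_normB _ _) _; apply: lerD; last exact: dual_le.
  rewrite normrM gtr0_norm// ler_pM2l//; apply: le_trans (ler_norm_sum _ _ _) _.
  apply: ler_sum => i _; apply: le_trans (ler_normB _ _) _.
  have pm (u v : R) : `|u * v| <= u ^+ 2 + v ^+ 2.
    by rewrite ler_norml; apply/andP; split; nra.
  by apply: lerD; exact: pm.
rewrite RintD// RintZ; last exact: rintegrable_sum.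
apply: lerD; last first.
  apply: (le_trans le1); apply: lerD; last by apply: ler_sum.
  by rewrite ler_wpM2l//; apply: ler_sum.
rewrite ler_pM2l// Rint_sum//; apply: ler_sum => i _.
rewrite RintD; [|by apply: rintegrableD; exact: sqs|by apply: rintegrableD; exact: sqs].
rewrite !RintD; [|exact: sqs..].
have le_unit f : sqint mu f -> fine (sqn mu f) <= M ->
    \int[mu]_x mollify (eta n) f x ^+ 2 <= M.
  move=> sf; apply: le_trans.
  have sm := sqint_mollify (kn n) sf.
  by rewrite -[leLHS]/(fine (sqn mu _)) -lee_fin !fineK ?sqint_fin_num//; exact: young.
have le_lap f : sqint mu f -> fine (sqn mu f) <= M ->
    \int[mu]_x mollify (nlap (eta n)) f x ^+ 2 <= L * M.
  move=> sf fM; apply: (@le_trans _ _ (L * fine (sqn mu f))); last by rewrite ler_wpM2l.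
  have sm := sqint_mollify (kl n) sf.
  rewrite -[leLHS]/(fine (sqn mu _)) -lee_fin EFinM !fineK ?sqint_fin_num//.
  exact: sqn_mollify.
by apply: lerD; apply: lerD; [exact: le_unit|exact: le_lap|exact: le_lap|exact: le_unit].
Qed.

Let measurable_rate n t : measurable_fun setT (fun x => rate n x t).
Proof. exact: rintegrable_measurable (irate n t). Qed.

Let mollify_wq_cont psi i x : kernel psi -> continuous (fun t => mollify psi (wq t i) x).
Proof.
move=> kpsi; under eq_fun do rewrite mollify_wq//.
by move=> t; apply: cvgB; [exact: (mollified_continuous sol)|exact: (mollified_continuous sol')].
Qed.

Let mollify_wp_cont psi i x : kernel psi -> continuous (fun t => mollify psi (wp t i) x).
Proof.
move=> kpsi; under eq_fun do rewrite mollify_wp//.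
by move=> t; apply: cvgB; [exact: (mollified_dcontinuous sol)|exact: (mollified_dcontinuous sol')].
Qed.

Let D_cont n i x : continuous (fun t => D n i t x).
Proof.
move=> t; apply: cvgB.
- exact: (nterm_continuous hN mG G_le G_lip ig sol).
- exact: (nterm_continuous hN mG G_le G_lip ig sol').
Qed.

Let cvg_bigsum (F : 'I_N -> R -> R) : (forall i, continuous (F i)) ->
  continuous (fun t => \sum_i F i t).
Proof.
move=> cF t; elim: (index_enum _) => [|i r IH].
  have -> : (fun s => \sum_(i <- [::]) F i s) = fun=> 0 by apply/funext => s; rewrite big_nil.
  exact: cst_continuous.
have -> : (fun s => \sum_(j <- i :: r) F j s) = (fun s => F i s + \sum_(j <- r) F j s).
  by apply/funext => s; rewrite big_cons.
by apply: cvgD; [exact: cF|exact: IH].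
Qed.

Let rate_cont n x : continuous (rate n x).
Proof.
move=> t; apply: cvgB.
  apply: cvgM; first exact: cvg_cst.
  apply: (@cvg_bigsum (fun i t => q n i t x * b n i t x - a n i t x * p n i t x)) => i s.
  by apply: cvgB; apply: cvgM; [exact: mollify_wq_cont|exact: mollify_wp_cont|
    exact: mollify_wq_cont|exact: mollify_wp_cont].
apply: cvgM; first exact: cvg_cst.
apply: (@cvg_bigsum (fun i t => p n i t x * D n i t x)) => i s.
by apply: cvgM; [exact: mollify_wp_cont|exact: D_cont].
Qed.

Let mollified_energy n t : R := vsqn (fun i => p n i t) + kappa * vsemi (fun i => q n i t).

(** At each x the increment of the density is the time integral of [rate]; the integrals are
    exchanged and [rate_integral] bounds the inner one. *)
Let mollified_energy_le n T (Y : R -> R) : 0 <= T -> continuous Y ->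
  (forall t, 0 <= t <= T -> energy t <= Y t) ->
  mollified_energy n T <= mollified_energy n 0 +
    (lambda + kappa^-1) * \int[leb]_(t in `[0, T]) Y t.
Proof.
move=> T0 cY eY; rewrite /mollified_energy -2!density_integral -lerBlDl.
have [C bC] := rate_norm n T.
have idens s : rintegrable mu (fun x => density n x s).
  apply: rintegrable_sum => i; apply: rintegrableD; first exact: sqint_mul.
  by apply: rintegrableZ; exact: sqint_mul.
have bC' t : 0 <= t <= T -> (\int[mu]_x `|rate n x t|%:E <= C%:E)%E.
  by case/andP => _; exact: bC.
rewrite -RintB//.
have -> : \int[mu]_x (density n x T - density n x 0) =
    \int[mu]_x \int[leb]_(t in `[0, T]) rate n x t.
  by apply: eq_Rintegral => x _; rewrite (c1_on_ftc (density_c1 n x) T0).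
rewrite (segment_fubini (measurable_rate n) (@rate_cont n) bC').
have iY := continuous_integrable_segment 0 T cY.
rewrite -RintegralZl//; apply: le_Rintegral => //.
- exact: (segment_integrable_inner (measurable_rate n) (@rate_cont n) bC').
- by apply: continuous_integrable_segment => t; apply: cvgM; [exact: cvg_cst|exact: cY].
move=> t; rewrite /= in_itv/= => tT; apply: le_trans (rate_integral n t) _.
by rewrite ler_wpM2l ?eY// addr_ge0// invr_ge0 ltW.
Qed.

Hypothesis su0 : forall i, sqint mu (u0 i).
Hypothesis su0' : forall i, sqint mu (u0' i).
Hypothesis sv0 : forall i, sqint mu (v0 i).
Hypothesis sv0' : forall i, sqint mu (v0' i).
Hypothesis wu0 : forall i, (wsemi (vsub u0 u0' i) < +oo)%E.

Let energy0 : R := vsqn (vsub v0 v0') + kappa * vsemi (vsub u0 u0').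

Let mollified_energy0 n : mollified_energy n 0 <= energy0.
Proof.
have pE i : p n i 0 = mollify (eta n) (vsub v0 v0' i).
  apply/funext => x; rewrite /p mollify_wp// /vsub mollifyB//; last exact: kernel_sqint.
  have [_ -> _] := velocity_c1_on delta0 alpha01 hN mG G_le G_lip ig sol n i x.
  by have [_ -> _] := velocity_c1_on delta0 alpha01 hN mG G_le G_lip ig sol' n i x.
have qE i : q n i 0 = mollify (eta n) (vsub u0 u0' i).
  apply/funext => x; rewrite /q mollify_wq// /vsub mollifyB//; last exact: kernel_sqint.
  have [_ _ ->] := velocity_c1_on delta0 alpha01 hN mG G_le G_lip ig sol n i x.
  by have [_ _ ->] := velocity_c1_on delta0 alpha01 hN mG G_le G_lip ig sol' n i x.
have su i : sqint mu (vsub u0 u0' i) by exact: sqintB.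
have sv i : sqint mu (vsub v0 v0' i) by exact: sqintB.
apply: lerD.
  apply: ler_sum => i _; rewrite pE -lee_fin !fineK ?sqint_fin_num//.
    exact: young.
  exact: sqint_mollify.
apply: ler_wpM2l (ltW kappa0) _ _ _; apply: ler_sum => i _; rewrite qE.
have le1 := wsemi_mollify_le delta alpha eta_unit n (su i).
have f1 : wsemi (vsub u0 u0' i) \is a fin_num by rewrite ge0_fin_numE// wsemi_ge0.
have f2 : wsemi (mollify (eta n) (vsub u0 u0' i)) \is a fin_num.
  by rewrite ge0_fin_numE ?wsemi_ge0//; exact: le_lt_trans le1 (wu0 i).
exact: (fine_le f2 f1 le1).
Qed.

Let fine_le_add (x y : \bar R) (d : R) : x \is a fin_num -> y \is a fin_num ->
  (x <= y + d%:E)%E -> fine x <= fine y + d.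
Proof. by move=> /fineK<- /fineK<-; rewrite -EFinD lee_fin. Qed.

Let energy_near t (e : R) : 0 < e -> \forall n \near \oo, energy t <= mollified_energy n t + e.
Proof.
(* Each of the two sums has N components, and the second carries the factor [kappa]; together their
   errors make up [e]. *)
move=> e0; pose d := e / (N%:R * (1 + kappa)).
have N0 : 0 < N%:R :> R by rewrite ltr0n.
have K0 : 0 < 1 + kappa by rewrite addr_gt0.
have d0 : 0 < d by rewrite divr_gt0// mulr_gt0.
have h1 : \forall n \near \oo, forall i, fine (sqn mu (wp t i)) <= fine (sqn mu (p n i t)) + d.
  apply: filter_forall => i; have := sqn_mollify_near eta_unit (swp t i) d0.
  apply: filterS => n; apply: fine_le_add.
  - exact: sqint_fin_num (swp t i).
  - exact: sqint_fin_num (sp n i t).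
have h2 : \forall n \near \oo, forall i, fine (wsemi (wq t i)) <= fine (wsemi (q n i t)) + d.
  apply: filter_forall => i.
  have wf : (wsemi (wq t i) < +oo)%E by rewrite -ge0_fin_numE ?wsemi_ge0.
  have := wsemi_mollify_near eta_unit (swq t i) wf d0.
  apply: filterS => n; apply: fine_le_add; first exact: wsemi_wq_fin.
  have m0 : (0 <= wsemi (mollify (eta n) (wq t i)))%E by exact: wsemi_ge0.
  rewrite (ge0_fin_numE m0).
  exact: le_lt_trans (wsemi_mollify_le delta alpha eta_unit n (swq t i)) wf.
near=> n.
have g1 : vsqn (wp t) <= vsqn (fun i => p n i t) + N%:R * d.
  have -> : N%:R * d = \sum_(i < N) d by rewrite sumr_const card_ord mulr_natl.
  rewrite -big_split/=; apply: ler_sum => i _; move: i.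
  by near: n.
have g2 : vsemi (wq t) <= vsemi (fun i => q n i t) + N%:R * d.
  have -> : N%:R * d = \sum_(i < N) d by rewrite sumr_const card_ord mulr_natl.
  rewrite -big_split/=; apply: ler_sum => i _; move: i.
  by near: n.
have -> : e = N%:R * d + kappa * (N%:R * d).
  by rewrite /d; field; rewrite (gt_eqF N0) (gt_eqF K0).
rewrite /energy /mollified_energy addrACA -mulrDr; apply: lerD => //.
by rewrite ler_pM2l.
Unshelve. all: by end_near. Qed.

Theorem energy_estimate t : 0 <= t ->
  vsqn (vsub (P t) (P' t)) + kappa * vsemi (vsub (Q t) (Q' t)) <=
  (vsqn (vsub v0 v0') + kappa * vsemi (vsub u0 u0')) * expR ((lambda + kappa^-1) * t).
Proof.
move=> t0; have c0 : 0 < lambda + kappa^-1 by rewrite ltr_wpDl// invr_gt0.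
have [M M0 bM] := vbound t.
apply: (@gronwall_majorant R energy energy0 (\sum_(i < N) M + kappa * \sum_(i < N) M) _ t) => //.
- rewrite addr_ge0 ?vsqn_ge0// mulr_ge0 ?(ltW kappa0)//.
  by apply: sumr_ge0 => i _; rewrite fine_ge0// wsemi_ge0.
- by rewrite addr_ge0 ?mulr_ge0 ?(ltW kappa0)//; apply: sumr_ge0.
- move=> s /andP[_ st]; have [_ b1 b2] := bM s st.
  apply: lerD; first exact: ler_sum.
  by rewrite ler_pM2l//; exact: ler_sum.
(* A single index [n], chosen for [s] and [e], suffices: the bound on the mollified energy does not
   depend on [n]. *)
- move=> Y cY eY s /andP[s0 st]; apply/ler_addgt0Pr => e e0.
  have [n _ /(_ n (leqnn n)) h] := energy_near s e0.
  apply: (le_trans h); rewrite lerD2r.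
  apply: le_trans (mollified_energy_le n s0 cY _) _.
    by move=> r /andP[r0 rs]; apply: eY; rewrite r0 (le_trans rs).
  by apply: lerD; [exact: mollified_energy0|exact: lexx].
- by rewrite t0 lexx.
Qed.

End energy.

(** * The nonlinear part of f *)

Section directional_derivatives.
Variables (R : realType) (V : normedModType R) (F : V -> R) (D : set V).
Hypothesis oD : open D.
Hypothesis hF : class_C 1 D F.

Lemma line_is_derive (p w : V) (r : R) : derivable F (p + r *: w) w ->
  is_derive r 1 (fun r : R => F (p + r *: w)) ('D_w F (p + r *: w)).
Proof.
move=> dF; pose l := 'D_w F (p + r *: w).
have h : h^-1 *: (F (p + (h *: 1 + r) *: w) - F (p + r *: w)) @[h --> (0 : R)^'] --> l.
  apply: cvg_trans dF; apply: near_eq_cvg; apply: nearW => h /=.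
  by rewrite [h *: 1](mulr1 h) scalerDl addrCA.
by apply: DeriveDef; [apply/cvg_ex; exists l; exact: h|exact/cvg_lim].
Qed.

Let dF v z : D z -> derivable F z v. Proof. by move=> Dz; have [_ /(_ v)[h _]] := hF; exact: h. Qed.

Let cF v z : D z -> {for z, continuous ('D_v F)}.
Proof. by move=> Dz; have [_ /(_ v)[_ [h _]]] := hF; exact: h. Qed.

Lemma derive_dirZ z c v : D z -> 'D_(c *: v) F z = c * 'D_v F z.
Proof.
move=> Dz.
have d1 : is_derive (c * 0 : R) 1 (fun r : R => F (z + r *: v)) ('D_v F z).
  have := @line_is_derive z v (c * 0).
  by rewrite mulr0 scale0r addr0; apply; exact: (@dF v z Dz).
have d2 : is_derive (0 : R) 1 (fun r : R => c * r) c.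
  by have := is_deriveZ c (is_derive_id (0 : R) 1); rewrite /GRing.scale/= mulr1.
have [_ e3] := @is_derive1_comp R _ (fun r : R => c * r) 0 _ _ d1 d2.
have := @line_is_derive z (c *: v) 0.
rewrite scale0r addr0 => /(_ (@dF _ _ Dz)) [_ <-].
have -> : (fun r : R => F (z + r *: (c *: v))) = (fun r : R => F (z + r *: v)) \o [eta *%R c].
  by apply/funext => r /=; rewrite scalerA mulrC.
by rewrite e3 mulrC.
Qed.

(** [class_C] provides directional derivatives only, so that additivity must come from their
    continuity: the step along [w] starts from z + h v, and the mean value theorem places its
    derivative near [z]. *)
Lemma derive_dirD z v w : D z -> 'D_(v + w) F z = 'D_v F z + 'D_w F z.
Proof.
move=> Dz; apply/eqP; rewrite -subr_eq0 -normr_le0; apply/ler_addgt0Pr => e e0.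
have e3 : 0 < e / 3 by rewrite divr_gt0.
have near_quot u : exists2 d : R, 0 < d & forall h : R, 0 < h < d ->
    `|h^-1 * (F (z + h *: u) - F z) - 'D_u F z| <= e / 3.
  have := @dF u z Dz => /cvgrPdist_le /(_ _ e3) /nbhs_ballP[d /= d0 hd].
  exists d => // h /andP[h0 hd'].
  have := hd h; rewrite /ball/= sub0r normrN gtr0_norm// => /(_ hd').
  rewrite gt_eqF// => /(_ isT); rewrite distrC [z + _]addrC; exact.
have [d1 d10 h1] := near_quot (v + w); have [d2 d20 h2] := near_quot v.
have : \forall y \near z, D y /\ `|'D_w F z - 'D_w F y| <= e / 3.
  apply: filterI; first exact: open_nbhs_nbhs.
  by have := @cF w z Dz => /cvgrPdist_le /(_ _ e3).
move=> /nbhs_ballP[d3 /= d30 h3].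
have m0 : 0 < `|v| + `|w| + 1 by rewrite ltr_wpDl// addr_ge0.
pose h : R := Num.min (Num.min d1 d2) (d3 / (`|v| + `|w| + 1)) / 2.
have M0 : 0 < Num.min (Num.min d1 d2) (d3 / (`|v| + `|w| + 1)).
  by rewrite !lt_min d10 d20/= divr_gt0.
have h0 : 0 < h by rewrite divr_gt0.
have hM : h < Num.min (Num.min d1 d2) (d3 / (`|v| + `|w| + 1)).
  by rewrite /h ltr_pdivrMr// mulr_natr mulr2n ltrDl.
move: hM; rewrite !lt_min => /andP[/andP[hd1 hd2]]; rewrite ltr_pdivlMr// => hd3.
have inball (c : R) : 0 <= c <= h -> ball z d3 (z + h *: v + c *: w).
  move=> /andP[c0 ch]; rewrite -ball_normE/= opprD addrA opprD addrA subrr sub0r -opprD normrN.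
  apply: le_lt_trans hd3; apply: le_trans (ler_normD _ _) _.
  have nv : `|h *: v| = h * `|v| by rewrite normrZ; congr (_ * _); exact: gtr0_norm.
  have nw : `|c *: w| = c * `|w| by rewrite normrZ; congr (_ * _); exact: ger0_norm.
  rewrite nv nw !mulrDr mulr1 -addrA lerD2l.
  by rewrite -[leLHS]addr0 lerD ?(ltW h0)// ler_wpM2r.
have [||c cst E] := @MVT_segment R (fun r => F (z + h *: v + r *: w))
    (fun r => 'D_w F (z + h *: v + r *: w)) 0 h (ltW h0).
- move=> r; rewrite in_itv/= => /andP[r0 rh]; apply: line_is_derive; apply: dF.
  by have [] := h3 _ (inball r _); rewrite ?(ltW r0) ?(ltW rh).
- apply: derivable_within_continuous => r; rewrite in_itv/= => rh.
  have : derivable F (z + h *: v + r *: w) w by apply: dF; have [] := h3 _ (inball r rh).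
  by move=> /line_is_derive[].
rewrite scale0r addr0 subr0 in E.
have {}cst : 0 <= c <= h by move: cst; rewrite in_itv.
have [_ h3c] := h3 _ (inball c cst).
have q1 := h1 h; have q2 := h2 h; rewrite h0 hd1 in q1; rewrite h0 hd2 in q2.
have {}q1 := q1 isT; have {}q2 := q2 isT.
rewrite scalerDr addrA in q1.
have E' : h^-1 * (F (z + h *: v + h *: w) - F (z + h *: v)) = 'D_w F (z + h *: v + c *: w).
  by rewrite E mulrC mulfK ?gt_eqF.
rewrite add0r; move: q1 q2 h3c; rewrite -E'.
have -> : h^-1 * (F (z + h *: v + h *: w) - F z) =
  h^-1 * (F (z + h *: v + h *: w) - F (z + h *: v)) + h^-1 * (F (z + h *: v) - F z) by ring.
move: (h^-1 * (F (z + h *: v + h *: w) - F (z + h *: v))) (h^-1 * (F (z + h *: v) - F z)).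
move: ('D_(v + w) F z) ('D_v F z) ('D_w F z) => a b c' s t.
rewrite !ler_norml => /andP[a1 a2] /andP[b1 b2] /andP[c1 c2].
by apply/andP; split; lra.
Qed.

Lemma derive_dir_sum z (I : Type) (r : seq I) (c : I -> R) (v : I -> V) : D z ->
  'D_(\sum_(i <- r) c i *: v i) F z = \sum_(i <- r) c i * 'D_(v i) F z.
Proof.
move=> Dz; elim: r => [|i r IH]; first by rewrite !big_nil derive0.
by rewrite !big_cons derive_dirD// IH derive_dirZ.
Qed.

End directional_derivatives.

(** * The operator norm *)

Section operator_norm.
Variables (R : realType) (N : nat).
Local Notation E := 'rV[R]_N.

Lemma enormZ c (x : E) : enorm (c *: x) = `|c| * enorm x.
Proof.
apply/eqP; rewrite -(@eqrXn2 _ 2) ?enorm_ge0 ?mulr_ge0 ?enorm_ge0// exprMn !enorm_sqr.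
by rewrite real_normK ?num_real// mulr_sumr; apply/eqP/eq_bigr => i _; rewrite mxE exprMn.
Qed.

Lemma enorm_le_sum (x : E) : enorm x <= \sum_i `|x ord0 i|.
Proof.
have s0 : 0 <= \sum_i `|x ord0 i| by apply: sumr_ge0.
rewrite -(@ler_sqr _ (enorm x)) ?nnegrE ?enorm_ge0// enorm_sqr expr2 mulr_suml.
apply: ler_sum => i _; rewrite -[x ord0 i ^+ 2]real_normK ?num_real// expr2 ler_wpM2l//.
by rewrite (bigD1 i)//= lerDl sumr_ge0.
Qed.

Lemma opnorm_bound (A : 'M[R]_N) (x : E) : enorm (x *m A) <= opnorm A * enorm x.
Proof.
pose S := [set enorm (x *m A) | x in [set x : E | enorm x <= 1]].
(* A supremum is an upper bound only for a set that is bounded above; the entries of [A] provide a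
   bound. *)
have ubS : has_ubound S.
  exists (\sum_j \sum_i `|A i j|) => _ [z /= z1 <-].
  apply: le_trans (enorm_le_sum _) _; apply: ler_sum => j _; rewrite mxE.
  apply: le_trans (ler_norm_sum _ _ _) _; apply: ler_sum => i _.
  by rewrite normrM ler_piMl// (le_trans (coor_le_enorm _ _)).
have [->|x0] := eqVneq x 0; first by rewrite mul0mx enorm0 mulr0.
have xn : 0 < enorm x by rewrite enorm_gt0.
rewrite -ler_pdivrMr//; apply: ub_le_sup => //.
exists ((enorm x)^-1 *: x); first by rewrite /= enormZ gtr0_norm ?invr_gt0// mulVf ?gt_eqF.
by rewrite -scalemxAl enormZ gtr0_norm ?invr_gt0// mulrC.
Qed.

End operator_norm.

(** * The gradient of Psi *)

Section nonlinear_part.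
Variables (R : realType) (N : nat).
Local Notation E := 'rV[R]_N.
Variables (f : E * E -> E) (Phi Psi : E * E -> R) (kappa alpha : R) (g : E -> R).
Hypothesis Phi_C2 : class_C 2 Omega Phi.
Hypothesis f_grad : forall z, Omega z -> f z = grad_u Phi z.
Hypothesis PhiE : forall y u, Omega (y, u) -> Phi (y, u) =
  kappa * (enorm u ^+ 2 / enorm y `^ (N%:R + 2 * alpha)) + Psi (y, u).
Hypothesis Psi_grad : forall y u, Omega (y, u) -> enorm (grad_u Psi (y, u)) <= g y.
Hypothesis Psi_hess : forall y u, Omega (y, u) -> opnorm (hess_u Psi (y, u)) <= g y.

Let c (y : E) : R := (enorm y `^ (N%:R + 2 * alpha))^-1.
Let e (i : 'I_N) : E * E := (0, delta_mx ord0 i).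

(** The subtracted term is the gradient of the quadratic part of [Phi], so that on [Omega] the
    gradient of [Psi] remains. *)
Definition nonlinear_part (i : 'I_N) (y u : E) : R :=
  f (y, u) ord0 i - 2 * kappa * c y * u ord0 i.

Lemma open_Omega : open (@Omega R N).
Proof.
have -> : @Omega R N = fst @^-1` (~` [set 0]).
  by apply/seteqP; split => z /=; [move/eqP|move=> h; apply/eqP].
apply: open_comp; first by move=> z _; exact: cvg_fst.
by apply: closed_openC; apply: accessible_closed_set1; apply: hausdorff_accessible; exact: norm_hausdorff.
Qed.

Let Phi_derivable z v : Omega z -> derivable Phi z v.
Proof. by move=> Oz; have [_ /(_ v)[h _]] := Phi_C2; exact: h. Qed.

Let A_C1 v : class_C 1 Omega ('D_v Phi).
Proof. by have [_ /(_ v)[]] := Phi_C2. Qed.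

Let fE z i : Omega z -> f z ord0 i = 'D_(e i) Phi z.
Proof. by move=> Oz; rewrite f_grad// mxE. Qed.

Let quad (z : E * E) : R := kappa * (enorm z.2 ^+ 2 * c z.1).

Let quad_is_derive z i : is_derive z (e i) quad (2 * kappa * c z.1 * z.2 ord0 i).
Proof.
have expand h : quad (h *: e i + z) = quad z + h * (2 * kappa * c z.1 * z.2 ord0 i) +
    h ^+ 2 * (kappa * c z.1).
  rewrite /quad /e/= scaler0 add0r !enorm_sqr (bigD1 i)//= [in RHS](bigD1 i)//=.
  rewrite !mxE !eqxx mulr1; under eq_bigr => j ji.
    rewrite !mxE (negbTE ji) andbF mulr0 add0r; over.
  by move: (\sum_(j | _) _) => s; ring.
have h : h^-1 *: (quad (h *: e i + z) - quad z) @[h --> (0 : R)^'] -->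
    2 * kappa * c z.1 * z.2 ord0 i.
  have lim : (2 * kappa * c z.1 * z.2 ord0 i + h * (kappa * c z.1)) @[h --> (0 : R)^'] -->
      2 * kappa * c z.1 * z.2 ord0 i + 0 * (kappa * c z.1).
    apply: cvgD; first exact: cvg_cst.
    apply: cvgM; last exact: cvg_cst.
    exact: cvg_within.
  rewrite mul0r addr0 in lim; apply: cvg_trans lim; apply: near_eq_cvg.
  near=> h; have h0 : h != 0 by near: h; exact: nbhs_dnbhs_neq.
  rewrite expand /GRing.scale/=; by field.
by apply: DeriveDef; [apply/cvg_ex; eexists; exact: h|exact/cvg_lim].
Unshelve. all: by end_near. Qed.

Let near_Omega (z : E * E) : Omega z -> \forall z' \near z, (@Omega R N) z'.
Proof. by move=> Oz; apply: open_nbhs_nbhs; split => //; exact: open_Omega. Qed.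

Let Psi_is_derive z i : Omega z -> is_derive z (e i) Psi (nonlinear_part i z.1 z.2).
Proof.
move=> Oz; have h := is_deriveB (derivableP (@Phi_derivable z (e i) Oz)) (quad_is_derive z i).
rewrite /nonlinear_part -surjective_pairing fE//.
apply: near_eq_is_derive h => /=.
apply: filterS (near_Omega Oz) => -[y u] Oyu.
change (Phi (y, u) - quad (y, u) = Psi (y, u)).
by rewrite (PhiE Oyu) /quad/= addrAC subrr add0r.
Qed.

Let Psi_gradE z : Omega z -> grad_u Psi z = \row_i nonlinear_part i z.1 z.2.
Proof. by move=> Oz; apply/rowP => i; rewrite !mxE; have [_ ->] := Psi_is_derive i Oz. Qed.

Lemma nonlinear_part_le i y u : y != 0 -> `|nonlinear_part i y u| <= g y.
Proof.
move=> y0; apply: le_trans (Psi_grad (y0 : Omega (y, u))).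
by rewrite Psi_gradE//; have := coor_le_enorm (\row_i nonlinear_part i y u) i; rewrite mxE.
Qed.

Let hessE z i j : Omega z -> hess_u Psi z j i =
  'D_(e j) ('D_(e i) Phi) z - 2 * kappa * c z.1 * (i == j)%:R.
Proof.
move=> Oz; rewrite mxE -/(e i) -/(e j).
have lin : is_derive z (e j) (fun z : E * E => 2 * kappa * c z.1 * z.2 ord0 i)
    (2 * kappa * c z.1 * (i == j)%:R).
  have h : h^-1 *: (2 * kappa * c (h *: e j + z).1 * (h *: e j + z).2 ord0 i -
      2 * kappa * c z.1 * z.2 ord0 i) @[h --> (0 : R)^'] --> 2 * kappa * c z.1 * (i == j)%:R.
    have lim : (fun _ : R => 2 * kappa * c z.1 * (i == j)%:R) @ (0 : R)^' -->
      2 * kappa * c z.1 * (i == j)%:R by exact: cvg_cst.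
    apply: cvg_trans lim; apply: near_eq_cvg.
    near=> h; have h0 : h != 0 by near: h; exact: nbhs_dnbhs_neq.
    rewrite /e/= scaler0 add0r !mxE eqxx/= /GRing.scale/=.
    by field.
  by apply: DeriveDef; [apply/cvg_ex; eexists; exact: h|exact/cvg_lim].
have dA : derivable ('D_(e i) Phi) z (e j).
  by have [_ /(_ (e j))[h _]] := A_C1 (e i); exact: h.
have [_ <-] := is_deriveB (derivableP dA) lin.
apply: near_eq_derive; apply: filterS (near_Omega Oz) => z' Oz'.
by have [_ ->] := Psi_is_derive i Oz'; rewrite /nonlinear_part -surjective_pairing fE.
Unshelve. all: by end_near. Qed.

(** The mean value theorem needs a scalar function: the vector is paired with its own increment [d]
    between [b] and [a]. The derivative is a Hessian form, bounded by g |a - b| |d|, and |d| is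
    divided out. *)
Lemma nonlinear_part_lip y a b : y != 0 ->
  enorm (\row_i (nonlinear_part i y a - nonlinear_part i y b)) <= g y * enorm (a - b).
Proof.
move=> y0; pose d := \row_i (nonlinear_part i y a - nonlinear_part i y b).
pose v : E * E := (0, a - b).
have Oz (r : R) : Omega ((y, b) + r *: v) by rewrite /Omega/= scaler0 addr0.
pose phi (r : R) := \sum_i d ord0 i * nonlinear_part i y (b + r *: (a - b)).
pose dphi (r : R) := \sum_i d ord0 i *
  ('D_v ('D_(e i) Phi) ((y, b) + r *: v) - 2 * kappa * c y * (a - b) ord0 i).
have term i (r : R) : is_derive r 1 (fun r : R => nonlinear_part i y (b + r *: (a - b)))
    ('D_v ('D_(e i) Phi) ((y, b) + r *: v) - 2 * kappa * c y * (a - b) ord0 i).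
  have dA : derivable ('D_(e i) Phi) ((y, b) + r *: v) v.
    by have [_ /(_ v)[h _]] := A_C1 (e i); exact: h.
  have d1 := line_is_derive dA.
  have d2 : is_derive r 1 (fun r : R => 2 * kappa * c y * (b + r *: (a - b)) ord0 i)
      (2 * kappa * c y * (a - b) ord0 i).
    have d3 : is_derive r 1 (fun r : R => b ord0 i + (a - b) ord0 i * r) ((a - b) ord0 i).
      have := is_deriveD (is_derive_cst (b ord0 i) r 1)
        (is_deriveZ ((a - b) ord0 i) (is_derive_id r 1)).
      by rewrite add0r /GRing.scale/= mulr1.
    have := is_deriveZ (2 * kappa * c y) d3; rewrite /GRing.scale/=.
    by congr (is_derive _ _ _ _); apply/funext => s; rewrite !mxE [s * _]mulrC.
  have := is_deriveB d1 d2; congr (is_derive _ _ _ _); apply/funext => s.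
  have Os : Omega (y, b + s *: (a - b)) := y0.
  rewrite /nonlinear_part (fE i Os).
  have -> : (y, b + s *: (a - b)) = (y, b) + s *: v.
    by rewrite /v; congr (_, _); rewrite /= scaler0 addr0.
  by [].
have dph (r : R) : is_derive r 1 phi (dphi r).
  rewrite /phi /dphi; have := @is_derive_sum R R R N
    (fun i (r : R) => d ord0 i * nonlinear_part i y (b + r *: (a - b))) r 1
    (fun i => d ord0 i * ('D_v ('D_(e i) Phi) ((y, b) + r *: v) - 2 * kappa * c y * (a - b) ord0 i))
    (fun i => is_deriveZ (d ord0 i) (term i r)).
  by congr (is_derive _ _ _ _); apply/funext => s; rewrite fct_sumE.
have [|t _ E'] := @MVT_segment R phi dphi 0 1 ler01 (fun x _ => dph x).
  by apply: derivable_within_continuous => r _; have [] := dph r.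
have EL : phi 1 - phi 0 = enorm d ^+ 2.
  rewrite /phi -sumrB enorm_sqr; apply: eq_bigr => i _.
  by rewrite -mulrBr scale1r scale0r addr0 addrCA subrr addr0 expr2 {2}/d mxE.
have vE : v = \sum_j (a - b) ord0 j *: e j.
  rewrite [RHS]surjective_pairing; congr (_, _).
    by rewrite (big_morph fst (id1 := 0) (op1 := +%R))// big1// => j _; rewrite /e/= scaler0.
  rewrite (big_morph snd (id1 := 0) (op1 := +%R))//; exact: row_sum_delta.
have ER : dphi t = dotp ((a - b) *m hess_u Psi ((y, b) + t *: v)) d.
  rewrite /dphi /dotp; apply: eq_bigr => i _; rewrite mulrC; congr (_ * _).
  rewrite [RHS]mxE; under [RHS]eq_bigr => j _ do rewrite hessE// mulrBr.
  rewrite sumrB; congr (_ - _).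
    have := derive_dir_sum open_Omega (A_C1 (e i)) (index_enum _) (fun j => (a - b) ord0 j) e (Oz t).
    by rewrite -vE.
  rewrite (bigD1 i)//= eqxx mulr1 big1 ?addr0 => [|j ji]; last first.
    by rewrite eq_sym (negbTE ji) !mulr0.
  by rewrite /v/= scaler0 addr0 mulrC.
have d0 : 0 <= enorm d := enorm_ge0 d.
have bound : enorm d ^+ 2 <= g y * enorm (a - b) * enorm d.
  rewrite -EL E' subr0 mulr1 ER; apply: le_trans (ler_norm _) _.
  apply: le_trans (dotp_le_enorm _ _) _; rewrite ler_wpM2r//.
  apply: le_trans (opnorm_bound _ _) _; rewrite ler_wpM2r ?enorm_ge0//.
  have -> : (y, b) + t *: v = (y, b + t *: (a - b)) by rewrite /v; congr (_, _); rewrite /= scaler0 addr0.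
  exact: Psi_hess.
have [->|dn] := eqVneq (enorm d) 0.
  by rewrite mulr_ge0 ?enorm_ge0// (le_trans (enorm_ge0 _) (Psi_grad (y0 : Omega (y, 0)))).
have dp : 0 < enorm d by rewrite lt0r dn.
by rewrite -(ler_pM2r dp) -expr2.
Qed.

Lemma measurable_Omega : measurable (@Omega R N).
Proof.
have -> : @Omega R N = (~` [set 0]) `*` setT.
  by apply/seteqP; split => z /=; [move/eqP|move=> -[h _]; apply/eqP].
by apply: measurableX => //; apply: measurableC; exact: measurable_rV_set1.
Qed.

Lemma measurable_nonlinear_part i :
  measurable_fun (@Omega R N) (fun z : E * E => nonlinear_part i z.1 z.2).
Proof.
apply: (@eq_measurable_fun _ _ _ _ _
  (fun z : E * E => 'D_(e i) Phi z - 2 * kappa * c z.1 * z.2 ord0 i)).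
  by move=> [y u]; rewrite inE => Oz; rewrite /nonlinear_part fE.
apply: measurable_funB.
  apply: measurable_fun_continuous_rV2; first exact: measurable_Omega.
  by move=> z Oz; have [h _] := A_C1 (e i); exact: h.
apply: measurable_funTS; apply: measurable_funM; last first.
  exact: measurableT_comp (measurable_coor i) measurable_snd.
apply: measurable_funM; first exact: measurable_cst.
have -> : (fun z : E * E => c z.1) = (fun z => enorm z.1 `^ (- (N%:R + 2 * alpha))).
  by apply/funext => z; rewrite powRN.
exact: (measurableT_comp (measurable_powR _)
  (measurableT_comp (@measurable_enorm R N) measurable_fst)).
Qed.

End nonlinear_part.

(** * From weak solutions to mollified solutions *)

Section almost_everywhere_shift.
Variables (R : realType) (N : nat).
Local Notation E := 'rV[R]_N.
Local Notation mu := (lebesgue_rV R N).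

Lemma ae_translate (P : E -> Prop) (a : E) :
  {ae mu, forall x, P x} -> {ae mu, forall x, P (x + a)}.
Proof.
move=> [A [mA A0 PA]]; exists ((fun x => x + a) @^-1` A); split.
- by rewrite -[X in measurable X]setTI; exact: measurable_translate.
- by rewrite lebesgue_rV_translate.
- by move=> x /= nP; apply: PA.
Qed.

(** By Tonelli and translation invariance the pairs with x - y in a null set form a null set, whose
    sections are null for almost every x. *)
Lemma ae_shift (P : E -> Prop) : {ae mu, forall x, P x} ->
  {ae mu, forall x, {ae mu, forall y, P (x - y)}}.
Proof.
move=> [A [mA A0 PA]].
have mB : measurable ((fun z : E * E => z.1 - z.2) @^-1` A).
  by rewrite -[X in measurable X]setTI; exact: measurable_subrV.
have mF : measurable_fun setT (fun z : E * E => (\1_A (z.1 - z.2))%:E : \bar R).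
  have mi : measurable_fun setT (\1_A : E -> R) by exact: measurable_indic.
  by apply/measurable_EFinP; exact: (measurableT_comp mi (@measurable_subrV R N)).
have F0 (z : E * E) : (0 <= (\1_A (z.1 - z.2))%:E :> \bar R)%E by rewrite lee_fin.
have i0 : (\int[mu]_x \int[mu]_y (\1_A (x - y))%:E = 0)%E.
  rewrite (@fubini_tonelli _ _ _ _ _ mu mu _ mF F0)/=.
  apply: integral0_eq => y _.
  rewrite (ge0_integral_translate (- y) (f := fun x => (\1_A x)%:E))//; last first.
    by apply/measurable_EFinP; exact: measurable_indic.
  by rewrite integral_indic// setIT.
have mG : measurable_fun setT (fun x : E => \int[mu]_y (\1_A (x - y))%:E)%E.
  exact: (@measurable_fun_fubini_tonelli_F _ _ _ _ _ mu _ mF F0).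
have : (\int[mu]_x `| \int[mu]_y (\1_A (x - y))%:E | = 0)%E.
  by rewrite -[RHS]i0; apply: eq_integral => x _; rewrite gee0_abs// integral_ge0.
move=> /(ae_eq_integral_abs mu measurableT mG); apply: filterS => x /(_ I) /= ix.
exists ((fun y => x - y) @^-1` A); split.
- have := measurable_xsection x mB; congr measurable.
  by apply/seteqP; split => y; rewrite xsectionE.
- rewrite -[RHS]ix -[X in mu X]setIT -integral_indic//.
  have := measurable_xsection x mB; congr measurable.
  by apply/seteqP; split => y; rewrite xsectionE.
- by move=> y /= nP; apply: PA.
Qed.

End almost_everywhere_shift.

(** * Borel representatives of the components *)

Section representatives.
Variables (R : realType) (N : nat) (delta alpha : R).
Local Notation E := 'rV[R]_N.
Local Notation mu := (lebesgue_rV R N).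
Local Notation w := (weight delta alpha).
Local Notation wsemi := (wsemi delta alpha).
Implicit Types (h : E -> E) (k : 'I_N -> E -> R).

(** Members of [L2] and [W] are Borel only up to a null set, whereas the theorems on real integrals
    want Borel functions; [k] collects the components of a representative. *)
Definition represents h k := (forall i, measurable_fun setT (k i)) /\
  {ae mu, forall x, forall i, h x ord0 i = k i x}.

Definition borel_rep h : 'I_N -> E -> R :=
  match pselect (exists k, represents h k) with
  | left hk => projT1 (cid hk)
  | right _ => fun _ _ => 0
  end.

Lemma borel_repP h : ae_measurable mu setT h -> represents h (borel_rep h).
Proof.
move=> [g mg hg]; rewrite /borel_rep; case: pselect => [hk|[]]; first by case: cid.
exists (fun i x => g x ord0 i); split => [i|].
  exact: measurableT_comp (measurable_coor i) mg.
by apply: filterS hg => x /(_ I) -> i.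
Qed.

Lemma represents_sub h h' k k' : represents h k -> represents h' k' ->
  represents (fun x => h x - h' x) (vsub k k').
Proof.
move=> [mk hk] [mk' hk']; split => [i|]; first exact: measurable_funB.
apply: filterS2 hk hk' => x e e' i; by rewrite !mxE e e'.
Qed.

Lemma represents_ae h h' k : ae_eq mu setT h' h -> represents h k -> represents h' k.
Proof.
move=> hh [mk hk]; split => //; apply: filterS2 hh hk => x /(_ I) -> e i; exact: e.
Qed.

Let sqr_poweR (x : \bar R) : (0 <= x)%E -> (x `^ 2 = x ^+ 2)%E.
Proof.
case: x => [r|_|//]; last by rewrite poweRyr.
by rewrite lee_fin => r0; rewrite poweR_EFin powR_mulrn// EFin_expe.
Qed.

Lemma L2norm_represents h k : represents h k ->
  (L2norm h ^+ 2 = \sum_i sqn mu (k i))%E.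
Proof.
move=> [mk hk]; rewrite -sqr_poweR ?Lnorm_ge0// powR_Lnorm// -sqn_vnorm//.
apply: integral_ae_eqW; apply: filterS hk => x e _ /=.
rewrite powR_mulrn// real_normK ?num_real//.
by congr ((enorm _ ^+ 2)%:E); apply/rowP => i; rewrite mxE.
Qed.

(** The values at x and at x - y are replaced for almost every x and then almost every y; Tonelli's
    theorem reverses the order of integration. *)
Lemma seminorm2_represents h k : represents h k ->
  (seminorm2 delta alpha h = \sum_i wsemi (k i))%E.
Proof.
move=> [mk hk].
transitivity (\int[mu]_x \int[mu]_y \sum_i (w y * diffq (k i) y x ^+ 2)%:E)%E.
  apply: integral_ae_eqW; apply: filterS2 hk (ae_shift hk) => x e e' _.
  rewrite integral_mkcond; apply: integral_ae_eqW; apply: filterS e' => y e' _.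
  rewrite patchE sumEFin -mulr_sumr /weight; case: ifPn => yB.
    rewrite indicE yB mul1r mulrC enorm_sqr; congr ((_ * _)%:E).
    by apply: eq_bigr => i _; rewrite !mxE e e'.
  by rewrite indicE (negbTE yB) !mul0r.
have m2 i : measurable_fun setT (fun z : E * E => (w z.2 * diffq (k i) z.2 z.1 ^+ 2)%:E : \bar R).
  apply/measurable_EFinP; apply: measurable_funM.
    by apply: measurableT_comp measurable_snd; exact: measurable_weight.
  by apply: measurable_funX; exact: measurable_diffq2.
have p2 i x y : (0 <= (w y * diffq (k i) y x ^+ 2)%:E)%E.
  by rewrite lee_fin mulr_ge0 ?weight_ge0 ?sqr_ge0.
under [RHS]eq_bigr => i _ do rewrite wsemi_fubini//.
rewrite -ge0_integral_sum//.
- apply: eq_integral => x _; rewrite ge0_integral_sum// => i.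
  exact: measurableT_comp (m2 i) (pair1_measurable x).
- by move=> i; exact: (@measurable_fun_fubini_tonelli_F _ _ _ _ _ mu _ (m2 i) (fun z => p2 i z.1 z.2)).
- by move=> i x _; exact: integral_ge0.
Qed.

Lemma Wnorm_represents h k (M : R) : represents h k -> 0 <= M ->
  (Wnorm delta alpha h <= M%:E)%E ->
  (\sum_i sqn mu (k i) <= (M ^+ 2)%:E)%E /\ (\sum_i wsemi (k i) <= (M ^+ 2)%:E)%E.
Proof.
move=> hk M0 hM; have L0 : (0 <= L2norm h)%E by exact: Lnorm_ge0.
have S0 : (0 <= seminorm2 delta alpha h)%E.
  by apply: integral_ge0 => x _; apply: integral_ge0 => y _; rewrite lee_fin mulr_ge0 ?sqr_ge0// invr_ge0 powR_ge0.
have P0 : (0 <= seminorm2 delta alpha h `^ 2^-1)%E by exact: poweR_ge0.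
rewrite -(L2norm_represents hk) -(seminorm2_represents hk); split.
  have : (L2norm h <= M%:E)%E by apply: le_trans hM; rewrite leeDl.
  move: L0; case: (L2norm h) => [r||//]; last by rewrite leye_eq.
  move=> r0 rM; rewrite -EFin_expe lee_fin; rewrite !lee_fin in r0 rM.
  by rewrite lerXn2r ?nnegrE.
have : (seminorm2 delta alpha h `^ 2^-1 <= M%:E)%E by apply: le_trans hM; rewrite leeDr.
move: S0; case: (seminorm2 delta alpha h) => [r||//]; last first.
  by rewrite poweRyr// leye_eq.
rewrite poweR_EFin !lee_fin => r0; rewrite powR12_sqrt// => h'.
by rewrite -(sqr_sqrtr r0) lerXn2r ?nnegrE ?sqrtr_ge0.
Qed.

Lemma L2_represents h : L2 h -> represents h (borel_rep h) /\
  forall i, sqint mu (borel_rep h i).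
Proof.
move=> [/borel_repP hk hoo]; split => // i; split; first by case: hk.
have fin : (L2norm h ^+ 2 < +oo)%E.
  move: hoo (Lnorm_ge0 mu 2%:E (EFin \o (enorm \o h))); rewrite -/(L2norm h).
  by case: (L2norm h) => // r _ _; rewrite -EFin_expe ltry.
apply: le_lt_trans fin; rewrite (L2norm_represents hk) (bigD1 i)//= leeDl//.
by apply: sume_ge0 => j _; exact: sqn_ge0.
Qed.

Lemma W_represents h : W delta alpha h -> [/\ represents h (borel_rep h),
  forall i, sqint mu (borel_rep h i) & forall i, (wsemi (borel_rep h i) < +oo)%E].
Proof.
move=> [hL hW]; have [hk hs] := L2_represents hL; split => // i.
have W0 : (0 <= Wnorm delta alpha h)%E by rewrite adde_ge0 ?Lnorm_ge0 ?poweR_ge0.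
have fin : Wnorm delta alpha h \is a fin_num by rewrite ge0_fin_numE.
have := @Wnorm_represents h _ _ hk (fine_ge0 W0); rewrite fineK// => /(_ (lexx _)) [_ h2].
apply: le_lt_trans (ltry (fine (Wnorm delta alpha h) ^+ 2)).
apply: le_trans h2; rewrite (bigD1 i)//= leeDl//.
by apply: sume_ge0 => j _; exact: wsemi_ge0.
Qed.

End representatives.

(** * Consequences of weak continuity in time *)

Section weak_continuity.
Variables (R : realType) (N : nat) (delta alpha : R).
Local Notation E := 'rV[R]_N.
Local Notation mu := (lebesgue_rV R N).
Local Notation leb := (@lebesgue_measure R).
Local Notation w := (weight delta alpha).
Local Notation wsemi := (wsemi delta alpha).

Lemma within_continuous_max (f : R -> R) : {within `[0, +oo[, continuous f} ->
  continuous (fun t : R => f (Num.max t 0)).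
Proof.
move=> /subspace_continuousP cf t.
have m0 (s : R) : 0 <= Num.max s 0 by rewrite le_max lexx orbT.
have cm : (fun s : R => Num.max s 0) @ t --> Num.max t 0.
  by apply: continuous_max; [exact: cvg_id|exact: cvg_cst].
have := cf (Num.max t 0); rewrite /= in_itv/= andbT => /(_ (m0 t)) h.
apply: cvg_trans h => A /= hA; apply: (@filterS _ (nbhs t) _ _ _ _ (cm _ hA)) => s /=.
by apply; rewrite in_itv/= andbT.
Qed.

(** If the bound failed at [t], it would fail on an interval to the right of [t], which has positive
    measure. In this way t = 0 is included. *)
Lemma continuous_ae_bound (c : R -> R) (B T : R) : continuous c ->
  {ae leb, forall t, 0 < t < T -> `|c t| <= B} ->
  forall t, 0 <= t < T -> `|c t| <= B.
Proof.
move=> cc [A [mA A0 hA]] t /andP[t0 tT]; rewrite leNgt; apply/negP => Bt.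
have cn : continuous (fun t => `|c t|) by move=> s; apply: cvg_norm; exact: cc.
have /nbhs_ballP[d /= d0 hd] : \forall s \near t, B < `|c s|.
  by have := cn t _ (lt_nbhsr Bt).
pose r := Num.min (t + d) T; have tr : t < r by rewrite /r lt_min tT ltrDl d0.
have sub : `]t, r[%classic `<=` A.
  move=> s; rewrite /= in_itv/= lt_min => /andP[ts /andP[sd sT]].
  apply: hA => /= /(_ _); rewrite (le_lt_trans t0 ts) sT => /(_ isT).
  apply/negP; rewrite -ltNge; apply: hd; rewrite /ball/= distrC gtr0_norm ?subr_gt0//.
  by rewrite ltrBlDl.
have : (leb `]t, r[%classic <= leb A)%E.
  apply: le_measure; [|by rewrite inE|exact: sub].
  by rewrite inE; apply: measurable_itv.
by rewrite A0 lebesgue_measure_itv/= lte_fin tr -EFinB lee_fin subr_le0 leNgt tr.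
Qed.

Lemma ae_leb_imply (P P' : R -> Prop) : (forall t, P t -> P' t) ->
  {ae leb, forall t, P t} -> {ae leb, forall t, P' t}.
Proof. by move=> PP' [A [mA A0 hA]]; exists A; split => // t nP; apply: hA => /PP'. Qed.

Definition wform (h p : E -> R) : R :=
  \int[mu]_y (w y * \int[mu]_x (diffq h y x * diffq p y x)).

Let inner (h p : E -> R) y : sqint mu h -> sqint mu p ->
  \int[mu]_x (w y * (diffq h y x * diffq p y x)) = w y * \int[mu]_x (diffq h y x * diffq p y x).
Proof. by move=> sh sp; rewrite RintZ//; apply: sqint_mul; exact: sqint_diffq. Qed.

(** With the root of the weight as a factor, the form becomes an inner product in L^2 of the product
    space, where Cauchy-Schwarz is available. *)
Let root (h : E -> R) (z : E * E) : R := Num.sqrt (w z.2) * diffq h z.2 z.1.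

Let root_sqint (h : E -> R) : measurable_fun setT h -> (wsemi h < +oo)%E ->
  sqint (mu \x mu)%E (root h) /\ sqn (mu \x mu)%E (root h) = wsemi h.
Proof.
move=> mh ho; have mr : measurable_fun setT (root h).
  apply: measurable_funM; last exact: measurable_diffq2.
  apply: measurableT_comp; first by apply: continuous_measurable_fun; exact: sqrt_continuous.
  by apply: measurableT_comp measurable_snd; exact: measurable_weight.
have sE z : root h z ^+ 2 = w z.2 * diffq h z.2 z.1 ^+ 2.
  by rewrite exprMn sqr_sqrtr// weight_ge0.
have e : sqn (mu \x mu)%E (root h) = wsemi h.
  rewrite wsemi_fubini// /sqn.
  rewrite (@fubini_tonelli1 _ _ _ _ _ mu mu (fun z => (root h z ^+ 2)%:E)).
  - by apply: eq_integral => x _; apply: eq_integral => y _; rewrite sE.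
  - by apply/measurable_EFinP; exact: measurable_funX.
  - by move=> z; rewrite lee_fin sqr_ge0.
by split => //; split => //; rewrite e.
Qed.

Lemma wform_prod (h p : E -> R) : sqint mu h -> sqint mu p ->
  (wsemi h < +oo)%E -> (wsemi p < +oo)%E ->
  wform h p = \int[(mu \x mu)%E]_z (root h z * root p z).
Proof.
move=> sh sp ho po; have mh := proj1 sh; have mp := proj1 sp.
have i1 := rintegrable_wform mh mp ho po.
transitivity (\int[(mu \x mu)%E]_z (w z.2 * (diffq h z.2 z.1 * diffq p z.2 z.1))).
  rewrite -(Rint_fubini1 i1)/=; apply: eq_Rintegral => y _.
  by rewrite inner.
apply: eq_Rintegral => z _; rewrite /root.
rewrite -{1}(sqr_sqrtr (weight_ge0 delta alpha z.2)); move: (Num.sqrt _) => s; ring.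
Qed.

Lemma wform_cauchy_schwarz (h p : E -> R) : sqint mu h -> sqint mu p ->
  (wsemi h < +oo)%E -> (wsemi p < +oo)%E ->
  wform h p ^+ 2 <= fine (wsemi h) * fine (wsemi p).
Proof.
move=> sh sp ho po; rewrite wform_prod//.
have [s1 <-] := root_sqint (proj1 sh) ho; have [s2 <-] := root_sqint (proj1 sp) po.
exact: cauchy_schwarz.
Qed.

Lemma wform_self (h : E -> R) : sqint mu h -> (wsemi h < +oo)%E ->
  wform h h = fine (wsemi h).
Proof.
move=> sh ho; rewrite wform_prod//; have [_ <-] := root_sqint (proj1 sh) ho.
by apply: eq_Rintegral => z _; rewrite -expr2.
Qed.

Lemma wform_linear a (h h' p : E -> R) : sqint mu h -> sqint mu h' -> sqint mu p ->
  (wsemi h < +oo)%E -> (wsemi h' < +oo)%E -> (wsemi p < +oo)%E ->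
  wform (fun x => a * h x + h' x) p = a * wform h p + wform h' p.
Proof.
move=> sh sh' sp ho ho' po.
have iw f : sqint mu f -> (wsemi f < +oo)%E ->
    rintegrable mu (fun y => w y * \int[mu]_x (diffq f y x * diffq p y x)).
  move=> sf fo; have := rintegrable_Rint1 (rintegrable_wform (proj1 sf) (proj1 sp) fo po).
  by rewrite (_ : (fun y => _) = (fun y => w y * \int[mu]_x (diffq f y x * diffq p y x)))//;
    apply/funext => y /=; rewrite inner.
have i1 := iw _ sh ho; have i2 := iw _ sh' ho'.
rewrite /wform -(RintZ a i1) -(RintD (rintegrableZ a i1) i2).
apply: eq_Rintegral => y _.
have j1 := sqint_mul (sqint_diffq y sh) (sqint_diffq y sp).
have j2 := sqint_mul (sqint_diffq y sh') (sqint_diffq y sp).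
rewrite mulrCA -mulrDr -(RintZ a j1) -(RintD (rintegrableZ a j1) j2).
by congr (_ * _); apply: eq_Rintegral => x _; rewrite /diffq; ring.
Qed.

Lemma wform_ae (h h' p : E -> R) : {ae mu, forall x, h x = h' x} -> wform h p = wform h' p.
Proof.
move=> hh; apply: eq_Rintegral => y _; congr (_ * _); apply: Rintegral_ae_eqW.
by apply: filterS2 hh (ae_translate (- y) hh) => x e e'; rewrite /diffq e e'.
Qed.

(** The function is paired with its own value at the fixed time [t]: the bound for almost every s
    passes to the continuous function of s and is then read at s = t. *)
Lemma ae_bound_sqn (K : R -> E -> R) (B T : R) : 0 <= B ->
  (forall t, sqint mu (K t)) ->
  (forall phi, sqint mu phi -> continuous (fun t => \int[mu]_x (K t x * phi x))) ->
  {ae leb, forall t, 0 < t < T -> fine (sqn mu (K t)) <= B} ->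
  forall t, 0 <= t < T -> fine (sqn mu (K t)) <= B.
Proof.
move=> B0 sK cK bK t tT; pose a := fine (sqn mu (K t)).
have a0 : 0 <= a by rewrite fine_ge0// sqn_ge0.
have h := continuous_ae_bound (B := Num.sqrt (B * a)) (T := T) (cK _ (sK t)).
have : `|\int[mu]_x (K t x * K t x)| <= Num.sqrt (B * a).
  apply: (h _ t tT); apply: ae_leb_imply bK => s bs sT; apply: abs_le_of_sqr; first exact: sqrtr_ge0.
  rewrite sqr_sqrtr ?mulr_ge0//; apply: le_trans (cauchy_schwarz (sK s) (sK t)) _.
  by rewrite ler_wpM2r// bs.
have -> : \int[mu]_x (K t x * K t x) = a.
  by apply: eq_Rintegral => x _; rewrite -expr2.
rewrite ger0_norm// => h'; rewrite -/a.
have a2 : a ^+ 2 <= B * a.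
  by rewrite -(sqr_sqrtr (mulr_ge0 B0 a0)) lerXn2r ?nnegrE ?sqrtr_ge0.
have [->//|an] := eqVneq a 0.
by rewrite -(ler_pM2r (_ : 0 < a)) -?expr2// lt0r an.
Qed.

Lemma ae_bound_wsemi (K : R -> E -> R) (B T : R) : 0 <= B ->
  (forall t, sqint mu (K t)) -> (forall t, (wsemi (K t) < +oo)%E) ->
  (forall phi, sqint mu phi -> (wsemi phi < +oo)%E -> continuous (fun t => wform (K t) phi)) ->
  {ae leb, forall t, 0 < t < T -> fine (wsemi (K t)) <= B} ->
  forall t, 0 <= t < T -> fine (wsemi (K t)) <= B.
Proof.
move=> B0 sK wK cK bK t tT; pose a := fine (wsemi (K t)).
have a0 : 0 <= a by rewrite fine_ge0// wsemi_ge0.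
have h := continuous_ae_bound (B := Num.sqrt (B * a)) (T := T) (cK _ (sK t) (wK t)).
have : `|wform (K t) (K t)| <= Num.sqrt (B * a).
  apply: (h _ t tT); apply: ae_leb_imply bK => s bs sT; apply: abs_le_of_sqr; first exact: sqrtr_ge0.
  rewrite sqr_sqrtr ?mulr_ge0//.
  apply: le_trans (wform_cauchy_schwarz (sK s) (sK t) (wK s) (wK t)) _.
  by rewrite ler_wpM2r// bs.
rewrite wform_self// ger0_norm// -/a => h'.
have a2 : a ^+ 2 <= B * a.
  by rewrite -(sqr_sqrtr (mulr_ge0 B0 a0)) lerXn2r ?nnegrE ?sqrtr_ge0.
have [->//|an] := eqVneq a 0.
by rewrite -(ler_pM2r (_ : 0 < a)) -?expr2// lt0r an.
Qed.

Definition pairing (i : 'I_N) (phi : E -> R) (h : E -> E) : R :=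
  \int[mu]_x (h x ord0 i * phi x).

Lemma pairing_represents i phi h k : represents h k ->
  pairing i phi h = \int[mu]_x (k i x * phi x).
Proof.
by move=> [_ hk]; apply: Rintegral_ae_eqW; apply: filterS hk => x ->.
Qed.

Let pairing_linear i phi (a : R) h h' : sqint mu phi -> L2 h -> L2 h' ->
  pairing i phi (fun x => a *: h x + h' x) = a * pairing i phi h + pairing i phi h'.
Proof.
move=> sphi /L2_represents[r s] /L2_represents[r' s'].
rewrite !(pairing_represents _ _ r) (pairing_represents _ _ r').
have i1 := sqint_mul (s i) sphi; have i2 := sqint_mul (s' i) sphi.
rewrite -(RintZ a i1) -(RintD (rintegrableZ a i1) i2).
have [_ e1] := r; have [_ e2] := r'.
apply: Rintegral_ae_eqW; apply: filterS2 e1 e2 => x e1 e2.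
by rewrite !mxE e1 e2; ring.
Qed.

Let pairing_bound i phi h : sqint mu phi -> L2 h ->
  (`|pairing i phi h|%:E <= (Num.sqrt (fine (sqn mu phi)))%:E * L2norm h)%E.
Proof.
move=> sphi hL; have [r s] := L2_represents hL.
have L0 : (0 <= L2norm h)%E by exact: Lnorm_ge0.
have fin : L2norm h \is a fin_num by rewrite ge0_fin_numE//; case: hL.
have p0 : 0 <= fine (sqn mu phi) by rewrite fine_ge0// sqn_ge0.
have sum : (sqn mu (borel_rep h i) <= L2norm h ^+ 2)%E.
  rewrite (L2norm_represents r) (bigD1 i)//= leeDl//.
  by apply: sume_ge0 => j _; exact: sqn_ge0.
rewrite (pairing_represents _ _ r) -(fineK fin) -EFinM lee_fin.
apply: abs_le_of_sqr; first by rewrite mulr_ge0 ?sqrtr_ge0 ?fine_ge0.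
apply: le_trans (cauchy_schwarz (s i) sphi) _.
rewrite exprMn sqr_sqrtr// mulrC ler_wpM2l//.
move: sum; rewrite -(fineK fin) -EFin_expe -[X in (X <= _)%E](fineK (sqint_fin_num (s i))).
by rewrite lee_fin.
Qed.

Lemma pairing_functional_L2 i phi : sqint mu phi ->
  bounded_functional L2 L2norm (pairing i phi).
Proof.
move=> sphi; split => [a h h' hL hL'|]; first exact: pairing_linear.
by exists (Num.sqrt (fine (sqn mu phi))) => h hL; exact: pairing_bound.
Qed.

Lemma pairing_functional_W i phi : sqint mu phi ->
  bounded_functional (W delta alpha) (Wnorm delta alpha) (pairing i phi).
Proof.
move=> sphi; split => [a h h' [hL _] [hL' _]|]; first exact: pairing_linear.
exists (Num.sqrt (fine (sqn mu phi))) => h [hL _].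
apply: le_trans (pairing_bound i sphi hL) _.
by rewrite lee_wpmul2l// ?lee_fin ?sqrtr_ge0// leeDl// poweR_ge0.
Qed.

Lemma wform_functional i phi : sqint mu phi -> (wsemi phi < +oo)%E ->
  bounded_functional (W delta alpha) (Wnorm delta alpha)
    (fun h => wform (fun x => h x ord0 i) phi).
Proof.
move=> sphi wphi.
have repE h : represents h (borel_rep h) ->
    wform (fun x => h x ord0 i) phi = wform (borel_rep h i) phi.
  by move=> [_ e]; apply: wform_ae; apply: filterS e => x ->.
split => [a h h' /W_represents[r s ws] /W_represents[r' s' ws']|].
  have [_ e1] := r; have [_ e2] := r'.
  have e3 : wform (fun x => (a *: h x + h' x) ord0 i) phi =
      wform (fun x => a * borel_rep h i x + borel_rep h' i x) phi.
    by apply: wform_ae; apply: filterS2 e1 e2 => x e1 e2; rewrite !mxE e1 e2.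
  have e4 := wform_linear a (s i) (s' i) sphi (ws i) (ws' i) wphi.
  exact: (etrans e3 (etrans e4 (esym (f_equal2 (fun u v => a * u + v) (repE _ r) (repE _ r'))))).
exists (Num.sqrt (fine (wsemi phi))) => h hW; have [r s ws] := W_represents hW.
have W0 : (0 <= Wnorm delta alpha h)%E by rewrite adde_ge0 ?Lnorm_ge0 ?poweR_ge0.
have fin : Wnorm delta alpha h \is a fin_num by rewrite ge0_fin_numE//; case: hW.
have p0 : 0 <= fine (wsemi phi) by rewrite fine_ge0// wsemi_ge0.
have f0 := fine_ge0 W0.
rewrite -(fineK fin) -EFinM lee_fin.
apply: abs_le_of_sqr; first by rewrite mulr_ge0 ?sqrtr_ge0.
have -> := repE _ r.
apply: le_trans (wform_cauchy_schwarz (s i) sphi (ws i) wphi) _.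
rewrite exprMn (sqr_sqrtr p0) mulrC; apply: ler_wpM2l p0 _ _ _.
have := @Wnorm_represents R N delta alpha h _ _ r f0; rewrite fineK// => /(_ (lexx _)) [_ h2].
have wfin : wsemi (borel_rep h i) \is a fin_num.
  by rewrite ge0_fin_numE; [exact: ws|exact: wsemi_ge0].
rewrite -lee_fin (fineK wfin); apply: le_trans h2; rewrite (bigD1 i)//= leeDl//.
by apply: sume_ge0 => j _; exact: wsemi_ge0.
Qed.

End weak_continuity.

(** * The operator tested with a mollifier *)

Section operator_form.
Variables (R : realType) (N : nat) (delta alpha kappa : R).
Local Notation E := 'rV[R]_N.
Local Notation mu := (lebesgue_rV R N).
Local Notation w := (weight delta alpha).
Local Notation wsemi := (wsemi delta alpha).
Local Notation eta := (@mollifier R N).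
Hypotheses (delta0 : 0 < delta) (alpha01 : 0 < alpha < 1) (hN : (0 < N)%N).
Variable f : E * E -> E.
Variables (G : 'I_N -> E -> E -> R) (g : E -> R) (S : set E).
Hypothesis GE : forall i y a, G i y a = \1_S y * nonlinear_part f kappa alpha i y a.
Hypothesis S_ball : S `<=` eball delta.
Hypothesis S_ae : {ae mu, forall y, y != 0 -> eball delta y -> S y}.
Hypothesis mG : forall i, measurable_fun setT (fun z : E * E => G i z.1 z.2).
Hypothesis G_le : forall i y a, `|G i y a| <= g y.
Hypothesis ig : rintegrable mu g.

Lemma dotp_delta (a : E) (c : R) i : dotp a (c *: delta_mx ord0 i) = a ord0 i * c.
Proof.
rewrite /dotp (bigD1 i)//= !mxE !eqxx mulr1 big1 ?addr0// => j ji.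
by rewrite !mxE (negbTE ji) andbF !mulr0.
Qed.

Let kn n : kernel (eta n). Proof. by case: (mollifier_approximate_unit R N). Qed.
Let eta0 n z : 0 <= eta n z. Proof. by case: (mollifier_approximate_unit R N). Qed.

Lemma dotp_mollify h k (c : R) n i x : represents h k -> (forall i, sqint mu (k i)) ->
  \int[mu]_z dotp (h z) ((c * eta n (z - x)) *: delta_mx ord0 i) =
  mollify (eta n) (k i) x * c.
Proof.
move=> [mk hk] sk; have mpsi := kernel_measurable (kn n).
rewrite mollifyE// mulrC -RintZ; last first.
  by apply: sqint_mul => //; exact: sqint_translate (- x) (kernel_sqint (kn n)).
apply: Rintegral_ae_eqW; apply: filterS hk => z e.
by rewrite dotp_delta e mulrCA.
Qed.

(** Splits [f] into its linear part and [G]. At y = 0, outside of [Omega], nothing is known about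
    [f], but the difference of test functions vanishes there. *)
Let form_pointwise h (k : 'I_N -> E -> R) (c : R) n i x z y :
  (y != 0 -> eball delta y -> S y) -> (h z - h (z - y) = vdiff k y z) ->
  ((fun y => dotp (f (y, h z - h (z - y)))
     ((c * eta n (z - x)) *: delta_mx ord0 i - (c * eta n (z - y - x)) *: delta_mx ord0 i))
     \_ (eball delta)) y =
  2 * kappa * c * (w y * (diffq (k i) y z * diffq (fun z => eta n (z - x)) y z)) +
  c * (G i y (vdiff k y z) * (eta n (z - x) - eta n (z - y - x))).
Proof.
move=> Sy e; rewrite patchE -scalerBl dotp_delta e.
have -> : diffq (fun z => eta n (z - x)) y z = eta n (z - x) - eta n (z - y - x) by [].
rewrite GE /weight -mulrBr.
have [->|y0] := eqVneq y 0.
  by rewrite subr0 subrr !mulr0 addr0; case: ifP.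
case: ifPn => yB.
  rewrite indicE yB indicE (mem_set (Sy y0 _)); last by move: yB; rewrite inE.
  rewrite /nonlinear_part mxE mul1r /=.
  move: (_ `^ _)^-1 (f _ ord0 i) (diffq _ _ _) (eta n _ - _) => s a b d; ring.
rewrite indicE (negbTE yB) indicE (_ : (y \in S) = false); first by rewrite !mul0r !mulr0 addr0.
by apply/negbTE; apply: contra yB; rewrite !inE; exact: S_ball.
Qed.

(** The two parts are integrable for different reasons, finite seminorms for the linear one and the
    bound by [g] for the other, so that they are treated separately. The factor 1/2 of [K_form]
    meets the 2 from differentiating the square. *)
Lemma K_form_mollified h k (c : R) n i x : represents h k ->
  (forall i, sqint mu (k i)) -> (forall i, (wsemi (k i) < +oo)%E) ->
  K_form delta f h (fun z => (c * eta n (z - x)) *: delta_mx ord0 i) =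
  mollified_force delta alpha kappa G k n i x * c.
Proof.
move=> [mk hk] sk wk; have mpsi := kernel_measurable (kn n).
have bx := bump_translate (- x) (mollifier_bump R N n).
have sx : sqint mu (fun z => eta n (z - x)) := kernel_sqint (bump_kernel bx).
have iA := rintegrable_wform (mk i) (proj1 sx) (wk i) (bump_wsemi delta0 alpha01 bx).
have iB := rintegrable_nterm mG G_le ig hN (kn n) (eta0 n) i x mk.
pose A z := \int[mu]_y (w y * (diffq (k i) y z * diffq (fun z => eta n (z - x)) y z)).
pose B z := \int[mu]_y (G i y (vdiff k y z) * (eta n (z - x) - eta n (z - y - x))).
have JA : rintegrable mu A by exact: (rintegrable_Rint2 iA).
have JB : rintegrable mu B by exact: (rintegrable_Rint1 iB).
have EA : \int[mu]_z A z = mollify (nlap delta alpha (eta n)) (k i) x.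
  exact: (wform_bump delta0 alpha01 x (mollifier_bump R N n) (sk i) (wk i)).
have EB : \int[mu]_z B z = 2 * nterm G (eta n) k i x.
  rewrite /nterm mulrA divff// mul1r; exact: (esym (Rint_fubini iB)).
rewrite /K_form.
have -> : \int[mu]_z \int[mu]_(y in eball delta)
    dotp (f (y, h z - h (z - y))) ((c * eta n (z - x)) *: delta_mx ord0 i -
      (c * eta n (z - y - x)) *: delta_mx ord0 i) =
    \int[mu]_z (2 * kappa * c * A z + c * B z).
  apply: Rintegral_ae_eqW.
  have h1 := ae_shift hk; have h2 := ae_rintegrable2 iA; have h3 := ae_rintegrable1 iB.
  apply: filterS2 hk (filterI h1 (filterI h2 h3)) => z ez [ezy [jA jB]].
  rewrite Rintegral_mkcond /A /B -(RintZ _ jA) -(RintZ _ jB).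
  rewrite -(RintD (rintegrableZ _ jA) (rintegrableZ _ jB)).
  apply: Rintegral_ae_eqW; apply: filterS2 S_ae ezy => y Sy ey.
  by apply: form_pointwise => //; apply/rowP => j; rewrite !mxE ez ey.
rewrite (RintD (rintegrableZ _ JA) (rintegrableZ _ JB)) !RintZ// EA EB /mollified_force.
by move: (mollify _ _ _) (nterm _ _ _ _ _) => s t; field.
Qed.

End operator_form.

(** * Weak solutions satisfy the mollified equation *)

Section solutions.
Variables (R : realType) (N : nat) (delta alpha kappa : R).
Local Notation E := 'rV[R]_N.
Local Notation mu := (lebesgue_rV R N).
Local Notation leb := (@lebesgue_measure R).
Local Notation w := (weight delta alpha).
Local Notation wsemi := (wsemi delta alpha).
Local Notation eta := (@mollifier R N).

Lemma ae_leb_imply2 (P1 P2 P' : R -> Prop) : (forall t, P1 t -> P2 t -> P' t) ->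
  {ae leb, forall t, P1 t} -> {ae leb, forall t, P2 t} -> {ae leb, forall t, P' t}.
Proof.
move=> PP' [A [mA A0 hA]] [B [mB B0 hB]]; exists (A `|` B); split.
- exact: measurableU.
- by apply: null_set_setU.
- move=> t nP; apply: contrapT => /not_orP[nA nB]; apply: nP; apply: PP'.
    by apply: contrapT => n1; apply: nA; exact: hA.
  by apply: contrapT => n2; apply: nB; exact: hB.
Qed.

Lemma ae_neq0 : {ae leb, forall t : R, t != 0}.
Proof.
exists [set 0]; split; [exact: measurable_set1|exact: lebesgue_measure_set1|].
by move=> t /= /negP; rewrite negbK => /eqP.
Qed.

(** Membership in [D] is left open at t = 0, so that the open half-line of [weak_dt] and the closed
    one of [weak_solution] are covered together. *)
Lemma Rintegral_half_line_ae (D : set R) (F F' : R -> R) :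
  (forall t, t != 0 -> (t \in D) = (0 < t)) ->
  {ae leb, forall t, 0 < t -> F t = F' t} ->
  \int[leb]_(t in D) F t = \int[leb]_(t in `[0, +oo[) F' t.
Proof.
move=> hD FF; rewrite Rintegral_mkcond [RHS]Rintegral_mkcond.
apply: Rintegral_ae_eqW; apply: ae_leb_imply2 FF ae_neq0 => t FF t0.
rewrite /patch (hD _ t0) mem_setE in_itv/= andbT.
by rewrite [0 <= t]le_eqVlt eq_sym (negbTE t0)/=; case: ltP => // /FF ->.
Qed.

Hypotheses (delta0 : 0 < delta) (alpha01 : 0 < alpha < 1) (hN : (0 < N)%N).
Variable f : E * E -> E.
Variables (G : 'I_N -> E -> E -> R) (g : E -> R) (S : set E).
Hypothesis GE : forall i y a, G i y a = \1_S y * nonlinear_part f kappa alpha i y a.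
Hypothesis S_ball : S `<=` eball delta.
Hypothesis S_ae : {ae mu, forall y, y != 0 -> eball delta y -> S y}.
Hypothesis mG : forall i, measurable_fun setT (fun z : E * E => G i z.1 z.2).
Hypothesis G_le : forall i y a, `|G i y a| <= g y.
Hypothesis ig : rintegrable mu g.

Variables (u ut U Ut : E -> R -> E) (u0 v0 : E -> E).
Hypothesis u_sol : weak_solution delta alpha f u u0 v0.
Hypothesis utE : time_derivative u ut.
Hypothesis UE : weakly_continuous_rep (W delta alpha) (Wnorm delta alpha) u U.
Hypothesis UtE : weakly_continuous_rep L2 L2norm ut Ut.
Hypotheses (u0_L2 : L2 u0) (v0_L2 : L2 v0).

(** Freezing negative times at 0 turns continuity on the half-line into continuity on the whole
    line. *)
Definition time_rep (V : E -> R -> E) (t : R) : 'I_N -> E -> R :=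
  borel_rep (V ^~ (Num.max t 0)).

Let m0 (t : R) : 0 <= Num.max t 0. Proof. by rewrite le_max lexx orbT. Qed.

Let Q := time_rep U.
Let P := time_rep Ut.

Let QP t : [/\ represents (U ^~ (Num.max t 0)) (Q t),
  forall i, sqint mu (Q t i) & forall i, (wsemi (Q t i) < +oo)%E].
Proof. by have [_ h _] := UE; apply: W_represents; exact: h. Qed.

Let PP t : represents (Ut ^~ (Num.max t 0)) (P t) /\ forall i, sqint mu (P t i).
Proof. by have [_ h _] := UtE; apply: L2_represents; exact: h. Qed.

Let uQ : {ae leb, forall t, 0 < t -> represents (u ^~ t) (Q t)}.
Proof.
have [h _ _] := UE; apply: ae_leb_imply h => t h t0.
apply: represents_ae (h t0) _; have [r _ _] := QP t.
by move: r; rewrite max_l// ltW.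
Qed.

Let utP : {ae leb, forall t, 0 < t -> represents (ut ^~ t) (P t)}.
Proof.
have [h _ _] := UtE; apply: ae_leb_imply h => t h t0.
apply: represents_ae (h t0) _; have [r _] := PP t.
by move: r; rewrite max_l// ltW.
Qed.

Let Q_continuous i phi : sqint mu phi -> continuous (fun t => \int[mu]_x (Q t i x * phi x)).
Proof.
move=> sphi; have [_ _ /(_ _ (pairing_functional_W delta alpha i sphi))] := UE.
move=> /within_continuous_max; rewrite (_ : (fun t => _) =
  (fun t => \int[mu]_x (Q t i x * phi x)))//.
by apply/funext => t; have [r _ _] := QP t; rewrite (pairing_represents _ _ r).
Qed.

Let P_continuous i phi : sqint mu phi -> continuous (fun t => \int[mu]_x (P t i x * phi x)).
Proof.
move=> sphi; have [_ _ /(_ _ (pairing_functional_L2 i sphi))] := UtE.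
move=> /within_continuous_max; rewrite (_ : (fun t => _) =
  (fun t => \int[mu]_x (P t i x * phi x)))//.
by apply/funext => t; have [r _] := PP t; rewrite (pairing_represents _ _ r).
Qed.

Let Q_form_continuous i phi : sqint mu phi -> (wsemi phi < +oo)%E ->
  continuous (fun t => wform delta alpha (Q t i) phi).
Proof.
move=> sphi wphi; have [_ _ /(_ _ (wform_functional i sphi wphi))] := UE.
move=> /within_continuous_max h.
have <- : (fun t => wform delta alpha (fun x => U x (Num.max t 0) ord0 i) phi) =
    (fun t => wform delta alpha (Q t i) phi).
  apply/funext => t; have [[_ r] _ _] := QP t; apply: wform_ae.
  by apply: filterS r => x e; exact: e.
exact: h.
Qed.

Let Q_const t : t <= 0 -> Q t = Q 0.
Proof. by move=> t0; rewrite /Q /time_rep max_r// max_r. Qed.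

Let P_const t : t <= 0 -> P t = P 0.
Proof. by move=> t0; rewrite /P /time_rep max_r// max_r. Qed.

Let P_bound : exists C, forall t i, fine (sqn mu (P t i)) <= C.
Proof.
have [[_ [C hC]] _] := utE; exists (`|C| ^+ 2) => t i.
have bound T : {ae leb, forall s, 0 < s < T -> fine (sqn mu (P s i)) <= `|C| ^+ 2}.
  apply: ae_leb_imply2 hC utP => s hC hr /andP[s0 _].
  have [|L le] := hC; first by rewrite /= in_itv/= s0.
  have r := hr s0; have [_ sP] := PP s.
  have L0 : (0 <= L2norm (ut ^~ s))%E by exact: Lnorm_ge0.
  have fin : L2norm (ut ^~ s) \is a fin_num by rewrite ge0_fin_numE//; case: L.
  have e := L2norm_represents r.
  rewrite -lee_fin (fineK (sqint_fin_num (sP i))).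
  apply: (@le_trans _ _ (L2norm (ut ^~ s) ^+ 2)%E).
    rewrite e (bigD1 i)//= leeDl//.
    by apply: sume_ge0 => j _; exact: sqn_ge0.
  move: le L0; rewrite -(fineK fin) -EFin_expe !lee_fin => le L0.
  by rewrite lerXn2r ?nnegrE// (le_trans le)// ler_norm.
have pos (s : R) : 0 <= s -> fine (sqn mu (P s i)) <= `|C| ^+ 2.
  move=> s0; apply: (@ae_bound_sqn R N (fun s => P s i) _ (s + 1)).
  - exact: sqr_ge0.
  - by move=> r; have [_] := PP r.
  - exact: P_continuous.
  - exact: bound.
  - by rewrite s0/= ltrDl.
have [t0|t0] := leP 0 t; first exact: pos.
by rewrite (P_const (ltW t0)); apply: pos; rewrite lexx.
Qed.

Let Q_bound T : exists C, forall t i, t <= T ->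
  fine (sqn mu (Q t i)) <= C /\ fine (wsemi (Q t i)) <= C.
Proof.
(* The essential bound reaches only times strictly below the end of the interval, hence the added
   1. *)
have [[hX _] _] := u_sol; pose T' := Num.max T 0 + 1.
have T'0 : 0 < T' by rewrite ltr_wpDl.
have [_ [C hC]] := hX _ T'0; exists (`|C| ^+ 2) => t i tT.
have bound : {ae leb, forall s, 0 < s < T' ->
    fine (sqn mu (Q s i)) <= `|C| ^+ 2 /\ fine (wsemi (Q s i)) <= `|C| ^+ 2}.
  apply: ae_leb_imply2 hC uQ => s hC hr /andP[s0 sT'].
  have [|L le] := hC; first by rewrite /= in_itv/= s0.
  have r := hr s0; have [_ sQ wQ] := QP s.
  have le' : (Wnorm delta alpha (u ^~ s) <= `|C|%:E)%E.
    by apply: (le_trans le); rewrite lee_fin ler_norm.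
  have [l1 l2] := Wnorm_represents r (normr_ge0 C) le'.
  have wf : wsemi (Q s i) \is a fin_num by rewrite ge0_fin_numE ?wsemi_ge0.
  split; rewrite -lee_fin.
    rewrite (fineK (sqint_fin_num (sQ i))); apply: le_trans l1.
    by rewrite (bigD1 i)//= leeDl//; apply: sume_ge0 => j _; exact: sqn_ge0.
  rewrite (fineK wf); apply: le_trans l2.
  by rewrite (bigD1 i)//= leeDl//; apply: sume_ge0 => j _; exact: wsemi_ge0.
have pos (s : R) : 0 <= s < T' -> fine (sqn mu (Q s i)) <= `|C| ^+ 2 /\
    fine (wsemi (Q s i)) <= `|C| ^+ 2.
  move=> sT; split.
    apply: (@ae_bound_sqn R N (fun s => Q s i) _ T') => //.
    - by move=> r; have [_] := QP r.
    - exact: Q_continuous.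
    - by apply: ae_leb_imply bound => r h /h[].
  apply: (@ae_bound_wsemi R N delta alpha (fun s => Q s i) _ T') => //.
  - by move=> r; have [_] := QP r.
  - by move=> r; have [_ _] := QP r.
  - exact: Q_form_continuous.
  - by apply: ae_leb_imply bound => r h /h[].
have [t0|t0] := leP 0 t.
  by apply: pos; rewrite t0/= (le_lt_trans tT)// /T' ltr_pwDr// le_max lexx.
by rewrite Q_const ?(ltW t0)//; apply: pos; rewrite lexx.
Qed.

Let Q_first n i x theta : positive_test1 theta ->
  \int[leb]_(t in `[0, +oo[) (mollify (eta n) (Q t i) x * derive1 theta t) =
  - \int[leb]_(t in `[0, +oo[) (mollify (eta n) (P t i) x * theta t).
Proof.
move=> [sth [a [b [a0 sup]]]]; have [_ wdt] := utE.
have [tf clos] := separated_test_function i sth sup (mollifier_smooth n x).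
have := wdt _ tf; rewrite dt_separated// => h.
have {}h : \int[leb]_(t in `]0, +oo[) \int[mu]_z dotp (u z t)
      (separated_test (derive1 theta) (fun z => eta n (z - x)) i (z, t)) =
    - \int[leb]_(t in `]0, +oo[) \int[mu]_z dotp (ut z t)
      (separated_test theta (fun z => eta n (z - x)) i (z, t)).
  by apply: h => z /clos /= az; exact: lt_le_trans az.
have mem (t : R) : t != 0 -> (t \in (`]0, +oo[%classic : set R)) = (0 < t).
  by move=> _; rewrite mem_setE in_itv/= andbT.
rewrite -(Rintegral_half_line_ae (D := `]0, +oo[%classic) mem (F := fun t =>
  \int[mu]_z dotp (u z t) (separated_test (derive1 theta) (fun z => eta n (z - x)) i (z, t)))).
  rewrite h; congr (- _); apply: Rintegral_half_line_ae => //.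
  apply: ae_leb_imply utP => t r t0; have [_ sP] := PP t.
  exact: (dotp_mollify (theta t) n i x (r t0) sP).
apply: ae_leb_imply uQ => t r t0; have [_ sQ _] := QP t.
exact: (dotp_mollify (derive1 theta t) n i x (r t0) sQ).
Qed.

Let Q_second n i x theta : test1 theta ->
  \int[leb]_(t in `[0, +oo[) (mollify (eta n) (Q t i) x * derive1 (derive1 theta) t -
     mollified_force delta alpha kappa G (Q t) n i x * theta t)
  - mollify (eta n) (borel_rep v0 i) x * theta 0
  + mollify (eta n) (borel_rep u0 i) x * derive1 theta 0 = 0.
Proof.
move=> [sth [a [b sup]]]; have [_ weq] := u_sol.
have [tf _] := separated_test_function i sth sup (mollifier_smooth n x).
have := weq _ tf; rewrite !dt_separated//; last exact: smooth1_derive.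
have [r0 s0] := L2_represents u0_L2; have [r1 s1] := L2_represents v0_L2.
pose phi z := eta n (z - x).
have e1 : \int[mu]_z dotp (v0 z) (separated_test theta phi i (z, 0)) =
    mollify (eta n) (borel_rep v0 i) x * theta 0 := dotp_mollify (theta 0) n i x r1 s1.
have e2 : \int[mu]_z dotp (u0 z) (separated_test (derive1 theta) phi i (z, 0)) =
    mollify (eta n) (borel_rep u0 i) x * derive1 theta 0 :=
  dotp_mollify (derive1 theta 0) n i x r0 s0.
rewrite e1 e2.
move=> h; rewrite -[RHS]h; congr (_ - _ + _); apply/esym; apply: Rintegral_half_line_ae.
  by move=> t t0; rewrite mem_setE in_itv/= andbT le_eqVlt eq_sym (negbTE t0).
apply: ae_leb_imply uQ => t r t0; have [_ sQ wQ] := QP t; congr (_ - _).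
  exact: (dotp_mollify (derive1 (derive1 theta) t) n i x (r t0) sQ).
exact: (K_form_mollified delta0 alpha01 hN GE S_ball S_ae mG G_le ig (theta t) n i x (r t0) sQ wQ).
Qed.

Lemma weak_solution_mollified :
  mollified_solution delta alpha kappa G Q P (borel_rep u0) (borel_rep v0).
Proof.
split.
- by move=> t i; have [_] := QP t.
- by move=> t i; have [_ _] := QP t.
- by move=> t i; have [_] := PP t.
- exact: Q_const.
- exact: Q_continuous.
- exact: P_continuous.
- exact: P_bound.
- exact: Q_bound.
- exact: Q_first.
- exact: Q_second.
Qed.

End solutions.

(** * Cutting off g near its singular set *)

Section truncation.
Variables (R : realType) (N : nat) (delta alpha : R).
Local Notation E := 'rV[R]_N.
Local Notation mu := (lebesgue_rV R N).
Local Notation w := (weight delta alpha).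
Local Notation s := (N%:R + 2 * alpha).
Hypotheses (delta0 : 0 < delta) (alpha01 : 0 < alpha < 1).
Variable g : E -> R.
Hypothesis g0 : forall y, 0 <= g y.
Hypothesis g_L2loc : L2loc g.

Let s0 : 0 < s.
Proof. by case/andP: alpha01 => a0 _; rewrite ltr_wpDl// mulr_gt0. Qed.

(* The origin and a null set outside of which g agrees with a Borel function are
   removed from the ball. *)
Lemma L2loc_truncation : exists (S : set E) (k : E -> R),
  [/\ measurable S, S `<=` eball delta, S `<=` [set y | y != 0] &
      {ae mu, forall y, y != 0 -> eball delta y -> S y}] /\
  [/\ rintegrable mu (fun y => \1_S y * g y), rintegrable mu k, forall y, 0 <= k y,
      forall y, (\1_S y * g y) ^+ 2 <= w y * k y &
      \int[mu]_y k y = \int[mu]_(y in eball delta) (g y ^+ 2 * enorm y `^ s)].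
Proof.
have [[gb mgb [A [mA A0 hA]]] gK] := g_L2loc.
pose S := @eball R N delta `&` (~` [set 0] `&` ~` A).
have mS : measurable S.
  apply: measurableI; first exact: measurable_eball.
  by apply: measurableI; apply: measurableC => //; exact: measurable_rV_set1.
pose gS y := \1_S y * g y.
have gSE : gS = (fun y => \1_S y * gb y).
  apply/funext => y; rewrite /gS indicE; case: (boolP (y \in S)) => yS; last by rewrite !mul0r.
  congr (_ * _); apply: contrapT => ne; move: yS; rewrite inE => -[_ [_]]; apply.
  by apply: hA => /= /(_ I).
have mgS : measurable_fun setT gS.
  by rewrite gSE; apply: measurable_funM => //; exact: measurable_indic.
have gS0 y : 0 <= gS y by rewrite mulr_ge0.
have Sball : S `<=` eball delta by move=> y [].
have Sn0 : S `<=` [set y | y != 0] by move=> y [_ [/eqP]].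
have gSout y : ~ S y -> gS y = 0 by move=> nS; rewrite /gS indicE memNset// mul0r.
have gSin y : S y -> gS y = g y by move=> yS; rewrite /gS indicE mem_set// mul1r.
have Sae : {ae mu, forall y, y != 0 -> eball delta y -> S y}.
  exists A; split => // y /= nS; apply: contrapT => nA; apply: nS => y0 yB.
  by split => //; split => // /eqP; rewrite (negbTE y0).
(* [L2loc] speaks of compact sets, so that the ball is enclosed in a cube. *)
pose K := [set x : E | forall i, `[- delta, delta]%classic (x ord0 i)].
have cK : compact K by apply: (@rV_compact _ _ (fun=> `[- delta, delta]%classic)) => i; exact: segment_compact.
have iS2 : rintegrable mu (fun y => gS y ^+ 2).
  apply: ge0_rintegrable; first exact: measurable_funX.
    by move=> y; rewrite sqr_ge0.
  apply: le_lt_trans (gK _ cK); rewrite [leRHS]integral_mkcond.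
  apply: ge0_le_integralW => y; first by rewrite lee_fin sqr_ge0.
  rewrite patchE; case: ifPn => yK.
    rewrite lee_fin; have [yS|/gSout ->] := pselect (S y); first by rewrite gSin.
    by rewrite expr0n sqr_ge0.
  rewrite gSout ?expr0n// => /Sball yB; move/negP: yK; apply; rewrite inE => i.
  rewrite /= in_itv/= -ler_norml; apply: le_trans (coor_le_enorm _ _) _; exact: ltW.
have iB : rintegrable mu (fun y => 1 * \1_(@eball R N delta) y).
  apply: rintegrable_indic_cst; first exact: measurable_eball.
  by apply: le_lt_trans (eball_bound _ (ltW delta0)) _; rewrite ltry.
(* On the ball, which has finite measure, g <= 1 + g^2. *)
have iS : rintegrable mu gS.
  apply: rintegrable_le (rintegrableD iB iS2) => // y.
  rewrite ger0_norm// mul1r; have [yS|/gSout ->] := pselect (S y); last first.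
    by rewrite expr0n addr0.
  rewrite indicE mem_set//=; last exact: Sball.
  by have := sqr_ge0 (gS y - 1); have := gS0 y; nra.
(* On [S] the factor |y|^s is the inverse of the weight, so that the required inequality is an
   equality there, and the integral of [k] is lambda. It is finite because |y|^s <= delta^s on the
   ball. *)
pose k y := gS y ^+ 2 * enorm y `^ s.
have k0 y : 0 <= k y by rewrite mulr_ge0 ?sqr_ge0 ?powR_ge0.
have ik : rintegrable mu k.
  apply: rintegrable_le (rintegrableZ (delta `^ s) iS2) => [|y].
    apply: measurable_funM; first exact: measurable_funX.
    exact: (measurableT_comp (measurable_powR _) (@measurable_enorm R N)).
  rewrite ger0_norm// /k mulrC; have [yS|/gSout ->] := pselect (S y); last first.
    by rewrite expr0n !mulr0.
  rewrite ler_wpM2r ?sqr_ge0// ge0_ler_powR ?(ltW s0) ?nnegrE ?enorm_ge0 ?(ltW delta0)//.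
  by apply: ltW; exact: Sball.
exists S, k; split; split => // [y|].
  rewrite -/(gS y) /k /weight; have [yS|/gSout ->] := pselect (S y); last first.
    by rewrite expr0n mul0r mulr0.
  have y0 : enorm y `^ s != 0.
    by rewrite gt_eqF// powR_gt0// enorm_gt0; exact: Sn0.
  rewrite indicE mem_set; last exact: Sball.
  by rewrite div1r mulrCA mulVf// mulr1.
rewrite [RHS]Rintegral_mkcond; apply: Rintegral_ae_eqW; apply: filterS Sae => y yS.
rewrite /k patchE; case: ifPn => yB; last first.
  by rewrite gSout ?expr0n ?mul0r// => /Sball h; move/negP: yB; apply; rewrite inE.
have [->|y0] := eqVneq y 0; first by rewrite enorm0 powR0 ?mulr0// gt_eqF.
by rewrite gSin//; apply: yS => //; move: yB; rewrite inE.
Qed.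

End truncation.

Lemma ge0_sum_eqy (R : realType) (I : finType) (F : I -> \bar R) (i : I) :
  (forall j, 0 <= F j)%E -> F i = +oo%E -> (\sum_j F j)%E = +oo%E.
Proof.
move=> F0 Fi; rewrite (bigD1 i)//= Fi addye// gt_eqF//.
by rewrite (@lt_le_trans _ _ 0%E)// sume_ge0.
Qed.

Unset Implicit Arguments.

Theorem theorem2p5 (R : realType) (N : nat) (hN : (0 < N)%N)
  (delta : R) (hdelta : 0 < delta)
  (f : 'rV[R]_N * 'rV[R]_N -> 'rV[R]_N)
  (Phi Psi : 'rV[R]_N * 'rV[R]_N -> R)
  (kappa alpha : R) (g : 'rV[R]_N -> R)
  (f_C1 : class_C 1 Omega f)
  (f_odd : forall y u, Omega (y, u) -> f (- y, - u) = - f (y, u))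
  (Phi_C2 : class_C 2 Omega Phi)
  (f_grad : forall z, Omega z -> f z = grad_u Phi z)
  (hkappa : 0 < kappa) (halpha : 0 < alpha < 1)
  (PhiE : forall y u, Omega (y, u) ->
    Phi (y, u) =
    kappa * (enorm u ^+ 2 / enorm y `^ (N%:R + 2 * alpha)) + Psi (y, u))
  (g_ge0 : forall y, 0 <= g y) (g_L2loc : L2loc g)
  (Psi_0 : forall y, Omega (y, 0) -> Psi (y, 0) = 0)
  (Psi_ge0 : forall z, Omega z -> 0 <= Psi z)
  (Psi_grad : forall y u, Omega (y, u) -> enorm (grad_u Psi (y, u)) <= g y)
  (Psi_hess : forall y u, Omega (y, u) -> opnorm (hess_u Psi (y, u)) <= g y)
  (u0 v0 u0' v0' : 'rV[R]_N -> 'rV[R]_N)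
  (u0_L2 : L2 u0) (v0_L2 : L2 v0) (u0'_L2 : L2 u0') (v0'_L2 : L2 v0')
  (u0_energy : (\int[lebesgue_rV R N]_x \int[lebesgue_rV R N]_(y in eball delta)
    (Phi (y, u0 x - u0 (x - y)))%:E < +oo)%E)
  (u0'_energy : (\int[lebesgue_rV R N]_x \int[lebesgue_rV R N]_(y in eball delta)
    (Phi (y, u0' x - u0' (x - y)))%:E < +oo)%E)
  (u u' : 'rV[R]_N -> R -> 'rV[R]_N)
  (u_sol : weak_solution delta alpha f u u0 v0)
  (u'_sol : weak_solution delta alpha f u' u0' v0')
  (ut ut' : 'rV[R]_N -> R -> 'rV[R]_N)
  (utE : time_derivative u ut) (ut'E : time_derivative u' ut')
  (U U' Ut Ut' : 'rV[R]_N -> R -> 'rV[R]_N)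
  (UE : weakly_continuous_rep (W delta alpha) (Wnorm delta alpha) u U)
  (U'E : weakly_continuous_rep (W delta alpha) (Wnorm delta alpha) u' U')
  (UtE : weakly_continuous_rep L2 L2norm ut Ut)
  (Ut'E : weakly_continuous_rep L2 L2norm ut' Ut') :
  let lambda := \int[lebesgue_rV R N]_(y in eball delta)
    (g y ^+ 2 * enorm y `^ (N%:R + 2 * alpha)) in
  forall t : R, 0 < t ->
    (L2norm (fun x => Ut x t - Ut' x t)%R ^+ 2
       + kappa%:E * seminorm2 delta alpha (fun x => U x t - U' x t)%R
     <= (expR ((lambda + kappa^-1) * t))%:E * L2norm (fun x => v0 x - v0' x)%R ^+ 2
       + (kappa * expR ((lambda + kappa^-1) * t))%:E
         * seminorm2 delta alpha (fun x => u0 x - u0' x)%R)%E.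
Proof.
move=> lambda t t0.
have [S [k [[mS S_ball S_n0 S_ae] [ig ik k0 gk kE]]]] :=
  L2loc_truncation hdelta halpha g_ge0 g_L2loc.
(* The cut-off by [S] makes the nonlinear part measurable and bounded for all y: [f] is constrained
   only for y != 0, and [g] is Borel only up to a null set. *)
pose G i (y a : 'rV[R]_N) := \1_S y * nonlinear_part f kappa alpha i y a.
pose gS y := \1_S y * g y.
have mG i : measurable_fun setT (fun z : 'rV[R]_N * 'rV[R]_N => G i z.1 z.2).
  have h := measurable_nonlinear_part kappa alpha Phi_C2 f_grad i.
  move/(measurable_restrictT _ (@measurable_Omega R N)) : h => h.
  have -> : (fun z : 'rV[R]_N * 'rV[R]_N => G i z.1 z.2) = (fun z => \1_S z.1 *
      ((fun z => nonlinear_part f kappa alpha i z.1 z.2) \_ Omega) z).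
    apply/funext => z; rewrite /G patchE indicE.
    case: (boolP (z.1 \in S)) => zS; last by rewrite !mul0r.
    by rewrite mem_set//; apply: S_n0; move: zS; rewrite inE.
  apply: measurable_funM => //; apply: measurableT_comp measurable_fst.
  exact: measurable_indic.
have G_le i y a : `|G i y a| <= gS y.
  rewrite /G /gS indicE; case: (boolP (y \in S)) => yS; last by rewrite !mul0r normr0.
  rewrite !mul1r; apply: (nonlinear_part_le Phi_C2 f_grad PhiE Psi_grad).
  by apply: S_n0; move: yS; rewrite inE.
have G_lip y a b : enorm (\row_i (G i y a - G i y b)) <= gS y * enorm (a - b).
  have -> : \row_i (G i y a - G i y b) = \1_S y *:
      \row_i (nonlinear_part f kappa alpha i y a - nonlinear_part f kappa alpha i y b).
    by apply/rowP => i; rewrite [LHS]mxE [RHS]mxE [X in _ = _ * X]mxE mulrBr.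
  rewrite enormZ /gS indicE; case: (boolP (y \in S)) => yS; last by rewrite normr0 !mul0r.
  rewrite normr1 !mul1r; apply: (nonlinear_part_lip Phi_C2 f_grad PhiE Psi_grad Psi_hess).
  by apply: S_n0; move: yS; rewrite inE.
have GE i y a : G i y a = \1_S y * nonlinear_part f kappa alpha i y a by [].
have sol := weak_solution_mollified hdelta halpha hN GE S_ball S_ae mG G_le ig
  u_sol utE UE UtE u0_L2 v0_L2.
have sol' := weak_solution_mollified hdelta halpha hN GE S_ball S_ae mG G_le ig
  u'_sol ut'E U'E Ut'E u0'_L2 v0'_L2.
have [ru su] := L2_represents u0_L2; have [ru' su'] := L2_represents u0'_L2.
have [rv sv] := L2_represents v0_L2; have [rv' sv'] := L2_represents v0'_L2.
have tmax : Num.max t 0 = t by rewrite max_l// ltW.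
have rep (V : 'rV[R]_N -> R -> 'rV[R]_N) : L2 (V ^~ t) -> represents (V ^~ t) (time_rep V t).
  by move=> /L2_represents[+ _]; rewrite /time_rep tmax.
have UL2 : L2 (U ^~ t) by have [_ /(_ t (ltW t0)) [h _] _] := UE.
have U'L2 : L2 (U' ^~ t) by have [_ /(_ t (ltW t0)) [h _] _] := U'E.
have UtL2 : L2 (Ut ^~ t) by have [_ /(_ t (ltW t0)) h _] := UtE.
have Ut'L2 : L2 (Ut' ^~ t) by have [_ /(_ t (ltW t0)) h _] := Ut'E.
rewrite (L2norm_represents (represents_sub (rep _ UtL2) (rep _ Ut'L2))).
rewrite (seminorm2_represents delta alpha (represents_sub (rep _ UL2) (rep _ U'L2))).
rewrite (L2norm_represents (represents_sub rv rv')).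
rewrite (seminorm2_represents delta alpha (represents_sub ru ru')).
pose mu := lebesgue_rV R N.
have vsqnE (h : 'I_N -> 'rV[R]_N -> R) : (forall i, sqint mu (h i)) ->
    (\sum_i sqn mu (h i))%E = (vsqn h)%:E.
  by move=> sh; rewrite -sumEFin; apply: eq_bigr => i _; rewrite fineK// sqint_fin_num.
have vsemiE (h : 'I_N -> 'rV[R]_N -> R) : (forall i, (wsemi delta alpha (h i) < +oo)%E) ->
    (\sum_i wsemi delta alpha (h i))%E = (vsemi delta alpha h)%:E.
  move=> wh; rewrite -sumEFin; apply: eq_bigr => i _; rewrite fineK//.
  by rewrite ge0_fin_numE ?wsemi_ge0.
have sv2 i : sqint mu (vsub (borel_rep v0) (borel_rep v0') i) by exact: sqintB.
have sp2 i : sqint mu (vsub (time_rep Ut t) (time_rep Ut' t) i).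
  by apply: sqintB; [exact: ms_dsqint sol t i|exact: ms_dsqint sol' t i].
rewrite (vsqnE _ sv2) (vsqnE _ sp2).
(* If some component of the initial difference has an infinite seminorm, the right-hand side is +oo.
   Otherwise every term is finite, and the estimate between real numbers applies. *)
have [wu|/existsNP[i /negP]] :=
    pselect (forall i, (wsemi delta alpha (vsub (borel_rep u0) (borel_rep u0') i) < +oo)%E); last first.
  rewrite -leNgt leye_eq => /eqP wi.
  rewrite [X in (_ <= _ + _ * X)%E](@ge0_sum_eqy R _ (fun i => wsemi delta alpha (vsub (borel_rep u0) (borel_rep u0') i))
    i (fun=> wsemi_ge0 _ _ _) wi).
  rewrite gt0_muley; last by rewrite lte_fin mulr_gt0// expR_gt0.
  by rewrite -EFinM addey// leey.
have ww i : (wsemi delta alpha (vsub (time_rep U t) (time_rep U' t) i) < +oo)%E.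
  apply: le_lt_trans (wsemi_sub delta alpha (ms_sqint sol t i) (ms_sqint sol' t i)) _.
  apply: lte_add_pinfty; apply: lte_mul_pinfty => //.
  - exact: (ms_wsemi sol).
  - exact: (ms_wsemi sol').
rewrite [X in (_ <= _ + _ * X)%E](vsemiE _ wu) [X in (_ + _ * X <= _)%E](vsemiE _ ww).
have := energy_estimate hdelta halpha hN hkappa mG G_le G_lip ig ik k0 gk sol sol' su su' sv sv' wu
  (ltW t0).
rewrite kE -/lambda -!EFinM -!EFinD lee_fin => h; apply: (le_trans h).
by rewrite mulrDl mulrC lerD2l mulrAC.
Qed.
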